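(* Let $\frac12<\alpha<1$. Assume $s\ge\frac16$ and $s>\frac{1-\alpha}{2}$. Then, for any $T>0$ and any $u_0\in H^s(\mathbb{T})$, there is at most one solution (in the sense of distribution) $u\in C([0,T];H^s(\mathbb{T}))$ to the Cauchy problem $$i\partial_tu+(-\partial_x^2)^\alpha u=\pm|u|^2u,\quad (t,x)\in[0,T]\times\mathbb{T},\qquad u(0,x)=u_0(x)$$ (either choice of sign).
   Context: $\mathbb{T}=\mathbb{R}/2\pi\mathbb{Z}$; $(-\partial_x^2)^\alpha$ is the Fourier multiplier with symbol $|n|^{2\alpha}$, $n\in\mathbb{Z}$; $u$ is complex-valued. Since $H^{1/6}(\mathbb{T})\hookrightarrow L^3(\mathbb{T})$, the nonlinearity $|u|^2u$ is well-defined in $L^1$ in $x$ for $s\ge\frac16$; a solution in the sense of distribution satisfies the equation in $\mathcal{D}'((0,T)\times\mathbb{T})$ and $u(0)=u_0$. *)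

(* Defs.v *)
From HB Require Import structures.
From mathcomp Require Import all_boot all_order all_algebra.
From mathcomp Require Export all_classical all_reals all_analysis.
From mathcomp Require Export complex.
Set Implicit Arguments.
Unset Strict Implicit.
Unset Printing Implicit Defensive.
Import Order.TTheory GRing.Theory Num.Theory.
Import numFieldNormedType.Exports.
Local Open Scope classical_set_scope.
Local Open Scope ring_scope.
Local Open Scope complex_scope.

Local Notation Re := complex.Re.
Local Notation Im := complex.Im.
Import complex.ComplexField.Normc.

Section complex_calculus.
Context {R : realType}.
Local Notation mu := (@lebesgue_measure R).

(* R[i] carries no R-normed-module or measurable structure, so integrals, limits
   and derivatives of complex-valued functions are taken componentwise. *)
Definition cintegral (D : set R) (f : R -> R[i]) : R[i] :=
  (\int[mu]_(x in D) Re (f x)) +i* (\int[mu]_(x in D) Im (f x)).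

Definition climn (z : nat -> R[i]) : R[i] :=
  limn (fun N => Re (z N)) +i* limn (fun N => Im (z N)).

Definition cexp (y : R) : R[i] := cos y +i* sin y.

Definition partial_t (g : R -> R -> R) (t x : R) : R := derive1 (g ^~ x) t.
Definition partial_x (g : R -> R -> R) (t x : R) : R := derive1 (g t) x.

Definition cpartial_t (f : R -> R -> R[i]) (t x : R) : R[i] :=
  partial_t (fun t x => Re (f t x)) t x +i* partial_t (fun t x => Im (f t x)) t x.

Definition mixed_partial (l : seq bool) (g : R -> R -> R) : R -> R -> R :=
  foldr (fun b => if b then partial_t else partial_x) g l.

Definition smooth (g : R -> R -> R) : Prop := forall l : seq bool,
  [/\ forall t x, derivable (mixed_partial l g ^~ x) t 1,
      forall t x, derivable (mixed_partial l g t) x 1 &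
      continuous (fun p : R * R => mixed_partial l g p.1 p.2)].

Definition csmooth (f : R -> R -> R[i]) : Prop :=
  smooth (fun t x => Re (f t x)) /\ smooth (fun t x => Im (f t x)).

End complex_calculus.

Section torus.
Context {R : realType}.
Local Notation mu := (@lebesgue_measure R).

(* Functions on R/(2 pi Z) are 2 pi-periodic functions on R, identified when
   they agree almost everywhere. *)
Definition torus : set R := `[0, 2 * pi].

Definition eqT (f g : R -> R[i]) : Prop := {ae mu, forall x, f x = g x}.

Definition L2T (f : R -> R[i]) : Prop :=
  [/\ periodic f (2 * pi),
      measurable_fun setT (fun x => Re (f x)),
      measurable_fun setT (fun x => Im (f x)) &
      (\int[mu]_(x in torus) ((normc (f x) ^+ 2)%:E) < +oo)%E].

Definition fourier_coef (f : R -> R[i]) (n : int) : R[i] :=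
  ((2 * pi)^-1)%:C * cintegral torus (fun x => f x * cexp (- (n%:~R * x))).

Definition Hs_norm (s : R) (f : R -> R[i]) : \bar R :=
  poweR (\esum_(n in [set: int])
    ((1 + n%:~R ^+ 2) `^ s * normc (fourier_coef f n) ^+ 2)%:E) 2^-1.

(* This is H^s for s >= 0 only. *)
Definition Hs (s : R) : set (R -> R[i]) :=
  [set f | L2T f /\ (Hs_norm s f < +oo)%E].

Definition C_Hs (s T : R) (u : R -> R -> R[i]) : Prop :=
  (forall t, t \in `[0, T] -> Hs s (u t)) /\
  (forall t, t \in `[0, T] ->
     Hs_norm s (fun x => u r x - u t x) @[r --> within `[0, T] (nbhs t)]
       --> 0%E).

Definition fourier_multiplier (m : int -> R) (f : R -> R[i]) (x : R) : R[i] :=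
  climn (fun N : nat => \sum_(k < (2 * N).+1)
    let n := k%:Z - N%:Z in (m n)%:C * fourier_coef f n * cexp (n%:~R * x)).

Definition frac_laplacian (alpha : R) : (R -> R[i]) -> R -> R[i] :=
  fourier_multiplier (fun n => `|n%:~R| `^ (2 * alpha)).

(* C_c^oo((0,T) x R/(2 pi Z)), with functions extended by 0 to all t. *)
Definition test_function (T : R) (phi : R -> R -> R[i]) : Prop :=
  [/\ csmooth phi,
      forall t, periodic (phi t) (2 * pi) &
      exists a b : R, [/\ 0 < a, b < T &
        forall t x, t \notin `[a, b] -> phi t x = 0]].

(* The distribution on (0,T) x R/(2 pi Z) given by a curve w of integrable
   functions. The time integral is taken last because a curve t |-> w t of
   a.e.-classes does not come with a jointly measurable representative. *)
Definition pairing (T : R) (w phi : R -> R -> R[i]) : R[i] :=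
  cintegral `[0, T] (fun t => cintegral torus (fun x => w t x * phi t x)).

(* Operators act on distributions by duality. The pairing is bilinear, and the
   symbol |n|^(2 alpha) is even, so the multiplier is its own transpose. *)
Definition fNLS_distr (alpha T : R) (sgn : bool) (u : R -> R -> R[i]) : Prop :=
  forall phi, test_function T phi ->
    (0 +i* 1) * - pairing T u (cpartial_t phi)
    + pairing T u (fun t => frac_laplacian alpha (phi t))
    = (-1) ^+ sgn * pairing T (fun t x => (normc (u t x) ^+ 2)%:C * u t x) phi.

Definition fNLS_solution (alpha s T : R) (sgn : bool) (u0 : R -> R[i])
    (u : R -> R -> R[i]) : Prop :=
  [/\ C_Hs s T u, fNLS_distr alpha T sgn u & eqT (u 0) u0].

End torus.

(* Main.v *)
(* The Fourier coefficients of a solution satisfy, for each [n], an ODE whose nonlinearity is the limit of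
   its frequency truncations, since [H^(1/6)] embeds in [L^3]. In the interaction picture the cubic terms
   oscillate with the phase [P = |n1|^(2 alpha) - |n2|^(2 alpha) + |n3|^(2 alpha) - |n|^(2 alpha)], where
   [n = n1 - n2 + n3], and [|P| >= c |n - n1| |n - n3| / (max frequency)^(2 - 2 alpha)]. An infinite iteration
   of normal form reductions (integrations by parts in time of the terms with large phase) expresses the
   truncated coefficients through absolutely convergent multilinear sums in [H^s]. The truncation error is
   small only in a weak weighted sup norm, and it enters each multilinear term once, which the smoothing
   gained by the reductions can absorb when [s > (1 - alpha) / 2]. Letting the truncation go to infinity,
   the difference of two solutions contracts on short time intervals, hence vanishes. *)
Require Import Defs.
From mathcomp Require Import all_boot all_order all_algebra.
From mathcomp Require Import measurable_realfun ring lra zify.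
Set Implicit Arguments.
Unset Strict Implicit.
Unset Printing Implicit Defensive.
Import Order.TTheory GRing.Theory Num.Theory.
Import numFieldNormedType.Exports.
Local Open Scope classical_set_scope.
Local Open Scope ring_scope.
Local Open Scope complex_scope.
Import complex.ComplexField.Normc.

(** A solution is only continuous in time with values in [H^s], so the time derivative of its
    coefficients in the interaction picture is known only in a sup norm with weight exponent
    governed by [rr = 3 b - 1], where [b <= 2 s]: this is what three frequencies leave after the
    smallest one is summed. Returning from this weak norm to the strong one costs a constant that
    depends on the set of frequencies. Hence two finite sets are kept, a fixed [s] where the
    difference is measured and a growing [r] that carries the equation, and every other constant
    must be independent of both. The number of monomials grows factorially with the number of
    reductions. The threshold that separates near from far phases therefore grows exponentially with
    the length of a monomial, which leaves a geometric series. A large threshold, not a short time,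
    makes the boundary terms contract; short times are needed for the near terms alone. In the limit
    [th -> 2] the weak kernel estimate requires [g < 2 b], that is, [1 - alpha < b], and this is the
    condition on [s]. *)

Section sums.
Context {R : realType}.
Implicit Types (d x y : R).

Lemma ler_sum_uniq (T : eqType) (s t : seq T) (f : T -> R) :
  uniq s -> {subset s <= t} -> (forall i, 0 <= f i) ->
  \sum_(i <- s) f i <= \sum_(i <- t) f i.
Proof.
elim: s t => [|a s IH] t /=; first by move=> _ _ f0; rewrite big_nil sumr_ge0.
move=> /andP[as_ us] st f0; rewrite big_cons [leRHS](big_rem a) /=; last by apply: st; rewrite mem_head.
rewrite lerD2l; apply: IH => // x xs.
have xt : x \in t by apply: st; rewrite in_cons xs orbT.
have xa : x != a by apply: contraNneq as_ => <-.
by move: (perm_mem (perm_to_rem (st a (mem_head _ _))) x); rewrite xt in_cons (negbTE xa).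
Qed.

Lemma powR_gtr0E x p : 0 < x -> x `^ p = expR (p * ln x).
Proof. by move=> x0; rewrite /powR gt_eqF. Qed.

Lemma ler_powRN x y (e : R) : 0 < x -> x <= y -> 0 <= e -> y `^ (- e) <= x `^ (- e).
Proof.
move=> x0 xy e0; have y0 := lt_le_trans x0 xy.
rewrite !powR_gtr0E// ler_expR !mulNr lerN2 ler_wpM2l// ler_ln ?posrE//.
Qed.

Lemma powRDp x r t : 0 < x -> x `^ (r + t) = x `^ r * x `^ t.
Proof. by move=> x0; rewrite powRD// (gt_eqF x0) implybT. Qed.

Lemma powRN1 x : 0 < x -> x `^ (- 1) = x^-1.
Proof. by move=> x0; rewrite powR_inv1// ltW. Qed.

(** Concavity of the logarithm in weighted form. With [m = p t + (1 - p)], the tangent bound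
    [ln a <= a - 1] is taken at [t / m] and [1 / m] with weights [p] and [1 - p]; the two right-hand
    sides then add up to 0. *)
Lemma bernoulli_powR (t p : R) : 0 < t -> 0 <= p <= 1 -> t `^ p <= 1 + p * (t - 1).
Proof.
move=> t0 /andP[p0 p1]; set m := 1 + _.
have m0 : 0 < m by rewrite /m; nra.
have H (a : R) : 0 < a -> ln a <= a - 1.
  by move=> a0; have := @le_ln1Dx R (a - 1); rewrite [1 + _]addrC subrK; apply; lra.
have h1 := H _ (divr_gt0 t0 m0).
have h2 : ln (m^-1) <= m^-1 - 1 by apply: H; rewrite invr_gt0.
rewrite lnM ?posrE// ?invr_gt0// in h1.
rewrite lnV ?posrE// in h1, h2 *.
rewrite powR_gtr0E// -[leRHS]lnK ?posrE// ler_expR.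
have e : p * (t / m) + (1 - p) * m^-1 = 1.
  by rewrite mulrA -mulrDl; apply/(canLR (mulfK _)); rewrite ?gt_eqF// /m; ring.
rewrite -subr_ge0.
have -> : ln m - p * ln t = p * (t / m - 1 - (ln t - ln m)) + (1 - p) * (m^-1 - 1 - - ln m).
  apply/eqP; rewrite -subr_eq0; apply/eqP.
  rewrite [LHS](_ : _ = 1 - (p * (t / m) + (1 - p) * m^-1)); last by ring.
  by rewrite e subrr.
by rewrite addr_ge0// mulr_ge0//; lra.
Qed.

(** Discrete comparison with a primitive. It follows from [1 + y <= exp y] at [y = d / (x + 1)] and
    from [1 / (x + 1) <= ln (x + 1) - ln x]. *)
Lemma telescope_powR d (m : nat) : 0 < d ->
  (m.+2%:R : R) `^ (- (1 + d)) <= d^-1 * (m.+1%:R `^ (- d) - m.+2%:R `^ (- d)).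
Proof.
move=> d0; set x : R := m.+1%:R; have x0 : 0 < x by rewrite ltr0n.
have -> : m.+2%:R = x + 1 :> R by rewrite /x -natr1.
have y0 : 0 < x + 1 by lra.
rewrite mulrC ler_pdivlMr//.
have -> : (x + 1) `^ (- (1 + d)) = (x + 1) `^ (- d) / (x + 1).
  have e : - (1 + d) = - d + - 1 by ring.
  by rewrite e powRDp// powRN1.
suff : (x+1) `^ (- d) * (1 + d / (x + 1)) <= x `^ (- d).
  by rewrite mulrDr mulr1 -mulrA [_^-1 * d]mulrC; lra.
rewrite !powR_gtr0E//.
have h : d / (x + 1) <= d * (ln (x + 1) - ln x).
  rewrite ler_pM2l// -[_^-1]opprK lerNl opprB -ln_div ?posrE//.
  have := @le_ln1Dx R (x / (x + 1) - 1); rewrite [1 + _]addrC subrK => H.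
  have e : x / (x + 1) = 1 - (x + 1)^-1 by apply/(canLR (mulfK _)); rewrite ?gt_eqF//; field; rewrite gt_eqF.
  apply: le_trans (H _) _; rewrite e; last by lra.
  have : (x + 1)^-1 < 1 by rewrite invf_lt1//; lra.
  lra.
apply: le_trans (_ : _ <= expR (- d * ln (x+1)) * expR (d / (x + 1))) _.
  by rewrite ler_pM2l ?expR_gt0// expR_ge1Dx.
by rewrite -expRD ler_expR; lra.
Qed.

Lemma sum_pseries d (N : nat) : 0 < d ->
  \sum_(0 <= k < N) (k.+1%:R : R) `^ (- (1 + d)) <= 1 + d^-1.
Proof.
move=> d0; case: N => [|N]; first by rewrite big_nil; rewrite addr_ge0// invr_ge0 ltW.
suff : \sum_(0 <= k < N.+1) (k.+1%:R : R) `^ (- (1 + d)) <= 1 + d^-1 * (1 - N.+1%:R `^ (- d)).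
  move=> h; apply: le_trans h _; by rewrite lerD2l ler_piMr ?invr_ge0 ?(ltW d0)// gerBl powR_ge0.
elim: N => [|N IH]; first by rewrite big_nat1 !powR1 subrr mulr0 addr0.
rewrite big_nat_recr//=; have := telescope_powR N d0; lra.
Qed.

(** The Japanese bracket, taken as [1 + |n|] rather than as a square root so that its subadditivity
    is the triangle inequality; [jb_powR_le] compares it with the weight of [Hs_norm]. *)
Definition jb (n : int) : R := 1 + `|n%:~R|.

Lemma jb_ge1 n : 1 <= jb n. Proof. by rewrite /jb lerDl. Qed.
Lemma jb_gt0 n : 0 < jb n. Proof. exact: lt_le_trans (jb_ge1 n). Qed.

Lemma sum_jb d : 0 < d -> exists Z : R, 0 < Z /\ forall s : seq int, uniq s ->
  \sum_(m <- s) jb m `^ (- (1 + d)) <= Z.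
Proof.
move=> d0; exists (2 * (1 + d^-1)); split; first by rewrite mulr_gt0// addr_gt0// invr_gt0.
move=> s us.
have [M HM] : exists M, forall m, m \in s -> (`|m| < M)%N.
  by exists (\max_(m <- s) `|m|%N).+1 => m ms; rewrite ltnS; apply: leq_bigmax_seq.
(* [Negz k] is [- (k + 1)] and has bracket [k + 2], so the same series in [k + 1] dominates both
   halves. *)
pose t := [seq Posz k | k <- iota 0 M] ++ [seq Negz k | k <- iota 0 M].
apply: (@le_trans _ _ (\sum_(m <- t) jb m `^ (- (1 + d)))).
  apply: ler_sum_uniq => // [m ms|m]; last exact: powR_ge0.
  have mM := HM _ ms.
  rewrite mem_cat; apply/orP; case: m ms mM => k _ /= kM.
    by left; apply/mapP; exists k => //; rewrite mem_iota.
  by right; apply/mapP; exists k => //; rewrite mem_iota /=; apply: ltn_trans kM.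
rewrite big_cat !big_map /= mulr2n mulrDl !mul1r.
have e : \sum_(j <- iota 0 M) (j.+1%:R : R) `^ (- (1 + d)) <= 1 + d^-1.
  by have := sum_pseries M d0; rewrite /index_iota subn0.
apply: lerD; apply: le_trans e; apply: ler_sum => k _.
  by rewrite /jb -pmulrn normr_nat addrC natr1.
apply: ler_powRN; rewrite ?ltr0n//; last by lra.
by rewrite /jb NegzE rmorphN /= normrN -pmulrn normr_nat lerDr.
Qed.

End sums.
(** * The resonance function *)

Section resonance.
Context {R : realType}.
Implicit Types (x y M p b : R).

(** For [p = b - 1] this is, up to the factor [b], the derivative of [|x|^b]. *)
Definition sgpow p x := Num.sg x * `|x| `^ p.

(** Away from 0 this is the chain rule. At 0 the difference quotient has absolute value
    [|h|^(b - 1)], which tends to 0 because [b > 1]. *)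
Lemma is_derive_abspow b x : 1 < b ->
  is_derive x 1 (fun x : R => `|x| `^ b) (b * sgpow (b - 1) x).
Proof.
move=> b1; rewrite /sgpow; case: (ltgtP x 0) => [x0|x0|->].
- have nx0 : 0 < - x by rewrite oppr_gt0.
  apply: (@near_eq_is_derive _ _ _ ((fun y => y `^ b) \o -%R)).
    by near=> y; rewrite /= ltr0_norm//; near: y; exact: lt_nbhsl.
  rewrite ltr0_sg// ltr0_norm// mulN1r mulrN -mulrN1.
  by apply: is_derive1_comp; apply: is_derive1_powR.
- apply: (@near_eq_is_derive _ _ _ (fun y => y `^ b)).
    by near=> y; rewrite /= gtr0_norm//; near: y; exact: lt_nbhsr.
  by rewrite gtr0_sg// gtr0_norm// mul1r; apply: is_derive1_powR.
- rewrite sgr0 mul0r mulr0.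
  have H : (fun h : R => h^-1 *: (((fun x : R => `|x| `^ b) \o shift 0) (h *: 1) - `|0 : R| `^ b)) @ 0^' --> (0 : R).
    apply/cvgrPdist_le => e e0.
    have c0 : 0 < b - 1 by rewrite subr_gt0.
    near=> h.
    have h0 : h != 0 by near: h; exact: nbhs_dnbhs_neq.
    have nh0 : 0 < `|h| by rewrite normr_gt0.
    have b0 : b != 0 by rewrite gt_eqF// (lt_trans ltr01).
    rewrite /= normr0 powR0// subr0 addr0 sub0r normrN [_ *: 1]mulr1 normrM normfV.
    rewrite (ger0_norm (powR_ge0 _ _)) mulrC -powRN1// -powRDp//.
    have he : `|h| <= e `^ (b - 1)^-1.
      near: h; apply: dnbhs0_le; exact: powR_gt0.
    rewrite -[leRHS](powRr1 (ltW e0)) -[X in e `^ X](mulVf (lt0r_neq0 c0)) powRrM.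
    by apply: ge0_ler_powR => //; rewrite ?nnegrE ?powR_ge0 ?(ltW c0).
  apply: DeriveDef; first by apply/cvg_ex; exists 0.
  exact: cvg_lim.
Unshelve. all: by end_near. Qed.

(** On [[-M, M]] the derivative of [sgpow p] is at least [p M^(p - 1)] because [p < 1]. It is
    singular at 0, so instead of the mean value theorem the concavity bound [bernoulli_powR] is used
    on each half-line, and the two parts are added when the interval crosses 0. *)
Lemma sgpow_incr p M x y : 0 < p < 1 -> `|x| <= M -> `|y| <= M -> x < y ->
  p * M `^ (p - 1) * (y - x) <= sgpow p y - sgpow p x.
Proof.
move=> /andP[p0 p1].
have pos u v : 0 <= u -> u < v -> v <= M -> p * M `^ (p - 1) * (v - u) <= v `^ p - u `^ p.
  move=> u0 uv vM; have v0 := le_lt_trans u0 uv.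
  have M0 := lt_le_trans v0 vM.
  apply: (@le_trans _ _ (p * v `^ (p - 1) * (v - u))).
    rewrite ler_wpM2r ?subr_ge0 ?(ltW uv)// ler_wpM2l ?(ltW p0)//.
    by rewrite -opprB; apply: ler_powRN => //; rewrite subr_ge0 ltW.
  have vp : v `^ p = v `^ (p - 1) * v.
    by rewrite -[X in _ * X](powRr1 (ltW v0)) -powRDp// subrK.
  have [->|u0'] := eqVneq u 0.
    rewrite powR0 ?gt_eqF// !subr0 vp -mulrA ler_piMl//; last exact: ltW.
    by rewrite mulr_ge0 ?powR_ge0// ltW.
  have {u0'} up : 0 < u by rewrite lt_neqAle eq_sym u0'.
  have := @bernoulli_powR R (u / v) p (divr_gt0 up v0).
  rewrite (ltW p0) (ltW p1) => /(_ isT).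
  have -> : (u / v) `^ p = u `^ p / v `^ p.
    rewrite powRM ?invr_ge0 ?(ltW up) ?(ltW v0)// -(powRN1 v0) -powRrM mulN1r powRN //.
  rewrite ler_pdivrMr ?powR_gt0// => h.
  suff : u `^ p <= v `^ p - p * v `^ (p - 1) * (v - u) by lra.
  apply: le_trans h _; rewrite [in leLHS]vp [in leRHS]vp le_eqVlt; apply/orP; left; apply/eqP.
  by field; rewrite gt_eqF.
have pos0 v : 0 <= v -> v <= M -> p * M `^ (p - 1) * v <= v `^ p.
  rewrite le_eqVlt => /orP[/eqP <-|v0 vM]; first by rewrite mulr0 powR_ge0.
  by have := pos 0 v (lexx _) v0 vM; rewrite powR0 ?gt_eqF// !subr0.
move=> xM yM xy; rewrite /sgpow.
case: (ltgtP x 0) => [x0|x0|x0].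
- rewrite (ltr0_sg x0) mulN1r opprK (ltr0_norm x0); rewrite (ltr0_norm x0) in xM.
  case: (ltgtP y 0) => [y0|y0|y0].
  + rewrite ltr0_sg// mulN1r (ltr0_norm y0); rewrite (ltr0_norm y0) in yM.
    by have := pos (- y) (- x); rewrite opprK (addrC (- x)) (addrC (- _)); apply=> //; rewrite ?oppr_ge0 ?ltrN2 // ltW.
  + rewrite gtr0_sg// mul1r (gtr0_norm y0); rewrite (gtr0_norm y0) in yM.
    have h1 := pos0 y (ltW y0) yM; have h2 := pos0 (- x) _ xM.
    by rewrite mulrDr; apply: lerD => //; apply: h2; rewrite oppr_ge0 ltW.
  + by rewrite y0 sgr0 mul0r !add0r; apply: pos0 => //; rewrite oppr_ge0 ltW.
- have y0 := lt_trans x0 xy.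
  by rewrite !gtr0_sg// !mul1r !gtr0_norm// in xM yM *; apply: pos => //; rewrite ltW.
- rewrite x0 sgr0 mul0r !subr0; rewrite x0 in xy.
  by rewrite gtr0_sg// mul1r gtr0_norm// in yM *; apply: pos0 => //; rewrite ltW.
Qed.

(** The mean value theorem for [y |-> |y + h|^b - |y|^b] over the step [l], followed by [sgpow_incr]
    for the increment of the derivative over the step [h]. *)
Lemma second_difference_abspow b M x (l h : R) : 1 < b < 2 -> 0 < l -> 0 < h ->
  - M <= x -> x + l + h <= M ->
  b * (b - 1) * M `^ (b - 2) * (l * h) <=
  `|x + l + h| `^ b - `|x + l| `^ b - `|x + h| `^ b + `|x| `^ b.
Proof.
move=> /andP[b1 b2] l0 h0 xM xlhM.
pose G y := `|y + h| `^ b - `|y| `^ b.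
pose G' y := b * sgpow (b - 1) (y + h) - b * sgpow (b - 1) y.
have dG y : is_derive y 1 G (G' y).
  apply: is_deriveB; last exact: is_derive_abspow.
  rewrite -[b * _]mulr1.
  apply: (@is_derive1_comp _ (fun x => `|x| `^ b) (fun y => y + h)); first exact: is_derive_abspow.
  by apply: is_derive_eq; rewrite addr0.
have cG : {within `[x, x + l], continuous G}.
  apply: continuous_subspaceT => y; apply/differentiable_continuous/derivable1_diffP.
  exact: (@ex_derive _ _ _ _ _ _ _ (dG y)).
have xl : x < x + l by rewrite ltrDl.
have [c + /eqP] := MVT xl (fun y _ => dG y) cG.
rewrite in_itv /= => /andP[xc cl] e.
have -> : `|x + l + h| `^ b - `|x + l| `^ b - `|x + h| `^ b + `|x| `^ b = G (x + l) - G x.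
  by rewrite /G; ring.
rewrite (eqP e) /G' -mulrBr.
have c0 : 0 < b - 1 < 1 by lra.
have := @sgpow_incr (b - 1) M c (c + h) c0.
rewrite !ler_norml => H.
have {}H : (b - 1) * M `^ (b - 1 - 1) * (c + h - c) <= sgpow (b - 1) (c + h) - sgpow (b - 1) c.
  by apply: H; rewrite ?ltrDl//; lra.
rewrite (_ : b - 1 - 1 = b - 2) in H; last by ring.
have -> : x + l - x = l by ring.
have -> : b * (b - 1) * M `^ (b - 2) * (l * h) = b * ((b - 1) * M `^ (b - 2) * (c + h - c)) * l by ring.
rewrite ler_pM2r// ler_pM2l//; lra.
Qed.

Definition resonance b (n n1 n3 : R) : R :=
  `|n1| `^ b - `|n1 + n3 - n| `^ b + `|n3| `^ b - `|n| `^ b.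

(** With [j = n - n1] and [k = n - n3] the resonance is, up to sign, the second difference of
    [|.|^b] with steps [|j|] and [|k|]. Its base point is the leftmost of [n], [n - j], [n - k],
    [n - j - k], which depends on the signs of [j] and [k]. *)
Lemma resonance_ge b (n n1 n3 : R) : 1 < b < 2 ->
  b * (b - 1) * (`|n| + `|n - n1| + `|n - n3|) `^ (b - 2) * (`|n - n1| * `|n - n3|)
  <= `|resonance b n n1 n3|.
Proof.
move=> hb; set j := n - n1; set k := n - n3.
have -> : n1 = n - j by rewrite /j; ring.
have -> : n3 = n - k by rewrite /k; ring.
rewrite /resonance (_ : n - j + (n - k) - n = n - j - k); last by ring.
set M := `|n| + _ + _.
have hn : - `|n| <= n <= `|n| by rewrite -ler_norml.
have main x (l h : R) : - M <= x -> x + `|l| + `|h| <= M ->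
  b * (b - 1) * M `^ (b - 2) * (`|l| * `|h|) <=
  `|x + `|l| + `|h| | `^ b - `|x + `|l| | `^ b - `|x + `|h| | `^ b + `|x| `^ b.
  move=> h1 h2.
  have [->|l0] := eqVneq l 0; first by rewrite normr0 mul0r mulr0 !addr0; lra.
  have [->|h0] := eqVneq h 0; first by rewrite normr0 !mulr0 !addr0; lra.
  by apply: second_difference_abspow; rewrite ?normr_gt0.
have J0 := normr_ge0 j; have K0 := normr_ge0 k; have N0 := normr_ge0 n.
have half y : b * (b - 1) * M `^ (b - 2) * (`|j| * `|k|) <= y ->
    forall z, z = y \/ z = - y -> b * (b - 1) * M `^ (b - 2) * (`|j| * `|k|) <= `|z|.
  move=> h z [->|->]; rewrite ?normrN; apply: le_trans h _; exact: ler_norm.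
case: (lerP 0 j) => hj; case: (lerP 0 k) => hk.
- apply: (half _ (main (n - j - k) j k _ _)); rewrite /M ?(ger0_norm hj) ?(ger0_norm hk); try lra.
  right; rewrite (_ : n - j - k + j + k = n) 1?(_ : n - j - k + j = n - k) 1?(_ : n - j - k + k = n - j); ring.
- apply: (half _ (main (n - j) j k _ _)); rewrite /M ?(ger0_norm hj) ?(ltr0_norm hk); try lra.
  left; rewrite (_ : n - j + j + - k = n - k) 1?(_ : n - j + j = n) 1?(_ : n - j + - k = n - j - k); ring.
- apply: (half _ (main (n - k) j k _ _)); rewrite /M ?(ltr0_norm hj) ?(ger0_norm hk); try lra.
  left; rewrite (_ : n - k + - j + k = n - j) 1?(_ : n - k + - j = n - j - k) 1?(_ : n - k + k = n); ring.
- apply: (half _ (main n j k _ _)); rewrite /M ?(ltr0_norm hj) ?(ltr0_norm hk); try lra.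
Qed.
End resonance.

(** * Bounds for the kernels of the cubic sums *)

Section kernel.
Context {R : realType}.
Implicit Types (g b d r th c D J K P : R).

(** Everything is in logarithms, with [l1], [l2'], [l3] for the weights [A1], [A2], [A3] and [lc]
    for [- ln c]. Here [N <= 8 J], so [J] pays the loss [N^g] of the resonance bound, and what is
    left of [J] goes into the decay in [lm]. The coefficients are variables, so the difference of
    the two sides is exhibited as a sum of products of nonnegative factors. *)
Lemma kernel_log_far g b d r th (lc l2 l8 lP lD lJ lK l1 l2' l3 lN lm lk : R) :
  0 < g < 1 -> 0 <= d -> d <= 1 - g -> 1 <= th <= 2 -> 0 <= r <= b -> b <= 1 ->
  0 <= lc -> 0 <= l2 -> 0 <= l8 -> 0 <= lJ -> 0 <= lK -> 0 <= l1 -> 0 <= l2' -> 0 <= l3 ->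
  lm <= lJ -> lm <= l1 -> lm <= l2' -> 0 <= lm ->
  lk <= lK -> 0 <= lk -> lK <= lJ ->
  lD - l3 <= l2 + (lK - lk) ->
  lJ + lK - g * lN - lc <= lP -> lN <= lJ + l8 -> 0 <= lP ->
  (1 + d <= 1 - g - d + b + b ->
    - lP + r * lD - r * l3 - b * l1 - b * l2' <= (lc + l2 + l8) - (1 + d) * lm - (1 + d) * lk) /\
  (1 + d <= th * (1 - g) - d + r + b ->
    - (th * lP) + r * lD - b * l3 - r * l1 - b * l2' <= 2 * (lc + l2 + l8) - (1 + d) * lm - (1 + d) * lk).
Proof.
move=> /andP[g0 g1] d0 dg /andP[th1 th2] /andP[r0 rb] b1 lc0 l20 l80 J0 K0 l10 l2'0 l30 mJ m1 m2 m0 kK k0 KJ hD hP hN P0.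
have H (x y : R) : 0 <= x -> 0 <= y -> 0 <= x * y by exact: mulr_ge0.
have b0 : 0 <= b := le_trans r0 rb.
have r1 : r <= 1 := le_trans rb b1.
have eA : 0 <= lP - (lJ + lK - g * lN - lc) by rewrite subr_ge0.
have P (x y u v : R) : x <= y -> u <= v -> 0 <= (y - x) * (v - u) by move=> ? ?; rewrite mulr_ge0 ?subr_ge0.
have Q (x u v : R) : 0 <= x -> u <= v -> 0 <= x * (v - u) by move=> ? ?; rewrite mulr_ge0 ?subr_ge0.
have S (x y u : R) : x <= y -> 0 <= u -> 0 <= (y - x) * u by move=> ? ?; rewrite mulr_ge0 ?subr_ge0.
have lkJ := le_trans kK KJ.
have e1 := Q _ _ _ r0 hD.
have e2 := S _ _ _ r1 l20.
have e3 := P _ _ _ _ rb kK.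
have e4 := P _ _ _ _ b1 kK.
have e5 := Q _ _ _ (ltW g0) hN.
have e6 := S _ _ _ (ltW g1) l80.
have e7 := Q _ _ _ d0 lkJ.
have e8 := Q _ _ _ b0 m2.
split=> hs.
- have e9 := P _ _ _ _ dg mJ.
  have e10 := Q _ _ _ b0 m1.
  have e11 := S _ _ _ hs m0.
  rewrite -subr_ge0 [leRHS](_ : _ = (lP - (lJ + lK - g * lN - lc)) + r * (l2 + (lK - lk) - (lD - l3)) + (1 - r) * l2
    + (b - r) * (lK - lk) + (1 - b) * (lK - lk) + g * (lJ + l8 - lN) + (1 - g) * l8 + d * (lJ - lk)
    + b * (l2' - lm) + (1 - g - d) * (lJ - lm) + b * (l1 - lm) + (1 - g - d + b + b - (1 + d)) * lm); last by ring.
  by repeat (apply: addr_ge0; [|by rewrite ?addr_ge0]).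
- have hd : d <= th * (1 - g) by apply: le_trans dg _; rewrite ler_peMl ?subr_ge0 ?(ltW g1).
  have th0 : 0 <= th by apply: le_trans th1.
  have e9 := P _ _ _ _ hd mJ.
  have e10 := Q _ _ _ r0 m1.
  have e11 := S _ _ _ hs m0.
  have e12 := S _ _ _ rb l30.
  have e13 := Q _ _ _ th0 hP.
  have e14 := S _ _ _ th1 K0.
  have e15 := S _ _ _ th2 lc0.
  have e16 := mulr_ge0 th0 e5.
  have e17 := mulr_ge0 th0 e6.
  have e18 := S _ _ _ th2 l80.
  rewrite -subr_ge0 [leRHS](_ : _ = r * (l2 + (lK - lk) - (lD - l3)) + (1 - r) * l2
    + (b - r) * (lK - lk) + (1 - b) * (lK - lk) + d * (lJ - lk) + b * (l2' - lm)
    + (th * (1 - g) - d) * (lJ - lm) + r * (l1 - lm) + (th * (1 - g) - d + r + b - (1 + d)) * lm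
    + (b - r) * l3 + th * (lP - (lJ + lK - g * lN - lc)) + (th - 1) * lK + (2 - th) * lc
    + th * (g * (lJ + l8 - lN)) + th * ((1 - g) * l8) + (2 - th) * l8 + l2); last by ring.
  by repeat (apply: addr_ge0; [|by rewrite ?addr_ge0]).
Qed.

(** Here all four frequencies are comparable to [N]. The resonance gives [N^g / (J K)], the two
    weights with exponent [b] give [N^(- 2 b)], and [g + 2 d <= 2 b] leaves [N^(- 2 d)], which
    supplies the missing decay [(J K)^(- d)]. *)
Lemma kernel_log_near g b d r th (lc l2 lP lD lJ lK l1 l2' l3 lN : R) :
  0 < g < 1 -> 0 <= d -> g + d + d <= b + b -> 1 <= th -> 0 <= r <= b -> b <= 1 ->
  0 <= lc -> 0 <= l2 ->
  lD <= lN -> lN - l2 <= l1 -> lN - l2 <= l2' -> lN - l2 <= l3 ->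
  lJ <= lN -> lK <= lN -> 0 <= lN ->
  lJ + lK - g * lN - lc <= lP -> 0 <= lP ->
  (- lP + r * lD - r * l3 - b * l1 - b * l2' <= (lc + 3 * l2) - (1 + d) * lJ - (1 + d) * lK) /\
  (- (th * lP) + r * lD - b * l3 - r * l1 - b * l2' <= (lc + 3 * l2) - (1 + d) * lJ - (1 + d) * lK).
Proof.
move=> /andP[g0 g1] d0 dg th1 /andP[r0 rb] b1 lc0 l20 hD h1 h2 h3 hJ hK N0 hP P0.
have b0 : 0 <= b := le_trans r0 rb.
have r1 : r <= 1 := le_trans rb b1.
have eA : 0 <= lP - (lJ + lK - g * lN - lc) by rewrite subr_ge0.
have Q (x u v : R) : 0 <= x -> u <= v -> 0 <= x * (v - u) by move=> ? ?; rewrite mulr_ge0 ?subr_ge0.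
have S (x y u : R) : x <= y -> 0 <= u -> 0 <= (y - x) * u by move=> ? ?; rewrite mulr_ge0 ?subr_ge0.
have T (x u : R) : 0 <= x -> lN - l2 <= u -> 0 <= x * (u - lN + l2).
  by move=> x0 h; rewrite mulr_ge0//; clear -h; lra.
have e1 := Q _ _ _ r0 hD.
have e2 := T _ _ b0 h2.
have e3 := Q _ _ _ d0 hJ.
have e4 := Q _ _ _ d0 hK.
have e5 : 0 <= (b + b - g - d - d) * lN by apply: mulr_ge0 => //; clear -dg; lra.
have e6 := S _ _ _ b1 l20.
have e7 := S _ _ _ r1 l20.
split.
- have e8 := T _ _ r0 h3.
  have e9 := T _ _ b0 h1.
  rewrite -subr_ge0 [leRHS](_ : _ = (lP - (lJ + lK - g * lN - lc)) + r * (lN - lD) + b * (l2' - lN + l2)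
    + d * (lN - lJ) + d * (lN - lK) + (b + b - g - d - d) * lN + ((1 - b) * l2 + (1 - b) * l2)
    + (1 - r) * l2 + r * (l3 - lN + l2) + b * (l1 - lN + l2)); last by ring.
  by repeat (apply: addr_ge0; [|by rewrite ?addr_ge0]).
- have e8 := T _ _ b0 h3.
  have e9 := T _ _ r0 h1.
  have e10 := S _ _ _ th1 P0.
  rewrite -subr_ge0 [leRHS](_ : _ = (lP - (lJ + lK - g * lN - lc)) + r * (lN - lD) + b * (l2' - lN + l2)
    + d * (lN - lJ) + d * (lN - lK) + (b + b - g - d - d) * lN + ((1 - b) * l2 + (1 - b) * l2)
    + (1 - r) * l2 + b * (l3 - lN + l2) + r * (l1 - lN + l2) + (th - 1) * lP); last by ring.
  by repeat (apply: addr_ge0; [|by rewrite ?addr_ge0]).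
Qed.

(* [zw d] is the summable weight absorbing one frequency of the cubic sum. *)
Definition zw d (x : R) := x `^ (- (1 + d)).

(** The majorant separates the variables: its first factor is summable in [n1] for fixed [n3], its
    second in [n3]. In the proof [m] is the logarithm of the smallest of [J], [A1], [A2], and [k]
    that of the smaller of [K], [A3], so each exponential is one of the terms of the corresponding
    factor. *)
Lemma kernel_bound g b d r th c D J K A1 A2 A3 P :
  0 < g < 1 -> 0 <= d -> d <= 1 - g -> g + d + d <= b + b -> 1 <= th <= 2 ->
  0 <= r <= b -> b <= 1 -> 1 + d <= th * (1 - g) - d + r + b ->
  0 < c <= 1 -> 1 <= D -> 1 <= J -> 1 <= K -> 1 <= A1 -> 1 <= A2 -> 1 <= A3 ->
  1 <= P -> K <= J ->
  D <= A1 + J + K -> D <= A2 + J + K -> D <= A3 + K ->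
  c * (J * K) <= P * (D + J + K) `^ g ->
  let M := 2 ^+ 8 / c ^+ 2 * ((zw d J + zw d A1 + zw d A2) * (zw d K + zw d A3)) in
  P `^ (- 1) * D `^ r * A3 `^ (- r) * A1 `^ (- b) * A2 `^ (- b) <= M /\
  P `^ (- th) * D `^ r * A3 `^ (- b) * A1 `^ (- r) * A2 `^ (- b) <= M.
Proof.
move=> g01 d0 dg dgb th12 r0b b1 hth /andP[c0 c1] D1 J1 K1 A11 A21 A31 P1 KJ D1' D2' D3' hP M.
have pos (x : R) : 1 <= x -> 0 < x by apply: lt_le_trans.
pose N := D + J + K; have N1 : 1 <= N by rewrite /N; lra.
have [[Dp Jp Kp] [A1p A2p A3p]] : [/\ 0 < D, 0 < J & 0 < K] /\ [/\ 0 < A1, 0 < A2 & 0 < A3].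
  by split; split; exact: pos.
have [Pp Np] : 0 < P /\ 0 < N by split; exact: pos.
rewrite -/N in hP.
have lnle (x y : R) : 0 < x -> x <= y -> ln x <= ln y.
  by move=> x0 xy; rewrite ler_ln ?posrE// (lt_le_trans x0).
have l0 (x : R) : 1 <= x -> 0 <= ln x by exact: ln_ge0.
have ln2_0 : 0 <= ln (2 : R) by apply: l0; lra.
have ln8 : ln (8 : R) = 3 * ln 2.
  have -> : (8 : R) = 2 ^+ 3 by rewrite -natrX.
  by rewrite lnXn// mulr_natl.
have lc0 : ln c <= 0 by apply: ln_le0.
have hPl : ln J + ln K - g * ln N - - ln c <= ln P.
  have := lnle _ _ (mulr_gt0 c0 (mulr_gt0 Jp Kp)) hP.
  rewrite !lnM ?posrE ?mulr_gt0 ?powR_gt0// ln_powR; lra.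
have [m [m_le hm]] : exists m, [/\ m <= ln J, m <= ln A1, m <= ln A2 & 0 <= m] /\
    expR (- (1 + d) * m) <= zw d J + zw d A1 + zw d A2.
  have z0 (x : R) : 0 <= zw d x by exact: powR_ge0.
  have zE (x : R) : 0 < x -> zw d x = expR (- (1 + d) * ln x) by move=> ?; rewrite /zw powR_gtr0E.
  have [a b'] := (z0 J, z0 A1); have c' := z0 A2.
  case: (lerP (ln J) (ln A1)) => h1; case: (lerP (ln J) (ln A2)) => h2;
    [exists (ln J)|exists (ln A2)|case: (lerP (ln A1) (ln A2)) => h3; [exists (ln A1)|exists (ln A2)]|
      case: (lerP (ln A1) (ln A2)) => h3; [exists (ln A1)|exists (ln A2)]];
    rewrite -zE//; clear -h1 h2 a b' c' l0 J1 A11 A21 h3 || clear -h1 h2 a b' c' l0 J1 A11 A21; split; (try by split; rewrite ?l0//; lra); lra.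
have [k [k_le hk]] : exists k, [/\ k <= ln K, ln D - ln A3 <= ln 2 + (ln K - k) & 0 <= k] /\
    expR (- (1 + d) * k) <= zw d K + zw d A3.
  have z0 (x : R) : 0 <= zw d x by exact: powR_ge0.
  have zE (x : R) : 0 < x -> zw d x = expR (- (1 + d) * ln x) by move=> ?; rewrite /zw powR_gtr0E.
  have [a b'] := (z0 K, z0 A3).
  case: (lerP K A3) => h.
    exists (ln K); rewrite -zE//; split; last by rewrite lerDl.
    have : ln D <= ln (2 * A3) by apply: lnle => //; clear -D3' h; lra.
    by rewrite lnM ?posrE// => hh; split; rewrite ?l0//; clear -hh; lra.
  exists (ln A3); rewrite -zE//; split; last by rewrite lerDr.
  have : ln D <= ln (2 * K) by apply: lnle => //; clear -D3' h; lra.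
  have h' := lnle _ _ A3p (ltW h).
  by rewrite lnM ?posrE// => hh; split; rewrite ?l0//; clear -hh h'; lra.
have MM u : u <= 2 * (- ln c + ln 2 + ln 8) - (1 + d) * m - (1 + d) * k -> expR u <= M.
  move=> hu; apply: (@le_trans _ _ (expR (2 * (- ln c + ln 2 + ln 8)) * (expR (- (1 + d) * m) * expR (- (1 + d) * k)))).
    by rewrite -!expRD ler_expR; clear -hu; lra.
  rewrite /M; apply: ler_pM; rewrite ?expR_ge0 ?mulr_ge0 ?expR_ge0//; last first.
    by apply: ler_pM; rewrite ?expR_ge0.
  have -> : 2 * (- ln c + ln 2 + ln 8) = ln (2 ^+ 8 / c ^+ 2).
    by rewrite lnM ?posrE ?exprn_gt0 ?invr_gt0 ?exprn_gt0// lnV ?posrE ?exprn_gt0// !lnXn// ln8; ring.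
  by rewrite lnK// posrE divr_gt0// exprn_gt0.
have E1 : P `^ (- 1) * D `^ r * A3 `^ (- r) * A1 `^ (- b) * A2 `^ (- b)
    = expR (- ln P + r * ln D - r * ln A3 - b * ln A1 - b * ln A2).
  by rewrite !powR_gtr0E// -!expRD; congr expR; ring.
have E2 : P `^ (- th) * D `^ r * A3 `^ (- b) * A1 `^ (- r) * A2 `^ (- b)
    = expR (- (th * ln P) + r * ln D - b * ln A3 - r * ln A1 - b * ln A2).
  by rewrite !powR_gtr0E// -!expRD; congr expR; ring.
rewrite E1 E2.
have dg' : 1 + d <= 1 - g - d + b + b by clear -dgb; lra.
(* If [8 J <= N], then [J + K <= N / 4] since [K <= J], hence [D >= 3 N / 4] and each of the three
   weights is at least [D - J - K >= N / 2]. *)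
case: (lerP (8 * J) N) => hN.
  case: m_le => mJ m1 m2 m0; case: k_le => kK k3 k0.
  have hA A : 0 < A -> D <= A + J + K -> ln N - ln 2 <= ln A.
    move=> A0 hA; have : ln N <= ln (2 * A) by apply: lnle => //; rewrite /N in hN *; clear -hN hA KJ Dp; lra.
    by rewrite lnM ?posrE// => hh; clear -hh; lra.
  have hl0 : 0 <= - ln c by clear -lc0; lra.
  have D3'' : D <= A3 + J + K by clear -D3' Jp; lra.
  have DN : D <= N by rewrite /N; clear -Jp Kp; lra.
  have JN : J <= N by rewrite /N; clear -Dp Kp; lra.
  have KN : K <= N by rewrite /N; clear -Dp Jp; lra.
  have [h1 h2] := @kernel_log_near g b d r th (- ln c) (ln 2) (ln P) (ln D) (ln J) (ln K) (ln A1) (ln A2) (ln A3) (ln N)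
    g01 d0 dgb (proj1 (andP th12)) r0b b1 hl0 ln2_0 (lnle _ _ Dp DN) (hA _ A1p D1') (hA _ A2p D2') (hA _ A3p D3'')
    (lnle _ _ Jp JN) (lnle _ _ Kp KN) (l0 _ N1) hPl (l0 _ P1).
  have hm1 : (1 + d) * m <= (1 + d) * ln J by rewrite ler_wpM2l// addr_ge0.
  have hk1 : (1 + d) * k <= (1 + d) * ln K by rewrite ler_wpM2l// addr_ge0.
  by split; apply: MM; rewrite ln8; [clear -h1 hm1 hk1 ln2_0 hl0|clear -h2 hm1 hk1 ln2_0 hl0]; lra.
case: m_le => mJ m1 m2 m0; case: k_le => kK k3 k0.
have hl0 : 0 <= - ln c by clear -lc0; lra.
have l80 : 0 <= ln (8 : R) by rewrite ln8 mulr_ge0.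
have hN8 : ln N <= ln J + ln 8 by rewrite -lnM ?posrE//; apply: lnle => //; rewrite mulrC ltW.
have [h1 h2] := @kernel_log_far g b d r th (- ln c) (ln 2) (ln 8) (ln P) (ln D) (ln J) (ln K) (ln A1) (ln A2) (ln A3) (ln N) m k
  g01 d0 dg th12 r0b b1 hl0 ln2_0 l80 (l0 _ J1) (l0 _ K1) (l0 _ A11) (l0 _ A21) (l0 _ A31) mJ m1 m2 m0 kK k0 (lnle _ _ Kp KJ) k3 hPl hN8 (l0 _ P1).
by split; apply: MM; [have h := h1 dg'|have h := h2 hth]; clear -h ln2_0 hl0 l80; lra.
Qed.
End kernel.

Section kernel_sum.
Context {R : realType}.
Implicit Types (g b d r th c : R).

(* For the equation, [g = 2 - 2 alpha] is the loss in the resonance bound, [b] is twice the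
   Sobolev exponent, [r = 3 b - 1] is twice the weight of the weak norm in which [|u|^2 u] lives. *)
Definition kernel_params g b d r th :=
  [/\ 0 < g < 1, 0 < d & [/\ d <= 1 - g, g + d + d <= b + b & [/\ 1 <= th <= 2,
  0 <= r <= b, b <= 1 & 1 + d <= th * (1 - g) - d + r + b]]].

(** [A2] depends on both [n1] and [n3], so it always sits in the factor that is summed first: over
    [n1] in the first product, over [n3] in the second. *)
Definition kmaj d (J K A1 A2 A3 : R) :=
  (zw d J + zw d A1 + zw d A2) * (zw d K + zw d A3) +
  (zw d K + zw d A3 + zw d A2) * (zw d J + zw d A1).

(** Three uses of [kernel_bound]: with [r] replaced by [b] for the strong norm, as it stands, and
    with [A1] and [A2] exchanged. When the weak slot is the third one the power [P^(- 1)] suffices,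
    and [P^(- th) <= P^(- 1)]. *)
Lemma kernel_all_le g b d r th c (D J K A1 A2 A3 P : R) : kernel_params g b d r th ->
  0 < c <= 1 -> 1 <= D -> 1 <= J -> 1 <= K -> 1 <= A1 -> 1 <= A2 -> 1 <= A3 ->
  1 <= P -> K <= J -> D <= A1 + J -> D <= A2 + J + K -> D <= A3 + K ->
  c * (J * K) <= P * (D + J + K) `^ g ->
  let M := 2 ^+ 8 / c ^+ 2 * kmaj d J K A1 A2 A3 in
  [/\ P `^ (- 1) * D `^ b * A1 `^ (- b) * A2 `^ (- b) * A3 `^ (- b) <= M,
      P `^ (- th) * D `^ r * A1 `^ (- r) * A2 `^ (- b) * A3 `^ (- b) <= M,
      P `^ (- th) * D `^ r * A1 `^ (- b) * A2 `^ (- r) * A3 `^ (- b) <= M &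
      P `^ (- th) * D `^ r * A1 `^ (- b) * A2 `^ (- b) * A3 `^ (- r) <= M].
Proof.
move=> [g01 d0 [dg dgb [th12 r0b b1 hth]]] c01 D1 J1 K1 A11 A21 A31 P1 KJ D1' D2' D3' hP M.
have z0 (x : R) : 0 <= zw d x by exact: powR_ge0.
have h (x y : R) : x <= 2 ^+ 8 / c ^+ 2 * ((zw d J + zw d A1 + zw d A2) * (zw d K + zw d A3)) -> y = x -> y <= M.
  move=> hx ->; apply: le_trans hx _; rewrite /M ler_wpM2l//.
    by rewrite mulr_ge0// invr_ge0 exprn_ge0//; case/andP: c01 => /ltW.
  by rewrite /kmaj lerDl mulr_ge0 ?addr_ge0.
have D1'' : D <= A1 + J + K by clear -D1' K1; lra.
have b0 : 0 <= b <= b by case/andP: r0b => r0 rb; rewrite lexx (le_trans r0 rb).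
have hthb : 1 + d <= th * (1 - g) - d + b + b by clear -hth r0b; lra.
have d0' := ltW d0.
have [H1 _] := kernel_bound g01 d0' dg dgb th12 b0 b1 hthb c01 D1 J1 K1 A11 A21 A31 P1 KJ D1'' D2' D3' hP.
have [H2 H3] := kernel_bound g01 d0' dg dgb th12 r0b b1 hth c01 D1 J1 K1 A11 A21 A31 P1 KJ D1'' D2' D3' hP.
have [_ H4] := kernel_bound g01 d0' dg dgb th12 r0b b1 hth c01 D1 J1 K1 A21 A11 A31 P1 KJ D2' D1'' D3' hP.
split.
- by apply: (h _ _ H1); ring.
- by apply: (h _ _ H3); ring.
- by apply: (h (P `^ (- th) * D `^ r * A3 `^ (- b) * A2 `^ (- r) * A1 `^ (- b))); [rewrite (addrAC (zw d J))|ring].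
- apply: (@le_trans _ _ (P `^ (- 1) * D `^ r * A1 `^ (- b) * A2 `^ (- b) * A3 `^ (- r))).
    rewrite !ler_wpM2r ?powR_ge0//; apply: ler_powR => //; rewrite lerN2; by case/andP: th12.
  by apply: (h _ _ H2); ring.
Qed.

(** Exchanging [n1] and [n3] swaps [J] with [K] and [A1] with [A3] and leaves [kmaj] invariant,
    which reduces everything to [K <= J]. *)
Lemma kernel_all g b d r th c (D J K A1 A2 A3 P : R) : kernel_params g b d r th ->
  0 < c <= 1 -> 1 <= D -> 1 <= J -> 1 <= K -> 1 <= A1 -> 1 <= A2 -> 1 <= A3 ->
  1 <= P -> D <= A1 + J -> D <= A2 + J + K -> D <= A3 + K ->
  c * (J * K) <= P * (D + J + K) `^ g ->
  let M := 2 ^+ 8 / c ^+ 2 * kmaj d J K A1 A2 A3 in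
  [/\ P `^ (- 1) * D `^ b * A1 `^ (- b) * A2 `^ (- b) * A3 `^ (- b) <= M,
      P `^ (- th) * D `^ r * A1 `^ (- r) * A2 `^ (- b) * A3 `^ (- b) <= M,
      P `^ (- th) * D `^ r * A1 `^ (- b) * A2 `^ (- r) * A3 `^ (- b) <= M &
      P `^ (- th) * D `^ r * A1 `^ (- b) * A2 `^ (- b) * A3 `^ (- r) <= M].
Proof.
move=> hp c01 D1 J1 K1 A11 A21 A31 P1 D1' D2' D3' hP M.
have [KJ|/ltW JK] := lerP K J; first exact: (kernel_all_le hp).
have := @kernel_all_le g b d r th c D K J A3 A2 A1 P hp c01 D1 K1 J1 A31 A21 A11 P1 JK D3'.
rewrite (addrAC A2) (addrAC D) [K * J]mulrC => /(_ D2' D1' hP) [h1 h2 h3 h4].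
have E : kmaj d K J A3 A2 A1 = kmaj d J K A1 A2 A3 by rewrite /kmaj addrC.
rewrite E -/M in h1 h2 h3 h4.
by split; [apply: le_trans h1|apply: le_trans h4|apply: le_trans h3|apply: le_trans h2];
   rewrite le_eqVlt; apply/orP; left; apply/eqP; ring.
Qed.

Definition rmod (be : R) (n n1 n3 : int) : R :=
  Num.max 1 `|resonance be n%:~R n1%:~R n3%:~R|.

Lemma rmod_ge1 be n n1 n3 : 1 <= rmod be n n1 n3.
Proof. by rewrite /rmod le_max lexx. Qed.

Lemma jbD (m n : int) : @jb R (m + n) <= jb m + jb n.
Proof. by rewrite /jb rmorphD /=; have := ler_normD (m%:~R : R) n%:~R; lra. Qed.

Lemma jbN (n : int) : @jb R (- n) = jb n.
Proof. by rewrite /jb rmorphN normrN. Qed.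

Lemma jb_le2 (n : int) : n != 0 -> @jb R n <= 2 * `|n%:~R|.
Proof.
move=> n0; rewrite /jb mulr_natl mulr2n lerD2r -intr_norm ler1z.
by rewrite -gtz0_ge1 normr_gt0.
Qed.

(** The factor 4 comes from [jb <= 2 |.|] at the two nonzero differences. The size enters the
    resonance bound with the negative exponent [- g], so it may be replaced by the larger sum of
    brackets. *)
Lemma rmod_ge g (n n1 n3 : int) : 0 < g < 1 -> n1 != n -> n3 != n ->
  (2 - g) * (1 - g) / 4 * (jb (n - n1) * jb (n - n3))
  <= rmod (2 - g) n n1 n3 * (jb n + jb (n - n1) + jb (n - n3)) `^ g.
Proof.
move=> /andP[g0 g1] h1 h3.
have be12 : 1 < 2 - g < 2 by lra.
have := resonance_ge n%:~R n1%:~R n3%:~R be12.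
rewrite -!rmorphB /=; set N := `|n%:~R| + _ + _; set j := `|_ : R|; set k := `|_ : R|.
rewrite (_ : 2 - g - 1 = 1 - g) 1?(_ : 2 - g - 2 = - g); try ring.
move=> H.
have jn : n - n1 != 0 by rewrite subr_eq0 eq_sym.
have kn : n - n3 != 0 by rewrite subr_eq0 eq_sym.
have J := jb_le2 jn; have K := jb_le2 kn; rewrite -/j -/k in J K.
have J1 := jb_ge1 (R:=R) (n - n1); have K1 := jb_ge1 (R:=R) (n - n3); have D1 := jb_ge1 (R:=R) n.
set N' := jb n + _ + _.
have j0 : 0 < j by clear -J J1; lra.
have k0 : 0 < k by clear -K K1; lra.
have N0 : 0 < N by rewrite /N ltr_wpDl// ltr_wpDl.
have NN : N <= N' by rewrite /N' /jb /N /j /k !lerD ?lerDr.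
have N0' : 0 < N' by apply: lt_le_trans NN.
have hb : `|resonance (2 - g) n%:~R n1%:~R n3%:~R| <= rmod (2 - g) n n1 n3.
  by rewrite /rmod le_max lexx orbT.
have {}H := le_trans H hb.
have Ng : 1 <= N `^ (- g) * N' `^ g.
  rewrite powRN mulrC ler_pdivlMr ?powR_gt0// mul1r.
  by apply: ge0_ler_powR; rewrite ?nnegrE//; exact: ltW.
have q0 : 0 < (2 - g) * (1 - g) by rewrite mulr_gt0//; clear -g1; lra.
apply: (@le_trans _ _ ((2 - g) * (1 - g) * N `^ (- g) * (j * k) * N' `^ g)); last first.
  by rewrite ler_wpM2r ?powR_ge0.
apply: (@le_trans _ _ ((2 - g) * (1 - g) * (j * k))).
  rewrite -mulrA ler_pM2l// mulrC ler_pdivrMr//.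
  apply: le_trans (ler_pM _ _ J K) _; [by clear -J1; lra|by clear -K1; lra|].
  by clear; lra.
rewrite [leRHS](_ : _ = (2 - g) * (1 - g) * (j * k) * (N `^ (- g) * N' `^ g)); last by ring.
rewrite ler_peMr//; apply: mulr_ge0; first exact: ltW.
by apply: mulr_ge0; exact: ltW.
Qed.

Lemma sum_zw_affine d (Z : R) (s : seq int) (f : int -> int) : 
  (forall s : seq int, uniq s -> \sum_(m <- s) jb m `^ (- (1 + d)) <= Z) ->
  uniq s -> injective f -> \sum_(m <- s) zw d (jb (f m)) <= Z.
Proof.
move=> HZ us fi; rewrite -(big_map f xpredT (fun m => zw d (jb m))).
by apply: HZ; rewrite map_inj_uniq.
Qed.

(** These kernels are squares, as they appear after Cauchy-Schwarz: [P^(- 1)] is for the strong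
    norm, [P^(- th)] for the weak one, whose exponent [r] sits in each of the three slots in
    turn. *)
Lemma kernel_sum g b d r th : kernel_params g b d r th ->
  exists C : R, 0 < C /\ forall (n : int) (s : seq int), uniq s ->
  let P n1 n3 := rmod (2 - g) n n1 n3 in
  let D := jb n in
  let S (F : int -> int -> R) :=
    \sum_(n1 <- s) \sum_(n3 <- s) (if (n1 != n) && (n3 != n) then F n1 n3 else 0) in
  [/\ S (fun n1 n3 => P n1 n3 `^ (- 1) * D `^ b * jb n1 `^ (- b) * jb (n1 + n3 - n) `^ (- b) * jb n3 `^ (- b)) <= C,
      S (fun n1 n3 => P n1 n3 `^ (- th) * D `^ r * jb n1 `^ (- r) * jb (n1 + n3 - n) `^ (- b) * jb n3 `^ (- b)) <= C,
      S (fun n1 n3 => P n1 n3 `^ (- th) * D `^ r * jb n1 `^ (- b) * jb (n1 + n3 - n) `^ (- r) * jb n3 `^ (- b)) <= C &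
      S (fun n1 n3 => P n1 n3 `^ (- th) * D `^ r * jb n1 `^ (- b) * jb (n1 + n3 - n) `^ (- b) * jb n3 `^ (- r)) <= C].
Proof.
move=> hp; have [g01 d0 _] := hp.
have [Z [Z0 HZ]] := sum_jb d0.
pose c := (2 - g) * (1 - g) / 4.
have c01 : 0 < c <= 1.
  case/andP: g01 => g0 g1; rewrite /c; apply/andP; split; first by rewrite divr_gt0// mulr_gt0; clear -g1; lra.
  by clear -g0 g1; nra.
have C0 : 0 < 2 ^+ 8 / c ^+ 2 by case/andP: c01 => c0 _; rewrite divr_gt0// exprn_gt0.
exists (2 ^+ 8 / c ^+ 2 * ((3 * Z) * (2 * Z) + (3 * Z) * (2 * Z))); split.
  by rewrite mulr_gt0// addr_gt0// !mulr_gt0.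
move=> n s us P D S.
pose kj n1 n3 := kmaj d (jb (n - n1)) (jb (n - n3)) (jb n1) (jb (n1 + n3 - n)) (jb n3).
have z0 (x : R) : 0 <= zw d x by exact: powR_ge0.
have kj0 n1 n3 : 0 <= kj n1 n3 by rewrite /kj /kmaj !(addr_ge0, mulr_ge0).
have Hz f : injective f -> \sum_(m <- s) zw d (jb (f m)) <= Z by move=> fi; exact: (sum_zw_affine HZ).
have Hkj : \sum_(n1 <- s) \sum_(n3 <- s) kj n1 n3 <= (3 * Z) * (2 * Z) + (3 * Z) * (2 * Z).
  rewrite /kj /kmaj; under eq_bigr do rewrite big_split /=.
  rewrite big_split /=; apply: lerD.
    rewrite exchange_big /=.
    apply: (@le_trans _ _ (\sum_(n3 <- s) (3 * Z) * (zw d (jb (n - n3)) + zw d (jb n3)))).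
      apply: ler_sum => n3 _; rewrite -mulr_suml; apply: ler_wpM2r; first by rewrite addr_ge0.
      rewrite 2!big_split /=.
      have a1 := Hz (fun m => n - m) (fun x y => @subrI _ n x y).
      have a2 := Hz id (fun x y => id).
      have a3 := Hz (fun m => m + n3 - n) (fun x y h => addIr _ (addIr _ h)).
      by clear -a1 a2 a3; lra.
    rewrite -mulr_sumr ler_pM2l ?mulr_gt0// big_split /=.
    have a1 := Hz (fun m => n - m) (fun x y => @subrI _ n x y).
    have a2 := Hz id (fun x y => id).
    by clear -a1 a2; lra.
  apply: (@le_trans _ _ (\sum_(n1 <- s) (3 * Z) * (zw d (jb (n - n1)) + zw d (jb n1)))).
    apply: ler_sum => n1 _; rewrite -mulr_suml; apply: ler_wpM2r; first by rewrite addr_ge0.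
    rewrite 2!big_split /=.
    have a1 := Hz (fun m => n - m) (fun x y => @subrI _ n x y).
    have a2 := Hz id (fun x y => id).
    have a3 := Hz (fun m => n1 + m - n) (fun x y h => addrI _ (addIr _ h)).
    by clear -a1 a2 a3; lra.
  rewrite -mulr_sumr ler_pM2l ?mulr_gt0// big_split /=.
  have a1 := Hz (fun m => n - m) (fun x y => @subrI _ n x y).
  have a2 := Hz id (fun x y => id).
  by clear -a1 a2; lra.
have HS F : (forall n1 n3, n1 != n -> n3 != n -> F n1 n3 <= 2 ^+ 8 / c ^+ 2 * kj n1 n3) ->
    S F <= 2 ^+ 8 / c ^+ 2 * (3 * Z * (2 * Z) + 3 * Z * (2 * Z)).
  move=> hF; apply: (@le_trans _ _ (2 ^+ 8 / c ^+ 2 * \sum_(n1 <- s) \sum_(n3 <- s) kj n1 n3)); last by rewrite ler_pM2l.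
  rewrite mulr_sumr; apply: ler_sum => n1 _; rewrite mulr_sumr; apply: ler_sum => n3 _.
  by case: ifP => [/andP[h1 h3]|_]; [exact: hF|rewrite mulr_ge0// ltW].
have tri n1 n3 : [/\ @jb R n <= jb n1 + jb (n - n1), @jb R n <= jb (n1 + n3 - n) + jb (n - n1) + jb (n - n3) & @jb R n <= jb n3 + jb (n - n3)].
  split.
  - by have := jbD n1 (n - n1); rewrite addrC subrK.
  - apply: le_trans (_ : jb (n1 + n3 - n + (n - n1) + (n - n3)) <= _).
      by rewrite (_ : _ + _ + _ = n)//; ring.
    by apply: le_trans (jbD _ _) _; rewrite lerD2r jbD.
  - by have := jbD n3 (n - n3); rewrite addrC subrK.
have main n1 n3 (h1 : n1 != n) (h3 : n3 != n) := let: And3 t1 t2 t3 := tri n1 n3 in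
  @kernel_all g b d r th c D (jb (n - n1)) (jb (n - n3)) (jb n1) (jb (n1 + n3 - n)) (jb n3)
   (P n1 n3) hp c01 (jb_ge1 _) (jb_ge1 _) (jb_ge1 _) (jb_ge1 _) (jb_ge1 _) (jb_ge1 _) (rmod_ge1 _ _ _ _) t1 t2 t3 (rmod_ge g01 h1 h3).
by split; apply: HS => n1 n3 h1 h3; have [] := main n1 n3 h1 h3.
Qed.

End kernel_sum.

(** * Trilinear estimates *)

Section cauchy_schwarz.
Context {R : realType}.

Lemma cauchy_schwarz (T : Type) (K : seq T) (a b : T -> R) :
  (\sum_(k <- K) a k * b k) ^+ 2 <= (\sum_(k <- K) a k ^+ 2) * (\sum_(k <- K) b k ^+ 2).
Proof.
elim: K => [|x K IH]; first by rewrite !big_nil expr0n mulr0.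
rewrite !big_cons; set A := \sum_(j <- K) a j ^+ 2; set B := \sum_(j <- K) b j ^+ 2; set C := \sum_(j <- K) _.
have A0 : 0 <= A by apply: sumr_ge0 => i _; exact: sqr_ge0.
have B0 : 0 <= B by apply: sumr_ge0 => i _; exact: sqr_ge0.
have h : 2 * (C * (a x * b x)) <= A * b x ^+ 2 + B * a x ^+ 2.
  apply: le_trans (ler_norm _) _; rewrite -ler_sqr ?nnegrE ?normr_ge0//; last first.
    by rewrite addr_ge0// mulr_ge0// sqr_ge0.
  rewrite real_normK ?num_real//.
  have : 4 * (C ^+ 2 * (a x * b x) ^+ 2) <= 4 * (A * B * (a x * b x) ^+ 2).
    by rewrite ler_pM2l// ler_wpM2r// sqr_ge0.
  have := sqr_ge0 (A * b x ^+ 2 - B * a x ^+ 2).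
  by clear; nra.
rewrite -subr_ge0 in h; rewrite -subr_ge0 in IH; rewrite -subr_ge0.
rewrite (_ : _ - _ = (A * b x ^+ 2 + B * a x ^+ 2 - 2 * (C * (a x * b x))) + (A * B - C ^+ 2)); last by ring.
exact: addr_ge0.
Qed.

Lemma cauchy_schwarz_le (T : Type) (K : seq T) (a b : T -> R) (u v : R) : 0 <= u -> 0 <= v ->
  \sum_(k <- K) a k ^+ 2 <= u ^+ 2 -> \sum_(k <- K) b k ^+ 2 <= v ^+ 2 ->
  \sum_(k <- K) a k * b k <= u * v.
Proof.
move=> u0 v0 hu hv; apply: le_trans (ler_norm _) _.
rewrite -ler_sqr ?nnegrE ?mulr_ge0// real_normK ?num_real//.
apply: le_trans (cauchy_schwarz _ _ _) _; rewrite exprMn.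
by apply: ler_pM => //; apply: sumr_ge0 => i _; exact: sqr_ge0.
Qed.

Lemma minkowski_seq (T : Type) (K : seq T) (a b : T -> R) (u v : R) : 0 <= u -> 0 <= v ->
  \sum_(k <- K) a k ^+ 2 <= u ^+ 2 -> \sum_(k <- K) b k ^+ 2 <= v ^+ 2 ->
  \sum_(k <- K) (a k + b k) ^+ 2 <= (u + v) ^+ 2.
Proof.
move=> u0 v0 hu hv; have h := cauchy_schwarz_le u0 v0 hu hv.
rewrite (eq_bigr (fun k => (a k ^+ 2 + b k ^+ 2) + 2 * (a k * b k))); last by move=> k _; ring.
by rewrite !big_split /= -mulr_sumr; clear -hu hv h; nra.
Qed.

End cauchy_schwarz.

Section trilinear.
Context {R : realType}.
Variables (g b d rr th : R).
Hypothesis hp : kernel_params g b d rr th.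
Implicit Types (n : int) (r : seq int).

Definition tri r (kap : int -> int -> int -> R) (x y z : int -> R) n : R :=
  \sum_(n1 <- r) \sum_(n3 <- r)
    (if n1 + n3 - n \in r then kap n n1 n3 * (x n1 * y (n1 + n3 - n) * z n3) else 0).

(* [rmod] is [max 1 |P|] for the resonance [P]. Near-resonant interactions are summed with [kapS];
   an integration by parts in time gains the better power in [kapW], for nonzero [P] only. *)
Definition kapS n n1 n3 : R := rmod (2 - g) n n1 n3 `^ (- 2^-1).
Definition kapW n n1 n3 : R :=
  if (n1 != n) && (n3 != n) then rmod (2 - g) n n1 n3 `^ (- (th / 2)) else 0.

(* Membership in the ball of radius [c], for the Sobolev norm ([nX]) and for the weak weighted
   sup norm ([nY]), over finitely many frequencies. *)
Definition nX r (x : int -> R) (c : R) := \sum_(n <- r) jb n `^ b * x n ^+ 2 <= c ^+ 2.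
Definition nY r (x : int -> R) (c : R) := forall n, n \in r -> jb n `^ (rr / 2) * x n <= c.

Lemma powR_half (x e : R) : 0 < x -> (x `^ (e / 2)) ^+ 2 = x `^ e.
Proof. by move=> x0; rewrite -powR_mulrn ?powR_ge0// -powRrM divfK. Qed.

Lemma sum_le_of_uniq r (F : int -> R) (f : int -> int) : uniq r -> injective f ->
  (forall n, 0 <= F n) ->
  \sum_(n <- r) (if f n \in r then F (f n) else 0) <= \sum_(n <- r) F n.
Proof.
move=> ur fi F0; rewrite -big_mkcond -big_filter -(big_map f xpredT F).
apply: ler_sum_uniq => //; first by rewrite map_inj_uniq// filter_uniq.
by move=> x /mapP[y]; rewrite mem_filter => /andP[h _] ->.
Qed.

Lemma nX_sqr r x c : nX r x c <-> \sum_(n <- r) (jb n `^ (b / 2) * x n) ^+ 2 <= c ^+ 2.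
Proof. by rewrite /nX; under eq_bigr do rewrite -(powR_half _ (jb_gt0 _)) -exprMn. Qed.

Lemma nX_add r x y c c' : 0 <= c -> 0 <= c' -> nX r x c -> nX r y c' ->
  nX r (fun n => x n + y n) (c + c').
Proof.
move=> c0 c0' /nX_sqr h /nX_sqr h'; apply/nX_sqr; under eq_bigr do rewrite mulrDr.
exact: minkowski_seq.
Qed.

Lemma nX_le r x y c c' : 0 <= c <= c' -> (forall n, n \in r -> 0 <= x n <= y n) -> nX r y c -> nX r x c'.
Proof.
move=> /andP[c0 cc'] xy; rewrite /nX => h.
apply: (@le_trans _ _ (c ^+ 2)); last by rewrite ler_sqr ?nnegrE// (le_trans c0).
apply: le_trans h; rewrite !big_seq; apply: ler_sum => n nr.
have /andP[x0 xy'] := xy n nr.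
by rewrite ler_wpM2l ?powR_ge0// ler_sqr ?nnegrE// (le_trans x0).
Qed.

Lemma nX_l2 r x c : nX r x c -> \sum_(n <- r) x n ^+ 2 <= c ^+ 2.
Proof.
apply: le_trans; apply: ler_sum => n _; rewrite ler_peMl ?sqr_ge0//.
case: hp => _ _ [_ _ [_ /andP[r0 rb] _ _]].
by rewrite -(powRr0 (jb n)) ler_powR ?jb_ge1// (le_trans r0).
Qed.

Lemma sum3_uniq r (X Y Z : int -> R) : uniq r ->
  (forall n, 0 <= X n) -> (forall n, 0 <= Y n) -> (forall n, 0 <= Z n) ->
  \sum_(n <- r) \sum_(n1 <- r) \sum_(n3 <- r)
    (if n1 + n3 - n \in r then X n1 * Y (n1 + n3 - n) * Z n3 else 0) <=
  (\sum_(n <- r) X n) * (\sum_(n <- r) Y n) * (\sum_(n <- r) Z n).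
Proof.
move=> ur X0 Y0 Z0; rewrite exchange_big /=.
rewrite mulr_suml mulr_suml; apply: ler_sum => n1 _; rewrite exchange_big /= mulr_sumr; apply: ler_sum => n3 _.
rewrite (eq_bigr (fun n => X n1 * Z n3 * (if n1 + n3 - n \in r then Y (n1 + n3 - n) else 0))); last first.
  by move=> n _; case: ifP; rewrite ?mulr0// mulrAC.
rewrite -mulr_sumr [leRHS]mulrAC ler_wpM2l ?mulr_ge0//.
by apply: (sum_le_of_uniq (f := fun n => n1 + n3 - n)) => // x y /addrI /oppr_inj.
Qed.

(** For each [n], Cauchy-Schwarz in [(n1, n3)] isolates the kernel, which [kernel_sum] bounds
    uniformly in [n]. The other factor, summed over [n] too, is at most the product of the three
    squared norms, since for fixed [n1] and [n3] the map from [n] to [n1 + n3 - n] is injective. *)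
Lemma tri_nonres : exists C : R, 0 < C /\ forall r kap x y z c1 c2 c3, uniq r ->
  (forall n n1 n3, 0 <= kap n n1 n3) -> (forall n n1 n3, (n1 == n) || (n3 == n) -> kap n n1 n3 = 0) ->
  (forall n n1 n3, kap n n1 n3 <= kapS n n1 n3) ->
  (forall n, 0 <= x n) -> (forall n, 0 <= y n) -> (forall n, 0 <= z n) -> 0 <= c1 -> 0 <= c2 -> 0 <= c3 ->
  nX r x c1 -> nX r y c2 -> nX r z c3 -> nX r (tri r kap x y z) (C * c1 * c2 * c3).
Proof.
have [C [C0 HC]] := kernel_sum hp.
exists (C + 1); split; first by rewrite addr_gt0.
move=> r kap x y z c1 c2 c3 ur k0 kn kS x0 y0 z0 c10 c20 c30 hx hy hz.
have key n : jb n `^ b * tri r kap x y z n ^+ 2 <=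
   C * \sum_(n1 <- r) \sum_(n3 <- r) (if n1 + n3 - n \in r then
      (jb n1 `^ b * x n1 ^+ 2) * (jb (n1 + n3 - n) `^ b * y (n1 + n3 - n) ^+ 2) * (jb n3 `^ b * z n3 ^+ 2) else 0).
  pose K := [seq (n1, n3) | n1 <- r, n3 <- r].
  pose A (k : int * int) : R := if k.1 + k.2 - n \in r then kap n k.1 k.2 * jb n `^ (b / 2) * jb k.1 `^ (- (b / 2))
      * jb (k.1 + k.2 - n) `^ (- (b / 2)) * jb k.2 `^ (- (b / 2)) else 0.
  pose B (k : int * int) : R := if k.1 + k.2 - n \in r then (jb k.1 `^ (b / 2) * x k.1) * (jb (k.1 + k.2 - n) `^ (b / 2) * y (k.1 + k.2 - n))
     * (jb k.2 `^ (b / 2) * z k.2) else 0.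
  have e : jb n `^ b * tri r kap x y z n ^+ 2 = (\sum_(k <- K) A k * B k) ^+ 2.
    rewrite -(powR_half _ (jb_gt0 n)) -exprMn /tri; congr (_ ^+ 2).
    rewrite big_allpairs mulr_sumr; apply: eq_bigr => n1 _; rewrite mulr_sumr; apply: eq_bigr => n3 _.
    rewrite /A /B /=; case: ifP => _; last by rewrite !mulr0.
    have i m : jb m `^ (- (b / 2)) * jb m `^ (b / 2) = 1 :> R.
      by rewrite powRN mulVf// gt_eqF// powR_gt0// jb_gt0.
    rewrite [RHS](_ : _ = kap n n1 n3 * jb n `^ (b / 2) * (x n1 * y (n1 + n3 - n) * z n3) *
      (jb n1 `^ (- (b / 2)) * jb n1 `^ (b / 2)) * (jb n3 `^ (- (b / 2)) * jb n3 `^ (b / 2)) *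
      (jb (n1 + n3 - n) `^ (- (b / 2)) * jb (n1 + n3 - n) `^ (b / 2))); last by ring.
    by rewrite !i; ring.
  rewrite e; apply: le_trans (cauchy_schwarz _ _ _) _.
  apply: ler_pM; try by apply: sumr_ge0 => k _; exact: sqr_ge0.
    have [h _ _ _] := HC n r ur; apply: le_trans h.
    rewrite big_allpairs; apply: ler_sum => n1 _; apply: ler_sum => n3 _; rewrite /A /=.
    case: ifP => _; last by rewrite expr0n; case: ifP => // _; rewrite !mulr_ge0 ?powR_ge0.
    case: ifPn => [_|]; last by rewrite negb_and !negbK => /kn ->; rewrite !mul0r expr0n.
    have half m : (jb m `^ (- (b / 2))) ^+ 2 = jb m `^ (- b) :> R by rewrite -mulNr powR_half// jb_gt0.
    rewrite !exprMn !half powR_half ?jb_gt0// !ler_wpM2r ?powR_ge0//.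
    have rm0 : 0 < rmod (2 - g) n n1 n3 by apply: lt_le_trans (rmod_ge1 _ _ _ _).
    rewrite -(powR_half _ rm0) ler_sqr ?nnegrE ?powR_ge0//.
    by have := kS n n1 n3; rewrite /kapS mulN1r.
  rewrite big_allpairs; apply: ler_sum => n1 _; apply: ler_sum => n3 _; rewrite /B /=.
  by case: ifP => _; rewrite ?expr0n// !exprMn !powR_half ?jb_gt0.
rewrite /nX; apply: le_trans (ler_sum _ (fun n _ => key n)) _; rewrite -mulr_sumr.
apply: (@le_trans _ _ (C * (c1 ^+ 2 * c2 ^+ 2 * c3 ^+ 2))).
  rewrite ler_pM2l//; apply: le_trans (@sum3_uniq r (fun n => jb n `^ b * x n ^+ 2)
    (fun n => jb n `^ b * y n ^+ 2) (fun n => jb n `^ b * z n ^+ 2) ur _ _ _) _;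
    try by move=> n; rewrite mulr_ge0 ?powR_ge0 ?sqr_ge0.
  have s0 (w : int -> R) : 0 <= \sum_(n <- r) jb n `^ b * w n ^+ 2.
    by apply: sumr_ge0 => n _; rewrite mulr_ge0 ?powR_ge0 ?sqr_ge0.
  by apply: ler_pM => //; [exact: mulr_ge0|apply: ler_pM].
have hC : C <= (C + 1) ^+ 2 by nra.
by rewrite !exprMn !mulrA !ler_wpM2r ?sqr_ge0.
Qed.

Lemma sum_one_le r (G : int -> R) n : uniq r -> (forall m, 0 <= G m) ->
  \sum_(m <- r) (if m == n then G m else 0) <= G n.
Proof.
move=> ur G0; rewrite -big_mkcond -big_filter.
have -> : G n = \sum_(m <- [:: n]) G m by rewrite big_seq1.
apply: ler_sum_uniq => //; first exact: filter_uniq.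
by move=> x; rewrite mem_filter inE => /andP[].
Qed.

Lemma nX_scale r x c k : 0 <= k -> nX r x c -> nX r (fun n => x n * k) (c * k).
Proof.
move=> k0; rewrite /nX exprMn => h; under eq_bigr do rewrite exprMn mulrA.
by rewrite -mulr_suml ler_wpM2r ?sqr_ge0.
Qed.

Lemma kapS_ge0 n n1 n3 : 0 <= kapS n n1 n3. Proof. exact: powR_ge0. Qed.

Lemma kapS_le1 n n1 n3 : kapS n n1 n3 <= 1.
Proof.
by rewrite -(powRr0 (rmod (2 - g) n n1 n3)) /kapS ler_powR ?rmod_ge1.
Qed.

Lemma kapW_ge0 n n1 n3 : 0 <= kapW n n1 n3.
Proof. by rewrite /kapW; case: ifP => // _; exact: powR_ge0. Qed.

Lemma kapW_le n n1 n3 : kapW n n1 n3 <= kapS n n1 n3.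
Proof.
rewrite /kapW; case: ifP => _; last exact: kapS_ge0.
rewrite ler_powR ?rmod_ge1// lerN2.
by case: hp => _ _ [_ _ [/andP[th1 _] _ _ _]]; rewrite -[leLHS]mul1r ler_pM2r ?invr_gt0.
Qed.

Lemma tri_ge0 r kap x y z n : (forall n n1 n3, 0 <= kap n n1 n3) ->
  (forall n, 0 <= x n) -> (forall n, 0 <= y n) -> (forall n, 0 <= z n) -> 0 <= tri r kap x y z n.
Proof.
move=> k0 x0 y0 z0; rewrite /tri; apply: sumr_ge0 => n1 _; apply: sumr_ge0 => n3 _.
by case: ifP => // _; rewrite !mulr_ge0.
Qed.

(** The terms with [n1 = n] or [n3 = n] have no decay. But there the two other frequencies coincide,
    so these terms are [x n] or [z n] times an [l^2] pairing, and [kapS <= 1] is enough. *)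
Lemma triS_bound : exists C : R, 0 < C /\ forall r x y z c1 c2 c3, uniq r ->
  (forall n, 0 <= x n) -> (forall n, 0 <= y n) -> (forall n, 0 <= z n) -> 0 <= c1 -> 0 <= c2 -> 0 <= c3 ->
  nX r x c1 -> nX r y c2 -> nX r z c3 -> nX r (tri r kapS x y z) (C * c1 * c2 * c3).
Proof.
have [C [C0 HC]] := tri_nonres.
exists (C + 1 + 1); split; first by rewrite !addr_gt0.
move=> r x y z c1 c2 c3 ur x0 y0 z0 c10 c20 c30 hx hy hz.
pose kapN n n1 n3 := if (n1 != n) && (n3 != n) then kapS n n1 n3 else 0.
have kN0 n n1 n3 : 0 <= kapN n n1 n3 by rewrite /kapN; case: ifP => // _; exact: kapS_ge0.
have h1 : nX r (tri r kapN x y z) (C * c1 * c2 * c3).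
  apply: HC => //.
  - by move=> n n1 n3 h; rewrite /kapN -negb_or h.
  - by move=> n n1 n3; rewrite /kapN; case: ifP => // _; exact: kapS_ge0.
have hyz : \sum_(m <- r) y m * z m <= c2 * c3 by apply: cauchy_schwarz_le => //; exact: nX_l2.
have hxy : \sum_(m <- r) x m * y m <= c1 * c2 by apply: cauchy_schwarz_le => //; exact: nX_l2.
have h2 : nX r (fun n => x n * (c2 * c3)) (c1 * (c2 * c3)) by apply: nX_scale => //; exact: mulr_ge0.
have h3 : nX r (fun n => z n * (c1 * c2)) (c3 * (c1 * c2)) by apply: nX_scale => //; exact: mulr_ge0.
have C1 : 0 <= C * c1 * c2 * c3 by rewrite !mulr_ge0// ltW.
have := nX_add (addr_ge0 C1 (mulr_ge0 c10 (mulr_ge0 c20 c30))) (mulr_ge0 c30 (mulr_ge0 c10 c20)) (nX_add C1 (mulr_ge0 c10 (mulr_ge0 c20 c30)) h1 h2) h3.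
apply: nX_le => [|n nr].
  have -> : (C + 1 + 1) * c1 * c2 * c3 = C * c1 * c2 * c3 + c1 * (c2 * c3) + c3 * (c1 * c2) by ring.
  by rewrite lexx andbT !addr_ge0// !mulr_ge0.
rewrite tri_ge0//=; last by move=> *; exact: kapS_ge0.
apply: (@le_trans _ _ (tri r kapN x y z n + x n * (\sum_(m <- r) y m * z m) + z n * (\sum_(m <- r) x m * y m))); last first.
  by rewrite lerD ?ler_wpM2l// lerD ?ler_wpM2l.
have -> : x n * (\sum_(m <- r) y m * z m) = \sum_(n3 <- r) x n * (y n3 * z n3) by rewrite mulr_sumr.
have -> : z n * (\sum_(m <- r) x m * y m) = \sum_(n1 <- r) z n * (x n1 * y n1) by rewrite mulr_sumr.
pose A n1 n3 := if n1 == n then x n * (y n3 * z n3) else 0.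
pose B n1 n3 := if n3 == n then z n * (x n1 * y n1) else 0.
apply: (@le_trans _ _ (tri r kapN x y z n + \sum_(n1 <- r) \sum_(n3 <- r) A n1 n3 + \sum_(n1 <- r) \sum_(n3 <- r) B n1 n3)).
  rewrite /tri -!big_split /=; apply: ler_sum => n1 _; rewrite -!big_split /=; apply: ler_sum => n3 _.
  have A0 : 0 <= A n1 n3 by rewrite /A; case: ifP => // _; rewrite !mulr_ge0.
  have B0 : 0 <= B n1 n3 by rewrite /B; case: ifP => // _; rewrite !mulr_ge0.
  case: ifP => _; last by rewrite add0r addr_ge0.
  rewrite /kapN; case: ifPn => [_|]; first by rewrite -addrA lerDl addr_ge0.
  rewrite negb_and !negbK mul0r add0r => /orP[/eqP e|/eqP e].
    apply: (@le_trans _ _ (A n1 n3)); last by rewrite lerDl.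
    rewrite /A e eqxx (_ : n + n3 - n = n3); last by ring.
    by rewrite -mulrA ler_piMl ?kapS_le1// !mulr_ge0.
  apply: (@le_trans _ _ (B n1 n3)); last by rewrite lerDr.
  rewrite /B e eqxx (_ : n1 + n - n = n1); last by ring.
  by rewrite (mulrC (z n)) ler_piMl ?kapS_le1// !mulr_ge0.
apply: lerD; [apply: lerD => //|].
  rewrite /A exchange_big /=; apply: ler_sum => n3 _.
  by apply: (@sum_one_le r (fun=> x n * (y n3 * z n3))) => // m; rewrite !mulr_ge0.
rewrite /B; apply: ler_sum => n1 _.
by apply: (@sum_one_le r (fun=> z n * (x n1 * y n1))) => // m; rewrite !mulr_ge0.
Qed.

(** [pa] is the slot known only in the weak norm. Its value is replaced by [cf] times the inverse
    weight, which joins the kernel, and Cauchy-Schwarz handles the two other slots with [n] fixed.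
    The hypothesis on [U] and [V] holds when distinct pairs [(n1, n3)] give distinct pairs of
    remaining frequencies. *)
Lemma weak_slot (C : R) r n (pa pb pc : int -> int -> int) (f x y : int -> R) cf cx cy :
  0 < C -> uniq r ->
  (forall n, 0 <= f n) -> (forall n, 0 <= x n) -> (forall n, 0 <= y n) -> 0 <= cf -> 0 <= cx -> 0 <= cy ->
  (forall n1 n3, n1 \in r -> n3 \in r -> n1 + n3 - n \in r -> pa n1 n3 \in r) ->
  \sum_(n1 <- r) \sum_(n3 <- r) (if (n1 != n) && (n3 != n) then
    rmod (2 - g) n n1 n3 `^ (- th) * jb n `^ rr * jb (pa n1 n3) `^ (- rr) * jb (pb n1 n3) `^ (- b) * jb (pc n1 n3) `^ (- b) else 0) <= C ->
  (forall U V : int -> R, (forall n, 0 <= U n) -> (forall n, 0 <= V n) ->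
    \sum_(n1 <- r) \sum_(n3 <- r) (if n1 + n3 - n \in r then U (pb n1 n3) * V (pc n1 n3) else 0) <=
     (\sum_(m <- r) U m) * (\sum_(m <- r) V m)) ->
  nY r f cf -> nX r x cx -> nX r y cy ->
  jb n `^ (rr / 2) * (\sum_(n1 <- r) \sum_(n3 <- r) (if n1 + n3 - n \in r then
    kapW n n1 n3 * (f (pa n1 n3) * x (pb n1 n3) * y (pc n1 n3)) else 0)) <= (C + 1) * cf * cx * cy.
Proof.
move=> C0 ur f0 x0 y0 cf0 cx0 cy0 hpa hk hUV hf hx hy.
pose K := [seq (n1, n3) | n1 <- r, n3 <- r].
pose A (k : int * int) : R := if k.1 + k.2 - n \in r then kapW n k.1 k.2 * jb n `^ (rr / 2) * jb (pa k.1 k.2) `^ (- (rr / 2))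
    * jb (pb k.1 k.2) `^ (- (b / 2)) * jb (pc k.1 k.2) `^ (- (b / 2)) else 0.
pose B (k : int * int) : R := if k.1 + k.2 - n \in r then (jb (pb k.1 k.2) `^ (b / 2) * x (pb k.1 k.2))
   * (jb (pc k.1 k.2) `^ (b / 2) * y (pc k.1 k.2)) else 0.
have half e m : (jb m `^ (- (e / 2))) ^+ 2 = jb m `^ (- e) :> R by rewrite -mulNr powR_half// jb_gt0.
have hAB : \sum_(k <- K) A k * B k <= (C + 1) * (cx * cy).
  apply: cauchy_schwarz_le; rewrite ?addr_ge0 ?mulr_ge0//; first exact: ltW.
    apply: (@le_trans _ _ C); last by nra.
    apply: le_trans hk; rewrite big_allpairs; apply: ler_sum => n1 _; apply: ler_sum => n3 _; rewrite /A /=.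
    case: ifP => _; last by rewrite expr0n; case: ifP => // _; rewrite !mulr_ge0 ?powR_ge0.
    rewrite /kapW; case: ifP => _; last by rewrite !mul0r expr0n.
    have rm0 : 0 < rmod (2 - g) n n1 n3 by apply: lt_le_trans (rmod_ge1 _ _ _ _).
    have e1 : (rmod (2 - g) n n1 n3 `^ (- (th / 2))) ^+ 2 = rmod (2 - g) n n1 n3 `^ (- th).
      by rewrite -(mulNr th) (powR_half _ rm0).
    have sq5 (a1 a2 a3 a4 a5 : R) : (a1 * a2 * a3 * a4 * a5) ^+ 2 = a1 ^+ 2 * a2 ^+ 2 * a3 ^+ 2 * a4 ^+ 2 * a5 ^+ 2 by ring.
    by rewrite sq5 e1 (half rr (pa n1 n3)) (half b (pb n1 n3)) (half b (pc n1 n3)) (powR_half rr (jb_gt0 n)).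
  rewrite exprMn; apply: le_trans (_ : _ <= (\sum_(n <- r) jb n `^ b * x n ^+ 2) * (\sum_(n <- r) jb n `^ b * y n ^+ 2)) _.
    apply: le_trans (hUV (fun n => jb n `^ b * x n ^+ 2) (fun n => jb n `^ b * y n ^+ 2) _ _);
      try by move=> m; rewrite mulr_ge0 ?powR_ge0 ?sqr_ge0.
    rewrite big_allpairs; apply: ler_sum => n1 _; apply: ler_sum => n3 _; rewrite /B /=.
    by case: ifP => _; rewrite ?expr0n// !exprMn !powR_half ?jb_gt0.
  by apply: ler_pM => //; apply: sumr_ge0 => m _; rewrite mulr_ge0 ?powR_ge0 ?sqr_ge0.
apply: (@le_trans _ _ (cf * \sum_(k <- K) A k * B k)); last first.
  by rewrite [leRHS](_ : _ = cf * ((C + 1) * (cx * cy))) ?ler_wpM2l//; ring.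
rewrite big_allpairs !mulr_sumr [leLHS]big_seq [leRHS]big_seq; apply: ler_sum => n1 n1r.
rewrite !mulr_sumr [leLHS]big_seq [leRHS]big_seq; apply: ler_sum => n3 n3r.
rewrite /A /B /=; case: ifP => [n2r|_]; last by rewrite !mulr0.
have hfa := hf _ (hpa _ _ n1r n3r n2r).
have i e m : jb m `^ (- (e / 2)) * jb m `^ (e / 2) = 1 :> R.
  by rewrite powRN mulVf// gt_eqF// powR_gt0// jb_gt0.
rewrite [leLHS](_ : _ = kapW n n1 n3 * jb n `^ (rr / 2) * (x (pb n1 n3) * y (pc n1 n3)) * f (pa n1 n3)); last by ring.
rewrite [leRHS](_ : _ = kapW n n1 n3 * jb n `^ (rr / 2) * (x (pb n1 n3) * y (pc n1 n3)) * (cf * jb (pa n1 n3) `^ (- (rr / 2))) *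
   (jb (pb n1 n3) `^ (- (b / 2)) * jb (pb n1 n3) `^ (b / 2)) * (jb (pc n1 n3) `^ (- (b / 2)) * jb (pc n1 n3) `^ (b / 2))); last by ring.
rewrite !i !mulr1 ler_wpM2l ?mulr_ge0 ?powR_ge0 ?kapW_ge0//.
by rewrite powRN ler_pdivlMr ?powR_gt0 ?jb_gt0// mulrC.
Qed.

Definition nB (rough : bool) := if rough then nY else nX.

(** One rough input makes the output rough; this is [weak_slot] in each of the three positions.
    Without rough input, [kapW <= kapS] and the vanishing of [kapW] on resonant terms reduce to
    [tri_nonres]. *)
Lemma triW_bound : exists C : R, 0 < C /\ forall r x y z c1 c2 c3 (b1 b2 b3 : bool), uniq r ->
  (forall n, 0 <= x n) -> (forall n, 0 <= y n) -> (forall n, 0 <= z n) -> 0 <= c1 -> 0 <= c2 -> 0 <= c3 ->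
  (b1 + b2 + b3 <= 1)%N -> nB b1 r x c1 -> nB b2 r y c2 -> nB b3 r z c3 ->
  nB [|| b1, b2 | b3] r (tri r kapW x y z) (C * c1 * c2 * c3).
Proof.
have [C [C0 HC]] := kernel_sum hp.
have [C' [C0' HC']] := tri_nonres.
exists (C' + (C + 1)); split; first by rewrite !addr_gt0.
move=> r x y z c1 c2 c3 b1 b2 b3 ur x0 y0 z0 c10 c20 c30.
have le12 : (C + 1) * c1 * c2 * c3 <= (C' + (C + 1)) * c1 * c2 * c3 by rewrite !ler_wpM2r// lerDr ltW.
case: b1; case: b2; case: b3 => //= _ hx hy hz.
- move=> n nr; apply: le_trans le12; have [_ hk _ _] := HC n r ur.
  have := @weak_slot C r n (fun n1 _ => n1) (fun n1 n3 => n1 + n3 - n) (fun _ n3 => n3) x y z c1 c2 c3 C0 ur x0 y0 z0 c10 c20 c30.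
  apply => //; move=> U V U0 V0; rewrite mulrC mulr_suml exchange_big; apply: ler_sum => n3 _ /=.
  rewrite (eq_bigr (fun n1 => V n3 * (if n1 + n3 - n \in r then U (n1 + n3 - n) else 0))); last first.
    by move=> n1 _; case: ifP; rewrite ?mulr0// mulrC.
  rewrite -mulr_sumr ler_wpM2l//.
  by apply: (sum_le_of_uniq (f := fun n1 => n1 + n3 - n)) => // u v /addIr /addIr.
- move=> n nr; apply: le_trans le12; have [_ _ hk _] := HC n r ur.
  rewrite [leRHS](_ : _ = (C + 1) * c2 * c1 * c3); last by ring.
  rewrite [tri _ _ _ _ _ _](_ : _ = \sum_(n1 <- r) \sum_(n3 <- r) (if n1 + n3 - n \in r then
    kapW n n1 n3 * (y (n1 + n3 - n) * x n1 * z n3) else 0)); last first.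
    by apply: eq_bigr => n1 _; apply: eq_bigr => n3 _; rewrite (mulrC (x n1)).
  have := @weak_slot C r n (fun n1 n3 => n1 + n3 - n) (fun n1 n3 => n1) (fun _ n3 => n3) y x z c2 c1 c3 C0 ur y0 x0 z0 c20 c10 c30.
  apply => //.
    apply: le_trans hk; apply: ler_sum => n1 _; apply: ler_sum => n3 _; case: ifP => // _.
    by rewrite -!mulrA [X in _ * (_ * X) <= _]mulrCA.
  move=> U V U0 V0; rewrite mulr_suml; apply: ler_sum => n1 _; rewrite mulr_sumr; apply: ler_sum => n3 _.
  by case: ifP => // _; rewrite mulr_ge0.
- move=> n nr; apply: le_trans le12; have [_ _ _ hk] := HC n r ur.
  rewrite [leRHS](_ : _ = (C + 1) * c3 * c1 * c2); last by ring.
  rewrite [tri _ _ _ _ _ _](_ : _ = \sum_(n1 <- r) \sum_(n3 <- r) (if n1 + n3 - n \in r then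
    kapW n n1 n3 * (z n3 * x n1 * y (n1 + n3 - n)) else 0)); last first.
    by apply: eq_bigr => n1 _; apply: eq_bigr => n3 _; case: ifP => // _; congr (_ * _); ring.
  have := @weak_slot C r n (fun n1 n3 => n3) (fun n1 n3 => n1) (fun n1 n3 => n1 + n3 - n) z x y c3 c1 c2 C0 ur z0 x0 y0 c30 c10 c20.
  apply => //.
    apply: le_trans hk; apply: ler_sum => n1 _; apply: ler_sum => n3 _; case: ifP => // _.
    rewrite le_eqVlt; apply/orP; left; apply/eqP; ring.
  move=> U V U0 V0; rewrite mulr_suml; apply: ler_sum => n1 _.
  rewrite (eq_bigr (fun n3 => U n1 * (if n1 + n3 - n \in r then V (n1 + n3 - n) else 0))); last first.
    by move=> n3 _; case: ifP; rewrite ?mulr0.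
  rewrite -mulr_sumr ler_wpM2l//.
  by apply: (sum_le_of_uniq (f := fun n3 => n1 + n3 - n)) => // u v /addIr /addrI.
- have := HC' r kapW x y z c1 c2 c3 ur kapW_ge0 _ kapW_le x0 y0 z0 c10 c20 c30 hx hy hz.
  move=> h; apply: nX_le (h _); rewrite ?mulr_ge0 ?(ltW C0')//=.
  + by rewrite !ler_wpM2r// lerDl addr_ge0// ltW.
  + by move=> n _; rewrite lexx tri_ge0//; exact: kapW_ge0.
  + by move=> n n1 n3 e; rewrite /kapW -negb_or e.
Qed.

End trilinear.

(** * The cubic product in the weak norm *)

Section weak_product.
Context {R : realType}.

Lemma sum_powR_telescope (b : R) (m : nat) : 0 <= b < 1 ->
  \sum_(0 <= k < m.+1) (k.+1%:R : R) `^ (- b) <= (1 - b)^-1 * m.+1%:R `^ (1 - b).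
Proof.
move=> /andP[b0 b1]; have q0 : 0 < 1 - b by rewrite subr_gt0.
elim: m => [|m IH].
  by rewrite big_nat1 !powR1 mulr1 invf_ge1// gerBl.
rewrite big_nat_recr//=; apply: le_trans (lerD IH (lexx _)) _.
set y : R := m.+2%:R; have y0 : 0 < y by rewrite ltr0n.
have m0 : 0 < m.+1%:R :> R by rewrite ltr0n.
have yE : m.+1%:R = y - 1 :> R by rewrite /y -[m.+2%:R]natr1 addrK.
have := @bernoulli_powR R (m.+1%:R / y) (1 - b) (divr_gt0 m0 y0).
rewrite (ltW q0) gerBl b0 => /(_ isT).
have -> : (m.+1%:R / y) `^ (1 - b) = m.+1%:R `^ (1 - b) / y `^ (1 - b).
  by rewrite powRM ?invr_ge0 ?(ltW m0) ?(ltW y0)// -(powRN1 y0) -powRrM mulN1r powRN.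
rewrite ler_pdivrMr ?powR_gt0// => h.
have yb : y `^ (1 - b) = y `^ (- b) * y by rewrite powRDp// powRr1 ?(ltW y0)// mulrC.
have e : (1 + (1 - b) * (m.+1%:R / y - 1)) * y `^ (1 - b) = y `^ (1 - b) - (1 - b) * y `^ (- b).
  by rewrite yE yb; field; rewrite gt_eqF.
rewrite e in h.
have yb0 : y `^ (- b) = (1 - b)^-1 * ((1 - b) * y `^ (- b)) by rewrite mulrA mulVf ?mul1r// gt_eqF.
by rewrite [X in _ + X]yb0 -mulrDr ler_pM2l ?invr_gt0//; clear -h; lra.
Qed.

Lemma sum_jb_le (b : R) : 0 <= b < 1 -> exists C : R, 0 < C /\ forall (s : seq int) (c : int), uniq s ->
  \sum_(m <- s) (if (`|m| <= `|c|)%N then jb m `^ (- b) else 0) <= C * jb c `^ (1 - b).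
Proof.
move=> hb; exists (2 * (1 - b)^-1); split; first by rewrite mulr_gt0// invr_gt0; case/andP: hb => _; rewrite subr_gt0.
move=> s c us; pose M := `|c|%N.+1; have HM k : (k <= `|c|)%N = (k < M)%N by [].
move: M HM => M HM.
pose t := [seq Posz k | k <- iota 0 M] ++ [seq Negz k | k <- iota 0 M].
rewrite -big_mkcond -big_filter.
apply: (@le_trans _ _ (\sum_(m <- t) jb m `^ (- b))).
  apply: ler_sum_uniq; first exact: filter_uniq.
    move=> m; rewrite mem_filter => /andP[mc _].
    rewrite mem_cat; rewrite HM in mc; apply/orP; case: m mc => k /= kM.
      by left; apply/mapP; exists k => //; rewrite mem_iota.
    by right; apply/mapP; exists k => //; rewrite mem_iota /=; apply: ltn_trans kM.
  by move=> m; exact: powR_ge0.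
rewrite big_cat !big_map /= -mulrA mulr_natl mulr2n.
have e : \sum_(j <- iota 0 M) (j.+1%:R : R) `^ (- b) <= (1 - b)^-1 * jb c `^ (1 - b).
  have -> : M = `|c|%N.+1 by apply/eqP; rewrite eqn_leq -HM leqnn andbT; have := HM `|c|%N.+1; rewrite ltnn; case: ltngtP.
  have := sum_powR_telescope `|c|%N hb; rewrite /index_iota subn0; congr (_ <= _ * (_ `^ _)).
  by rewrite /jb -natr1 addrC -intr_norm pmulrn abszE.
apply: lerD; apply: le_trans e; apply: ler_sum => k _.
  by rewrite /jb -pmulrn normr_nat addrC natr1.
apply: ler_powRN; rewrite ?ltr0n//; last by case/andP: hb.
by rewrite /jb NegzE rmorphN /= normrN -pmulrn normr_nat lerDr.
Qed.

Lemma sum_atmost1 (r : seq int) (chi : int -> bool) (G : R) : uniq r -> 0 <= G ->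
  (forall u v, chi u -> chi v -> u = v) -> \sum_(m <- r) (if chi m then G else 0) <= G.
Proof.
move=> ur G0 h; rewrite -big_mkcond -big_filter.
have := filter_uniq chi ur; have : forall m, m \in filter chi r -> chi m by move=> m; rewrite mem_filter => /andP[].
case: (filter chi r) => [|a [|c l]] hc u; first by rewrite big_nil.
  by rewrite big_seq1.
have ac : a = c by apply: h; apply: hc; rewrite !inE eqxx ?orbT.
by move: u; rewrite ac /= inE eqxx.
Qed.

Variable (b : R).
Hypothesis hb : 3^-1 <= b < 1.
Let rr := 3 * b - 1.
Hypothesis hrr : rr <= b.

(** [chi] stands for the linear relation between the frequencies with [n] fixed: [(u, w)] determines
    [v], and [(u, v)] determines [w]. The smallest frequency is summed against [jb u^(- b)], which
    costs [jb v^(1 - b)]. The exponent [rr = 3 b - 1] balances this, because [b - rr = 1 - 2 b] and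
    the excess weight of [w] can be moved to the smaller [v]. *)
Lemma ordered_sum : exists C : R, 0 < C /\ forall r (chi : int -> int -> int -> bool) (x y z : int -> R) c1 c2 c3 n,
  uniq r -> (forall n, 0 <= x n) -> (forall n, 0 <= y n) -> (forall n, 0 <= z n) -> 0 <= c1 -> 0 <= c2 -> 0 <= c3 ->
  (forall u v v' w, chi u v w -> chi u v' w -> v = v') -> (forall u v w w', chi u v w -> chi u v w' -> w = w') ->
  (forall u v w, chi u v w -> jb n <= jb u + jb v + jb w :> R) ->
  nX b r x c1 -> nX b r y c2 -> nX b r z c3 ->
  \sum_(u <- r) \sum_(v <- r) \sum_(w <- r) (if chi u v w && (`|u| <= `|v| <= `|w|)%N
     then jb n `^ (rr / 2) * (x u * y v * z w) else 0) <= C * c1 * c2 * c3.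
Proof.
have hb01 : 0 <= b < 1 by case/andP: hb => h1 ->; rewrite andbT (le_trans _ h1)// invr_ge0.
have [C [C0 HC]] := sum_jb_le hb01.
exists (3 * (C + 1)); split; first by rewrite mulr_gt0// addr_gt0.
move=> r chi x y z c1 c2 c3 n ur x0 y0 z0 c10 c20 c30 hv hw hn hx hy hz.
pose K := [seq (k, w) | k <- [seq (u, v) | u <- r, v <- r], w <- r].
pose ok (k : int * int * int) := chi k.1.1 k.1.2 k.2 && (`|k.1.1| <= `|k.1.2|)%N.
pose A (k : int * int * int) : R := if ok k then (jb k.1.1 `^ (b / 2) * x k.1.1) * (jb k.2 `^ (b / 2) * z k.2) else 0.
pose B (k : int * int * int) : R := if ok k then (jb k.1.2 `^ (b / 2) * y k.1.2) * (jb k.1.1 `^ (- (b / 2)) * jb k.1.2 `^ (- ((1 - b) / 2))) else 0.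
have P0 (e : R) m : 0 <= jb m `^ e :> R by exact: powR_ge0.
have hAB : \sum_(k <- K) A k * B k <= (c1 * c3) * ((C + 1) * c2).
  apply: cauchy_schwarz_le; rewrite ?mulr_ge0 ?addr_ge0 ?(ltW C0)//.
    rewrite /K !big_allpairs.
    apply: (@le_trans _ _ (\sum_(u <- r) \sum_(w <- r) (jb u `^ b * x u ^+ 2) * (jb w `^ b * z w ^+ 2))).
      apply: ler_sum => u _; rewrite exchange_big; apply: ler_sum => w _ /=.
      apply: le_trans (sum_atmost1 (chi := fun v => chi u v w) ur (_ : 0 <= _ ) _); last first.
      - by move=> v v'; exact: hv.
      - by rewrite !mulr_ge0 ?sqr_ge0.
      apply: ler_sum => v _; rewrite /A /ok /=; case: (chi u v w) => /=; last by rewrite expr0n.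
      case: ifP => _; last by rewrite expr0n !mulr_ge0 ?sqr_ge0.
      by rewrite !exprMn (powR_half b (jb_gt0 u)) (powR_half b (jb_gt0 w)).
    under eq_bigr do rewrite -mulr_sumr.
    rewrite -mulr_suml exprMn; apply: ler_pM => //; apply: sumr_ge0 => m _; rewrite mulr_ge0 ?sqr_ge0//.
  rewrite /K !big_allpairs.
  apply: (@le_trans _ _ (\sum_(u <- r) \sum_(v <- r) (jb v `^ b * y v ^+ 2) * (jb v `^ (- (1 - b)) * (if (`|u| <= `|v|)%N then jb u `^ (- b) else 0)))).
    apply: ler_sum => u _; apply: ler_sum => v _.
    have G0 : 0 <= (jb v `^ b * y v ^+ 2) * (jb v `^ (- (1 - b)) * (if (`|u| <= `|v|)%N then jb u `^ (- b) else 0)) :> R.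
      by case: ifP => _; rewrite !mulr_ge0 ?sqr_ge0.
    apply: le_trans (sum_atmost1 (chi := chi u v) ur G0 _); last by move=> w w'; exact: hw.
    apply: ler_sum => w _; rewrite /B /ok /=; case: (chi u v w) => /=; last by rewrite expr0n.
    case: ifP => _; last by rewrite expr0n !mulr0.
    have sq3 (a1 a2 a3 a4 : R) : (a1 * a2 * (a3 * a4)) ^+ 2 = a1 ^+ 2 * a2 ^+ 2 * (a4 ^+ 2 * a3 ^+ 2) by ring.
    rewrite sq3 (powR_half b (jb_gt0 v)) -(mulNr b) -(mulNr (1 - b)).
    by rewrite (powR_half (- b) (jb_gt0 u)) (powR_half (- (1 - b)) (jb_gt0 v)).
  rewrite exchange_big /=.
  apply: (@le_trans _ _ (\sum_(v <- r) C * (jb v `^ b * y v ^+ 2))).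
    apply: ler_sum => v _; rewrite -mulr_sumr mulrC -mulr_sumr.
    rewrite ler_wpM2r ?mulr_ge0 ?sqr_ge0//.
    rewrite powRN mulrC ler_pdivrMr ?powR_gt0 ?jb_gt0//; exact: HC.
  rewrite -mulr_sumr exprMn; apply: ler_pM => //; rewrite ?(ltW C0)//.
    by apply: sumr_ge0 => m _; rewrite mulr_ge0 ?sqr_ge0.
  by nra.
rewrite [leRHS](_ : _ = 3 * ((c1 * c3) * ((C + 1) * c2))); last by ring.
apply: (@le_trans _ _ (3 * \sum_(k <- K) A k * B k)); last by rewrite ler_pM2l.
rewrite /K !big_allpairs mulr_sumr; apply: ler_sum => u _; rewrite mulr_sumr; apply: ler_sum => v _.
rewrite mulr_sumr; apply: ler_sum => w _; rewrite /A /B /ok /=.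
have AB0 : 0 <= 3 * ((jb u `^ (b / 2) * x u) * (jb w `^ (b / 2) * z w) *
   ((jb v `^ (b / 2) * y v) * (jb u `^ (- (b / 2)) * jb v `^ (- ((1 - b) / 2))))) by rewrite !mulr_ge0.
case: ifPn => [/andP[hc /andP[uv vw]]|_]; last by case: ifP => _ //; rewrite ?mul0r ?mulr0.
rewrite hc uv /=.
have i e m : jb m `^ (- (e / 2)) * jb m `^ (e / 2) = 1 :> R.
  by rewrite powRN mulVf// gt_eqF// powR_gt0// jb_gt0.
have jle m m' : (`|m| <= `|m'|)%N -> jb m <= jb m' :> R.
  by move=> h; rewrite /jb lerD2l -!intr_norm ler_int -!abszE lez_nat.
have juw := jle _ _ (leq_trans uv vw); have jvw := jle _ _ vw.
(* [jb n <= 3 jb w] because [w] is the largest frequency, and [3^(rr / 2) <= 3] because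
   [rr / 2 <= 1]. *)
have jn : jb n `^ (rr / 2) <= 3 * jb w `^ (rr / 2).
  have rr0 : 0 <= rr / 2 by rewrite divr_ge0// /rr; case/andP: hb => h _; clear -h b hb rr hrr; lra.
  apply: (@le_trans _ _ ((3 * jb w) `^ (rr / 2))).
    apply: (ge0_ler_powR rr0); rewrite ?nnegrE ?mulr_ge0 ?(ltW (jb_gt0 _))//.
    by apply: le_trans (hn _ _ _ hc) _; clear -juw jvw b hb rr hrr; lra.
  rewrite powRM ?(ltW (jb_gt0 _))// ler_wpM2r//.
  rewrite -[leRHS]powRr1// ler_powR//; first by clear -b hb rr hrr; lra.
  by rewrite ler_pdivrMr//; rewrite mul1r; apply: le_trans hrr _; case/andP: hb => _ h1; rewrite (le_trans (ltW h1))// ler1n.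
have jw : jb w `^ (rr / 2) <= jb w `^ (b / 2) * jb v `^ (- ((1 - b) / 2)) * jb v `^ (b / 2).
  apply: (@le_trans _ _ (jb w `^ (b / 2) * jb v `^ (- ((b - rr) / 2)))).
    rewrite [rr / 2](_ : _ = b / 2 + - ((b - rr) / 2)); last by field.
    rewrite powRDp ?jb_gt0// ler_wpM2l//; apply: ler_powRN; rewrite ?jb_gt0//.
    by rewrite divr_ge0// subr_ge0.
  rewrite -mulrA ler_wpM2l// -powRDp ?jb_gt0// le_eqVlt; apply/orP; left; apply/eqP; congr (_ `^ _).
  by rewrite /rr; field.
rewrite [leRHS](_ : _ = (3 * (jb w `^ (b / 2) * jb v `^ (- ((1 - b) / 2)) * jb v `^ (b / 2))) *
    (x u * y v * z w) * (jb u `^ (- (b / 2)) * jb u `^ (b / 2))); last by ring.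
rewrite (i b u) mulr1; apply: ler_wpM2r; first by rewrite !mulr_ge0.
by apply: le_trans jn _; exact: (ler_wpM2l (ler0n R 3) jw).
Qed.

(** The three frequencies are sorted by size in six ways and [ordered_sum] is applied to the
    permuted factors. Ties are counted several times, which is harmless because all terms are
    nonnegative. *)
Lemma weak_product : exists C : R, 0 < C /\ forall r (x y z : int -> R) c1 c2 c3 n,
  uniq r -> (forall n, 0 <= x n) -> (forall n, 0 <= y n) -> (forall n, 0 <= z n) -> 0 <= c1 -> 0 <= c2 -> 0 <= c3 ->
  nX b r x c1 -> nX b r y c2 -> nX b r z c3 ->
  jb n `^ (rr / 2) * tri r (fun _ _ _ => 1) x y z n <= C * c1 * c2 * c3.
Proof.
have [C [C0 HC]] := ordered_sum.
exists (6 * C); split; first by rewrite mulr_gt0.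
move=> r x y z c1 c2 c3 n ur x0 y0 z0 c10 c20 c30 hx hy hz.
pose F n1 n2 n3 : R := if n1 + n3 == n2 + n then jb n `^ (rr / 2) * (x n1 * y n2 * z n3) else 0.
have F0 n1 n2 n3 : 0 <= F n1 n2 n3 by rewrite /F; case: ifP => // _; rewrite !mulr_ge0 ?powR_ge0.
apply: (@le_trans _ _ (\sum_(n1 <- r) \sum_(n2 <- r) \sum_(n3 <- r) F n1 n2 n3)).
  rewrite /tri mulr_sumr; apply: ler_sum => n1 _; rewrite exchange_big mulr_sumr; apply: ler_sum => n3 _ /=.
  case: ifPn => [h|_]; last by rewrite mulr0 sumr_ge0.
  rewrite (bigD1_seq (n1 + n3 - n))//= /F subrK eqxx mul1r lerDl sumr_ge0// => m _; exact: F0.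
pose le2 (u v : int) := (`|u| <= `|v|)%N.
pose G (o : int -> int -> int -> bool) n1 n2 n3 := if o n1 n2 n3 then F n1 n2 n3 else 0.
have G0 o n1 n2 n3 : 0 <= G o n1 n2 n3 by rewrite /G; case: ifP.
pose o1 (n1 n2 n3 : int) := le2 n1 n2 && le2 n2 n3.
pose o2 (n1 n2 n3 : int) := le2 n1 n3 && le2 n3 n2.
pose o3 (n1 n2 n3 : int) := le2 n2 n1 && le2 n1 n3.
pose o4 (n1 n2 n3 : int) := le2 n2 n3 && le2 n3 n1.
pose o5 (n1 n2 n3 : int) := le2 n3 n1 && le2 n1 n2.
pose o6 (n1 n2 n3 : int) := le2 n3 n2 && le2 n2 n1.
pose S (H : int -> int -> int -> R) := \sum_(n1 <- r) \sum_(n2 <- r) \sum_(n3 <- r) H n1 n2 n3.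
apply: (@le_trans _ _ (S (G o1) + S (G o2) + S (G o3) + S (G o4) + S (G o5) + S (G o6))).
  rewrite /S -!big_split /=; apply: ler_sum => n1 _; rewrite -!big_split /=; apply: ler_sum => n2 _.
  rewrite -!big_split /=; apply: ler_sum => n3 _.
  have [g1 g2 g3] := And3 (G0 o1 n1 n2 n3) (G0 o2 n1 n2 n3) (G0 o3 n1 n2 n3).
  have [g4 g5 g6] := And3 (G0 o4 n1 n2 n3) (G0 o5 n1 n2 n3) (G0 o6 n1 n2 n3).
  have : [|| o1 n1 n2 n3, o2 n1 n2 n3, o3 n1 n2 n3, o4 n1 n2 n3, o5 n1 n2 n3 | o6 n1 n2 n3].
    rewrite /o1 /o2 /o3 /o4 /o5 /o6 /le2.
    by case: (leqP `|n1| `|n2|) => h1; case: (leqP `|n2| `|n3|) => h2; case: (leqP `|n1| `|n3|) => h3; rewrite ?(ltnW h1) ?(ltnW h2) ?(ltnW h3) ?orbT//=; lia.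
  have T (o : int -> int -> int -> bool) : o n1 n2 n3 -> G o n1 n2 n3 = F n1 n2 n3 by rewrite /G => ->.
  by case/or4P => [/T h|/T h|/T h|/or3P[/T h|/T h|/T h]]; clear -g1 g2 g3 g4 g5 g6 h b hb rr hrr; lra.
rewrite [6 * C](_ : _ = C + C + C + C + C + C); last by ring.
rewrite !mulrDl.
have tri1 n1 n2 n3 : n1 + n3 == n2 + n -> jb n <= jb n1 + jb n2 + jb n3 :> R.
  move=> /eqP e; have -> : n = n1 + n3 - n2 by rewrite e addrAC subrr add0r.
  by apply: le_trans (jbD _ _) _; rewrite jbN; have := @jbD R n1 n3; clear -b hb rr hrr; lra.
pose chi (n1 n2 n3 : int) := n1 + n3 == n2 + n.
have c_n1 u v n2 n3 : chi u n2 n3 -> chi v n2 n3 -> u = v.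
  by rewrite /chi => /eqP h /eqP h'; apply: (@addIr _ n3); rewrite h h'.
have c_n2 u v n1 n3 : chi n1 u n3 -> chi n1 v n3 -> u = v.
  by rewrite /chi => /eqP h /eqP h'; apply: (@addIr _ n); rewrite -h -h'.
have c_n3 u v n1 n2 : chi n1 n2 u -> chi n1 n2 v -> u = v.
  by rewrite /chi => /eqP h /eqP h'; apply: (@addrI _ n1); rewrite h h'.
have E1 : S (G o1) <= C * c1 * c2 * c3.
  apply: le_trans (HC r (fun u v w => chi u v w) x y z c1 c2 c3 n ur x0 y0 z0 c10 c20 c30 _ _ _ hx hy hz).
  - rewrite /S; apply: ler_sum => n1 _; apply: ler_sum => n2 _; apply: ler_sum => n3 _.
    by rewrite /G /F /o1 /le2 /chi; case: (_ == _); rewrite ?andbF //=; case: ifP.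
  - by move=> u v v' w; exact: c_n2.
  - by move=> u v w w'; exact: c_n3.
  - by move=> u v w; exact: tri1.
have E2 : S (G o2) <= C * c1 * c2 * c3.
  rewrite (mulrAC _ c2).
  apply: le_trans (HC r (fun u v w => chi u w v) x z y c1 c3 c2 n ur x0 z0 y0 c10 c30 c20 _ _ _ hx hz hy).
  - rewrite /S; apply: ler_sum => n1 _; rewrite exchange_big; apply: ler_sum => n3 _; apply: ler_sum => n2 _.
    by rewrite /G /F /o2 /le2 /chi (mulrAC _ (z _)); case: (_ == _); rewrite ?andbF //=; case: ifP.
  - by move=> u v v' w; exact: c_n3.
  - by move=> u v w w'; exact: c_n2.
  - by move=> u v w h; rewrite addrAC; exact: tri1.
have E3 : S (G o3) <= C * c1 * c2 * c3.
  rewrite (mulrAC C).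
  apply: le_trans (HC r (fun u v w => chi v u w) y x z c2 c1 c3 n ur y0 x0 z0 c20 c10 c30 _ _ _ hy hx hz).
  - rewrite /S exchange_big; apply: ler_sum => n2 _; apply: ler_sum => n1 _; apply: ler_sum => n3 _.
    by rewrite /G /F /o3 /le2 /chi (mulrC (y _)); case: (_ == _); rewrite ?andbF //=; case: ifP.
  - by move=> u v v' w; exact: c_n1.
  - by move=> u v w w'; exact: c_n3.
  - by move=> u v w h; rewrite (addrC (jb u)); exact: tri1.
have E4 : S (G o4) <= C * c1 * c2 * c3.
  rewrite [leRHS](_ : _ = C * c2 * c3 * c1); last by ring.
  apply: le_trans (HC r (fun u v w => chi w u v) y z x c2 c3 c1 n ur y0 z0 x0 c20 c30 c10 _ _ _ hy hz hx).
  - rewrite /S exchange_big; apply: ler_sum => n2 _; rewrite exchange_big; apply: ler_sum => n3 _; apply: ler_sum => n1 _.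
    have -> : y n2 * z n3 * x n1 = x n1 * y n2 * z n3 by ring.
    by rewrite /G /F /o4 /le2 /chi; case: (_ == _); rewrite ?andbF //=; case: ifP.
  - by move=> u v v' w; exact: c_n3.
  - by move=> u v w w'; exact: c_n1.
  - by move=> u v w h; rewrite (addrC _ (jb w)) addrA; exact: tri1.
have E5 : S (G o5) <= C * c1 * c2 * c3.
  rewrite [leRHS](_ : _ = C * c3 * c1 * c2); last by ring.
  apply: le_trans (HC r (fun u v w => chi v w u) z x y c3 c1 c2 n ur z0 x0 y0 c30 c10 c20 _ _ _ hz hx hy).
  - rewrite /S; under eq_bigr do rewrite exchange_big.
    rewrite exchange_big; apply: ler_sum => n3 _; apply: ler_sum => n1 _; apply: ler_sum => n2 _.
    have -> : z n3 * x n1 * y n2 = x n1 * y n2 * z n3 by ring.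
    by rewrite /G /F /o5 /le2 /chi; case: (_ == _); rewrite ?andbF //=; case: ifP.
  - by move=> u v v' w; exact: c_n1.
  - by move=> u v w w'; exact: c_n2.
  - by move=> u v w h; rewrite -addrA addrC; exact: tri1.
have E6 : S (G o6) <= C * c1 * c2 * c3.
  rewrite [leRHS](_ : _ = C * c3 * c2 * c1); last by ring.
  apply: le_trans (HC r (fun u v w => chi w v u) z y x c3 c2 c1 n ur z0 y0 x0 c30 c20 c10 _ _ _ hz hy hx).
  - rewrite /S; under eq_bigr do rewrite exchange_big.
    rewrite exchange_big; apply: ler_sum => n3 _; rewrite exchange_big; apply: ler_sum => n2 _; apply: ler_sum => n1 _.
    have -> : z n3 * y n2 * x n1 = x n1 * y n2 * z n3 by ring.
    by rewrite /G /F /o6 /le2 /chi; case: (_ == _); rewrite ?andbF //=; case: ifP.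
  - by move=> u v v' w; exact: c_n2.
  - by move=> u v w w'; exact: c_n1.
  - by move=> u v w h; rewrite addrC (addrC (jb u)) addrA; exact: tri1.
by rewrite !lerD.
Qed.

End weak_product.

Section pointwise_weight.
Context {R : realType}.

Lemma one_le_jb_powR (e : R) n : 0 <= e -> 1 <= jb n `^ e.
Proof. by move=> e0; rewrite -(powRr0 (jb n)); apply: ler_powR; first exact: jb_ge1. Qed.

Lemma nX_point (b : R) (x : int -> R) c n : 0 <= b -> 0 <= c -> 0 <= x n -> nX b [:: n] x c -> x n <= c.
Proof.
move=> b0 c0 x0; rewrite /nX big_seq1 => h; rewrite -ler_sqr ?nnegrE//; apply: le_trans h.
by rewrite ler_peMl ?sqr_ge0// one_le_jb_powR.
Qed.

End pointwise_weight.

(** * Calculus of complex-valued functions by components *)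

Section complex_calculus.
Context {R : realType}.
Implicit Types (z w : R[i]).
Local Notation Re := complex.Re.
Local Notation Im := complex.Im.

Lemma normc_ge0 z : 0 <= normc z. Proof. by case: z => a b; exact: sqrtr_ge0. Qed.

Lemma normcN z : normc (- z) = normc z. Proof. by case: z => a b; rewrite /= !sqrrN. Qed.

Lemma normc_le_add z w : normc (z + w) <= normc z + normc w.
Proof. by rewrite -lecR rmorphD /=; have := ler_normD z w. Qed.

Lemma normc_le_sub z w : normc (z - w) <= normc z + normc w.
Proof. by rewrite -(normcN w); exact: normc_le_add. Qed.

Lemma normc_sum (T : Type) (s : seq T) (F : T -> R[i]) : 
  normc (\sum_(i <- s) F i) <= \sum_(i <- s) normc (F i).
Proof.
elim: s => [|a s IH]; first by rewrite !big_nil normc0.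
by rewrite !big_cons; apply: le_trans (normc_le_add _ _) _; rewrite lerD2l.
Qed.

Lemma normc_real (x : R) : normc x%:C = `|x|.
Proof. by rewrite /= expr0n /= addr0 sqrtr_sqr. Qed.

Lemma normc_conj z : normc (conjc z) = normc z.
Proof. by case: z => a b; rewrite /= sqrrN. Qed.

Lemma normc_cexp (x : R) : normc (cexp x) = 1.
Proof. by rewrite /= cos2Dsin2 sqrtr1. Qed.

Lemma normc_i : normc ('i : R[i]) = 1.
Proof. by rewrite /= expr0n expr1n /= add0r sqrtr1. Qed.

Lemma Re_le_normc z : `|Re z| <= normc z.
Proof. by case: z => a b /=; rewrite -sqrtr_sqr ler_wsqrtr// lerDl sqr_ge0. Qed.

Lemma Im_le_normc z : `|Im z| <= normc z.
Proof. by case: z => a b /=; rewrite -sqrtr_sqr ler_wsqrtr// lerDr sqr_ge0. Qed.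

Lemma normc_le_ReIm z : normc z <= `|Re z| + `|Im z|.
Proof.
case: z => a b /=; rewrite -[leRHS](ger0_norm (addr_ge0 (normr_ge0 _) (normr_ge0 _))) -sqrtr_sqr.
rewrite ler_wsqrtr// sqrrD !real_normK ?num_real//.
by rewrite addrAC lerDl mulrn_wge0// mulr_ge0.
Qed.

Lemma sqr_normc_ReIm z : normc z ^+ 2 = Re z ^+ 2 + Im z ^+ 2.
Proof. by case: z => a b /=; rewrite sqr_sqrtr// addr_ge0// sqr_ge0. Qed.

Lemma mulc_conj z : z * conjc z = (normc z ^+ 2)%:C.
Proof.
rewrite sqr_normc_ReIm; case: z => a b /=.
by apply/eqP; rewrite eq_complex /=; apply/andP; split; apply/eqP; ring.
Qed.

Lemma cexpD (x y : R) : cexp (x + y) = cexp x * cexp y.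
Proof. by apply/eqP; rewrite /cexp eq_complex /= cosD sinD; apply/andP; split=> //; rewrite addrC. Qed.

Lemma cexp0 : cexp (0 : R) = 1.
Proof. by rewrite /cexp cos0 sin0. Qed.

Lemma conj_cexp (x : R) : conjc (cexp x) = cexp (- x).
Proof. by rewrite /cexp /= cosN sinN. Qed.

Definition cder (f : R -> R[i]) (t : R) (l : R[i]) :=
  is_derive t 1 (fun s => Re (f s)) (Re l) /\ is_derive t 1 (fun s => Im (f s)) (Im l).

Lemma cder_eq f t l l' : cder f t l -> l = l' -> cder f t l'.
Proof. by move=> ? <-. Qed.

Lemma cder_ext f g t l : (forall s, f s = g s) -> cder f t l -> cder g t l.
Proof. by move=> fg [h1 h2]; split; [move: h1|move: h2]; congr is_derive; apply/funext => s; rewrite fg. Qed.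

Lemma cder_cst z t : cder (fun=> z) t 0.
Proof. by split; exact: is_derive_cst. Qed.

Lemma cderD f g t l m : cder f t l -> cder g t m -> cder (fun s => f s + g s) t (l + m).
Proof.
move=> [f1 f2] [g1 g2]; split.
  by rewrite (_ : (fun s => _) = (fun s => Re (f s)) + (fun s => Re (g s))) ?raddfD/=; [exact: is_deriveD|apply/funext => s; rewrite raddfD].
by rewrite (_ : (fun s => _) = (fun s => Im (f s)) + (fun s => Im (g s))) ?raddfD/=; [exact: is_deriveD|apply/funext => s; rewrite raddfD].
Qed.

Lemma cderM f g t l m : cder f t l -> cder g t m -> cder (fun s => f s * g s) t (l * g t + f t * m).
Proof.
move=> [f1 f2] [g1 g2]; split.
  rewrite (_ : (fun s => _) = (fun s => Re (f s)) * (fun s => Re (g s)) - (fun s => Im (f s)) * (fun s => Im (g s))); last first.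
    by apply/funext => s; rewrite !fctE; case: (f s) => a b; case: (g s).
  apply: is_derive_eq; rewrite /=; case: (f t) => a b; case: (g t) => a' b'; case: l {f1 f2} => u v; case: m {g1 g2} => u' v' /=.
  by rewrite /GRing.scale /=; ring.
rewrite (_ : (fun s => _) = (fun s => Re (f s)) * (fun s => Im (g s)) + (fun s => Im (f s)) * (fun s => Re (g s))); last first.
  by apply/funext => s; rewrite !fctE; case: (f s) => a b; case: (g s).
apply: is_derive_eq; rewrite /=; case: (f t) => a b; case: (g t) => a' b'; case: l {f1 f2} => u v; case: m {g1 g2} => u' v' /=.
by rewrite /GRing.scale /=; ring.
Qed.

Lemma cderMl z f t l : cder f t l -> cder (fun s => z * f s) t (z * l).
Proof. by move=> h; apply: cder_eq (cderM (cder_cst z t) h) _; rewrite mul0r add0r. Qed.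

Lemma cderN f t l : cder f t l -> cder (fun s => - f s) t (- l).
Proof.
move=> h; rewrite -mulN1r; apply: cder_ext (cderMl (-1) h) => s; by rewrite mulN1r.
Qed.

Lemma cderB f g t l m : cder f t l -> cder g t m -> cder (fun s => f s - g s) t (l - m).
Proof. by move=> hf hg; exact: cderD hf (cderN hg). Qed.

Lemma cder_sum (T : Type) (r : seq T) (F : T -> R -> R[i]) (L : T -> R[i]) t :
  (forall i, cder (F i) t (L i)) -> cder (fun s => \sum_(i <- r) F i s) t (\sum_(i <- r) L i).
Proof.
move=> h; elim: r => [|a r IH].
  by rewrite big_nil; apply: cder_ext (cder_cst 0 t) => s; rewrite big_nil.
by rewrite big_cons; apply: cder_ext (cderD (h a) IH) => s; rewrite big_cons.
Qed.

Lemma cder_conj f t l : cder f t l -> cder (fun s => conjc (f s)) t (conjc l).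
Proof.
move=> [h1 h2]; split.
  by rewrite (_ : (fun s => _) = (fun s => Re (f s))); [move: h1; case: l {h2}|apply/funext => s; case: (f s)].
rewrite (_ : (fun s => _) = - (fun s => Im (f s))); last by apply/funext => s; rewrite !fctE; case: (f s).
by move: h2; case: l {h1} => a b /= h2; exact: is_deriveN.
Qed.

Lemma cder_cexp (w t : R) : cder (fun s => cexp (s * w)) t ('i * w%:C * cexp (t * w)).
Proof.
have d : is_derive t 1 (fun s : R => s * w) w.
  by apply: is_derive_eq; rewrite /GRing.scale /=; ring.
split; rewrite /cexp /=.
  have h := @is_derive1_comp _ cos (fun s => s * w) t _ _ (is_derive_cos (t * w)) d.
  by apply: is_derive_eq h _; ring.
have h := @is_derive1_comp _ sin (fun s => s * w) t _ _ (is_derive_sin (t * w)) d.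
by apply: is_derive_eq h _; ring.
Qed.

End complex_calculus.

(** * Normal form reductions *)

Section operators.
Context {R : realType}.
Variables (I KT : Type) (K : seq KT) (l1 l2 l3 : I -> KT -> I) (P : I -> KT -> R).
Implicit Types (k c : I -> KT -> R -> R[i]) (nu : seq I) (phi : R) (G H : seq I -> R -> R[i]).

(* A list [nu] stands for the monomial of its modes. [op] substitutes the cubic nonlinearity into each
   mode [x] in turn: the triple [l1 x q, l2 x q, l3 x q] replaces [x] and [P x q] is added to the phase [phi]. *)
Fixpoint op k nu G phi : R[i] :=
  if nu is x :: nu' then
    \sum_(q <- K) k x q phi * G (l1 x q :: l2 x q :: l3 x q :: nu') (phi + P x q)
    + op k nu' (fun mu psi => G (x :: mu) psi) phi
  else 0.

Lemma op_ext k nu G H phi : (forall mu psi, size mu = (size nu).+2 -> G mu psi = H mu psi) ->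
  op k nu G phi = op k nu H phi.
Proof.
elim: nu G H => //= x nu IH G H e; congr (_ + _).
  by apply: eq_bigr => q _; rewrite e.
by apply: IH => mu psi s; apply: e; rewrite /= s.
Qed.

Lemma op_extk k k' nu G phi : (forall x q, k x q phi = k' x q phi) -> op k nu G phi = op k' nu G phi.
Proof. by move=> e; elim: nu G => //= x nu IH G; rewrite IH; congr (_ + _); apply: eq_bigr => q _; rewrite e. Qed.

Lemma opD k nu G H phi : op k nu (fun mu psi => G mu psi + H mu psi) phi = op k nu G phi + op k nu H phi.
Proof.
elim: nu G H => [|x nu IH] G H /=; first by rewrite addr0.
rewrite IH addrACA -big_split; congr (_ + _); apply: eq_bigr => q _; exact: mulrDr.
Qed.

Lemma opZ k z nu G phi : op k nu (fun mu psi => z * G mu psi) phi = z * op k nu G phi.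
Proof.
elim: nu G => [|x nu IH] G /=; first by rewrite mulr0.
by rewrite IH mulrDr mulr_sumr; congr (_ + _); apply: eq_bigr => q _; rewrite mulrCA.
Qed.

Lemma opDk k k' nu G phi : op (fun x q p => k x q p + k' x q p) nu G phi = op k nu G phi + op k' nu G phi.
Proof.
elim: nu G => [|x nu IH] G /=; first by rewrite addr0.
rewrite IH addrACA -big_split; congr (_ + _); apply: eq_bigr => q _; exact: mulrDl.
Qed.

Lemma op_phase k (f : R -> R[i]) nu G phi :
  op k nu (fun mu psi => f psi * G mu psi) phi = op (fun x q p => k x q p * f (p + P x q)) nu G phi.
Proof.
elim: nu G => //= x nu IH G; rewrite IH; congr (_ + _).
by apply: eq_bigr => q _; rewrite mulrA.
Qed.

Lemma op_cder k nu (G : R -> seq I -> R -> R[i]) H phi t :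
  (forall mu psi, cder (fun s => G s mu psi) t (H mu psi)) ->
  cder (fun s => op k nu (G s) phi) t (op k nu H phi).
Proof.
elim: nu G H => [|x nu IH] G H h /=; first exact: cder_cst.
apply: cderD; last by apply: IH => mu psi; exact: h.
by apply: cder_sum => q; apply: cderMl; exact: h.
Qed.

Definition prodI (A : I -> R[i]) nu := foldr (fun x z => A x * z) 1 nu.
Definition expo (A : I -> R[i]) (t : R) nu phi := cexp (t * phi) * prodI A nu.

(** The derivation that sends each [A x] to [e x], evaluated on the monomial: the error replaces one
    mode at a time. *)
Fixpoint errI (A e : I -> R[i]) nu : R[i] :=
  if nu is x :: nu' then e x * prodI A nu' + A x * errI A e nu' else 0.

Variable c0 : I -> KT -> R[i].
Definition NN nu G phi := op (fun x q _ => c0 x q) nu G phi.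

(** Leibniz rule: differentiating each mode in turn is what [NN] does. Since [NN] carries the phase
    [phi] along, that phase has to be divided out again. *)
Lemma prodI_cder (A : I -> R -> R[i]) (e : I -> R[i]) (t : R) nu phi :
  (forall x, cder (A x) t (\sum_(q <- K) c0 x q * cexp (t * P x q) *
      (A (l1 x q) t * A (l2 x q) t * A (l3 x q) t) + e x)) ->
  cder (fun s => prodI (A^~ s) nu) t
   (cexp (- (t * phi)) * NN nu (expo (A^~ t) t) phi + errI (A^~ t) e nu).
Proof.
move=> h; rewrite /NN; elim: nu => [|x nu IH] /=.
  by apply: cder_eq (cder_cst _ _) _; rewrite mulr0 addr0.
apply: cder_eq (cderM (h x) IH) _.
set B := op _ _ _ _; set B' := op _ _ _ _.
have -> : B' = A x t * B.
  rewrite /B /B' -opZ; apply: op_ext => mu psi _; rewrite /expo /=; ring.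
have -> : \sum_(q <- K) c0 x q * expo (A^~ t) t [:: l1 x q, l2 x q, l3 x q & nu] (phi + P x q) =
   cexp (t * phi) * ((\sum_(q <- K) c0 x q * cexp (t * P x q) *
      (A (l1 x q) t * A (l2 x q) t * A (l3 x q) t)) * prodI (A^~ t) nu).
  rewrite mulr_suml mulr_sumr; apply: eq_bigr => q _; rewrite /expo /= mulrDr cexpD; ring.
have e1 : cexp (- (t * phi)) * cexp (t * phi) = 1 by rewrite -cexpD addNr cexp0.
set U := (\sum_(q <- K) _); set V := prodI _ _; set E := cexp (t * phi); set F := cexp (- _); set W := errI _ _ _.
rewrite -/E -/F in e1.
rewrite [RHS](_ : _ = (F * E) * (U * V) + F * (A x t * B) + (e x * V + A x t * W)); last by ring.
rewrite e1; ring.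
Qed.

Lemma expo_cder (A : I -> R -> R[i]) (e : I -> R[i]) (t : R) nu phi :
  (forall x, cder (A x) t (\sum_(q <- K) c0 x q * cexp (t * P x q) *
      (A (l1 x q) t * A (l2 x q) t * A (l3 x q) t) + e x)) ->
  cder (fun s => expo (A^~ s) s nu phi) t
   ('i * phi%:C * expo (A^~ t) t nu phi + NN nu (expo (A^~ t) t) phi + cexp (t * phi) * errI (A^~ t) e nu).
Proof.
move=> h; apply: cder_eq (cderM (cder_cexp phi t) (prodI_cder nu phi h)) _.
have e1 : cexp (t * phi) * cexp (- (t * phi)) = 1 by rewrite -cexpD subrr cexp0.
rewrite mulrDr (mulrA (cexp _) (cexp _)) e1 mul1r /expo; ring.
Qed.

Variable L : nat -> R.
Hypothesis L1 : forall l, 1 <= L l.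
(** The new frequency is compared with the accumulated phase, so that [phi + P x q] stays comparable
    to [P x q] and the division meets no small denominator. The threshold may grow with the length
    [l] of the monomial. *)
Definition far l phi x q := L l * Num.max 1 `|phi| < `|P x q|.

(* Far substitutions oscillate and are integrated by parts in [LL], which divides by the new phase;
   near ones are kept in [NNnear]. *)
Definition NNnear nu G phi := op (fun x q p => if far (size nu) p x q then 0 else c0 x q) nu G phi.
Definition LL nu G phi :=
  op (fun x q p => if far (size nu) p x q then c0 x q / ('i * (p + P x q)%:C) else 0) nu G phi.
Definition iterL j G := iter j (fun H nu phi => LL nu H phi) G.

Lemma far_gt l phi x q : far l phi x q -> `|P x q| - `|phi| <= `|phi + P x q| /\ `|phi| < `|P x q|.
Proof.
move=> h; split.
  by rewrite (addrC phi); exact: lerB_normD.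
apply: le_lt_trans h; apply: (@le_trans _ _ (1 * Num.max 1 `|phi|)).
  by rewrite mul1r le_max lexx orbT.
by rewrite ler_wpM2r// le_max ler01.
Qed.

(** Multiplication by ['i * psi] undoes the division in [LL]. This is the algebraic core of the
    integration by parts in time. *)
Lemma NN_split nu G phi :
  NN nu G phi = NNnear nu G phi + LL nu (fun mu psi => 'i * psi%:C * G mu psi) phi.
Proof.
rewrite /NN /NNnear /LL op_phase -opDk; apply: op_extk => x q.
case: ifPn => [h|_]; last by rewrite mul0r addr0.
have [h1 h2] := far_gt h.
have p0 : phi + P x q != 0 by rewrite -normr_gt0; apply: lt_le_trans h1; rewrite subr_gt0.
rewrite add0r divfK// mulf_neq0// eq_complex /= ?oner_eq0 ?andbF//.
by rewrite (negbTE p0).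
Qed.

Lemma iterL_ext j G H nu phi : (forall mu psi, G mu psi = H mu psi) -> iterL j G nu phi = iterL j H nu phi.
Proof.
move=> e; elim: j nu phi => [|j IH] nu phi; first exact: e.
by rewrite /iterL /= /LL; apply: op_ext => mu psi _; exact: IH.
Qed.

Lemma iterLD j G H nu phi : iterL j (fun mu psi => G mu psi + H mu psi) nu phi = iterL j G nu phi + iterL j H nu phi.
Proof.
elim: j nu phi => // j IH nu phi.
by rewrite /iterL /= /LL -opD; apply: op_ext => mu psi _; exact: IH.
Qed.

Lemma iterLZ j z G nu phi : iterL j (fun mu psi => z * G mu psi) nu phi = z * iterL j G nu phi.
Proof.
elim: j nu phi => // j IH nu phi.
by rewrite /iterL /= /LL -opZ; apply: op_ext => mu psi _; exact: IH.
Qed.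

Lemma iterLSr j G nu phi : iterL j.+1 G nu phi = iterL j (fun mu psi => LL mu G psi) nu phi.
Proof. by rewrite /iterL iterSr. Qed.

Lemma iterL_cder j (G : R -> seq I -> R -> R[i]) H nu phi t :
  (forall mu psi, cder (fun s => G s mu psi) t (H mu psi)) ->
  cder (fun s => iterL j (G s) nu phi) t (iterL j H nu phi).
Proof.
move=> h; elim: j nu phi => [|j IH] nu phi; first exact: h.
by rewrite /iterL /=; apply: op_cder => mu psi; exact: IH.
Qed.

(** A far step changes the phase to one of size at least [|P| - |phi| >= 3 max 1 |phi|]. After
    enough doublings the next far step would need a resonance larger than [Pmax]. *)
Lemma iterL_vanish (Pmax : R) j G nu phi : (forall l, 4 <= L l) ->
  (forall x q, `|P x q| <= Pmax) -> Pmax < 2 ^+ j.+1 * Num.max 1 `|phi| -> iterL j.+1 G nu phi = 0.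
Proof.
move=> L4 hP; have maxp p : 0 < Num.max 1 `|p : R| by rewrite lt_max ltr01.
elim: j nu phi => [|j IH] nu phi hphi.
  rewrite /iterL /= /LL (@op_extk _ (fun _ _ _ => 0)); last first.
    move=> x q; rewrite /far ifN// -leNgt (le_trans (hP x q))// (le_trans (ltW hphi))//.
    by rewrite ler_pM2r// expr1 (le_trans _ (L4 _))// ler_nat.
  by elim: nu G => //= x nu IH G; rewrite IH addr0 big1// => q _; rewrite mul0r.
rewrite /iterL iterS /LL -/(iterL _ _).
have opk k F : (forall x q mu, k x q phi * F mu (phi + P x q) = 0) -> op k nu F phi = 0.
  elim: nu F {hphi IH} => //= x nu IH F h.
  rewrite IH; last by move=> *; exact: h.
  by rewrite addr0 big1// => q _; exact: h.
apply: opk => x q mu; case: ifPn => [h|_]; last by rewrite mul0r.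
rewrite [X in _ * X]IH ?mulr0//; apply: lt_le_trans hphi _.
rewrite exprSr -mulrA ler_pM2l ?exprn_gt0//.
have [h1 h2] := far_gt h; rewrite le_max; apply/orP; right; apply: le_trans h1.
have h4 : 4 * Num.max 1 `|phi| <= `|P x q| by apply: le_trans (ltW h); rewrite ler_pM2r.
have h5 : `|phi| <= Num.max 1 `|phi| by rewrite le_max lexx orbT.
by have h6 := maxp phi; clear -h4 h5 h6 L1; lra.
Qed.

(* A far substitution at least doubles the phase, so on a finite set of frequencies the iteration
   terminates and leaves no remainder. *)
Lemma normal_form (Pmax : R) : (forall l, 4 <= L l) -> (forall x q, `|P x q| <= Pmax) ->
  exists J : nat, forall (A : I -> R -> R[i]) (e : R -> I -> R[i]) (t : R),
  (forall x, cder (A x) t (\sum_(q <- K) c0 x q * cexp (t * P x q) *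
      (A (l1 x q) t * A (l2 x q) t * A (l3 x q) t) + e t x)) ->
  forall x, cder (fun s => A x s - \sum_(0 <= j < J) (-1) ^+ j * iterL j.+1 (expo (A^~ s) s) [:: x] 0) t
   (\sum_(0 <= j < J) (-1) ^+ j * iterL j (fun nu phi => NNnear nu (expo (A^~ t) t) phi) [:: x] 0
    + (\sum_(0 <= j < J) (-1) ^+ j.+1 * iterL j.+1 (fun nu phi => cexp (t * phi) * errI (A^~ t) (e t) nu) [:: x] 0
     + e t x)).
Proof.
move=> L4 hP.
have [J hJ] : exists J : nat, Pmax < 2 ^+ J.+1.
  exists (Num.bound `|Pmax|); apply: lt_le_trans (_ : (Num.bound `|Pmax|).+1%:R <= _).
    by apply: le_lt_trans (ler_norm _) _; apply: lt_trans (archi_boundP (normr_ge0 _)) _; rewrite ltr_nat.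
  by rewrite -natrX ler_nat ltnW// ltn_expl.
exists J.+1 => A e t h x.
set E := expo _ _; pose Er nu phi := cexp (t * phi) * errI (A^~ t) (e t) nu.
pose X j := iterL j (fun nu phi => NN nu E phi) [:: x] 0.
pose N j := iterL j (fun nu phi => NNnear nu E phi) [:: x] 0.
(* [D j] is the derivative of the [j]-th correction. By [NN_split] its part with ['i * phi] equals
   [X j - N j], so [D j] is [X j - N j + X j.+1] plus the error. The alternating sum telescopes to
   [X 0], and the last [X] vanishes. *)
pose D j := iterL j.+1 (fun nu phi => 'i * phi%:C * E nu phi + NN nu E phi + Er nu phi) [:: x] 0.
have hD j : D j = X j - N j + X j.+1 + iterL j.+1 Er [:: x] 0.
  rewrite /D iterLD iterLD; congr (_ + _ + _).
  rewrite iterLSr /X /N; apply/eqP; rewrite eq_sym subr_eq -iterLD; apply/eqP.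
  by apply: iterL_ext => nu phi; rewrite NN_split addrC.
have XJ : X J.+1 = 0 by apply: (iterL_vanish _ _ L4 hP); rewrite normr0 max_l ?ler01// mulr1.
have tel n : X 0%N = \sum_(0 <= j < n) (-1) ^+ j * (D j + N j - iterL j.+1 Er [:: x] 0) + (-1) ^+ n * X n.
  elim: n => [|n IH]; first by rewrite big_nil add0r expr0 mul1r.
  rewrite big_nat_recr// [LHS]IH -addrA; congr (_ + _).
  by rewrite exprSr hD; ring.
have hd : cder (fun s => A x s - \sum_(0 <= j < J.+1) (-1) ^+ j * iterL j.+1 (expo (A^~ s) s) [:: x] 0) t
    (X 0%N + e t x - \sum_(0 <= j < J.+1) (-1) ^+ j * D j).
  apply: cderB.
    apply: cder_eq (h x) _; congr (_ + _); rewrite /X /iterL /= /NN /= addr0; apply: eq_bigr => q _.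
    by rewrite /E /expo /= add0r mulr1; ring.
  apply: cder_sum => j; apply: cderMl; apply: iterL_cder => mu psi; exact: expo_cder.
apply: cder_eq hd _.
rewrite (tel J.+1) XJ mulr0 addr0.
have -> : \sum_(0 <= j < J.+1) (-1) ^+ j * (D j + N j - iterL j.+1 Er [:: x] 0) =
   \sum_(0 <= j < J.+1) (-1) ^+ j * D j + \sum_(0 <= j < J.+1) (-1) ^+ j * N j
   - \sum_(0 <= j < J.+1) (-1) ^+ j * iterL j.+1 Er [:: x] 0.
  by rewrite -big_split -sumrB; apply: eq_bigr => j _; rewrite mulrBr mulrDr.
rewrite [X in _ = _ + (X + _)](_ : _ = - \sum_(0 <= j < J.+1) (-1) ^+ j * iterL j.+1 Er [:: x] 0); last first.
  by rewrite -sumrN; apply: eq_bigr => j _; rewrite exprSr; ring.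
rewrite -/Er; ring.
Qed.

End operators.

(** * Summation over the generations *)

Section series_bounds.
Context {R : realType}.

Lemma sum_halves (J : nat) : \sum_(0 <= j < J) (2^-1 : R) ^+ j <= 2.
Proof.
have -> : \sum_(0 <= j < J) (2^-1 : R) ^+ j = 2 - 2 * 2^-1 ^+ J.
  elim: J => [|J IH]; first by rewrite big_nil expr0 mulr1 subrr.
  by rewrite big_nat_recr//= IH exprS; field.
by rewrite lerBlDr lerDl mulr_ge0 ?exprn_ge0.
Qed.

Lemma odd_le_pow j : [/\ (1 + 2 * j <= 2 * 2 ^ j)%N, (3 + 2 * j <= 4 * 2 ^ j)%N & (5 + 2 * j <= 8 * 2 ^ j)%N].
Proof. by elim: j => // j [? ? ?]; rewrite expnS; split; lia. Qed.

Lemma geometric_le (w a : R) j : 0 <= w -> 0 <= a -> w * a <= 2^-1 -> w ^+ j * a ^+ j <= 2^-1 ^+ j.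
Proof. by move=> w0 a0 h; rewrite -exprMn lerXn2r ?nnegrE ?mulr_ge0. Qed.

(** After [j.+1] reductions a monomial has [1 + 2 j.+1] modes, at most [4 * 2^j]. Each reduction
    costs [y Rr^2 <= 1 / 128], which beats this count and leaves the ratio 1/2. *)
Lemma smooth_term (y Rr d : R) p j : 0 <= y -> y * Rr ^+ 2 * 2 ^+ (2 * p + 7) <= 1 -> 0 <= d ->
  y ^+ j.+1 * ((1 + 2 * j.+1)%N%:R * Rr ^+ (1 + 2 * j.+1).-1 * d) <= 2^-1 ^+ j * (d / 8).
Proof.
move=> y0 ys d0.
have -> : (1 + 2 * j.+1).-1 = (2 * j.+1)%N by lia.
rewrite exprM; set z := Rr ^+ 2 in ys *; have z0 : 0 <= z by exact: sqr_ge0.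
set w := y * z in ys; have w0 : 0 <= w by rewrite mulr_ge0.
have w1 : w * 128 <= 1.
  apply: le_trans ys; rewrite ler_wpM2l// exprD (_ : 2 ^+ 7 = 128); last by ring.
  by rewrite ler_peMl// exprn_ege1// ler1n.
have g := @geometric_le w 2 j w0 (ler0n _ _).
have {}g : w ^+ j * 2 ^+ j <= 2^-1 ^+ j by apply: g; move: w1 w0; lra.
have o : (1 + 2 * j.+1)%N%:R <= 4 * 2 ^+ j :> R.
  by rewrite -natrX -natrM ler_nat -[(1 + _)%N]/(1 + 2 * j.+1)%N mulnS addnA; have [] := odd_le_pow j.
rewrite [leLHS](_ : _ = w ^+ j * (1 + 2 * j.+1)%N%:R * (w * d)); last first.
  by rewrite /w; clearbody z; rewrite exprMn !exprS; ring.
apply: (@le_trans _ _ (w ^+ j * (4 * 2 ^+ j) * (w * d))).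
  have wd : 0 <= w * d by rewrite mulr_ge0.
  by rewrite ler_wpM2r// ler_wpM2l// exprn_ge0.
rewrite [leLHS](_ : _ = w ^+ j * 2 ^+ j * (4 * w * d)); last by ring.
apply: ler_pM => //.
- by apply: mulr_ge0; exact: exprn_ge0.
- by apply: mulr_ge0 => //; exact: mulr_ge0.
- by rewrite mulrC ler_wpM2l//; move: w1 w0; lra.
Qed.

(** The three mode counts together grow like [8^i], and the threshold of the near step like
    [4^(p i)]. The exponent [2 p + 7] gives [y Rr^2 <= 1 / (16 * 8 * 4^p)], so the ratio 1/2
    remains. *)
Lemma near_term (y Rr Cs Lam d : R) p i : 0 <= y -> y * Rr ^+ 2 * 2 ^+ (2 * p + 7) <= 1 -> 0 <= Cs -> 0 <= Lam ->
  0 <= d -> y ^+ i * (2 * ((1 + 2 * i)%N%:R * Cs * ((Lam * 2 ^+ (3 + 2 * i)) ^+ p * ((3 + 2 * i)%N%:R * Cs *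
      ((5 + 2 * i)%N%:R * Rr ^+ (4 + 2 * i) * d))))) <= 2^-1 ^+ i * (128 * Cs ^+ 2 * (Lam * 8) ^+ p * Rr ^+ 4 * d).
Proof.
move=> y0 ys Cs0 Lam0 d0; have [q1 q2 q3] := odd_le_pow i.
rewrite (_ : (Lam * 2 ^+ (3 + 2 * i)) ^+ p = (Lam * 8) ^+ p * (4 ^+ p) ^+ i); last first.
  rewrite exprD exprM mulrA exprMn -!exprM mulnC; congr ((_ * _) ^+ _ * _); first by ring.
  by rewrite [RHS]exprM -[in RHS](_ : 2 ^+ 2 = 4)// -?exprM; [congr (_ ^+ _); lia | ring].
rewrite exprD exprM; set z := Rr ^+ 2 in ys *; have z0 : 0 <= z by exact: sqr_ge0.
set w := y * z in ys; have w0 : 0 <= w by rewrite mulr_ge0.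
set a : R := 8 * 4 ^+ p; have a0 : 0 <= a by rewrite mulr_ge0 ?exprn_ge0.
have g := @geometric_le w a i w0 a0.
have {}g : w ^+ i * a ^+ i <= 2^-1 ^+ i.
  apply: g; have e : 2 ^+ (2 * p + 7) = 16 * a by rewrite /a exprD exprM -(_ : 2 ^+ 2 = 4); ring.
  have wa0 : 0 <= w * a by rewrite mulr_ge0.
  move: ys wa0; rewrite e mulrCA; lra.
have {}q1 : (1 + 2 * i)%N%:R <= 2 * 2 ^+ i :> R.
  by rewrite -natrX -natrM ler_nat.
have {}q2 : (3 + 2 * i)%N%:R <= 4 * 2 ^+ i :> R.
  by rewrite -natrX -natrM ler_nat.
have {}q3 : (5 + 2 * i)%N%:R <= 8 * 2 ^+ i :> R.
  by rewrite -natrX -natrM ler_nat.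
set D := 2 * Cs ^+ 2 * (Lam * 8) ^+ p * Rr ^+ 4 * d.
have D0 : 0 <= D.
  apply: mulr_ge0 d0; apply: mulr_ge0; last exact: exprn_even_ge0.
  apply: mulr_ge0; last by rewrite exprn_ge0// mulr_ge0.
  by rewrite mulr_ge0// sqr_ge0.
rewrite [leLHS](_ : _ = w ^+ i * (4 ^+ p) ^+ i * ((1 + 2 * i)%N%:R * (3 + 2 * i)%N%:R * (5 + 2 * i)%N%:R) * D); last first.
  by rewrite /D /w; clearbody z; rewrite [(y * z) ^+ i]exprMn; ring.
apply: (@le_trans _ _ (w ^+ i * (4 ^+ p) ^+ i * (2 * 2 ^+ i * (4 * 2 ^+ i) * (8 * 2 ^+ i)) * D)).
  rewrite ler_wpM2r// ler_wpM2l ?mulr_ge0 ?exprn_ge0//.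
  by apply: ler_pM; rewrite ?mulr_ge0//; apply: ler_pM.
rewrite [leLHS](_ : _ = w ^+ i * a ^+ i * (64 * D)); last first.
  have e8 : 8 ^+ i = 2 ^+ i * 2 ^+ i * 2 ^+ i :> R by rewrite -!exprMn; congr (_ ^+ _); ring.
  by rewrite /a [(8 * _) ^+ i]exprMn e8; ring.
rewrite [X in _ <= _ * X](_ : _ = 64 * D); last by rewrite /D; ring.
by rewrite ler_wpM2r// mulr_ge0.
Qed.

End series_bounds.

(** * Majorants for the multilinear expressions *)

Section majorants.
Context {R : realType}.
Variables (I KT : Type) (K : seq KT) (l1 l2 l3 : I -> KT -> I).
Implicit Types (kap : I -> KT -> R) (nu : seq I) (g G H : seq I -> R).

Definition triI kap (Y1 Y2 Y3 : I -> R) x : R :=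
  \sum_(q <- K) kap x q * (Y1 (l1 x q) * Y2 (l2 x q) * Y3 (l3 x q)).

(** The counterpart of [op] for absolute values: phases are dropped and the kernel is real. *)
Fixpoint opR kap nu g : R :=
  if nu is x :: nu' then
    \sum_(q <- K) kap x q * g (l1 x q :: l2 x q :: l3 x q :: nu') + opR kap nu' (fun mu => g (x :: mu))
  else 0.

Lemma opR_le kap nu g G : (forall x q, 0 <= kap x q) ->
  (forall mu, size mu = (size nu).+2 -> g mu <= G mu) -> opR kap nu g <= opR kap nu G.
Proof.
move=> k0; elim: nu g G => //= x nu IH g G h; apply: lerD.
  by apply: ler_sum => q _; rewrite ler_wpM2l// h.
by apply: IH => mu s; apply: h; rewrite /= s.
Qed.

Lemma opR_add kap nu g G : opR kap nu (fun mu => g mu + G mu) = opR kap nu g + opR kap nu G.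
Proof.
elim: nu g G => [|x nu IH] g G /=; first by rewrite addr0.
rewrite IH addrACA -big_split; congr (_ + _); apply: eq_bigr => q _; exact: mulrDr.
Qed.

Lemma opR_scale kap nu g z : opR kap nu (fun mu => z * g mu) = z * opR kap nu g.
Proof.
elim: nu g => [|x nu IH] g /=; first by rewrite mulr0.
by rewrite IH mulrDr mulr_sumr; congr (_ + _); apply: eq_bigr => q _; rewrite mulrCA.
Qed.

(** The norms enter only through the four closure properties below; [true] stands for the weak norm
    and [false] for the strong one. *)
Variable B : bool -> (I -> R) -> R -> Prop.
Hypothesis B_mono : forall b Y Y' c c', (forall x, 0 <= Y' x <= Y x) -> 0 <= c <= c' -> B b Y c -> B b Y' c'.
Hypothesis B_add : forall b Y Y' c c', 0 <= c -> 0 <= c' -> B b Y c -> B b Y' c' -> B b (fun x => Y x + Y' x) (c + c').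
Hypothesis B_zero : forall b, B b (fun=> 0) 0.
Hypothesis B_scale : forall b Y c z, 0 <= z -> B b Y c -> B b (fun x => z * Y x) (z * c).

Record profile := Profile { pfun : I -> R; prough : bool; pcst : R }.
Definition pok p := [/\ forall x, 0 <= pfun p x, 0 <= pcst p & B (prough p) (pfun p) (pcst p)].
Fixpoint okall ps := if ps is p :: ps' then pok p /\ okall ps' else True.
Definition flags ps := sumn [seq (prough p : nat) | p <- ps].
Definition profile_cst ps := foldr (fun p c => pcst p * c) 1 ps.
Fixpoint prodY ps nu : R :=
  match ps, nu with
  | [::], [::] => 1
  | p :: ps', x :: nu' => pfun p x * prodY ps' nu'
  | _, _ => 0
  end.

Lemma profile_cst_ge0 ps : okall ps -> 0 <= profile_cst ps.
Proof. by elim: ps => //= p ps IH [[_ h _] h']; rewrite mulr_ge0// IH. Qed.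

(* Sums of products of nonnegative profiles, exactly [m] of which are only bounded in the rough norm. *)
Inductive Maj (m : nat) : nat -> (seq I -> R) -> R -> Prop :=
| Maj_zero n G C : (forall nu, size nu = n -> G nu <= 0) -> 0 <= C -> Maj m n G C
| Maj_prod ps n G C z : 0 <= z -> size ps = n -> okall ps -> flags ps = m ->
    (forall nu, size nu = n -> G nu <= z * prodY ps nu) -> z * profile_cst ps <= C -> Maj m n G C
| Maj_add n G1 G2 G C1 C2 C : Maj m n G1 C1 -> Maj m n G2 C2 ->
    (forall nu, size nu = n -> G nu <= G1 nu + G2 nu) -> C1 + C2 <= C -> Maj m n G C.

Lemma Maj_ge0 m n G C : Maj m n G C -> 0 <= C.
Proof.
elim=> [//|ps {}n {}G {}C z z0 _ h _ _|{}n G1 G2 {}G C1 C2 {}C _ h1 _ h2 _].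
  by apply: le_trans; rewrite mulr_ge0// profile_cst_ge0.
by apply: le_trans; rewrite addr_ge0.
Qed.

Lemma Maj_le m n G H C C' : Maj m n G C -> (forall nu, size nu = n -> H nu <= G nu) -> C <= C' -> Maj m n H C'.
Proof.
move=> h; case: h H C' => [{}n {}G {}C h1 h2|ps {}n {}G {}C z z0 h1 h2 h3 h4 h5|{}n G1 G2 {}G C1 C2 {}C h1 h2 h3 h4] H C' hH hC.
- by apply: Maj_zero; [move=> nu s; apply: le_trans (hH _ s) (h1 _ s)|apply: le_trans hC].
- by apply: (Maj_prod z0 h1 h2 h3); [move=> nu s; apply: le_trans (hH _ s) (h4 _ s)|apply: le_trans hC].
- by apply: (Maj_add h1 h2); [move=> nu s; apply: le_trans (hH _ s) (h3 _ s)|apply: le_trans hC].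
Qed.

Lemma Maj_scale m n G C z : 0 <= z -> Maj m n G C -> Maj m n (fun nu => z * G nu) (z * C).
Proof.
move=> z0; elim=> [{}n {}G {}C h1 h2|ps {}n {}G {}C z' z0' h1 h2 h3 h4 h5|{}n G1 G2 {}G C1 C2 {}C _ h1 _ h2 h3 h4].
- by apply: Maj_zero; [move=> nu s; rewrite mulr_ge0_le0// h1|rewrite mulr_ge0].
- apply: (@Maj_prod m ps n _ _ (z * z')); rewrite ?mulr_ge0// -?mulrA ?ler_wpM2l// => nu s.
  by rewrite -mulrA ler_wpM2l// h4.
- by apply: (Maj_add h1 h2); rewrite -?mulrDr ?ler_wpM2l// => nu s; rewrite -mulrDr ler_wpM2l// h3.
Qed.

Lemma Maj_cons m n G H C p : pok p -> Maj m n G C ->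
  (forall x nu, size nu = n -> H (x :: nu) <= pfun p x * G nu) -> Maj (prough p + m) n.+1 H (pcst p * C).
Proof.
move=> hp h; have [p0 pc0 _] := hp.
elim: h H => [{}n {}G {}C h1 h2|ps {}n {}G {}C z z0 h1 h2 h3 h4 h5|{}n G1 G2 {}G C1 C2 {}C _ h1 _ h2 h3 h4] H hH.
- apply: Maj_zero; last by rewrite mulr_ge0.
  by case=> // x nu [s]; apply: le_trans (hH _ _ s) _; rewrite mulr_ge0_le0// h1.
- apply: (@Maj_prod _ (p :: ps) _ _ _ z) => //=; rewrite ?h1//.
  + by rewrite /flags /= -/(flags ps) h3.
  + by case=> // x nu [s]; apply: le_trans (hH _ _ s) _; rewrite mulrCA ler_wpM2l//; exact: h4.
  by rewrite mulrCA ler_wpM2l.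
- pose H1 nu := if nu is x :: nu' then pfun p x * G1 nu' else 0.
  pose H2 nu := if nu is x :: nu' then pfun p x * G2 nu' else 0.
  apply: (@Maj_add _ _ H1 H2 _ (pcst p * C1) (pcst p * C2)).
  + by apply: h1.
  + by apply: h2.
  + case=> // x nu [s]; apply: le_trans (hH _ _ s) _; rewrite /H1 /H2 -mulrDr ler_wpM2l//; exact: h3.
  + by rewrite -mulrDr ler_wpM2l.
Qed.

Lemma Maj_final m G C : (m <= 1)%N -> Maj m 1 G C ->
  exists Y : I -> R, [/\ forall x, 0 <= Y x, forall x, G [:: x] <= Y x & B (m == 1)%N Y C].
Proof.
move=> m1; move e : 1%N => n h; elim: h e => [{}n {}G {}C h1 h2|ps {}n {}G {}C z z0 h1 h2 h3 h4 h5|{}n G1 G2 {}G C1 C2 {}C k1 h1 k2 h2 h3 h4] e.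
- exists (fun=> 0); split=> // [x|]; first by apply: h1; rewrite -e.
  by apply: (B_mono _ _ (B_zero _)) => [x|]; rewrite ?lexx.
- case: ps h1 h2 h3 h4 h5 => [|p [|? ?]]; rewrite -e //= => _ [[p0 pc0 hB] _].
  rewrite /flags /= addn0 mulr1 => hm h4 h5.
  exists (fun x => z * pfun p x); split.
  + by move=> x; rewrite mulr_ge0.
  + by move=> x; have := h4 [:: x] erefl; rewrite /= mulr1.
  + have hb : (m == 1)%N = prough p by rewrite -hm; case: (prough p).
    rewrite hb; apply: (B_mono _ _ (B_scale z0 hB)) => [x|]; first by rewrite lexx mulr_ge0.
    by rewrite h5 mulr_ge0.
- have [Y1 [a1 b1 c1]] := h1 e; have [Y2 [a2 b2 c2]] := h2 e.
  exists (fun x => Y1 x + Y2 x); split.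
  + by move=> x; rewrite addr_ge0.
  + by move=> x; apply: le_trans (h3 _ _) _; rewrite -?e// lerD.
  + apply: (B_mono _ _ (B_add (Maj_ge0 k1) (Maj_ge0 k2) c1 c2)) => [x|]; first by rewrite lexx addr_ge0.
    by rewrite h4 addr_ge0 ?(Maj_ge0 k1) ?(Maj_ge0 k2).
Qed.

(** A substitution into the first mode merges the first three profiles into one by the trilinear
    bound; otherwise the first profile stays and the induction treats the rest. Each mode
    contributes one term, hence the factor [n]. Since [m <= 1], the disjunction of the three flags
    equals their sum. *)
Lemma Maj_op kap Ck m n G C : (forall x q, 0 <= kap x q) -> 0 <= Ck ->
  (forall p1 p2 p3, pok p1 -> pok p2 -> pok p3 -> (prough p1 + prough p2 + prough p3 <= m)%N ->
    B [|| prough p1, prough p2 | prough p3] (triI kap (pfun p1) (pfun p2) (pfun p3)) (Ck * pcst p1 * pcst p2 * pcst p3)) ->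
  (m <= 1)%N -> Maj m n.+2 G C -> Maj m n (fun nu => opR kap nu G) (n%:R * Ck * C).
Proof.
move=> k0 Ck0 HT m1.
have main ps : size ps = n.+2 -> okall ps -> (flags ps <= m)%N ->
    Maj (flags ps) n (fun nu => opR kap nu (prodY ps)) (n%:R * Ck * profile_cst ps).
  elim: n ps => [|n' IH] ps hs hok hm.
    by apply: Maj_zero; [case|rewrite !mul0r].
  case: ps hs hok hm => [|p1 [|p2 [|p3 ps]]] //= [hs] [ok1 [ok2 [ok3 okps]]] hm.
  have [a1 b1 c1] := ok1; have [a2 b2 c2] := ok2; have [a3 b3 c3] := ok3.
  have hm3 : (prough p1 + prough p2 + prough p3 <= m)%N.
    apply: leq_trans hm; rewrite /flags /= !addnA leq_addr//.
  pose p := Profile (triI kap (pfun p1) (pfun p2) (pfun p3)) [|| prough p1, prough p2 | prough p3] (Ck * pcst p1 * pcst p2 * pcst p3).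
  have okp : pok p.
    split=> /=; [move=> x|by rewrite !mulr_ge0|exact: HT].
    by apply: sumr_ge0 => q _; rewrite !mulr_ge0.
  have rp : (prough p : nat) = (prough p1 + prough p2 + prough p3)%N.
    rewrite /=; move: hm3; move: m1; clear.
    by case: (prough p1); case: (prough p2); case: (prough p3) => //=; case: m => [|[|]].
  pose H1 nu := if nu is x :: nu' then pfun p x * prodY ps nu' else 0.
  pose H2 nu := if nu is x :: nu' then pfun p1 x * opR kap nu' (prodY [:: p2, p3 & ps]) else 0.
  have C0 := profile_cst_ge0 okps.
  apply: (@Maj_add _ _ H1 H2 _ (profile_cst (p :: ps)) (pcst p1 * (n'%:R * Ck * profile_cst [:: p2, p3 & ps]))).
  - apply: (@Maj_prod _ (p :: ps) _ _ _ 1) => //=; rewrite ?hs ?mul1r//.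
      by rewrite /flags /= -/p -[(prough p1 || _ : nat)]/(prough p : nat) rp !addnA.
    by case=> // x nu [s]; rewrite mul1r.
  - rewrite /flags /= -/(flags [:: p2, p3 & ps]).
    have h : Maj (flags [:: p2, p3 & ps]) n' (fun nu => opR kap nu (prodY [:: p2, p3 & ps])) (n'%:R * Ck * profile_cst [:: p2, p3 & ps]).
      apply: IH => //=; first by rewrite hs.
      by apply: leq_trans hm; rewrite /flags /= leq_addl.
    exact: (Maj_cons ok1 h).
  - case=> // x nu [s] /=; rewrite lerD//.
      rewrite /H1 /= /triI mulr_suml; apply: ler_sum => q _; rewrite -!mulrA lexx//.
    by rewrite /H2 -opR_scale; apply: opR_le.
  - by rewrite /= -natr1 le_eqVlt; apply/orP; left; apply/eqP; ring.
move=> h; move e : n.+2 h => n2 h; elim: h e => [{}n2 {}G {}C h1 h2|ps {}n2 {}G {}C z z0 h1 h2 h3 h4 h5|{}n2 G1 G2 {}G C1 C2 {}C _ h1 _ h2 h3 h4] e.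
- apply: Maj_zero; last by rewrite !mulr_ge0.
  move=> nu s; have : opR kap nu G <= opR kap nu (fun=> 0 * 0) by apply: opR_le => // mu; rewrite s e mul0r => /h1.
  by rewrite opR_scale mul0r.
- have := main ps; rewrite h1 e h3 leqnn => /(_ erefl h2 isT) /(Maj_scale z0) hM.
  apply: Maj_le hM _ _.
    by move=> nu s; rewrite -opR_scale; apply: opR_le => // mu; rewrite s e => /h4.
  by rewrite mulrCA ler_wpM2l// mulr_ge0.
- apply: (Maj_add (h1 e) (h2 e)) => [nu s|].
    by rewrite -opR_add; apply: opR_le => // mu; rewrite s e => /h3.
  by rewrite -mulrDr ler_wpM2l// mulr_ge0.
Qed.

Lemma Maj_prodI (A : I -> R[i]) (Y : I -> R) (r : R) n : 0 <= r -> (forall x, normc (A x) <= Y x) ->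
  B false Y r -> Maj 0 n (fun nu => normc (prodI A nu)) (r ^+ n).
Proof.
move=> r0 hA hB; have Y0 x : 0 <= Y x by apply: le_trans (hA x); exact: normc_ge0.
elim: n => [|n IH].
  apply: (@Maj_prod _ [::] _ _ _ 1) => //=; last by rewrite expr0 mulr1.
  by case=> // _; rewrite mul1r -[prodI A [::]]/1 normc1.
have okp : pok (Profile Y false r) by [].
have := @Maj_cons 0 n _ (fun nu => normc (prodI A nu)) _ _ okp IH.
rewrite exprS; apply => x nu s /=; rewrite normcM ler_wpM2r ?normc_ge0//.
Qed.

(** The difference of two products is telescoped, one factor [A - A'] at a time. *)
Lemma Maj_prodI_sub (A A' : I -> R[i]) (Y Y' Yd : I -> R) (r d : R) n : 0 <= r -> 0 <= d ->
  (forall x, normc (A x) <= Y x) -> (forall x, normc (A' x) <= Y' x) -> (forall x, normc (A x - A' x) <= Yd x) ->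
  B false Y r -> B false Y' r -> B false Yd d ->
  Maj 0 n (fun nu => normc (prodI A nu - prodI A' nu)) (n%:R * r ^+ n.-1 * d).
Proof.
move=> r0 d0 hA hA' hd hB hB' hBd.
have Y0' x : 0 <= Y' x by apply: le_trans (hA' x); exact: normc_ge0.
have Yd0 x : 0 <= Yd x by apply: le_trans (hd x); exact: normc_ge0.
elim: n => [|n IH].
  by apply: Maj_zero; [case=> // _; rewrite -[prodI A [::]]/1 -[prodI A' [::]]/1 subrr normc0|rewrite !mul0r].
have okp : pok (Profile Y' false r) by [].
have okd : pok (Profile Yd false d) by [].
pose H1 nu := if nu is x :: nu' then Yd x * normc (prodI A nu') else 0.
pose H2 nu := if nu is x :: nu' then Y' x * normc (prodI A nu' - prodI A' nu') else 0.
apply: (@Maj_add _ _ H1 H2 _ (d * r ^+ n) (r * (n%:R * r ^+ n.-1 * d))).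
- exact: (@Maj_cons 0 n _ H1 _ _ okd (Maj_prodI n r0 hA hB)).
- exact: (@Maj_cons 0 n _ H2 _ _ okp IH).
- case=> // x nu [s] /=.
  rewrite (_ : _ - _ = (A x - A' x) * prodI A nu + A' x * (prodI A nu - prodI A' nu)); last by ring.
  apply: le_trans (normc_le_add _ _) _; rewrite !normcM lerD ?ler_wpM2r ?normc_ge0//.
- rewrite le_eqVlt; apply/orP; left; apply/eqP.
  by case: n {IH H1 H2} => [|n] /=; rewrite -?natr1 ?exprS; ring.
Qed.

Lemma Maj_errI (A e : I -> R[i]) (Y Ye : I -> R) (r d : R) n : 0 <= r -> 0 <= d ->
  (forall x, normc (A x) <= Y x) -> (forall x, normc (e x) <= Ye x) -> B false Y r -> B true Ye d ->
  Maj 1 n (fun nu => normc (errI A e nu)) (n%:R * r ^+ n.-1 * d).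
Proof.
move=> r0 d0 hA he hB hBe.
have Y0 x : 0 <= Y x by apply: le_trans (hA x); exact: normc_ge0.
have Ye0 x : 0 <= Ye x by apply: le_trans (he x); exact: normc_ge0.
elim: n => [|n IH].
  by apply: Maj_zero; [case=> // _; rewrite -[errI A e [::]]/0 normc0|rewrite !mul0r].
have okp : pok (Profile Y false r) by [].
have oke : pok (Profile Ye true d) by [].
pose H1 nu := if nu is x :: nu' then Ye x * normc (prodI A nu') else 0.
pose H2 nu := if nu is x :: nu' then Y x * normc (errI A e nu') else 0.
apply: (@Maj_add _ _ H1 H2 _ (d * r ^+ n) (r * (n%:R * r ^+ n.-1 * d))).
- exact: (@Maj_cons 0 n _ H1 _ _ oke (Maj_prodI n r0 hA hB)).
- exact: (@Maj_cons 1 n _ H2 _ _ okp IH).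
- case=> // x nu [s] /=.
  apply: le_trans (normc_le_add _ _) _; rewrite !normcM lerD ?ler_wpM2r ?normc_ge0//.
- rewrite le_eqVlt; apply/orP; left; apply/eqP.
  by case: n {IH H1 H2} => [|n] /=; rewrite -?natr1 ?exprS; ring.
Qed.

Variables (c0 : I -> KT -> R[i]) (P : I -> KT -> R) (kS kW : I -> KT -> R) (Cs Cw eta Rr : R) (p : nat).
Hypothesis kS0 : forall x q, 0 <= kS x q.
Hypothesis kW0 : forall x q, 0 <= kW x q.
Hypotheses (Cs0 : 0 <= Cs) (Cw0 : 0 <= Cw) (eta0 : 0 < eta) (p_eta : 1 <= p%:R * eta) (Rr0 : 0 <= Rr).
Hypothesis c0S : forall x q, normc (c0 x q) <= kS x q * Num.max 1 `|P x q| `^ 2^-1.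
Hypothesis c0W : forall x q, 1 <= `|P x q| -> normc (c0 x q) <= kW x q * `|P x q| `^ (1 - eta).
Hypothesis B_triS : forall p1 p2 p3, pok p1 -> pok p2 -> pok p3 -> (prough p1 + prough p2 + prough p3 <= 0)%N ->
    B [|| prough p1, prough p2 | prough p3] (triI kS (pfun p1) (pfun p2) (pfun p3)) (Cs * pcst p1 * pcst p2 * pcst p3).
Hypothesis B_triW : forall p1 p2 p3, pok p1 -> pok p2 -> pok p3 -> (prough p1 + prough p2 + prough p3 <= 1)%N ->
    B [|| prough p1, prough p2 | prough p3] (triI kW (pfun p1) (pfun p2) (pfun p3)) (Cw * pcst p1 * pcst p2 * pcst p3).

(** The first summand makes [2 Cw / nfLam] as small as [smooth_term] and [near_term] require, the
    second makes every threshold at least 4. In [nfL] the factor [2 ^+ n] will absorb the number of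
    modes, and since [p * eta >= 1] the power [p] turns a gain [|P|^(- eta)] into the inverse of
    [nfLam * 2 ^+ n]. *)
Definition nfLam : R := 2 * Cw * Rr ^+ 2 * 2 ^+ (2 * p + 7) + 4.
Definition nfL (n : nat) : R := (nfLam * 2 ^+ n) ^+ p.
Local Notation Lam := nfLam.
Local Notation L := nfL.
Local Notation M phi := (Num.max 1 `|phi : R|).
Local Notation LLf := (LL K l1 l2 l3 P c0 L).
Local Notation NNf := (NNnear K l1 l2 l3 P c0 L).
Local Notation iterLf := (iterL K l1 l2 l3 P c0 L).

Lemma Lam4 : 4 <= Lam.
Proof. by rewrite /nfLam lerDr !mulr_ge0// ?exprn_ge0. Qed.

Lemma p_gt0 : (0 < p)%N.
Proof. by case: p p_eta => //; rewrite mul0r ler10. Qed.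

Lemma nfL4 n : 4 <= L n.
Proof.
have h : 4 <= Lam * 2 ^+ n.
  by apply: le_trans Lam4 _; rewrite ler_peMr ?exprn_ege1 ?ler1n// (le_trans _ Lam4).
apply: (le_trans h); rewrite /nfL -[leLHS]expr1 ler_weXn2l ?p_gt0//.
by apply: le_trans h; rewrite ler1n.
Qed.

Lemma normc_op_le k kap nu F g phi z : 0 <= z ->
  (forall x q mu, size mu = (size nu).+2 -> normc (k x q phi * F mu (phi + P x q)) <= z * (kap x q * g mu)) ->
  normc (op K l1 l2 l3 P k nu F phi) <= z * opR kap nu g.
Proof.
move=> z0; elim: nu F g => [|x nu IH] F g h; first by rewrite /op normc0 mulr0.
rewrite [op _ _ _ _ _ _ _ _ _]/= [opR _ _ _]/=.
apply: le_trans (normc_le_add _ _) _; rewrite mulrDr lerD//.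
  apply: le_trans (normc_sum _ _) _; rewrite mulr_sumr; apply: ler_sum => q _; exact: h.
by apply: IH => y q mu s; apply: h; rewrite /= s.
Qed.

Lemma farP n phi x q : far P L n phi x q ->
  [/\ L n <= `|P x q|, M (P x q) = `|P x q|, `|P x q| <= 2 * `|phi + P x q| & M (phi + P x q) = `|phi + P x q|].
Proof.
move=> h; have L4 := nfL4 n.
have [h1 _] := far_gt (fun l => le_trans (ler1n _ 4) (nfL4 l)) h.
have h2 : 1 <= M phi by rewrite le_max lexx.
have h3 : `|phi| <= M phi by rewrite le_max lexx orbT.
have h4 : L n <= `|P x q| by apply: le_trans (ltW h); rewrite ler_peMr// (le_trans _ L4).
have h5 : 4 * M phi <= `|P x q| by apply: le_trans (ltW h); rewrite ler_wpM2r// (le_trans _ h2).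
have h6 : 2 <= `|phi + P x q| by move: h1 h2 h3 h5; lra.
split=> //.
- by apply: max_r; move: h4 L4; lra.
- by move: h1 h2 h3 h5; lra.
- by apply: max_r; move: h6; lra.
Qed.

(** The majorant must not depend on the phase, which changes at each substitution. *)
Definition mbounded m (F : seq I -> R -> R[i]) (C : nat -> R) :=
  exists2 g, (forall nu phi, normc (F nu phi) <= g nu) & forall n, Maj m n g (C n).

(** On far terms [|P| <= 2 |phi + P|], so [c0W] bounds the quotient by [2 kW |P|^(- eta)], and
    [|P| >= L n] turns this into [2 kW / (Lam * 2 ^+ n)]. The factor [n] from [Maj_op] is then paid
    by [2 ^+ n]. *)
Lemma mbounded_LL m F C : (m <= 1)%N -> mbounded m F C ->
  mbounded m (fun nu phi => LLf nu F phi) (fun n => 2 * Cw / Lam * C n.+2).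
Proof.
move=> m1 [g h1 h2].
have Lam0 : 0 < Lam by apply: lt_le_trans Lam4.
pose z n := 2 / (Lam * 2 ^+ n).
have z0 n : 0 <= z n by rewrite divr_ge0// mulr_ge0 ?exprn_ge0// ltW.
exists (fun nu => z (size nu) * opR kW nu g).
  move=> nu phi; rewrite /LL; apply: normc_op_le => // x q mu s.
  have g0 := le_trans (normc_ge0 _) (h1 mu (phi + P x q)).
  case: ifPn => [h|_]; last by rewrite mul0r normc0 mulr_ge0// mulr_ge0.
  have [f1 f2 f3 f4] := farP h.
  rewrite mulrA normcM; apply: ler_pM => //; rewrite ?normc_ge0//.
  have P0 : 0 < `|P x q| by apply: lt_le_trans f1; apply: lt_le_trans (nfL4 _).
  have Q0 : 0 < `|phi + P x q| by move: P0 f3; lra.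
  rewrite normcM normcV normcM normc_i mul1r normc_real.
  rewrite ler_pdivrMr//; apply: le_trans (@c0W x q _) _.
    by apply: le_trans f1; apply: le_trans (nfL4 _); rewrite ler1n.
  have hL : `|P x q| `^ (- eta) <= (Lam * 2 ^+ size nu)^-1.
    rewrite powRN lef_pV2 ?posrE ?powR_gt0 ?mulr_gt0 ?exprn_gt0//.
    have b1 : 1 <= Lam * 2 ^+ size nu.
      by apply: le_trans (_ : Lam <= _); rewrite ?(le_trans _ Lam4) ?ler1n// ler_peMr ?exprn_ege1 ?ler1n// ltW.
    apply: (@le_trans _ _ (L (size nu) `^ eta)); last by rewrite ge0_ler_powR ?nnegrE// ?(le_trans _ f1) ?(le_trans _ (nfL4 _))// ltW.
    rewrite /nfL -(@powR_mulrn _ (Lam * 2 ^+ size nu) p) ?(le_trans _ b1)// -powRrM.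
    by rewrite -[leLHS]powRr1 ?(le_trans _ b1)//; apply: ler_powR.
  rewrite powRD ?(gt_eqF P0) ?implybT// powRr1 ?(ltW P0)// -mulrA.
  rewrite [leRHS](_ : _ = kW x q * ((Lam * 2 ^+ size nu)^-1 * (2 * `|phi + P x q|))); last by rewrite /z; ring.
  rewrite ler_wpM2l// mulrC; apply: ler_pM => //; rewrite ?powR_ge0//.
move=> n; have h3 := Maj_scale (z0 n) (Maj_op kW0 Cw0 _ m1 (h2 n.+2)).
apply: Maj_le (h3 _) _ _ => [p1 p2 p3 o1 o2 o3 hm|nu ->//|].
  by apply: B_triW => //; exact: leq_trans m1.
rewrite !mulrA ler_wpM2r ?(Maj_ge0 (h2 _))// /z invfM.
rewrite [leLHS](_ : _ = 2 * Cw / Lam * (n%:R / 2 ^+ n)); last by ring.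
rewrite ler_piMr ?divr_ge0 ?mulr_ge0// ?(ltW Lam0)// ler_pdivrMr ?exprn_gt0// mul1r.
by rewrite -natrX ler_nat ltnW// ltn_expl.
Qed.

Lemma mbounded_iterL m F C j : (m <= 1)%N -> mbounded m F C ->
  mbounded m (iterLf j F) (fun n => (2 * Cw / Lam) ^+ j * C (n + 2 * j)%N).
Proof.
move=> m1; elim: j F C => [|j IH] F C h.
  by case: h => g h1 h2; exists g => // n; rewrite mul1r muln0 addn0.
have [g h1 h2] := mbounded_LL m1 (IH _ _ h).
exists g; first exact: h1.
move=> n; apply: Maj_le (h2 n) _ _ => //.
by rewrite mulrA -exprS mulnS addnA addn2 !addSn.
Qed.

(* Majorants up to the growth [max 1 |phi| ^ (1/2)] created by nearly resonant terms and absorbed by the next denominator. *)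
Definition hbounded (F : seq I -> R -> R[i]) (C : nat -> R) :=
  exists2 g, (forall nu phi, normc (F nu phi) <= M phi `^ 2^-1 * g nu) & forall n, Maj 0 n g (C n).

(** For a near term [|P| <= L n * max 1 |phi|], so the loss [|P|^(1/2)] of [c0S] becomes a half
    power of the phase before the substitution. *)
Lemma hbounded_NNnear F C : mbounded 0 F C ->
  hbounded (fun nu phi => NNf nu F phi) (fun n => L n * (n%:R * Cs * C n.+2)).
Proof.
move=> [g h1 h2]; have L0 n : 0 <= L n by apply: le_trans (nfL4 n).
exists (fun nu => L (size nu) * opR kS nu g).
  move=> nu phi; rewrite mulrA /NNnear; apply: normc_op_le.
    by rewrite mulr_ge0// powR_ge0.
  move=> x q mu s; have g0 := le_trans (normc_ge0 _) (h1 mu (phi + P x q)).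
  case: ifPn => [_|h]; first by rewrite mul0r normc0 !mulr_ge0// powR_ge0.
  rewrite normcM mulrA; apply: ler_pM => //; rewrite ?normc_ge0//.
  apply: le_trans (c0S _ _) _; rewrite mulrC ler_wpM2r//.
  move: h; rewrite -leNgt => h.
  have L1 : 1 <= L (size nu) by apply: le_trans (nfL4 _); rewrite ler1n.
  have M1 : 1 <= M phi by rewrite le_max lexx.
  apply: (@le_trans _ _ ((L (size nu) * M phi) `^ 2^-1)).
    rewrite ge0_ler_powR ?nnegrE ?invr_ge0 ?le_max ?ler01 ?mulr_ge0// ?(le_trans _ M1)//.
    by rewrite ge_max h andbT -[leLHS]mulr1 ler_pM.
  rewrite powRM ?(le_trans _ M1)// mulrC ler_wpM2l ?powR_ge0//.
  by rewrite -[leRHS]powRr1//; apply: ler_powR => //; rewrite invf_le1 ?ler1n.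
move=> n; apply: Maj_le (Maj_scale (L0 n) (Maj_op kS0 Cs0 B_triS isT (h2 n.+2))) _ _ => //.
by move=> nu ->.
Qed.

(** The half powers [|P|^(1/2)] from [c0S] and [|phi + P|^(1/2)] from the near term meet one
    denominator [|phi + P|], and [|P| <= 2 |phi + P|]. All gain is used up, so [kS] appears here
    instead of [kW]. *)
Lemma mbounded_LL_h F C : hbounded F C ->
  mbounded 0 (fun nu phi => LLf nu F phi) (fun n => 2 * (n%:R * Cs * C n.+2)).
Proof.
move=> [g h1 h2].
exists (fun nu => 2 * opR kS nu g); last first.
  by move=> n; apply: Maj_scale => //; exact: (Maj_op kS0 Cs0 B_triS isT (h2 n.+2)).
move=> nu phi; rewrite /LL; apply: normc_op_le => // x q mu s.
have M1 psi : 1 <= M psi by rewrite le_max lexx.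
have g0 : 0 <= g mu.
  have w0 : 0 < M (phi + P x q) `^ 2^-1 by apply: powR_gt0; apply: lt_le_trans (M1 _).
  by rewrite -(pmulr_rge0 _ w0) (le_trans (normc_ge0 _) (h1 mu (phi + P x q))).
case: ifPn => [h|_]; last by rewrite mul0r normc0 !mulr_ge0.
have [f1 f2 f3 f4] := farP h.
rewrite normcM; apply: le_trans (ler_wpM2l (normc_ge0 _) (h1 _ _)) _.
rewrite !mulrA ler_wpM2r//.
have P0 : 0 < `|P x q| by apply: lt_le_trans f1; apply: lt_le_trans (nfL4 _).
have Q0 : 0 < `|phi + P x q| by move: P0 f3; lra.
rewrite normcM normcV normcM normc_i mul1r normc_real f4.
rewrite mulrAC ler_pdivrMr//.
apply: le_trans (ler_wpM2r (powR_ge0 _ _) (c0S _ _)) _; rewrite f2.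
rewrite -mulrA (mulrC 2) -!mulrA ler_wpM2l// -powRM//.
rewrite [leRHS](_ : _ = ((2 * `|phi + P x q|) * (2 * `|phi + P x q|)) `^ 2^-1); last first.
  by rewrite -expr2 -powR_mulrn ?mulr_ge0// -powRrM mulfV ?pnatr_eq0// powRr1 ?mulr_ge0.
rewrite ge0_ler_powR ?nnegrE ?invr_ge0 ?mulr_ge0//; apply: ler_pM => //.
by rewrite ler_peMl ?ler1n.
Qed.

Local Notation BB b F c := (B b (fun x => normc (F x)) c).

Lemma mbounded_B m F C : (m <= 1)%N -> mbounded m F C -> BB (m == 1)%N (fun x => F [:: x] 0) (C 1%N).
Proof.
move=> m1 [g h1 h2]; have [Y [Y0 hY hB]] := Maj_final m1 (h2 1%N).
apply: B_mono hB => [x|]; last by rewrite lexx andbT (Maj_ge0 (h2 1%N)).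
by rewrite normc_ge0 (le_trans (h1 _ _) (hY _)).
Qed.

Lemma B_altsum b (F : nat -> I -> R[i]) (c : nat -> R) J : (forall j, 0 <= c j) ->
  (forall j, BB b (F j) (c j)) ->
  BB b (fun x => \sum_(0 <= j < J) (-1) ^+ j * F j x) (\sum_(0 <= j < J) c j).
Proof.
move=> c0' h; have s0 n : 0 <= \sum_(0 <= j < n) c j by apply: sumr_ge0.
elim: J => [|J IH].
  rewrite big_nil; apply: (B_mono _ _ (B_zero _)) => [x|]; rewrite ?lexx//.
  by rewrite normc_ge0 big_nil normc0 lexx.
rewrite big_nat_recr//=.
apply: (B_mono _ _ (B_add (s0 J) (c0' J) IH (h J))) => [x|]; last by rewrite lexx addr_ge0.
rewrite normc_ge0/= big_nat_recr//=; apply: le_trans (normc_le_add _ _) _; rewrite lerD//.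
by rewrite -signr_odd normcM; case: (odd J); rewrite ?expr0 ?expr1 ?normcN normc1 mul1r.
Qed.

Lemma mbounded_expo_sub (A A' : I -> R[i]) t d : 0 <= d -> BB false A Rr -> BB false A' Rr ->
  BB false (fun x => A x - A' x) d ->
  mbounded 0 (fun nu phi => expo A t nu phi - expo A' t nu phi) (fun n => n%:R * Rr ^+ n.-1 * d).
Proof.
move=> d0 h1 h2 h3; exists (fun nu => normc (prodI A nu - prodI A' nu)).
  by move=> nu phi; rewrite /expo -mulrBr normcM normc_cexp mul1r.
by move=> n; apply: (Maj_prodI_sub n Rr0 d0 _ _ _ h1 h2 h3).
Qed.

Lemma mbounded_err (A e : I -> R[i]) t d : 0 <= d -> BB false A Rr -> BB true e d ->
  mbounded 1 (fun nu phi => cexp (t * phi) * errI A e nu) (fun n => n%:R * Rr ^+ n.-1 * d).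
Proof.
move=> d0 h1 h2; exists (fun nu => normc (errI A e nu)).
  by move=> nu phi; rewrite normcM normc_cexp mul1r.
by move=> n; apply: (Maj_errI n Rr0 d0 _ _ h1 h2).
Qed.

Let y : R := 2 * Cw / Lam.

Lemma y_ge0 : 0 <= y.
Proof. by rewrite /y !mulr_ge0// invr_ge0 (le_trans _ Lam4). Qed.

Lemma y_small : y * Rr ^+ 2 * 2 ^+ (2 * p + 7) <= 1.
Proof.
have Lam0 : 0 < Lam by apply: lt_le_trans Lam4.
rewrite (_ : y * _ * _ = 2 * Cw * Rr ^+ 2 * 2 ^+ (2 * p + 7) / Lam); last by rewrite /y; ring.
by rewrite ler_pdivrMr// mul1r /nfLam lerDl.
Qed.

Lemma smooth_sum J d : 0 <= d ->
  \sum_(0 <= j < J) y ^+ j.+1 * ((1 + 2 * j.+1)%N%:R * Rr ^+ (1 + 2 * j.+1).-1 * d) <= d / 4.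
Proof.
move=> d0; apply: (@le_trans _ _ (\sum_(0 <= j < J) 2^-1 ^+ j * (d / 8))).
  by apply: ler_sum => j _; apply: smooth_term y_small d0; exact: y_ge0.
rewrite -mulr_suml; apply: le_trans (ler_wpM2r _ (sum_halves J)) _; first by rewrite divr_ge0.
by rewrite le_eqVlt; apply/orP; left; apply/eqP; field.
Qed.

(** The first summand is for the near term without any reduction, the second is twice the constant
    of [near_term], from the geometric series. *)
Definition nfC : R := 3 * Cs * Rr ^+ 2 * L 1 + 256 * Cs ^+ 2 * (Lam * 8) ^+ p * Rr ^+ 4.

(** For [j = i.+1] the innermost reduction is estimated together with the near substitution by
    [mbounded_LL_h]; only the [i] outer reductions contribute a factor [y]. *)
Let cnear (d : R) j : R := if j is i.+1 then
    y ^+ i * (2 * ((1 + 2 * i)%N%:R * Cs * (L (3 + 2 * i) * ((3 + 2 * i)%N%:R * Cs *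
      ((5 + 2 * i)%N%:R * Rr ^+ (4 + 2 * i) * d)))))
  else L 1 * (1 * Cs * (3 * Rr ^+ 2 * d)).

Lemma cnear_ge0 d j : 0 <= d -> 0 <= cnear d j.
Proof.
move=> d0; have L0 n : 0 <= L n by apply: le_trans (nfL4 _).
case: j => [|j]; rewrite /cnear.
  by rewrite mulr_ge0 ?L0// !mulr_ge0// exprn_ge0.
have hr : 0 <= Rr ^+ (4 + 2 * j) by exact: exprn_ge0.
apply: mulr_ge0; first by rewrite exprn_ge0 ?y_ge0.
apply: mulr_ge0 => //; apply: mulr_ge0; first exact: mulr_ge0.
apply: mulr_ge0 => //; apply: mulr_ge0; first exact: mulr_ge0.
by apply: mulr_ge0 => //; exact: mulr_ge0.
Qed.

Lemma smooth_term_ge0 j d : 0 <= d ->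
  0 <= y ^+ j.+1 * ((1 + 2 * j.+1)%N%:R * Rr ^+ (1 + 2 * j.+1).-1 * d).
Proof.
move=> d0; apply: mulr_ge0; first by rewrite exprn_ge0 ?y_ge0.
by apply: mulr_ge0 => //; apply: mulr_ge0 => //; exact: exprn_ge0.
Qed.

Lemma nfC_ge0 : 0 <= nfC.
Proof. by rewrite /nfC addr_ge0// !mulr_ge0 ?exprn_ge0 ?mulr_ge0// (le_trans _ Lam4). Qed.

Lemma near_sum J d : 0 <= d -> \sum_(0 <= j < J) cnear d j <= nfC * d.
Proof.
move=> d0; case: J => [|J]; first by rewrite big_nil mulr_ge0// nfC_ge0.
rewrite big_nat_recl// /nfC mulrDl lerD//.
  by rewrite /cnear le_eqVlt; apply/orP; left; apply/eqP; ring.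
apply: (@le_trans _ _ (\sum_(0 <= i < J) 2^-1 ^+ i * (128 * Cs ^+ 2 * (Lam * 8) ^+ p * Rr ^+ 4 * d))).
  by apply: ler_sum => i _; apply: near_term y_ge0 y_small Cs0 (le_trans _ Lam4) d0.
rewrite -mulr_suml.
have K0 : 0 <= 128 * Cs ^+ 2 * (Lam * 8) ^+ p * Rr ^+ 4 * d.
  by rewrite !mulr_ge0 ?exprn_ge0 ?mulr_ge0//; apply: le_trans Lam4.
by apply: le_trans (ler_wpM2r K0 (sum_halves J)) _; rewrite le_eqVlt; apply/orP; left; apply/eqP; ring.
Qed.

(** [Z] collects the boundary terms; its Lipschitz constant 1/4 does not involve time. The
    derivative of the corrected difference splits into near terms, bounded in the strong norm by the
    difference [d], and error terms, bounded in the weak norm only. The factor 4 counts two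
    solutions, each with the error itself and its images, at most [2 * eps] together. *)
Lemma normal_form_estimate Pmax : (forall x q, `|P x q| <= Pmax) ->
  exists Z : (I -> R[i]) -> R -> I -> R[i],
  (forall A A' t d, 0 <= d -> BB false A Rr -> BB false A' Rr -> BB false (fun x => A x - A' x) d ->
    BB false (fun x => Z A t x - Z A' t x) (d / 4)) /\
  (forall (A A' : I -> R -> R[i]) (e e' : I -> R[i]) t d eps, 0 <= d -> 0 <= eps ->
    BB false (A^~ t) Rr -> BB false (A'^~ t) Rr -> BB false (fun x => A x t - A' x t) d ->
    BB true e eps -> BB true e' eps ->
    (forall x, cder (A x) t (\sum_(q <- K) c0 x q * cexp (t * P x q) *
      (A (l1 x q) t * A (l2 x q) t * A (l3 x q) t) + e x)) ->
    (forall x, cder (A' x) t (\sum_(q <- K) c0 x q * cexp (t * P x q) *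
      (A' (l1 x q) t * A' (l2 x q) t * A' (l3 x q) t) + e' x)) ->
    exists F1 F2, [/\ BB false F1 (nfC * d), BB true F2 (4 * eps) &
      forall x, cder (fun s => A x s - A' x s - (Z (A^~ s) s x - Z (A'^~ s) s x)) t (F1 x + F2 x)]).
Proof.
move=> hP; have [J hJ] := normal_form K l1 l2 l3 c0 (fun l => le_trans (ler1n _ 4) (nfL4 l)) nfL4 hP.
exists (fun A t x => \sum_(0 <= j < J) (-1) ^+ j * iterLf j.+1 (expo A t) [:: x] 0).
have sub j (F G : seq I -> R -> R[i]) nu phi : iterLf j F nu phi - iterLf j G nu phi = iterLf j (fun mu psi => F mu psi - G mu psi) nu phi.
  rewrite -mulN1r -iterLZ -iterLD; apply: iterL_ext => mu psi; by rewrite mulN1r.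
have errB (A e : I -> R[i]) t eps : 0 <= eps -> BB false A Rr -> BB true e eps ->
    BB true (fun x => \sum_(0 <= j < J) (-1) ^+ j.+1 * iterLf j.+1 (fun nu phi => cexp (t * phi) * errI A e nu) [:: x] 0) (eps / 4).
  move=> e0 h1 h2.
  have h3 : BB true (fun x => \sum_(0 <= j < J) (-1) ^+ j * iterLf j.+1 (fun nu phi => cexp (t * phi) * errI A e nu) [:: x] 0)
      (\sum_(0 <= j < J) y ^+ j.+1 * ((1 + 2 * j.+1)%N%:R * Rr ^+ (1 + 2 * j.+1).-1 * eps)).
    apply: (B_altsum (F := fun j x => iterLf j.+1 (fun nu phi => cexp (t * phi) * errI A e nu) [:: x] 0)) => j; first exact: smooth_term_ge0.
    exact: (mbounded_B _ (mbounded_iterL j.+1 _ (mbounded_err t e0 h1 h2))).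
  apply: (B_mono _ _ h3) => [x|].
    rewrite normc_ge0 andTb; set u := (X in normc X <= _); set v := (X in _ <= normc X).
    suff -> : u = - v by rewrite normcN.
    by rewrite /u /v -sumrN; apply: eq_bigr => j _; rewrite exprS mulN1r mulNr.
  by rewrite smooth_sum// andbT; apply: sumr_ge0 => j _; exact: smooth_term_ge0.
split=> [A A' t d d0 h1 h2 h3|A A' e e' t d eps d0 e0 h1 h2 h3 he he' hA hA'].
  have h : BB false (fun x => \sum_(0 <= j < J) (-1) ^+ j * iterLf j.+1 (fun nu phi => expo A t nu phi - expo A' t nu phi) [:: x] 0)
      (\sum_(0 <= j < J) y ^+ j.+1 * ((1 + 2 * j.+1)%N%:R * Rr ^+ (1 + 2 * j.+1).-1 * d)).
    apply: (B_altsum (F := fun j x => iterLf j.+1 (fun nu phi => expo A t nu phi - expo A' t nu phi) [:: x] 0)) => j; first exact: smooth_term_ge0.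
    exact: (mbounded_B _ (mbounded_iterL j.+1 _ (mbounded_expo_sub t d0 h1 h2 h3))).
  apply: (B_mono _ _ h) => [x|].
    rewrite normc_ge0 andTb -sumrB le_eqVlt; apply/orP; left; apply/eqP; congr normc.
    by apply: eq_bigr => j _; rewrite -mulrBr sub.
  by rewrite smooth_sum// andbT; apply: sumr_ge0 => j _; exact: smooth_term_ge0.
pose D nu phi := expo (A^~ t) t nu phi - expo (A'^~ t) t nu phi.
pose Er (A e : I -> R[i]) x := \sum_(0 <= j < J) (-1) ^+ j.+1 * iterLf j.+1 (fun nu phi => cexp (t * phi) * errI A e nu) [:: x] 0.
exists (fun x => \sum_(0 <= j < J) (-1) ^+ j * iterLf j (fun nu phi => NNf nu D phi) [:: x] 0).
exists (fun x => (Er (A^~ t) e x + e x) - (Er (A'^~ t) e' x + e' x)); split.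
- have h : BB false (fun x => \sum_(0 <= j < J) (-1) ^+ j * iterLf j (fun nu phi => NNf nu D phi) [:: x] 0) (\sum_(0 <= j < J) cnear d j).
    apply: (B_altsum (F := fun j x => iterLf j (fun nu phi => NNf nu D phi) [:: x] 0)) => j; first exact: cnear_ge0.
    have hn := hbounded_NNnear (mbounded_expo_sub t d0 h1 h2 h3).
    (* For [j = 0] the phase is 0 and the growth factor [max 1 |phi| ^ (1/2)] is 1; for [j > 0] the
       innermost [LL] absorbs it. *)
    case: j => [|j].
      case: hn => g g1 g2.
      have hn : mbounded 0 (fun nu _ => NNf nu D 0) (fun n => L n * (n%:R * Cs * (n.+2%:R * Rr ^+ n.+1 * d))).
        exists g => // nu phi; apply: le_trans (g1 nu 0) _.
        by rewrite normr0 max_l ?ler01// powR1 mul1r.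
      exact: (mbounded_B _ hn).
    have [g g1 g2] := @mbounded_iterL 0 _ _ j isT (mbounded_LL_h hn).
    have hb : mbounded 0 (iterLf j.+1 (fun nu phi => NNf nu D phi)) (fun n => y ^+ j * (2 * ((n + 2 * j)%N%:R * Cs *
        (L (n + 2 * j).+2 * ((n + 2 * j).+2%:R * Cs * ((n + 2 * j).+4%:R * Rr ^+ (n + 2 * j).+3 * d)))))).
      by exists g => // nu phi; rewrite iterLSr; exact: g1.
    exact: (mbounded_B _ hb).
  apply: (B_mono _ _ h) => [x|]; first by rewrite normc_ge0 lexx.
  by rewrite near_sum// andbT; apply: sumr_ge0 => j _; exact: cnear_ge0.
- have hE B' f : BB false B' Rr -> BB true f eps -> BB true (fun x => Er B' f x + f x) (2 * eps).
    move=> k1 k2; have := B_add _ e0 (errB _ _ t _ e0 k1 k2) k2; rewrite divr_ge0// => /(_ isT) k3.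
    apply: (B_mono _ _ k3) => [x|]; first by rewrite normc_ge0 normc_le_add.
    by rewrite addr_ge0 ?divr_ge0//=; move: e0; lra.
  have e2 : 0 <= 2 * eps by rewrite mulr_ge0.
  apply: (B_mono _ _ (B_add e2 e2 (hE _ _ h1 he) (hE _ _ h2 he'))) => [x|]; first by rewrite normc_ge0 normc_le_sub.
  by rewrite addr_ge0//=; move: e0; lra.
- move=> x; have k1 := hJ A (fun _ => e) t hA x; have k2 := hJ A' (fun _ => e') t hA' x.
  apply: (cder_ext (f := fun s => (A x s - \sum_(0 <= j < J) (-1) ^+ j * iterLf j.+1 (expo (A^~ s) s) [:: x] 0) -
     (A' x s - \sum_(0 <= j < J) (-1) ^+ j * iterLf j.+1 (expo (A'^~ s) s) [:: x] 0))) => [s|]; first by ring.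
  apply: cder_eq (cderB k1 k2) _; rewrite -/(Er _ _ _) -/(Er _ _ _).
  have -> : \sum_(0 <= j < J) (-1) ^+ j * iterLf j (fun nu phi => NNf nu D phi) [:: x] 0 =
     \sum_(0 <= j < J) (-1) ^+ j * iterLf j (fun nu phi => NNf nu (expo (A^~ t) t) phi) [:: x] 0 -
     \sum_(0 <= j < J) (-1) ^+ j * iterLf j (fun nu phi => NNf nu (expo (A'^~ t) t) phi) [:: x] 0.
    rewrite -sumrB; apply: eq_bigr => j _; rewrite -mulrBr sub; congr (_ * _); apply: iterL_ext => nu phi.
    by rewrite /NNnear -mulN1r -opZ -opD; apply: op_ext => mu psi _; rewrite mulN1r.
  by rewrite /Er; ring.
Qed.

End majorants.

Lemma big_pairs (R : realType) (V : nmodType) (r : seq int) (F : int * int -> V) :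
  \sum_(q <- [seq (n1, n3) | n1 <- r, n3 <- r]) F q = \sum_(n1 <- r) \sum_(n3 <- r) F (n1, n3).
Proof. by rewrite big_allpairs_dep. Qed.

Lemma resonance_eq0 (R : realType) (be n n1 n3 : R) : n1 = n \/ n3 = n -> resonance be n n1 n3 = 0.
Proof.
case=> ->; rewrite /resonance.
  have -> : n + n3 - n = n3 by ring.
  by rewrite subrK subrr.
have -> : n1 + n - n = n1 by ring.
by ring.
Qed.

Lemma conjcM (R : realType) (z w : R[i]) : conjc (z * w) = conjc z * conjc w.
Proof. exact: rmorphM. Qed.

Lemma conjcD (R : realType) (z w : R[i]) : conjc (z + w) = conjc z + conjc w.
Proof. exact: rmorphD. Qed.

Lemma conjc0 (R : realType) : conjc (0 : R[i]) = 0.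
Proof. exact: rmorph0. Qed.

Lemma conjc_sum (R : realType) (T : Type) (s : seq T) (F : T -> R[i]) :
  conjc (\sum_(x <- s) F x) = \sum_(x <- s) conjc (F x).
Proof. exact: rmorph_sum. Qed.

Lemma le_of_eq (R : realType) (x y : R) : x = y -> x <= y.
Proof. by move->. Qed.

Lemma eq_of_normc_small (R : realType) (z w : R[i]) : (forall eta, 0 < eta -> normc (z - w) <= eta) -> z = w.
Proof.
move=> h; apply/eqP; rewrite -subr_eq0; apply/eqP; apply: eq0_normc; apply/le_anti; rewrite normc_ge0 andbT.
by apply/ler_addgt0Pr => eta eta0; rewrite add0r h.
Qed.

(** * Uniqueness for the Fourier coefficients *)

Section truncated_system.
Context {R : realType}.
Variables (g b d rr th : R).
Hypothesis hp : kernel_params g b d rr th.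
Hypothesis th2 : th < 2.
Variable kappa : R[i].
Hypothesis kappa1 : normc kappa = 1.
Variable Rr : R.
Hypothesis Rr0 : 0 <= Rr.

Local Notation be := (2 - g).
Local Notation sym n := (`|n%:~R : R| `^ be).
Local Notation nXb := (nX b).
Local Notation nYr := (nY rr).
Local Notation nBb := (nB b rr).

Definition cubic (r : seq int) (u : int -> R[i]) (n : int) : R[i] :=
  \sum_(n1 <- r) \sum_(n3 <- r) (if n1 + n3 - n \in r then u n1 * conjc (u (n1 + n3 - n)) * u n3 else 0).

Let conjb (s : bool) (z : R[i]) := if s then conjc z else z.

(** Modes range over all integers, so everything attached to a frequency outside [r] is set to 0;
    this lets one fixed list [K r] of pairs serve all modes. *)
Let inr (r : seq int) (x : int * bool) (q : int * int) :=
  [&& x.1 \in r, q.1 \in r, q.2 \in r & q.1 + q.2 - x.1 \in r].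
Let K (r : seq int) := [seq (n1, n3) | n1 <- r, n3 <- r].
Let l1 (x : int * bool) (q : int * int) := (q.1, x.2).
Let l2 (x : int * bool) (q : int * int) := (q.1 + q.2 - x.1, ~~ x.2).
Let l3 (x : int * bool) (q : int * int) := (q.2, x.2).
Let c0 r x q : R[i] := if inr r x q then conjb x.2 kappa else 0.
Let res (x : int * bool) (q : int * int) : R := resonance be x.1%:~R q.1%:~R q.2%:~R.
Let P r x q : R := if inr r x q then (-1) ^+ x.2 * res x q else 0.
Let kS r (x : int * bool) (q : int * int) := if inr r x q then kapS g x.1 q.1 q.2 else 0.
Let kW r (x : int * bool) (q : int * int) := if inr r x q then kapW g th x.1 q.1 q.2 else 0.
Let B r (rough : bool) (Y : int * bool -> R) (c : R) := forall s, nBb rough r (fun n => Y (n, s)) c.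

Lemma nB_le rough r (x y : int -> R) (c c' : R) : 0 <= c <= c' -> (forall n, n \in r -> 0 <= x n <= y n) ->
  nBb rough r y c -> nBb rough r x c'.
Proof.
case: rough => /= /andP[c0' cc] xy; last by apply: nX_le => //; rewrite c0'.
move=> h n nr; apply: le_trans cc; apply: le_trans (h n nr); rewrite ler_wpM2l ?powR_ge0//.
by have /andP[] := xy n nr.
Qed.

Lemma B_mono r rough Y Y' c c' : (forall x, 0 <= Y' x <= Y x) -> 0 <= c <= c' -> B r rough Y c -> B r rough Y' c'.
Proof. by move=> h1 h2 h3 s; apply: nB_le (h3 s) => // n _. Qed.

Lemma B_add r rough Y Y' c c' : 0 <= c -> 0 <= c' -> B r rough Y c -> B r rough Y' c' ->
  B r rough (fun x => Y x + Y' x) (c + c').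
Proof.
move=> h1 h2 h3 h4 s; have := h3 s; have := h4 s; case: rough {h3 h4} => h3 h4; last exact: nX_add.
by move=> n nr; rewrite mulrDr lerD// ?h3 ?h4.
Qed.

Lemma B_zero r rough : B r rough (fun=> 0) 0.
Proof.
move=> s; case: rough => [n _|]; first by rewrite mulr0.
by rewrite /nB /nX /= big1 => [|n _]; rewrite ?expr0n ?mulr0.
Qed.

Lemma B_scale r rough Y c z : 0 <= z -> B r rough Y c -> B r rough (fun x => z * Y x) (z * c).
Proof.
move=> z0 h s; have := h s; case: rough {h} => h.
  by move=> n nr; rewrite mulrCA ler_wpM2l// h.
rewrite /= (mulrC z c); have := nX_scale z0 h; rewrite /nX => {}h.
by under eq_bigr do rewrite (mulrC z).
Qed.

Lemma tri_triI r kap kap' (Y1 Y2 Y3 : int * bool -> R) n s : n \in r ->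
  (forall q, kap' (n, s) q = if inr r (n, s) q then kap n q.1 q.2 else 0) ->
  triI (K r) l1 l2 l3 kap' Y1 Y2 Y3 (n, s) = tri r kap (fun m => Y1 (m, s)) (fun m => Y2 (m, ~~ s)) (fun m => Y3 (m, s)) n.
Proof.
move=> nr hk; rewrite /triI /K (big_pairs R) /tri big_seq [RHS]big_seq; apply: eq_bigr => n1 h1.
rewrite big_seq [RHS]big_seq; apply: eq_bigr => n3 h3.
by rewrite hk /inr /= nr h1 h3 /=; case: ifP => _; rewrite ?mul0r.
Qed.

Lemma normc_conjb s z : normc (conjb s z) = normc z.
Proof. by case: s => //=; exact: normc_conj. Qed.

Lemma normP r x q : inr r x q -> `|P r x q| = `|res x q|.
Proof. by move=> h; rewrite /P h normrM normrX normrN1 expr1n mul1r. Qed.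

(* The mode [(n, false)] is the [n]-th coefficient in the interaction picture, [(n, true)] its conjugate. *)
Definition rotated (r : seq int) (u : int -> R -> R[i]) (x : int * bool) (t : R) : R[i] :=
  if x.1 \in r then conjb x.2 (cexp (- (t * sym x.1)) * u x.1 t) else 0.

Lemma rotatedF r u n t : n \in r -> rotated r u (n, false) t = cexp (- (t * sym n)) * u n t.
Proof. by move=> h; rewrite /rotated h. Qed.

Lemma rotatedT r u n t : n \in r -> rotated r u (n, true) t = cexp (t * sym n) * conjc (u n t).
Proof. by move=> h; rewrite /rotated h /conjb conjcM conj_cexp opprK. Qed.

Lemma rotated_conj r u n s t : rotated r u (n, ~~ s) t = conjc (rotated r u (n, s) t).
Proof.
rewrite /rotated /=; case: ifP => _; last by rewrite conjc0.
by case: s; rewrite /conjb ?conjcK.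
Qed.

Lemma normc_rotated r u x t : x.1 \in r -> normc (rotated r u x t) = normc (u x.1 t).
Proof. by move=> h; rewrite /rotated h normc_conjb normcM normc_cexp mul1r. Qed.

Lemma rotated_sub r u v x t : rotated r u x t - rotated r v x t = rotated r (fun n t => u n t - v n t) x t.
Proof.
rewrite /rotated; case: ifP => _; rewrite ?subr0//; case: x.2; rewrite /conjb -?rmorphB -mulrBr//.
Qed.

Lemma normc_rotated_B r u t c : 0 <= c -> nXb r (fun n => normc (u n t)) c ->
  B r false (fun x => normc (rotated r u x t)) c.
Proof.
move=> c0' h s; apply: (nB_le (rough := false) _ _ h); first by rewrite c0' lexx.
by move=> n nr; rewrite normc_ge0 normc_rotated//= lexx.
Qed.

(** The rotation removes the linear term and combines the four symbols into the resonance. The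
    conjugate modes satisfy the conjugate equation, with the opposite phase; modes outside [r]
    vanish identically. *)
Lemma rotated_cder r u e t : 
  (forall n, n \in r -> cder (u n) t ('i * (sym n)%:C * u n t + kappa * (cubic r (u^~ t) n + e n))) ->
  forall x, cder (rotated r u x) t (\sum_(q <- K r) c0 r x q * cexp (t * P r x q) *
      (rotated r u (l1 x q) t * rotated r u (l2 x q) t * rotated r u (l3 x q) t)
      + rotated r (fun n t => kappa * e n) x t).
Proof.
move=> h [n s]; case: (boolP (n \in r)) => nr; last first.
  have e0 e' m t' : m \notin r -> rotated r e' (m, s) t' = 0 by rewrite /rotated => /negbTE ->.
  apply: (@cder_ext _ (fun=> 0)) => [t'|]; first by rewrite e0.
  apply: cder_eq (cder_cst _ _) _; rewrite e0// addr0 big1// => q _.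
  by rewrite /c0 /inr /= (negbTE nr) !mul0r.
have hA : cder (fun t => cexp (- (t * sym n)) * u n t) t
    (\sum_(q <- K r) (if inr r (n, s) q then kappa else 0) * cexp (t * res (n, s) q) *
      (rotated r u (q.1, false) t * rotated r u (q.1 + q.2 - n, true) t * rotated r u (q.2, false) t)
    + cexp (- (t * sym n)) * (kappa * e n)).
  have hc : cder (fun t => cexp (- (t * sym n))) t ('i * (- sym n)%:C * cexp (- (t * sym n))).
    apply: (@cder_ext _ (fun t => cexp (t * (- sym n)))) => [x|]; first by rewrite mulrN.
    by apply: cder_eq (cder_cexp _ _) _; rewrite mulrN.
  apply: cder_eq (cderM hc (h n nr)) _.
  have -> : \sum_(q <- K r) (if inr r (n, s) q then kappa else 0) * cexp (t * res (n, s) q) *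
      (rotated r u (q.1, false) t * rotated r u (q.1 + q.2 - n, true) t * rotated r u (q.2, false) t) =
     cexp (- (t * sym n)) * (kappa * cubic r (u^~ t) n).
    rewrite /cubic (big_pairs R) mulrA mulr_sumr big_seq [RHS]big_seq; apply: eq_bigr => n1 h1.
    rewrite mulr_sumr big_seq [RHS]big_seq; apply: eq_bigr => n3 h3.
    rewrite /inr /= nr h1 h3 /=; case: ifP => h2; last by rewrite mulr0 !mul0r.
    rewrite !rotatedF// rotatedT//.
    have -> : - (t * sym n) = t * res (n, s) (n1, n3) + - (t * sym n1) + t * sym (n1 + n3 - n) + - (t * sym n3).
      by rewrite /res /resonance /= rmorphB rmorphD /=; ring.
    by rewrite 3!cexpD; ring.
  rewrite rmorphN /=; ring.
have {}hA : cder (rotated r u (n, false)) t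
    (\sum_(q <- K r) (if inr r (n, s) q then kappa else 0) * cexp (t * res (n, s) q) *
      (rotated r u (q.1, false) t * rotated r u (q.1 + q.2 - n, true) t * rotated r u (q.2, false) t)
    + rotated r (fun n t => kappa * e n) (n, false) t).
  by rewrite (rotatedF (fun n t => kappa * e n))//; apply: cder_ext hA => t'; rewrite rotatedF.
case: s hA => hA.
  apply: (@cder_ext _ (fun t => conjc (rotated r u (n, false) t))) => [t'|]; first by rewrite -rotated_conj.
  apply: cder_eq (cder_conj hA) _; rewrite conjcD -rotated_conj; congr (_ + _).
  rewrite conjc_sum; apply: eq_bigr => q _.
  rewrite !conjcM conj_cexp -!rotated_conj /= /c0 /P /l1 /l2 /l3 /=.
  by case: ifP => _; rewrite ?expr1 ?mulN1r ?mulrN// conjc0 !mul0r.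
apply: cder_eq hA _; congr (_ + _); apply: eq_bigr => q _; rewrite /c0 /P /l1 /l2 /l3 /=.
by case: ifP => _; rewrite ?expr0 ?mul1r// !mul0r.
Qed.

Lemma P_bounded r : exists M, forall x q, `|P r x q| <= M.
Proof.
exists (\sum_(n <- r) \sum_(n1 <- r) \sum_(n3 <- r) `|resonance be n%:~R n1%:~R n3%:~R|) => x q.
case: (boolP (inr r x q)) => h; last first.
  rewrite /P ifN// normr0; apply: sumr_ge0 => n _; apply: sumr_ge0 => n1 _; exact: sumr_ge0.
rewrite normP// /res; move: h => /and4P[h1 h2 h3 _].
have mem (F : int -> R) m : (forall n, 0 <= F n) -> m \in r -> F m <= \sum_(n <- r) F n.
  move=> F0 hm; rewrite (perm_big _ (perm_to_rem hm)) big_cons lerDl; exact: sumr_ge0.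
apply: le_trans (mem _ _ _ h1); last by move=> n; apply: sumr_ge0 => n1 _; exact: sumr_ge0.
apply: le_trans (mem _ _ _ h2); last by move=> n; exact: sumr_ge0.
by apply: le_trans (mem _ _ _ h3).
Qed.

(** The scalar mean value theorem is applied to the real part of the pairing of [G] with its own
    increment [w = G t - G a]. If [N] is the squared norm of [w], this gives
    [N <= sqrt N * M * (t - a)]. *)
Lemma mean_value_X r (G F : int -> R -> R[i]) (a t M : R) : 0 <= M -> a <= t ->
  (forall tau, a <= tau <= t -> forall n, n \in r -> cder (G n) tau (F n tau)) ->
  (forall tau, a <= tau <= t -> nXb r (fun n => normc (F n tau)) M) ->
  nXb r (fun n => normc (G n t - G n a)) (M * (t - a)).
Proof.
move=> M0 at' hG hF.
have [<-|ltat] := eqVneq a t.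
  rewrite subrr mulr0 /nX big1 ?expr0n// => n _; by rewrite subrr normc0 expr0n mulr0.
have {}ltat : a < t by rewrite lt_neqAle ltat.
pose w n := G n t - G n a.
pose N := \sum_(n <- r) jb n `^ b * normc (w n) ^+ 2.
have N0 : 0 <= N by apply: sumr_ge0 => n _; rewrite mulr_ge0 ?powR_ge0 ?sqr_ge0.
pose z n := (jb n `^ b)%:C * conjc (w n).
pose Phi s := \sum_(n <- r) z n * (if n \in r then G n s else 0).
pose dPhi s := \sum_(n <- r) z n * (if n \in r then F n s else 0).
have hN : complex.Re (Phi t) - complex.Re (Phi a) = N.
  rewrite -raddfB /Phi -sumrB -[N]/(complex.Re N%:C) /N rmorph_sum /=; congr complex.Re.
  rewrite !big_seq; apply: eq_bigr => n nr; rewrite nr -mulrBr -/(w n) /z -mulrA (mulrC (conjc _)).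
  by rewrite mulc_conj; exact/esym/rmorphM.
have hd s : a <= s <= t -> cder Phi s (dPhi s).
  move=> hs; apply: cder_sum => n; apply: cderMl; case: ifP => nr; first exact: hG.
  exact: cder_cst.
have dphiM s : a <= s <= t -> complex.Re (dPhi s) <= Num.sqrt N * M.
  move=> hs; apply: le_trans (ler_norm _) _; apply: le_trans (Re_le_normc _) _.
  apply: le_trans (normc_sum _ _) _.
  rewrite [leLHS](_ : _ = \sum_(n <- r) (jb n `^ (b / 2) * normc (w n)) * (jb n `^ (b / 2) * normc (F n s))); last first.
    rewrite !big_seq; apply: eq_bigr => n nr; rewrite nr /z !normcM normc_conj normc_real ger0_norm ?powR_ge0//.
    by rewrite -(powR_half b (jb_gt0 n)); ring.
  apply: cauchy_schwarz_le => //.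
    rewrite sqr_sqrtr// /N; apply: le_of_eq; apply: eq_bigr => n _.
    by rewrite exprMn powR_half ?jb_gt0.
  have := hF s hs; rewrite /nX; apply: le_trans; apply: le_of_eq; apply: eq_bigr => n _.
  by rewrite exprMn powR_half ?jb_gt0.
have sub s : s \in `]a, t[%R -> a <= s <= t by rewrite in_itv /= => /andP[/ltW -> /ltW ->].
have [||c ct hc] := @MVT R (fun s => complex.Re (Phi s)) (fun s => complex.Re (dPhi s)) a t ltat.
- by move=> s /sub hs; have [] := hd s hs.
- apply: derivable_within_continuous => s; rewrite in_itv /= => hs.
  by have [h _] := hd s hs; exact: ex_derive.
have hN2 : N <= Num.sqrt N * (M * (t - a)).
  rewrite {1}(_ : N = complex.Re (dPhi c) * (t - a)); last by rewrite -hc hN.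
  by rewrite mulrA ler_wpM2r ?subr_ge0// ?dphiM// ?sub// ltW.
rewrite /nX -/N.
have Mt0 : 0 <= M * (t - a) by rewrite mulr_ge0// subr_ge0.
have [->|N1] := eqVneq N 0; first exact: sqr_ge0.
have sN : 0 < Num.sqrt N by rewrite sqrtr_gt0 lt_neqAle eq_sym N1.
rewrite -[leLHS]sqr_sqrtr// ler_sqr ?nnegrE ?sqrtr_ge0//.
by rewrite -(ler_pM2l sN) -expr2 sqr_sqrtr.
Qed.

Lemma nX_sub r s (x : int -> R) c : uniq s -> {subset s <= r} -> nXb r x c -> nXb s x c.
Proof.
move=> us sr; apply: le_trans; apply: ler_sum_uniq => // n; by rewrite mulr_ge0 ?powR_ge0 ?sqr_ge0.
Qed.

(** The only passage from the weak to the strong norm. Its constant depends on the finite set, so it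
    may be used on the fixed observation set but not on the growing truncation set. *)
Lemma nX_of_nY r (x : int -> R) c : 0 <= c -> (forall n, 0 <= x n) -> nYr r x c ->
  nXb r x (c * Num.sqrt (\sum_(n <- r) jb n `^ (b - rr))).
Proof.
move=> c0' x0 h; rewrite /nX exprMn sqr_sqrtr; last by apply: sumr_ge0 => n _; exact: powR_ge0.
rewrite mulr_sumr big_seq [leRHS]big_seq; apply: ler_sum => n nr.
have {}h : (jb n `^ (rr / 2) * x n) ^+ 2 <= c ^+ 2.
  by rewrite ler_sqr ?nnegrE ?mulr_ge0 ?powR_ge0// h.
rewrite (_ : jb n `^ b = jb n `^ (b - rr) * jb n `^ rr); last by rewrite -powRDp ?jb_gt0// subrK.
by rewrite -mulrA [leRHS]mulrC ler_wpM2l ?powR_ge0// -(powR_half rr (jb_gt0 n)) -exprMn.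
Qed.

(** The equation lives on [r], the conclusion on [s]: the weak error costs a constant of [s] alone,
    and [C] depends on neither set. The boundary terms at time [t] give [dl / 4]; the initial
    difference and the boundary terms at time [a] give at most [2 * da]. *)
Lemma truncated_step : exists C : R, 0 <= C /\ forall r s (u v : int -> R -> R[i]) (e e' : R -> int -> R[i]) a t dl da eps,
  uniq r -> uniq s -> {subset s <= r} -> 0 <= dl -> 0 <= da -> 0 <= eps -> a <= t ->
  (forall tau, a <= tau <= t -> [/\
     forall n, n \in r -> cder (u n) tau ('i * (sym n)%:C * u n tau + kappa * (cubic r (u^~ tau) n + e tau n)),
     forall n, n \in r -> cder (v n) tau ('i * (sym n)%:C * v n tau + kappa * (cubic r (v^~ tau) n + e' tau n)),
     nXb r (fun n => normc (u n tau)) Rr, nXb r (fun n => normc (v n tau)) Rr &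
     [/\ nXb r (fun n => normc (u n tau - v n tau)) dl, nYr r (fun n => normc (e tau n)) eps &
      nYr r (fun n => normc (e' tau n)) eps]]) ->
  nXb r (fun n => normc (u n a - v n a)) da ->
  nXb s (fun n => normc (u n t - v n t))
    (dl / 4 + 2 * da + (C * dl + 4 * eps * Num.sqrt (\sum_(n <- s) jb n `^ (b - rr))) * (t - a)).
Proof.
have [Cs [Cs0 HS]] := triS_bound hp; have [Cw [Cw0 HW]] := triW_bound hp.
(* With a coefficient of modulus 1 and [kapW] equal to [P^(- th / 2)], the hypothesis [c0W] forces
   [1 - eta = th / 2]; [p] only has to satisfy [p * eta >= 1]. *)
pose eta := 1 - th / 2; have eta0 : 0 < eta by rewrite subr_gt0 ltr_pdivrMr// mul1r.
pose p := (Num.truncn eta^-1).+1.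
have hpe : 1 <= p%:R * eta by rewrite -ler_pdivrMr// mul1r ltW// truncnS_gt.
pose C := nfC Cs Cw Rr p.
have C0 : 0 <= C by apply: nfC_ge0 => //; exact: ltW.
exists C; split=> // r s u v e e' a t dl da eps ur us sr dl0 da0 e0 at' h ha.
have [Pm hPm] := P_bounded r.
have kS0 x q : 0 <= kS r x q by rewrite /kS; case: ifP => // _; exact: kapS_ge0.
have kW0 x q : 0 <= kW r x q by rewrite /kW; case: ifP => // _; exact: kapW_ge0.
have c0S x q : normc (c0 r x q) <= kS r x q * Num.max 1 `|P r x q| `^ 2^-1.
  rewrite /c0 /kS; case: ifP => hi; last by rewrite normc0 mul0r.
  rewrite normc_conjb kappa1 normP// /kapS -/(rmod _ _ _ _) powRN mulVf// gt_eqF// powR_gt0//.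
  exact: lt_le_trans (rmod_ge1 _ _ _ _).
have c0W x q : 1 <= `|P r x q| -> normc (c0 r x q) <= kW r x q * `|P r x q| `^ (1 - eta).
  rewrite /c0 /kW; case: (boolP (inr r x q)) => hi; last by rewrite normc0 mul0r.
  rewrite normc_conjb kappa1 normP// => h1.
  have -> : 1 - eta = th / 2 by rewrite /eta; ring.
  rewrite /kapW ifT; last first.
    apply/andP; split; apply/eqP => hq; move: h1; rewrite /res hq resonance_eq0 ?normr0 ?ler10//; by [left|right].
  have -> : rmod be x.1 q.1 q.2 = `|res x q| by rewrite /rmod max_r.
  by rewrite powRN mulVf// gt_eqF// powR_gt0// (lt_le_trans _ h1).
have okB p0 : pok (B r) p0 -> [/\ forall x, 0 <= pfun p0 x, 0 <= pcst p0 & B r (prough p0) (pfun p0) (pcst p0)] by [].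
have HS' p1 p2 p3 : pok (B r) p1 -> pok (B r) p2 -> pok (B r) p3 -> (prough p1 + prough p2 + prough p3 <= 0)%N ->
    B r [|| prough p1, prough p2 | prough p3] (triI (K r) l1 l2 l3 (kS r) (pfun p1) (pfun p2) (pfun p3)) (Cs * pcst p1 * pcst p2 * pcst p3).
  move=> [f1 k1 b1] [f2 k2 b2] [f3 k3 b3] hr sg.
  move: b1 b2 b3; case: (prough p1) hr => //; case: (prough p2) => //; case: (prough p3) => // _ b1 b2 b3.
  apply: (nB_le (rough := false) _ _ (HS r _ _ _ _ _ _ ur _ _ _ k1 k2 k3 (b1 sg) (b2 (~~ sg)) (b3 sg))) => //.
    by rewrite lexx !mulr_ge0// ltW.
  move=> n nr; rewrite (tri_triI (kap := kapS g))// lexx andbT.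
  by apply: tri_ge0 => // *; exact: kapS_ge0.
have HW' p1 p2 p3 : pok (B r) p1 -> pok (B r) p2 -> pok (B r) p3 -> (prough p1 + prough p2 + prough p3 <= 1)%N ->
    B r [|| prough p1, prough p2 | prough p3] (triI (K r) l1 l2 l3 (kW r) (pfun p1) (pfun p2) (pfun p3)) (Cw * pcst p1 * pcst p2 * pcst p3).
  move=> [f1 k1 b1] [f2 k2 b2] [f3 k3 b3] hr sg.
  apply: (nB_le _ _ (HW r _ _ _ _ _ _ _ _ _ ur _ _ _ k1 k2 k3 hr (b1 sg) (b2 (~~ sg)) (b3 sg))) => //.
    by rewrite lexx !mulr_ge0// ltW.
  move=> n nr; rewrite (tri_triI (kap := kapW g th))// lexx andbT.
  by apply: tri_ge0 => // *; exact: kapW_ge0.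
have [Z [Z1 Z2]] := normal_form_estimate (@B_mono r) (@B_add r) (@B_zero r) (@B_scale r)
   kS0 kW0 (ltW Cs0) (ltW Cw0) eta0 hpe Rr0 c0S c0W HS' HW' hPm.
have hF tau : exists F : (int * bool -> R[i]) * (int * bool -> R[i]), a <= tau <= t ->
    [/\ B r false (fun x => normc (F.1 x)) (C * dl), B r true (fun x => normc (F.2 x)) (4 * eps) &
     forall x, cder (fun s => rotated r u x s - rotated r v x s -
       (Z (rotated r u ^~ s) s x - Z (rotated r v ^~ s) s x)) tau (F.1 x + F.2 x)].
  case: (boolP (a <= tau <= t)) => [ht|_]; last by exists (fun=> 0, fun=> 0).
  have [h1 h2 h3 h4 [h5 h6 h7]] := h tau ht.
  have hR (w : R -> int -> R[i]) : nYr r (fun n => normc (w tau n)) eps ->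
      B r true (fun x => normc (rotated r (fun n t => kappa * w tau n) x tau)) eps.
    move=> hw sg n nr; rewrite normc_rotated//= normcM kappa1 mul1r; exact: hw.
  have hd : B r false (fun x => normc (rotated r u x tau - rotated r v x tau)) dl.
    under [X in B _ _ X _]funext do rewrite rotated_sub.
    exact: normc_rotated_B.
  have [F1 [F2 hF]] := Z2 _ _ _ _ tau _ _ dl0 e0 (normc_rotated_B Rr0 h3) (normc_rotated_B Rr0 h4) hd
     (hR e h6) (hR e' h7) (rotated_cder h1) (rotated_cder h2).
  by exists (F1, F2).
have [F {}hF] := choice hF.
pose G n s := rotated r u (n, false) s - rotated r v (n, false) s -
       (Z (rotated r u ^~ s) s (n, false) - Z (rotated r v ^~ s) s (n, false)).
set Ks := Num.sqrt _.
have Ks0 : 0 <= Ks by exact: sqrtr_ge0.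
have ta0 : 0 <= t - a by rewrite subr_ge0.
have M0 : 0 <= C * dl + 4 * eps * Ks by rewrite addr_ge0 ?mulr_ge0.
have hG : nXb s (fun n => normc (G n t - G n a)) ((C * dl + 4 * eps * Ks) * (t - a)).
  apply: (mean_value_X (F := fun n tau => (F tau).1 (n, false) + (F tau).2 (n, false))) => // tau htau.
    by move=> n ns; have [_ _ hc] := hF tau htau; exact: hc.
  have [hF1 hF2 _] := hF tau htau.
  have k1 := nX_sub us sr (hF1 false).
  have k2 : nYr s (fun n => normc ((F tau).2 (n, false))) (4 * eps) by move=> n ns; exact: (hF2 false n (sr n ns)).
  have k3 : nXb s _ _ := nX_of_nY (mulr_ge0 (ler0n _ 4) e0) (fun n => normc_ge0 _) k2.
  apply: nX_le (nX_add (mulr_ge0 C0 dl0) (mulr_ge0 (mulr_ge0 (ler0n _ 4) e0) Ks0) k1 k3).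
    by rewrite lexx M0.
  by move=> n _; rewrite normc_ge0 normc_le_add.
have hZ tau dd : 0 <= dd -> a <= tau <= t -> nXb r (fun n => normc (u n tau - v n tau)) dd ->
    nXb s (fun n => normc (Z (rotated r u ^~ tau) tau (n, false) - Z (rotated r v ^~ tau) tau (n, false))) (dd / 4).
  move=> dd0 ht hdd; have [h1 h2 h3 h4 [h5 h6 h7]] := h tau ht.
  apply: (nX_sub us sr); apply: (Z1 _ _ tau dd dd0 (normc_rotated_B Rr0 h3) (normc_rotated_B Rr0 h4) _ false).
  under [X in B _ _ X _]funext do rewrite rotated_sub.
  exact: normc_rotated_B.
have tin : a <= t <= t by rewrite at' lexx.
have ain : a <= a <= t by rewrite at' lexx.
have hdt : nXb r (fun n => normc (u n t - v n t)) dl by have [_ _ _ _ []] := h t tin.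
have e4 (x : R) : 0 <= x -> 0 <= x / 4 by move=> x0; rewrite divr_ge0.
have k1 := nX_add (mulr_ge0 M0 ta0) (e4 _ dl0) hG (hZ t dl dl0 tin hdt).
have k2 := nX_add da0 (e4 _ da0) (nX_sub us sr ha) (hZ a da da0 ain ha).
have k3 := nX_add (addr_ge0 (mulr_ge0 M0 ta0) (e4 _ dl0)) (addr_ge0 da0 (e4 _ da0)) k1 k2.
apply: nX_le k3.
  rewrite !addr_ge0 ?mulr_ge0 ?e4//= [leRHS]addrC -!addrA lerD2l lerD2l.
  by rewrite mulr_natl mulr2n lerD2l ler_pdivrMr// ler_peMr// ler1n.
move=> n ns; rewrite normc_ge0 andTb.
have nr := sr n ns.
have hW tau : normc (u n tau - v n tau) = normc (rotated r u (n, false) tau - rotated r v (n, false) tau).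
  by rewrite rotated_sub normc_rotated.
rewrite !hW /G.
set At := rotated r u _ t; set Bt := rotated r v _ t; set Aa := rotated r u _ a; set Ba := rotated r v _ a.
set Zt := Z _ t _; set Zt' := Z _ t _; set Za := Z _ a _; set Za' := Z _ a _.
rewrite [X in normc X](_ : _ = (At - Bt - (Zt - Zt') - (Aa - Ba - (Za - Za'))) + (Zt - Zt') + ((Aa - Ba) - (Za - Za'))); last by ring.
apply: le_trans (normc_le_add _ _) _; apply: lerD.
  exact: normc_le_add.
exact: normc_le_sub.
Qed.

Lemma nX_lim r (x : int -> R) c : 0 <= c -> (forall eta, 0 < eta -> nXb r x (c + eta)) -> nXb r x c.
Proof.
move=> c0' h; set S := \sum_(n <- r) jb n `^ b * x n ^+ 2.
have S0 : 0 <= S by apply: sumr_ge0 => n _; rewrite mulr_ge0 ?powR_ge0 ?sqr_ge0.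
rewrite /nX -/S -(sqr_sqrtr S0) ler_sqr ?nnegrE ?sqrtr_ge0//.
apply/ler_addgt0Pr => eta eta0; have := h eta eta0; rewrite /nX -/S => h1.
by rewrite -ler_sqr ?nnegrE ?sqrtr_ge0 ?addr_ge0 ?(ltW eta0)// sqr_sqrtr.
Qed.

(** From a time where the coefficients agree, the bound on the difference is halved again and again
    on an interval of length [tau]: one quarter comes from the boundary terms and one quarter from
    the near terms, since [C * tau <= 1 / 4]. The set [r] is chosen after [s] and [eta], so the weak
    error disappears before the next halving. *)
Lemma coefficient_uniqueness (T : R) (u v : int -> R -> R[i]) (Fu Fv : R -> int -> R[i]) : 0 < T ->
  (forall t, 0 <= t <= T -> forall r, uniq r ->
     nXb r (fun n => normc (u n t)) Rr /\ nXb r (fun n => normc (v n t)) Rr) ->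
  (forall t, 0 < t < T -> forall n, cder (u n) t ('i * (sym n)%:C * u n t + kappa * Fu t n) /\
     cder (v n) t ('i * (sym n)%:C * v n t + kappa * Fv t n)) ->
  (forall (eps : R) (s : seq int), 0 < eps -> exists r, [/\ uniq r, {subset s <= r} & forall t, 0 <= t <= T ->
     nYr r (fun n => normc (Fu t n - cubic r (u^~ t) n)) eps /\ nYr r (fun n => normc (Fv t n - cubic r (v^~ t) n)) eps]) ->
  (forall t0 eps : R, 0 <= t0 <= T -> 0 < eps -> exists2 del, 0 < del & forall t, 0 <= t <= T -> `|t - t0| < del ->
     forall r, uniq r -> nXb r (fun n => normc (u n t - u n t0)) eps /\ nXb r (fun n => normc (v n t - v n t0)) eps) ->
  (forall n, u n 0 = v n 0) ->
  forall t, 0 <= t <= T -> forall n, u n t = v n t.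
Proof.
move=> T0 hX hD hF hC h0; have [C [C0 hS]] := truncated_step.
have b0 : 0 <= b by case: hp => _ _ [_ _ [_ /andP[r0 rb] _ _]]; exact: le_trans r0 rb.
pose tau := (4 * (C + 1))^-1.
have tau0 : 0 < tau by rewrite invr_gt0 mulr_gt0// ltr_wpDl.
have Ctau : C * tau <= 1 / 4.
  rewrite /tau invfM mulrCA mulrC ler_pM2r ?invr_gt0// ler_pdivrMr ?ltr_wpDl// mul1r lerDl//.
have open_step t0 : 0 <= t0 -> (forall n, u n t0 = v n t0) ->
    forall t, t0 <= t <= t0 + tau -> t < T -> forall n, u n t = v n t.
  move=> t00 e0.
  have bound j t : t0 <= t <= t0 + tau -> t < T -> forall s, uniq s -> nXb s (fun n => normc (u n t - v n t)) (2 * Rr / 2 ^+ j).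
    elim: j t => [|j IH] t ht tT s us.
      have ht' : 0 <= t <= T by move: ht => /andP[a1 a2]; rewrite (le_trans t00 a1) ltW.
      have [h1 h2] := hX t ht' s us; apply: nX_le (nX_add Rr0 Rr0 h1 h2) => [|n _].
        by rewrite addr_ge0//= expr0 divr1 mulr_natl mulr2n.
      by rewrite normc_ge0 normc_le_sub.
    set dl := 2 * Rr / 2 ^+ j in IH; have dl0 : 0 <= dl by rewrite divr_ge0 ?exprn_ge0// mulr_ge0.
    have -> : 2 * Rr / 2 ^+ j.+1 = dl / 2 by rewrite exprS /dl invfM; ring.
    have dl2 : 0 <= dl / 2 by rewrite divr_ge0.
    have /andP[t0t tt0] := ht.
    move: t0t; rewrite le_eqVlt => /orP[/eqP<-|t0t].
      by rewrite /nX big1 ?sqr_ge0// => n _; rewrite e0 subrr normc0 expr0n mulr0.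
    apply: nX_lim => // eta eta0.
    pose Ks := Num.sqrt (\sum_(n <- s) jb n `^ (b - rr) : R).
    have Ks0 : 0 <= Ks by exact: sqrtr_ge0.
    (* This gives [4 * eps * Ks * tau <= eta / 2]; with [2 * (eta / 4)] from the initial difference
       the total is [eta]. *)
    pose eps := eta / (8 * (Ks * tau + 1)).
    have den0 : 0 < 8 * (Ks * tau + 1) by rewrite mulr_gt0// ltr_wpDl// mulr_ge0// ltW.
    have eps0 : 0 < eps by rewrite divr_gt0.
    have [r [ur sr hr]] := hF eps s eps0.
    have t0T : 0 <= t0 <= T by rewrite t00 ltW// (lt_trans t0t).
    have [del del0 hdel] := hC t0 (eta / 8) t0T ltac:(by rewrite divr_gt0).
    (* The equation is available only in the open interval [(0, T)]. The step therefore starts at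
       some [a > t0], so close that by continuity the difference there is at most [eta / 4]. *)
    pose a := Num.min t (t0 + del / 2).
    have t0a : t0 < a by rewrite lt_min t0t ltrDl divr_gt0.
    have at_ : a <= t by rewrite ge_min lexx.
    have aT : 0 <= a <= T by rewrite (le_trans t00 (ltW t0a)) (le_trans at_ (ltW tT)).
    have adel : `|a - t0| < del.
      rewrite ger0_norm ?subr_ge0 ?(ltW t0a)// ltrBlDl (@le_lt_trans _ _ (t0 + del / 2))//.
        by rewrite ge_min lexx orbT.
      by rewrite ltrD2l gtr_pMr// invf_lt1// ltr1n.
    have [ha1 ha2] := hdel a aT adel r ur.
    have e8 : 0 <= eta / 8 by rewrite divr_ge0// ltW.
    have ha : nXb r (fun n => normc (u n a - v n a)) (eta / 4).
      apply: nX_le (nX_add e8 e8 ha1 ha2) => [|n _].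
        by rewrite addr_ge0//= le_eqVlt; apply/orP; left; apply/eqP; field.
      rewrite normc_ge0 andTb [X in normc X](_ : _ = (u n a - u n t0) - (v n a - v n t0)); last by rewrite e0; ring.
      exact: normc_le_sub.
    have e4 : 0 <= eta / 4 by rewrite divr_ge0// ltW.
    have := hS r s u v (fun t n => Fu t n - cubic r (u^~ t) n) (fun t n => Fv t n - cubic r (v^~ t) n) a t dl (eta / 4) eps
       ur us sr dl0 e4 (ltW eps0) at_ _ ha; rewrite -/Ks => hst.
    apply: nX_le (hst _) => [|n _|tau' /andP[at' tt']]; last first.
    - have h1 : 0 < tau' < T by rewrite (le_lt_trans t00 (lt_le_trans t0a at')) (le_lt_trans tt' tT).
      have h2 : 0 <= tau' <= T by move: h1 => /andP[/ltW -> /ltW ->].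
      have [h3 h4] := hX tau' h2 r ur; have [h5 h6] := hr tau' h2.
      split=> // [n nr|n nr|].
      + by have [h7 _] := hD tau' h1 n; rewrite subrKC.
      + by have [_ h7] := hD tau' h1 n; rewrite subrKC.
      + split=> //; apply: IH => //; last exact: le_lt_trans tT.
        by rewrite (le_trans (ltW t0a) at') (le_trans tt' tt0).
    - by rewrite normc_ge0 lexx.
    have ta : 0 <= t - a by rewrite subr_ge0.
    have M0 : 0 <= C * dl + 4 * eps * Ks.
      by apply: addr_ge0; apply: mulr_ge0 => //; apply: mulr_ge0 => //; exact: ltW.
    apply/andP; split.
      apply: addr_ge0; last exact: mulr_ge0.
      by apply: addr_ge0; [exact: divr_ge0|exact: mulr_ge0].
    have ttau : t - a <= tau by rewrite lerBlDl (le_trans tt0)// lerD2r ltW.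
    have k1 : (C * dl + 4 * eps * Ks) * (t - a) <= (C * dl + 4 * eps * Ks) * tau by rewrite ler_wpM2l.
    have k2 : C * tau * dl <= 1 / 4 * dl by rewrite ler_wpM2r.
    have k3 : 4 * eps * Ks * tau <= eta / 2.
      rewrite /eps -!mulrA mulrCA ler_wpM2l ?(ltW eta0)// mulrCA mulrC ler_pdivrMr//.
      have : 0 <= Ks * tau by rewrite mulr_ge0// ltW.
      by set w := Ks * tau => w0; rewrite mulrDr; lra.
    have k4 : (C * dl + 4 * eps * Ks) * tau = C * tau * dl + 4 * eps * Ks * tau by ring.
    by rewrite k4 in k1; lra.
  move=> t ht tT n; apply: eq_of_normc_small => eta eta0.
  pose j := (Num.truncn (2 * Rr / eta)).+1.
  have := bound j t ht tT [:: n] isT => /(nX_point b0 _ _) h.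
  have {}h : normc (u n t - v n t) <= 2 * Rr / 2 ^+ j by apply: h; rewrite ?normc_ge0// divr_ge0 ?exprn_ge0// mulr_ge0.
  apply: le_trans h _; rewrite ler_pdivrMr ?exprn_gt0// [leRHS]mulrC -ler_pdivrMr//.
  apply: (@le_trans _ _ j%:R); first by rewrite ltW// truncnS_gt.
  by rewrite -natrX ler_nat ltnW// ltn_expl.
have step t0 : 0 <= t0 -> (forall n, u n t0 = v n t0) ->
    forall t, t0 <= t <= t0 + tau -> t <= T -> forall n, u n t = v n t.
  move=> t00 e0 t ht; rewrite le_eqVlt => /orP[/eqP tT|tT]; last exact: (open_step t0).
  move: ht => /andP[]; rewrite le_eqVlt => /orP[/eqP <- _ //|t0t tt0] n.
  have tT' : 0 <= t <= T by rewrite tT lexx ltW.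
  apply: eq_of_normc_small => eta eta0.
  have eta2 : 0 < eta / 2 by rewrite divr_gt0.
  have [del del0 hdel] := hC t (eta / 2) tT' eta2.
  pose a := Num.max t0 (t - del / 2).
  have at_ : a < t by rewrite gt_max t0t ltrBlDr ltrDl divr_gt0.
  have t0a : t0 <= a by rewrite le_max lexx.
  have adel : `|a - t| < del.
    rewrite ltr0_norm ?subr_lt0// opprB ltrBlDr -ltrBlDl lt_max; apply/orP; right.
    by rewrite ltrD2l ltrN2 gtr_pMr// invf_lt1// ltr1n.
  have aT : a < T by rewrite -tT.
  have [h1 h2] := hdel a ltac:(by rewrite (le_trans t00 t0a) ltW) adel [:: n] isT.
  have {}h1 := nX_point b0 (ltW eta2) (normc_ge0 _) h1; have {}h2 := nX_point b0 (ltW eta2) (normc_ge0 _) h2.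
  have e := open_step t0 t00 e0 a ltac:(by rewrite t0a (le_trans (ltW at_))) aT n.
  rewrite [X in normc X](_ : _ = (v n a - v n t) - (u n a - u n t)); last by rewrite e; ring.
  by apply: le_trans (normc_le_sub _ _) _; rewrite [leRHS]splitr lerD.
have all k t : 0 <= t <= k%:R * tau -> t <= T -> forall n, u n t = v n t.
  elim: k t => [|k IH] t /andP[t0 tk] tT.
    by have -> : t = 0 by apply/le_anti; rewrite t0 andbT -(mul0r tau).
  case: (leP t (k%:R * tau)) => [h|h]; first by apply: IH; rewrite ?t0.
  have k0 : 0 <= k%:R * tau by rewrite mulr_ge0// ltW.
  apply: (step (k%:R * tau)) => //; last by rewrite ltW//= -[X in _ + X]mul1r -mulrDl natr1.
  by apply: IH; [rewrite k0 lexx|exact: le_trans (ltW h) tT].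
move=> t /andP[t0 tT]; apply: (all (Num.truncn (t / tau)).+1) => //.
by rewrite t0 -ler_pdivrMr// ltW// truncnS_gt.
Qed.

End truncated_system.

Lemma ae_imp (R : realType) (S Q : R -> Prop) : (forall x, S x -> Q x) ->
  {ae (@lebesgue_measure R), forall x, S x} -> {ae (@lebesgue_measure R), forall x, Q x}.
Proof. by move=> h; apply: filterS; [exact: (ae_filter_ringOfSetsType (@lebesgue_measure R))|exact: h]. Qed.

Lemma ae_and (R : realType) (S Q : R -> Prop) : {ae (@lebesgue_measure R), forall x, S x} ->
  {ae (@lebesgue_measure R), forall x, Q x} -> {ae (@lebesgue_measure R), forall x, S x /\ Q x}.
Proof. by move=> h1 h2; apply: filterI h1 h2; exact: (ae_filter_ringOfSetsType (@lebesgue_measure R)). Qed.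

(** * Integration of complex-valued functions by components *)

Section complex_integration.
Context {R : realType}.
Local Notation mu := (@lebesgue_measure R).
Local Notation Re := (@complex.Re R).
Local Notation Im := (@complex.Im R).
Implicit Types (f g : R -> R[i]) (h : R -> R).

Variable D : set R.
Hypothesis mD : measurable D.

Definition rint h := mu.-integrable D (EFin \o h).
Definition cint f := rint (Re \o f) /\ rint (Im \o f).
Definition cmeas f := measurable_fun D (Re \o f) /\ measurable_fun D (Im \o f).

Lemma rintP h : rint h -> measurable_fun D h.
Proof. by move=> /measurable_int /measurable_EFinP. Qed.

Lemma rint_le h k : measurable_fun D h -> rint k -> (forall x, D x -> `|h x| <= k x) -> rint h.
Proof.
move=> mh ik hk; apply: le_integrable ik => //; first exact/measurable_EFinP.
by move=> x Dx; rewrite /= lee_fin (le_trans (hk x Dx))// ler_norm.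
Qed.

Lemma eq_cmeas f g : (forall x, D x -> f x = g x) -> cmeas f -> cmeas g.
Proof.
move=> e [h1 h2]; split; [apply: eq_measurable_fun h1|apply: eq_measurable_fun h2] => x /set_mem Dx /=; by rewrite e.
Qed.

Lemma cmeas_cst z : cmeas (fun=> z).
Proof. by split; exact: measurable_cst. Qed.

Lemma cmeasD f g : cmeas f -> cmeas g -> cmeas (fun x => f x + g x).
Proof.
move=> [f1 f2] [g1 g2]; split; [have h := measurable_funD f1 g1|have h := measurable_funD f2 g2];
  by apply: eq_measurable_fun h => x _ /=; rewrite raddfD.
Qed.

Lemma cmeasM f g : cmeas f -> cmeas g -> cmeas (fun x => f x * g x).
Proof.
move=> [f1 f2] [g1 g2]; split.
  have h := measurable_funB (measurable_funM f1 g1) (measurable_funM f2 g2).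
  by apply: eq_measurable_fun h => x _ /=; case: (f x) => a b; case: (g x).
have h := measurable_funD (measurable_funM f1 g2) (measurable_funM f2 g1).
by apply: eq_measurable_fun h => x _ /=; case: (f x) => a b; case: (g x).
Qed.

Lemma cmeas_real h : measurable_fun D h -> cmeas (fun x => (h x)%:C).
Proof. by move=> mh; split=> //; exact: measurable_cst. Qed.

Lemma cmeas_sum (T : Type) (s : seq T) (F : T -> R -> R[i]) :
  (forall i, cmeas (F i)) -> cmeas (fun x => \sum_(i <- s) F i x).
Proof.
move=> h; elim: s => [|a s IH].
  by apply: eq_cmeas (cmeas_cst 0) => x _; rewrite big_nil.
by apply: eq_cmeas (cmeasD (h a) IH) => x _; rewrite big_cons.
Qed.

Lemma cmeas_normc f : cmeas f -> measurable_fun D (fun x => normc (f x)).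
Proof.
move=> [f1 f2].
have h := measurableT_comp (continuous_measurable_fun (@sqrt_continuous R)) (measurable_funD (measurable_funX 2 f1) (measurable_funX 2 f2)).
by apply: eq_measurable_fun h => x _ /=; case: (f x).
Qed.

Lemma cint_meas f : cint f -> cmeas f.
Proof. by move=> [/rintP h1 /rintP h2]. Qed.

Lemma cint_le f h : cmeas f -> rint h -> (forall x, D x -> normc (f x) <= h x) -> cint f.
Proof.
move=> [f1 f2] ih fh; split; apply: rint_le ih _ => // x Dx.
  exact: le_trans (Re_le_normc _) (fh x Dx).
exact: le_trans (Im_le_normc _) (fh x Dx).
Qed.

Lemma cint_normc f : cint f -> rint (fun x => normc (f x)).
Proof.
move=> hf; have [f1 f2] := hf.
have h : rint (fun x => `|Re (f x)| + `|Im (f x)|).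
  exact: integrableD (integrable_norm f1) (integrable_norm f2).
apply: rint_le h _; first exact: cmeas_normc (cint_meas hf).
by move=> x _; rewrite ger0_norm ?normc_ge0// normc_le_ReIm.
Qed.

Lemma rintZ c h : rint h -> rint (fun x => c * h x).
Proof. exact: (@integrableZl _ _ R mu D mD). Qed.

Lemma rintD h k : rint h -> rint k -> rint (fun x => h x + k x).
Proof. exact: (@integrableD _ _ R mu D mD). Qed.

Lemma cint_bounded f g M : cint f -> cmeas g -> (forall x, D x -> normc (g x) <= M) ->
  cint (fun x => f x * g x).
Proof.
move=> hf hg gM; apply: (cint_le (cmeasM (cint_meas hf) hg) (rintZ M (cint_normc hf))) => x Dx.
by rewrite normcM mulrC ler_wpM2r ?normc_ge0// gM.
Qed.

Lemma eq_cint f g : (forall x, D x -> f x = g x) -> cint f -> cint g.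
Proof.
move=> e [h1 h2]; split; [apply: eq_integrable h1|apply: eq_integrable h2] => // x /set_mem Dx /=; by rewrite e.
Qed.

Lemma cintD f g : cint f -> cint g -> cint (fun x => f x + g x).
Proof.
move=> [f1 f2] [g1 g2]; split; [have h := @integrableD _ _ R mu D mD _ _ f1 g1|have h := @integrableD _ _ R mu D mD _ _ f2 g2];
  by apply: eq_integrable h => // x _ /=; rewrite raddfD.
Qed.

Lemma cint0 : cint (fun=> 0).
Proof. by split; exact: integrable0. Qed.

Lemma cintZ z f : cint f -> cint (fun x => z * f x).
Proof.
move=> hf; apply: (cint_le (cmeasM (cmeas_cst z) (cint_meas hf)) (rintZ (normc z) (cint_normc hf))) => x _.
by rewrite normcM.
Qed.

Lemma cint_sum (T : Type) (s : seq T) (F : T -> R -> R[i]) :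
  (forall i, cint (F i)) -> cint (fun x => \sum_(i <- s) F i x).
Proof.
move=> h; elim: s => [|a s IH]; first by apply: eq_cint cint0 => x _; rewrite big_nil.
by apply: eq_cint (cintD (h a) IH) => x _; rewrite big_cons.
Qed.

Lemma eq_cintegral f g : (forall x, D x -> f x = g x) -> cintegral D f = cintegral D g.
Proof. by move=> e; rewrite /cintegral; congr (_ +i* _); apply: eq_Rintegral => x /set_mem Dx; rewrite e. Qed.

Lemma cintegralD f g : cint f -> cint g -> cintegral D (fun x => f x + g x) = cintegral D f + cintegral D g.
Proof.
move=> [f1 f2] [g1 g2]; rewrite /cintegral -[RHS]/((_ + _) +i* (_ + _)) -!RintegralD//.
by congr (_ +i* _); apply: eq_Rintegral => x _; rewrite raddfD.
Qed.

Lemma cintegral0 : cintegral D (fun=> 0 : R[i]) = 0.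
Proof. by rewrite /cintegral /= Rintegral_cst// mul0r. Qed.

Lemma cintegralZ z f : cint f -> cintegral D (fun x => z * f x) = z * cintegral D f.
Proof.
move=> [f1 f2]; case: z => a b; rewrite /cintegral -[RHS]/((_ - _) +i* (_ + _)).
rewrite -!RintegralZl// -RintegralB//; [|exact: rintZ f1|exact: rintZ f2].
rewrite -RintegralD//; [|exact: rintZ f2|exact: rintZ f1].
by congr (_ +i* _); apply: eq_Rintegral => x _; case: (f x).
Qed.

Lemma cintegralB f g : cint f -> cint g -> cintegral D (fun x => f x - g x) = cintegral D f - cintegral D g.
Proof.
move=> hf hg; rewrite -mulN1r -cintegralZ// -cintegralD//; last exact: cintZ.
by apply: eq_cintegral => x _; rewrite mulN1r.
Qed.

Lemma cintegral_sum (T : Type) (s : seq T) (F : T -> R -> R[i]) : (forall i, cint (F i)) ->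
  cintegral D (fun x => \sum_(i <- s) F i x) = \sum_(i <- s) cintegral D (F i).
Proof.
move=> h; elim: s => [|a s IH].
  by rewrite big_nil -[RHS]cintegral0; apply: eq_cintegral => x _; rewrite big_nil.
rewrite big_cons -IH -cintegralD//; last exact: cint_sum.
by apply: eq_cintegral => x _; rewrite big_cons.
Qed.

Definition ccvg (z : nat -> R[i]) l := (Re (z k) @[k --> \oo] --> Re l) /\ (Im (z k) @[k --> \oo] --> Im l).

Lemma cdominated (F : nat -> R -> R[i]) f h : (forall k, cmeas (F k)) -> cmeas f -> rint h ->
  {ae mu, forall x, D x -> ccvg (F^~ x) (f x)} ->
  {ae mu, forall x k, D x -> normc (F k x) <= h x} ->
  cint f /\ ccvg (fun k => cintegral D (F k)) (cintegral D f).
Proof.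
move=> mF mf ih cF hF.
have main (p : R[i] -> R) : (forall k, measurable_fun D (p \o F k)) -> measurable_fun D (p \o f) ->
    (forall z, `|p z| <= normc z) -> {ae mu, forall x, D x -> p (F k x) @[k --> \oo] --> p (f x)} ->
    rint (p \o f) /\ (\int[mu]_(x in D) p (F k x) @[k --> \oo] --> \int[mu]_(x in D) p (f x)).
  move=> m1 m2 pn cp.
  have [] := @dominated_convergence _ _ R mu D mD (fun k => EFin \o (p \o F k)) (EFin \o (p \o f)) (EFin \o h).
  - by move=> k; have mk := m1 k; apply/measurable_EFinP; exact: mk.
  - exact/measurable_EFinP.
  - apply: (ae_imp _ cp) => x hx Dx; apply/fine_cvgP; split; [exact: nearW|exact: hx].
  - exact: ih.
  - apply: (ae_imp _ hF) => x hx k Dx; rewrite /= lee_fin; exact: le_trans (pn _) (hx k Dx).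
  move=> h1 _ h3; split=> //; rewrite /Rintegral.
  by apply: fine_cvg; rewrite fineK//; exact: integrable_fin_num.
have cR : {ae mu, forall x, D x -> Re (F k x) @[k --> \oo] --> Re (f x)} by apply: (ae_imp _ cF) => x hx /hx[].
have cI : {ae mu, forall x, D x -> Im (F k x) @[k --> \oo] --> Im (f x)} by apply: (ae_imp _ cF) => x hx /hx[].
have [r1 r2] := main Re (fun k => (mF k).1) mf.1 Re_le_normc cR.
have [i1 i2] := main Im (fun k => (mF k).2) mf.2 Im_le_normc cI.
by split; split.
Qed.

End complex_integration.

Section torus_integrals.
Context {R : realType}.
Local Notation mu := (@lebesgue_measure R).
Local Notation Re := (@complex.Re R).
Local Notation Im := (@complex.Im R).
Local Notation torus := (@torus R).
Local Notation pi := (@trigo.pi R).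

Lemma measurable_torus : measurable torus.
Proof. exact: measurable_itv. Qed.
Local Notation mT := measurable_torus.

Lemma torus_lty : (mu torus < +oo)%E.
Proof. by rewrite /Defs.torus lebesgue_measure_itv/=; case: ifP; rewrite ?ltry. Qed.

Lemma mu_torus : mu torus = (2 * pi)%:E.
Proof. by rewrite /Defs.torus lebesgue_measure_itv/= lte_fin mulr_gt0 ?pi_gt0// sube0. Qed.

Lemma rint_bounded (D : set R) (h : R -> R) (M : R) : measurable D -> (mu D < +oo)%E ->
  measurable_fun D h -> (forall x, D x -> `|h x| <= M) -> rint D h.
Proof.
move=> mD muD mh hM; apply: measurable_bounded_integrable => //.
by exists M; split; [exact: num_real|move=> x xM y Dy; apply: le_trans (hM y Dy) (ltW xM)].
Qed.

Lemma FTC_closed (F f : R -> R) (a b : R) : a < b -> {in `[a, b], continuous f} ->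
  (forall x : R, a <= x <= b -> is_derive x 1 F (f x)) -> \int[mu]_(x in `[a, b]) f x = F b - F a.
Proof.
move=> ab cf dF.
have cF x : a <= x <= b -> F y @[y --> x] --> F x.
  by move=> hx; apply: differentiable_continuous; apply/derivable1_diffP; have h := dF x hx; exact: ex_derive.
have aa : a <= a <= b by rewrite lexx ltW.
have bb : a <= b <= b by rewrite lexx ltW.
rewrite /Rintegral (@continuous_FTC2 _ f F)//.
- by apply: continuous_in_subspaceT => x /set_mem hx; exact: cf.
- split=> [x|//|//]; [|exact: cvg_at_right_filter (cF a aa)|exact: cvg_at_left_filter (cF b bb)].
  rewrite in_itv /= => /andP[h1 h2]; have h := dF x; have h3 := h _; have h4 : a <= x <= b by rewrite !ltW.
  by have h5 := dF x h4; exact: ex_derive.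
- move=> x; rewrite in_itv /= => /andP[h1 h2]; have h4 : a <= x <= b by rewrite !ltW.
  by rewrite derive1E; have h5 := dF x h4; exact: derive_val.
Qed.

Lemma FTC_everywhere (F f : R -> R) (a b : R) : a < b -> continuous f -> (forall x : R, is_derive x 1 F (f x)) ->
  \int[mu]_(x in `[a, b]) f x = F b - F a.
Proof.
move=> ab cf dF; have c : {in `[a, b], continuous f} by move=> x _; exact: cf.
exact: (FTC_closed ab c (fun x _ => dF x)).
Qed.

Lemma cexp_2pi (n : int) : cexp (n%:~R * (2 * pi)) = 1 :> R[i].
Proof.
have h2 : cexp (2 * pi) = 1 :> R[i].
  by rewrite /cexp mulrC mulr_natr cos2pi sin2pi.
have hn (k : nat) : cexp (k%:R * (2 * pi)) = 1 :> R[i].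
  elim: k => [|k IH]; first by rewrite mul0r cexp0.
  by rewrite -natr1 mulrDl cexpD IH (mul1r (2 * pi)) h2 mulr1.
case: n => k; first by rewrite -pmulrn hn.
by rewrite NegzE mulrNz mulNr -conj_cexp -pmulrn hn conjc1.
Qed.

Lemma cder_continuous (f : R -> R[i]) x l : cder f x l -> {for x, continuous (Re \o f)} /\ {for x, continuous (Im \o f)}.
Proof.
by move=> [h1 h2]; split; apply: differentiable_continuous; apply/derivable1_diffP; [move: h1|move: h2] => h; exact: ex_derive.
Qed.

Lemma cFTC (F f : R -> R[i]) (a b : R) : a < b -> continuous (Re \o f) -> continuous (Im \o f) ->
  (forall x, cder F x (f x)) -> cintegral `[a, b] f = F b - F a.
Proof.
move=> ab cR cI dF; rewrite /cintegral.
have h1 := FTC_everywhere ab cR (fun x => (dF x).1).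
have h2 := FTC_everywhere ab cI (fun x => (dF x).2).
rewrite /= in h1 h2; rewrite h1 h2.
by case: (F b) => x y; case: (F a).
Qed.

Lemma cexp_continuous (w : R) : continuous (Re \o (fun x => cexp (w * x))) /\ continuous (Im \o (fun x => cexp (w * x))).
Proof.
have e : (fun x : R => cexp (w * x)) = (fun x => cexp (x * w)) by apply/funext => x; rewrite mulrC.
by rewrite e; split=> x; have [] := cder_continuous (cder_cexp w x).
Qed.

Lemma cmeas_cexp D (w : R) : measurable D -> cmeas D (fun x => cexp (w * x)).
Proof.
move=> mD; have [h1 h2] := cexp_continuous w.
by split; apply: measurable_funTS; exact: continuous_measurable_fun.
Qed.

Lemma cint_bounded_torus (f : R -> R[i]) M : cmeas torus f -> (forall x, torus x -> normc (f x) <= M) -> cint torus f.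
Proof.
move=> mf fM; apply: (@cint_le _ _ mT _ (fun=> M)) => //.
apply: (@rint_bounded _ _ `|M|) => //; [exact: mT|exact: torus_lty].
Qed.

Lemma cint_cexp (w : R) : cint torus (fun x => cexp (w * x)).
Proof.
by apply: (@cint_bounded_torus _ 1) => [|x _]; [apply: cmeas_cexp; exact: mT|rewrite normc_cexp].
Qed.

Lemma pi2_gt0 : 0 < 2 * pi.
Proof. by rewrite mulr_gt0// pi_gt0. Qed.

Lemma cintegral_cexp (n : int) : cintegral torus (fun x => cexp (n%:~R * x)) = if n == 0 then (2 * pi)%:C else 0.
Proof.
case: eqVneq => [->|n0].
  rewrite (@eq_cintegral _ torus _ (fun=> 1)); last by move=> x _; rewrite mul0r cexp0.
  rewrite /cintegral /= !Rintegral_cst; try exact: mT.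
  by rewrite mul1r mul0r; congr (_ +i* _); exact: (congr1 fine mu_torus).
have n1 : (n%:~R : R) != 0 by rewrite intr_eq0.
have in0 : 'i * (n%:~R : R)%:C != 0 :> R[i].
  rewrite mulf_neq0//; first by rewrite eq_complex /= oner_eq0 andbF.
  by rewrite eq_complex /= negb_and n1.
have [h1 h2] := cexp_continuous n%:~R.
rewrite /torus (@cFTC (fun x => ('i * (n%:~R : R)%:C)^-1 * cexp (x * n%:~R)))//.
- by rewrite mul0r cexp0 mulrC (mulrC (2 * pi)) cexp_2pi mul1r mulr1 subrr.
- exact: pi2_gt0.
- move=> x; apply: cder_eq (cderMl _ (cder_cexp _ _)) _.
  by rewrite mulrA mulVf// mul1r mulrC.
Qed.

Lemma fourier_coef_trig (T : Type) (s : seq T) (d : T -> R[i]) (l : T -> int) n :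
  fourier_coef (fun x => \sum_(k <- s) d k * cexp ((l k)%:~R * x)) n = \sum_(k <- s) (if l k == n then d k else 0).
Proof.
have e x : (\sum_(k <- s) d k * cexp ((l k)%:~R * x)) * cexp (- (n%:~R * x)) =
    \sum_(k <- s) d k * cexp ((l k - n)%:~R * x).
  by rewrite mulr_suml; apply: eq_bigr => k _; rewrite -mulrA -cexpD rmorphB /= mulrBl.
rewrite /fourier_coef (eq_cintegral (g := fun x => \sum_(k <- s) d k * cexp ((l k - n)%:~R * x))); last by move=> x _; exact: e.
rewrite cintegral_sum; [|exact: mT|]; last by move=> k; apply: cintZ; [exact: mT|exact: cint_cexp].
rewrite mulr_sumr; apply: eq_bigr => k _; rewrite cintegralZ; [|exact: mT|exact: cint_cexp].
rewrite cintegral_cexp subr_eq0; case: ifP => _; last by rewrite !mulr0.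
rewrite mulrCA -rmorphM /= mulVf ?mulr1// gt_eqF// pi2_gt0//.
Qed.

Lemma cint_fourier (f : R -> R[i]) (w : R) : cint torus f -> cint torus (fun x => f x * cexp (w * x)).
Proof.
move=> hf; apply: (@cint_bounded _ _ mT _ _ 1) => //.
  by apply: cmeas_cexp; exact: mT.
by move=> x _; rewrite normc_cexp.
Qed.

Lemma fourier_coefB (f g : R -> R[i]) n : cint torus f -> cint torus g ->
  fourier_coef (fun x => f x - g x) n = fourier_coef f n - fourier_coef g n.
Proof.
move=> hf hg; rewrite /fourier_coef -mulrBr -cintegralB; last first.
- by have := cint_fourier (- n%:~R) hg; under eq_fun do rewrite mulNr.
- by have := cint_fourier (- n%:~R) hf; under eq_fun do rewrite mulNr.
- exact: mT.
by congr (_ * _); apply: eq_cintegral => x _; rewrite mulrBl.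
Qed.

Lemma L2T_cmeas (f : R -> R[i]) D : measurable D -> L2T f -> cmeas D f.
Proof. by move=> mD [_ h1 h2 _]; split; exact: measurable_funTS. Qed.

Lemma L2T_rint (f : R -> R[i]) : L2T f -> rint torus (fun x => normc (f x) ^+ 2).
Proof.
move=> hf; have [_ _ _ h3] := hf; have mf := cmeas_normc (L2T_cmeas mT hf).
apply/integrableP; split; first by apply/measurable_EFinP; exact: measurable_funX.
apply: le_lt_trans h3; rewrite le_eqVlt; apply/orP; left; apply/eqP; apply: eq_integral => x _.
by rewrite /= ger0_norm// sqr_ge0.
Qed.

Lemma L2T_of_rint (f : R -> R[i]) : periodic f (2 * pi) -> cmeas [set: R] f ->
  rint torus (fun x => normc (f x) ^+ 2) -> L2T f.
Proof.
move=> pf [m1 m2] /integrableP[_ h]; split=> //; apply: le_lt_trans h; rewrite le_eqVlt; apply/orP; left; apply/eqP.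
by apply: eq_integral => x _; rewrite /= ger0_norm// sqr_ge0.
Qed.

Lemma L2T_cint (f : R -> R[i]) : L2T f -> cint torus f.
Proof.
move=> hf; apply: (@cint_le _ _ mT _ (fun x => 1 + normc (f x) ^+ 2)); first exact: L2T_cmeas mT hf.
  apply: (rintD mT _ (L2T_rint hf)).
  by apply: (@rint_bounded _ (fun=> 1) 1 mT torus_lty (measurable_cst _)) => x _; rewrite normr1.
by move=> x _; have := normc_ge0 (f x); nra.
Qed.

Lemma L2T_sub (f g : R -> R[i]) : L2T f -> L2T g -> L2T (fun x => f x - g x).
Proof.
move=> hf hg; have [pf _ _ _] := hf; have [pg _ _ _] := hg.
have mfg : cmeas [set: R] (fun x => f x - g x).
  apply: (@eq_cmeas _ [set: R] (fun x => f x + (-1) * g x)); first by move=> x _; rewrite mulN1r.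
  apply: cmeasD; first exact: L2T_cmeas.
  by apply: cmeasM; [exact: cmeas_cst|exact: L2T_cmeas].
apply: L2T_of_rint => //; first by move=> x; rewrite pf pg.
apply: (@rint_le _ _ mT _ (fun x => 2 * normc (f x) ^+ 2 + 2 * normc (g x) ^+ 2)).
- apply: measurable_funX; apply: measurable_funTS; exact: cmeas_normc mfg.
- by apply: (rintD mT); apply: rintZ; [exact: mT|exact: L2T_rint|exact: mT|exact: L2T_rint].
- move=> x _; rewrite ger0_norm ?sqr_ge0//.
  have h := normc_le_sub (f x) (g x); have n0 := normc_ge0 (f x - g x).
  have n1 := normc_ge0 (f x); have n2 := normc_ge0 (g x).
  apply: (@le_trans _ _ ((normc (f x) + normc (g x)) ^+ 2)).
    by rewrite ler_sqr ?nnegrE// (le_trans n0 h).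
  rewrite -subr_ge0 (_ : _ - _ = (normc (f x) - normc (g x)) ^+ 2); first exact: sqr_ge0.
  by ring.
Qed.

End torus_integrals.

(** * Uniqueness of Fourier coefficients of integrable functions *)

Section lebesgue_translation.
Context {R : realType}.
Local Notation mu := (@lebesgue_measure R).

Lemma measurable_shift (A : set R) c : measurable A -> measurable ((fun x : R => x + c) @^-1` A).
Proof.
move=> mA; rewrite -[X in measurable X]classical_sets.setTI.
have mf : measurable_fun [set: R] (fun x : R => x + c).
  by apply: continuous_measurable_fun => x; apply: cvgD; [exact: cvg_id|exact: cvg_cst].
exact: mf.
Qed.

(** The pushforward under the translation agrees with Lebesgue measure on half-open intervals, hence
    everywhere. *)
Lemma lebesgue_measure_shift (A : set R) c : measurable A -> mu ((fun x : R => x + c) @^-1` A) = mu A.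
Proof.
move=> mA.
have mf : measurable_fun [set: measurableTypeR R] (fun x : measurableTypeR R => x + c : measurableTypeR R).
  by move=> _ B mB; rewrite classical_sets.setTI; exact: measurable_shift.
pose nu := measure_function_pushforward__canonical__measure_function_Measure mu mf.
apply/esym/(@lebesgue_measure_unique R nu) => // X /ocitvP[->|[[a b] /= ab ->]]; first by rewrite !measure0.
rewrite /nu /= /pushforward.
have -> : (fun x : R => x + c) @^-1` `]a, b] = `]a - c, b - c]%classic.
  by apply/seteqP; split => x /=; rewrite !in_itv /= ltrBlDr lerBrDr.
rewrite !lebesgue_measure_itv /= !lte_fin ltrD2r ab -!EFinB; congr (_%:E); ring.
Qed.

Lemma ae_shift (S : R -> Prop) c : {ae mu, forall x, S x} -> {ae mu, forall x, S (x + c)}.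
Proof.
move=> [A [mA A0 hA]]; exists ((fun x => x + c) @^-1` A); split.
- exact: measurable_shift.
- by rewrite lebesgue_measure_shift.
- by move=> x /= h; apply: hA.
Qed.

(** Every real number is a point of [[0, p]] moved by a multiple of [p], and the exceptional null
    set has countably many translates. *)
Lemma ae_periodic (S : R -> Prop) p : 0 < p -> (forall x, S (x + p) <-> S x) ->
  {ae mu, forall x, x \in `[0, p] -> S x} -> {ae mu, forall x, S x}.
Proof.
move=> p0 hS h.
have hn x (n : nat) : S (x + n%:R * p) <-> S x.
  elim: n => [|n IH]; first by rewrite mul0r addr0.
  by rewrite -natr1 mulrDl mul1r addrA hS.
have h1 := ae_foralln (fun n => ae_shift (n%:R * p) h).
have h2 := ae_foralln (fun n => ae_shift (- (n%:R * p)) h).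
apply: (ae_imp _ (ae_and h1 h2)) => x [k1 k2].
case: (leP 0 x) => x0.
  pose n := Num.truncn (x / p).
  have := k2 n; rewrite -(hn _ n) subrK; apply; rewrite in_itv /= subr_ge0 -ler_pdivlMr// lerBlDr.
  rewrite truncn_le ?divr_ge0 ?(ltW p0)//= -{1}(mul1r p) -mulrDl -ler_pdivrMr// addrC natr1 ltW//.
  exact: truncnS_gt.
pose n := (Num.truncn (- x / p)).+1.
have := k1 n; rewrite (hn _ n); apply; rewrite in_itv /= -lerBlDl sub0r -ler_pdivrMr// ltW ?truncnS_gt//=.
rewrite -lerBrDl -{2}(mul1r p) -[n%:R]natr1 mulrDl mul1r addrC lerD2l.
rewrite -ler_pdivlMr// truncn_le// divr_ge0 ?(ltW p0)// oppr_ge0 ltW//.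
Qed.

End lebesgue_translation.

Section indicator_limit.
Context {R : realType}.
Implicit Types (x y t w : R).

Lemma bernoulli_ge x n : -1 <= x -> 1 + n%:R * x <= (1 + x) ^+ n.
Proof.
move=> x1; elim: n => [|n IH]; first by rewrite mul0r addr0.
rewrite exprS; apply: (@le_trans _ _ ((1 + x) * (1 + n%:R * x))).
  by rewrite -natr1; have := sqr_ge0 x; have : 0 <= n%:R :> R by []; nra.
by rewrite ler_wpM2l// -lerBlDl sub0r.
Qed.

Lemma pow_one_sub_le w n : 0 <= w <= 1 -> (1 - w) ^+ n * (1 + n%:R * w) <= 1.
Proof.
move=> /andP[w0 w1].
apply: (@le_trans _ _ ((1 - w) ^+ n * (1 + w) ^+ n)).
  by rewrite ler_wpM2l ?exprn_ge0 ?subr_ge0// bernoulli_ge// (le_trans _ w0)// lerN10.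
rewrite -exprMn exprn_ile1//; first by rewrite mulr_ge0 ?subr_ge0 ?addr_ge0.
by rewrite mulrBl mul1r mulrDr mulr1 opprD addrA addrK lerBlDr lerDl mulr_ge0.
Qed.

(* [1 - (1 - w^k)^N] with [N ~ k t^-k] converges to the indicator of [t <= w] on [[0, 1]], so that
   superlevel sets of trigonometric polynomials are limits of trigonometric polynomials. *)
Definition threshold_exponent t (k : nat) : nat := k * (Num.truncn (t ^- k)).+1.
Definition threshold t w (k : nat) : R := 1 - (1 - w ^+ k) ^+ threshold_exponent t k.

Lemma threshold_bound t w k : 0 <= w <= 1 -> 0 <= threshold t w k <= 1.
Proof.
move=> /andP[w0 w1].
have h : 0 <= 1 - w ^+ k <= 1 by rewrite subr_ge0 exprn_ile1//= lerBlDr lerDl exprn_ge0.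
by rewrite subr_ge0 lerBlDr lerDl exprn_ge0 ?exprn_ile1//; case/andP: h.
Qed.

Lemma mul_geometric_le w k : 0 <= w < 1 -> k%:R * w ^+ k * (1 - w) <= 1.
Proof.
move=> /andP[w0 w1].
have := pow_one_sub_le k (_ : 0 <= 1 - w <= 1); rewrite subr_ge0 (ltW w1) lerBlDr lerDl w0 => /(_ isT).
rewrite subKr mulrDr mulr1 mulrA (mulrC (w ^+ k)); have := exprn_ge0 k w0; lra.
Qed.

(** Let [N] be the exponent. For [t <= w], [pow_one_sub_le] bounds [(1 - w^k)^N] by
    [1 / (1 + N w^k)], and [N w^k >= k]. For [w < t], Bernoulli bounds the threshold by
    [N w^k <= 2 k (w / t)^k]; writing [w / t = s^2], one factor [s^k] absorbs [k] and the other
    tends to 0. *)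
Lemma threshold_cvg t w : 0 < t <= 1 -> 0 <= w <= 1 -> threshold t w k @[k --> \oo] --> ((t <= w)%R%:R : R).
Proof.
move=> /andP[t0 t1] /andP[w0 w1].
have wk k : 0 <= w ^+ k <= 1 by rewrite exprn_ge0// exprn_ile1.
have tb k : 0 <= threshold t w k <= 1 by apply: threshold_bound; rewrite w0.
case: (leP t w) => tw.
  have l1 : (1 - (k.+1%:R)^-1 : R) @[k --> \oo] --> (1%:R : R).
    rewrite -[X in _ --> X]subr0; apply: cvgB; first exact: cvg_cst.
    exact: (@cvg_harmonic R).
  apply: squeeze_cvgr l1 (cvg_cst _); apply: nearW => k.
  have /andP[_ ->] := tb k; rewrite andbT /threshold lerD2l lerN2.
  have /andP[v0 v1] := wk k.
  rewrite -div1r ler_pdivlMr//; apply: le_trans (pow_one_sub_le (threshold_exponent t k) (wk k)).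
  rewrite ler_wpM2l ?exprn_ge0 ?subr_ge0// -natr1 addrC lerD2l /threshold_exponent natrM -mulrA ler_peMr//.
  apply: (@le_trans _ _ (t ^- k * w ^+ k)); last by rewrite ler_wpM2r// ltW// truncnS_gt.
  by rewrite mulrC ler_pdivlMr ?exprn_gt0// mul1r lerXn2r ?nnegrE// ltW.
pose r := w / t; have r0 : 0 <= r by rewrite divr_ge0// ltW.
have r1 : r < 1 by rewrite ltr_pdivrMr// mul1r.
pose s := Num.sqrt r; have s0 : 0 <= s by exact: sqrtr_ge0.
have s1 : s < 1 by rewrite -[ltRHS]sqrtr1 ltr_sqrt.
have sr : s ^+ 2 = r by exact: sqr_sqrtr.
have l0 : (2 / (1 - s) * s ^+ k) @[k --> \oo] --> (0 : R).
  have := @cvg_geometric R (2 / (1 - s)) s; rewrite ger0_norm// => /(_ s1); exact.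
rewrite -[(false%:R : R)]/(0 : R).
apply: squeeze_cvgr (cvg_cst _) l0; apply: nearW => k.
have /andP[-> _] := tb k; rewrite /= /threshold.
have /andP[v0 v1] := wk k.
have h : 1 - (threshold_exponent t k)%:R * w ^+ k <= (1 - w ^+ k) ^+ threshold_exponent t k.
  by have := @bernoulli_ge (- w ^+ k) (threshold_exponent t k); rewrite lerN2 v1 mulrN => /(_ isT).
apply: (@le_trans _ _ ((threshold_exponent t k)%:R * w ^+ k)); first by rewrite lerBlDl -lerBlDr.
have hk : (Num.truncn (t ^- k)).+1%:R <= 2 * t ^- k.
  have tk1 : 1 <= t ^- k by rewrite invf_ge1 ?exprn_gt0// exprn_ile1// ltW.
  rewrite -natr1 mulr_natl mulr2n lerD// truncn_le// (le_trans _ tk1)//.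
rewrite natrM; apply: (@le_trans _ _ (2 * (k%:R * s ^+ k) * s ^+ k)).
  have -> : 2 * (k%:R * s ^+ k) * s ^+ k = k%:R * (2 * t ^- k) * w ^+ k.
    by rewrite -mulrA -mulrA -exprD addnn -mul2n exprM sr /r expr_div_n; ring.
  by rewrite ler_wpM2r// ler_wpM2l.
rewrite ler_wpM2r ?exprn_ge0// ler_wpM2l// -[leRHS]mul1r ler_pdivlMr ?subr_gt0//.
by apply: mul_geometric_le; rewrite s0.
Qed.

End indicator_limit.

Lemma ccvg_unique (R : realType) (z : nat -> R[i]) l l' : ccvg z l -> ccvg z l' -> l = l'.
Proof.
move=> [h1 h2] [h3 h4].
have e1 : complex.Re l = complex.Re l' by apply: (cvg_unique _ h1 h3); exact: Rhausdorff.
have e2 : complex.Im l = complex.Im l' by apply: (cvg_unique _ h2 h4); exact: Rhausdorff.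
by move: e1 e2; case: l {h1 h2} => a b; case: l' {h3 h4} => c d /= -> ->.
Qed.

Section zero_on_arcs.
Context {R : realType}.
Local Notation mu := (@lebesgue_measure R).
Local Notation torus := (@torus R).
Local Notation pi := (@trigo.pi R).

(** The primitive of [g] is constant on [(0, 2 pi)] because its increments are integrals over arcs,
    and by Lebesgue differentiation its derivative is [g] almost everywhere. *)
Lemma ae_zero_of_arcs (g : R -> R) : rint torus g ->
  (forall y h : R, 0 < h -> h < y -> h < 2 * pi - y -> \int[mu]_(x in `[y - h, y + h]) g x = 0) ->
  {ae mu, forall x, x \in `[0, 2 * pi] -> g x = 0}.
Proof.
move=> ig harc; have mT := @measurable_torus R.
pose G := g \_ torus.
have iG : mu.-integrable [set: R] (EFin \o G).
  by have := (@integrable_mkcond _ _ R mu torus (EFin \o g) mT).1 ig; rewrite restrict_EFin.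
have iGD (D : set R) : measurable D -> mu.-integrable D (EFin \o G).
  by move=> mD; apply: integrableS iG => //; exact: measurableT.
have lG : locally_integrable [set: R] G by apply: open_integrable_locally => //; exact: openT.
have := FTC1Ny (fun y => iGD _ (measurable_itv _)) lG.
set F := fun x => _ => hF.
have Fcst (z w : R) : 0 < z -> z < w -> w < 2 * pi -> F w = F z.
  move=> z0 zw w2; apply/eqP; rewrite -subr_eq0; apply/eqP.
  rewrite /F Rintegral_itvB ?bnd_simp ?(ltW zw)//; last exact: iGD.
  rewrite Rintegral_itv_obnd_cbnd; last exact: iGD.
  have := harc ((z + w) / 2) ((w - z) / 2); rewrite (_ : (z + w) / 2 - (w - z) / 2 = z); last by field.
  rewrite (_ : (z + w) / 2 + (w - z) / 2 = w); last by field.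
  move=> <-; [|by move: zw; lra|by move: z0; lra|by move: w2; lra].
  apply: eq_Rintegral => x /set_mem /=; rewrite in_itv /= => /andP[zx xw].
  by rewrite /G patchE mem_set// /Defs.torus /= in_itv /= (le_trans (ltW z0) zx) (le_trans xw (ltW w2)).
have h0 : {ae mu, forall x, x != 0 /\ x != 2 * pi}.
  have one (c : R) : {ae mu, forall x, x != c}.
    exists [set c]; split; [exact: measurable_set1|exact: lebesgue_measure_set1|].
    by move=> x /= /negP; rewrite negbK => /eqP.
  exact: ae_and (one 0) (one (2 * pi)).
apply: (ae_imp _ (ae_and hF h0)) => x [[dF eF] [x0 x2]]; rewrite in_itv /= => /andP[xx0 xx2].
have {}x0 : 0 < x by rewrite lt_neqAle eq_sym x0.
have {}x2 : x < 2 * pi by rewrite lt_neqAle x2.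
have <- : G x = g x by rewrite /G patchE mem_set// /Defs.torus /= in_itv /= xx0 xx2.
rewrite -eF derive1E -(derive_cst (F x) x 1); apply: near_eq_derive.
near=> w.
have w0 : 0 < w by near: w; exact: lt_nbhsr.
have w2 : w < 2 * pi by near: w; exact: lt_nbhsl.
case: (ltgtP w x) => [wx|xw|->//]; last exact: Fcst.
exact/esym/Fcst.
Unshelve. all: by end_near. Qed.

End zero_on_arcs.

Section fourier_uniqueness.
Context {R : realType}.
Local Notation mu := (@lebesgue_measure R).
Local Notation Re := (@complex.Re R).
Local Notation Im := (@complex.Im R).
Local Notation torus := (@torus R).
Local Notation pi := (@trigo.pi R).

Definition trigpoly (f : R -> R[i]) := exists s : seq (R[i] * int),
  forall x, f x = \sum_(k <- s) k.1 * cexp (k.2%:~R * x).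

Lemma trigpoly_cst z : trigpoly (fun=> z).
Proof. by exists [:: (z, 0)] => x; rewrite big_seq1 /= mul0r cexp0 mulr1. Qed.

Lemma trigpoly_cexp (n : int) : trigpoly (fun x => cexp (n%:~R * x)).
Proof. by exists [:: (1, n)] => x; rewrite big_seq1 /= mul1r. Qed.

Lemma trigpolyD f g : trigpoly f -> trigpoly g -> trigpoly (fun x => f x + g x).
Proof. by move=> [s hs] [t ht]; exists (s ++ t) => x; rewrite big_cat hs ht. Qed.

Lemma trigpolyM f g : trigpoly f -> trigpoly g -> trigpoly (fun x => f x * g x).
Proof.
move=> [s hs] [t ht]; exists [seq (k.1 * l.1, k.2 + l.2) | k <- s, l <- t] => x.
rewrite big_allpairs_dep hs ht mulr_suml; apply: eq_bigr => k _.
by rewrite mulr_sumr; apply: eq_bigr => l _ /=; rewrite rmorphD /= mulrDl cexpD; ring.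
Qed.

Lemma trigpolyX f n : trigpoly f -> trigpoly (fun x => f x ^+ n).
Proof.
move=> hf; elim: n => [|n IH]; first exact: trigpoly_cst.
have [s hs] := trigpolyM hf IH; by exists s => x; rewrite -hs exprS.
Qed.

Lemma trigpoly_one_sub f : trigpoly f -> trigpoly (fun x => 1 - f x).
Proof.
move=> hf; have [s hs] := trigpolyD (trigpoly_cst 1) (trigpolyM (trigpoly_cst (-1)) hf).
by exists s => x; rewrite -hs mulN1r.
Qed.

(** A trigonometric polynomial with values in [[0, 1]] whose superlevel sets on the circle are the
    arcs centred at [y]. *)
Definition cos_bump (y x : R) : R := (1 + cos (x - y)) / 2.

Lemma cos_bump01 y x : 0 <= cos_bump y x <= 1.
Proof.
rewrite /cos_bump; have := cos_le1 (x - y); have := cos_geN1 (x - y); lra.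
Qed.

Lemma trigpoly_cos_bump y : trigpoly (fun x => (cos_bump y x)%:C).
Proof.
have [s hs] := trigpolyD (trigpoly_cst (2^-1)%:C) (trigpolyD
  (trigpolyM (trigpoly_cst ((4^-1)%:C * cexp (- y))) (trigpoly_cexp 1))
  (trigpolyM (trigpoly_cst ((4^-1)%:C * cexp y)) (trigpoly_cexp (-1)))).
exists s => x; rewrite -hs mulrNz !mulr1z mul1r mulN1r -!mulrA -!cexpD.
have -> : y - x = - (x - y) by ring.
rewrite -conj_cexp (addrC (- y)) -mulrDr /cexp /cos_bump.
have e (c d : R) : (c +i* d) + conjc (c +i* d) = (c + c)%:C by rewrite /conjc /=; congr (_ +i* _); ring.
by rewrite e -rmorphM -rmorphD /=; congr (_ %:C); field.
Qed.

Variable f : R -> R[i].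
Hypothesis fint : cint torus f.
Hypothesis f0 : forall n, fourier_coef f n = 0.

Lemma annihilates_trigpoly p : trigpoly p -> cintegral torus (fun x => f x * p x) = 0.
Proof.
move=> [s hs]; have mT := @measurable_torus R.
rewrite (eq_cintegral (g := fun x => \sum_(k <- s) k.1 * (f x * cexp (k.2%:~R * x)))); last first.
  by move=> x _; rewrite hs mulr_sumr; apply: eq_bigr => k _; rewrite mulrCA.
rewrite cintegral_sum//; last by move=> k; apply: cintZ => //; exact: cint_fourier.
rewrite big1// => k _; rewrite cintegralZ//; last exact: cint_fourier.
suff -> : cintegral torus (fun x => f x * cexp (k.2%:~R * x)) = 0 by rewrite mulr0.
have := f0 (- k.2); rewrite /fourier_coef => /eqP; rewrite mulf_eq0 => /orP[|/eqP e].
  by rewrite eq_complex /= eqxx andbT invr_eq0 gt_eqF// pi2_gt0.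
by rewrite -e; apply: eq_cintegral => x _; rewrite mulrNz mulNr opprK.
Qed.

(** The thresholds of [cos_bump y] are trigonometric polynomials, hence annihilated by [f]. They are
    bounded by 1, so dominated convergence with majorant [|f|] passes to the indicator. *)
Lemma annihilates_superlevel (y t : R) : 0 < t <= 1 ->
  cint torus (fun x => f x * ((t <= cos_bump y x)%R%:R : R)%:C) /\
  cintegral torus (fun x => f x * ((t <= cos_bump y x)%R%:R : R)%:C) = 0.
Proof.
move=> ht; have mT := @measurable_torus R.
pose F k x := f x * (threshold t (cos_bump y x) k)%:C.
have tpF k : trigpoly (fun x => (threshold t (cos_bump y x) k)%:C).
  have [s hs] := trigpoly_one_sub (trigpolyX (threshold_exponent t k) (trigpoly_one_sub (trigpolyX k (trigpoly_cos_bump y)))).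
  by exists s => x; rewrite -hs /threshold rmorphB rmorphXn rmorphB rmorphXn.
have mb : measurable_fun torus (cos_bump y).
  apply: measurable_funTS; apply: continuous_measurable_fun => x; rewrite /cos_bump.
  apply: cvgM; last exact: cvg_cst.
  apply: cvgD; first exact: cvg_cst.
  apply: continuous_comp; last exact: continuous_cos.
  by apply: cvgB; [exact: cvg_id|exact: cvg_cst].
have mth k : measurable_fun torus (fun x => threshold t (cos_bump y x) k).
  rewrite /threshold; apply: measurable_funB; first exact: measurable_cst.
  apply: measurable_funX; apply: measurable_funB; first exact: measurable_cst.
  exact: measurable_funX.
have [|||||h1 h2] := @cdominated _ torus mT F (fun x => f x * ((t <= cos_bump y x)%R%:R : R)%:C) (fun x => normc (f x)).
- move=> k; apply: cmeasM; first exact: cint_meas.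
  exact: cmeas_real (mth k).
- apply: cmeasM; first exact: cint_meas.
  apply: cmeas_real; apply: (measurable_fun_cvg mth) => x _.
  exact: threshold_cvg ht (cos_bump01 y x).
- exact: cint_normc.
- apply: aeW => x _; rewrite /ccvg.
  have h := threshold_cvg ht (cos_bump01 y x).
  have e (c : R) : Re (f x * c%:C) = Re (f x) * c /\ Im (f x * c%:C) = Im (f x) * c.
    by case: (f x) => a b /=; rewrite !mulr0 subr0 add0r.
  rewrite (e _).1 (e _).2; split.
    by under eq_fun do rewrite /F (e _).1; apply: cvgM h; exact: cvg_cst.
  by under eq_fun do rewrite /F (e _).2; apply: cvgM h; exact: cvg_cst.
- apply: aeW => x k _; rewrite /F normcM normc_real ler_piMr ?normc_ge0//.
  by have /andP[a b] := threshold_bound t k (cos_bump01 y x); rewrite ger0_norm.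
split=> //.
have e0 : (fun k => cintegral torus (F k)) = (fun=> 0) by apply/funext => k; exact: annihilates_trigpoly.
by rewrite e0 in h2; apply: (ccvg_unique h2); split; exact: cvg_cst.
Qed.

(** The conditions on [h] keep the arc inside [(0, 2 pi)], so [|x - y| < 2 pi - h]. When
    [|x - y| > pi], the cosine is read at [2 pi - |x - y|], which still exceeds [h]. *)
Lemma arcE (y h x : R) : 0 <= x <= 2 * pi -> 0 < h -> h < y -> h < 2 * pi - y ->
  ((1 + cos h) / 2 <= cos_bump y x)%R = (x \in `[y - h, y + h]).
Proof.
move=> /andP[x0 x2] h0 hy h2y; rewrite /cos_bump ler_pM2r// lerD2l.
have hpi : h < pi by rewrite -(ltr_pM2l (ltr0n R 2)); move: hy h2y; lra.
set d := `|x - y|; have -> : cos (x - y) = cos d by rewrite /d; case: ger0P => // _; rewrite cosN.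
have -> : (x \in `[y - h, y + h]) = (d <= h).
  by rewrite in_itv /= /d ler_distl.
have d0 : 0 <= d by exact: normr_ge0.
have d2 : d < 2 * pi - h.
  by rewrite /d ltr_norml; apply/andP; split; move: x0 x2 hy h2y; lra.
have inpi z : 0 <= z -> z <= pi -> z \in `[0, pi] by move=> z0 z1; rewrite in_itv /= z0.
have ih := inpi h (ltW h0) (ltW hpi).
case: (leP d pi) => dpi; first by rewrite leNgt ltr_cos ?ih ?inpi// -leNgt.
have -> : cos d = cos (2 * pi - d).
  by rewrite -[in RHS]cosN opprB -[in RHS]cosD2pi mulr_natl; congr cos; rewrite subrK.
rewrite leNgt ltr_cos ?ih ?inpi//; [|by move: d2 h0; lra|by move: dpi; lra].
by rewrite ltrBrDr -ltrBrDl d2/=; apply/esym/negbTE; rewrite -ltNge; apply: lt_trans dpi.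
Qed.

Lemma arc_integral (y h : R) : 0 < h -> h < y -> h < 2 * pi - y ->
  \int[mu]_(x in `[y - h, y + h]) Re (f x) = 0 /\ \int[mu]_(x in `[y - h, y + h]) Im (f x) = 0.
Proof.
move=> h0 hy h2y.
have ht : 0 < (1 + cos h) / 2 <= 1.
  have hpi : h < pi by rewrite -(ltr_pM2l (ltr0n R 2)); move: hy h2y; lra.
  have : cos pi < cos h by rewrite ltr_cos ?in_itv /= ?lexx ?(ltW h0) ?(ltW hpi) ?pi_ge0.
  by rewrite cospi; have := cos_le1 h; lra.
have [_ h1] := annihilates_superlevel y ht.
have main (p : R[i] -> R) : (forall z c, p (z * c%:C) = p z * c) ->
    \int[mu]_(x in `[y - h, y + h]) p (f x) = \int[mu]_(x in torus) p (f x * (((1 + cos h) / 2 <= cos_bump y x)%R%:R : R)%:C).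
  move=> hp; have -> : `[y - h, y + h]%classic = torus `&` `[y - h, y + h]%classic.
    rewrite setIidr// => x /=; rewrite /Defs.torus /= !in_itv /= => /andP[a b].
    by apply/andP; split; move: a b hy h2y; lra.
  rewrite Rintegral_mkcondr; apply: eq_Rintegral => x /set_mem.
  rewrite /Defs.torus /= in_itv /= => xt; rewrite hp arcE// patchE.
  have -> : (x \in (`[y - h, y + h]%classic : set R)) = (x \in `[y - h, y + h]) by apply: asboolb.
  by case: ifP; rewrite ?mulr1 ?mulr0.
have pR z (c : R) : Re (z * c%:C) = Re z * c by case: z => a b /=; rewrite mulr0 subr0.
have pI z (c : R) : Im (z * c%:C) = Im z * c by case: z => a b /=; rewrite mulr0 add0r.
by rewrite (main Re pR) (main Im pI); move: h1; rewrite /cintegral => -[-> ->].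
Qed.

Lemma fourier_uniqueness_torus : {ae mu, forall x, x \in `[0, 2 * pi] -> f x = 0}.
Proof.
have [i1 i2] := fint.
have h1 := ae_zero_of_arcs i1 (fun y h a b c => (arc_integral a b c).1).
have h2 := ae_zero_of_arcs i2 (fun y h a b c => (arc_integral a b c).2).
apply: (ae_imp _ (ae_and h1 h2)) => x [k1 k2] hx.
by move: (k1 hx) (k2 hx) => /=; case: (f x) => a b /= -> ->.
Qed.

End fourier_uniqueness.

Lemma fourier_uniqueness (R : realType) (f : R -> R[i]) : periodic f (2 * trigo.pi) -> cint (@torus R) f ->
  (forall n, fourier_coef f n = 0) -> {ae (@lebesgue_measure R), forall x, f x = 0}.
Proof.
move=> pf fint f0; apply: (ae_periodic (@pi2_gt0 R)); first by move=> x; rewrite pf.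
exact: fourier_uniqueness_torus.
Qed.

(** * Fourier coefficients of the nonlinearity *)

Section dyadic_cube.
Context {R : realType}.
Variables (w M : R) (x : nat -> R).
Hypotheses (w1 : 1 < w) (M0 : 0 <= M) (x0 : forall k, 0 <= x k).
Let G k := \sum_(0 <= j < k.+1) x j.
Hypothesis GM : forall k, G k <= M * w ^+ (2 * k).
Let y k := w ^+ k * x k.
Let V := fix V k := if k is k'.+1 then y k + V k' / w else y 0%N.
Let c := w / (w - 1).

(* The largest index carries the [l^2] bound and the two smaller ones the growth [M w^(2 k)], as in the
   Sobolev embedding of [H^(1/6)] into [L^3]. *)
Lemma dyadic_cube k : G k ^+ 3 <= 3 * M * (1 + c ^+ 2) * \sum_(0 <= j < k.+1) (w ^+ j * x j) ^+ 2.
Proof.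
have w0 : 0 < w by apply: lt_trans w1.
have wn0 : w != 0 by rewrite gt_eqF.
have w10 : 0 < w - 1 by rewrite subr_gt0.
have c1 : 1 <= c by rewrite ler_pdivlMr// mul1r lerBlDr lerDl.
have y0 j : 0 <= y j by rewrite mulr_ge0 ?exprn_ge0// ltW.
have V0 j : 0 <= V j by elim: j => [|j IH] /=; rewrite ?addr_ge0 ?divr_ge0 ?(ltW w0).
have GS j : G j.+1 = G j + x j.+1 by rewrite /G big_nat_recr.
have G00 : G 0%N = x 0%N by rewrite /G big_nat1.
have G0 j : 0 <= G j by apply: sumr_ge0.
(* The square grows by at most [2 G_(j+1) x_(j+1)], and the growth hypothesis bounds [G_(j+1)]; the
   weights [w] then recombine into the recursion for [V]. *)
have sq j : G j ^+ 2 <= 2 * M * w ^+ j * V j.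
  elim: j => [|j IH].
    have := GM 0; rewrite G00 muln0 expr0 mulr1 /= /y expr0 mul1r => h.
    by have := x0 0; move: M0; nra.
  rewrite [V j.+1]/= mulrDr.
  have -> : 2 * M * w ^+ j.+1 * (V j / w) = 2 * M * w ^+ j * V j by rewrite exprS; field.
  have -> : 2 * M * w ^+ j.+1 * y j.+1 = 2 * (M * w ^+ (2 * j.+1)) * x j.+1.
    by rewrite /y mul2n -addnn exprD; ring.
  have h := GM j.+1; have := x0 j.+1; have := G0 j; move: h IH; rewrite GS.
  set a := x _; set b := G _; set d := M * _; set e := 2 * M * _ * _ => *; nra.
have cube j : G j ^+ 3 <= 6 * M * \sum_(0 <= i < j.+1) y i * V i.
  elim: j => [|j IH].
    rewrite big_nat1 /= /y expr0 mul1r G00; have := GM 0; rewrite G00 muln0 expr0 mulr1 => h.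
    have := x0 0; have := sqr_ge0 (x 0%N); move: h M0; set a := x _ => h m0 a2 a0.
    by rewrite exprS -expr2; nra.
  rewrite big_nat_recr//= mulrDr.
  have e : 6 * M * (y j.+1 * V j.+1) = 3 * x j.+1 * (2 * M * w ^+ j.+1 * V j.+1) by rewrite /y; ring.
  rewrite [_ * (y j.+1 + _)]/(y j.+1 * V j.+1) e.
  have h := sq j.+1; have := x0 j.+1; have := G0 j; move: h IH; rewrite GS.
  set a := x _; set b := G _; set d := 2 * M * _ * _; set s := 6 * M * _ => h1 h2 b0 a0.
  have h3 : 3 * a * (b + a) ^+ 2 <= 3 * a * d by rewrite ler_wpM2l// mulr_ge0.
  apply: le_trans (lerD h2 h3); rewrite -subr_ge0.
  rewrite (_ : _ - _ = a ^+ 2 * (3 * b + 2 * a)); last by ring.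
  by rewrite mulr_ge0 ?sqr_ge0// addr_ge0 ?mulr_ge0.
(* Convolution with the geometric weights [w^(- i)] is bounded on [l^2]. The extra term
   [V j ^+ 2 / w] on the left is what the induction step consumes. *)
have energy j : (1 - w^-1) * \sum_(0 <= i < j.+1) V i ^+ 2 + V j ^+ 2 / w <= c * \sum_(0 <= i < j.+1) y i ^+ 2.
  elim: j => [|j IH].
    rewrite !big_nat1 /= mulrBl mul1r mulrC subrK ler_peMl ?sqr_ge0//.
  rewrite !(big_nat_recr j.+1)//= !mulrDr.
  have h : (y j.+1 + V j / w) ^+ 2 <= V j ^+ 2 / w + c * y j.+1 ^+ 2.
    rewrite -subr_ge0 (_ : _ - _ = (V j - V j / w - y j.+1) ^+ 2 / (w - 1)).
      by rewrite divr_ge0 ?sqr_ge0// ltW.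
    by rewrite /c; field; rewrite wn0 (gt_eqF w10).
  move: IH h; set a := \sum_(0 <= i < j.+1) V i ^+ 2; set b := \sum_(_ <= _ < _) _.
  set v := y j.+1 + V j / w; set v2 := v ^+ 2; set u := V j ^+ 2 / w; set z := y j.+1 ^+ 2 => h1 h2.
  have -> : (1 - w^-1) * a + (1 - w^-1) * v2 + v2 / w = (1 - w^-1) * a + v2 by ring.
  by move: h1 h2; lra.
have iw : 1 - w^-1 = c^-1 by rewrite /c invf_div; field.
set Y := \sum_(0 <= j < k.+1) (w ^+ j * x j) ^+ 2.
have hV : \sum_(0 <= i < k.+1) V i ^+ 2 <= c ^+ 2 * Y.
  have := energy k; rewrite iw -/Y => h.
  have c0 : 0 < c by apply: lt_le_trans c1.
  have : c^-1 * \sum_(0 <= i < k.+1) V i ^+ 2 <= c * Y.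
    by apply: le_trans h; rewrite lerDl divr_ge0 ?sqr_ge0// ltW.
  by rewrite mulrC ler_pdivrMr// mulrAC -expr2.
apply: le_trans (cube k) _.
have h : \sum_(0 <= i < k.+1) y i * V i <= 2^-1 * (Y + \sum_(0 <= i < k.+1) V i ^+ 2).
  rewrite /Y -big_split mulr_sumr; apply: ler_sum => i _ /=.
  by have := sqr_ge0 (y i - V i); rewrite -/(y i); lra.
have M6 : 0 <= 6 * M by rewrite mulr_ge0.
apply: le_trans (ler_wpM2l M6 h) _.
rewrite [leRHS](_ : _ = 6 * M * (2^-1 * (Y + c ^+ 2 * Y))); last by field.
by rewrite ler_wpM2l// ler_wpM2l// lerD2l.
Qed.

End dyadic_cube.

(** Enumerated in the same way as the partial sums in [fourier_multiplier]. *)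
Definition freqs (N : nat) : seq int := [seq k%:Z - N%:Z | k <- iota 0 (2 * N).+1].

Arguments freqs : simpl never.

Lemma mem_freqs N n : (n \in freqs N) = (`|n| <= N)%N.
Proof.
apply/mapP/idP => [[k]|h]; first by rewrite mem_iota => /andP[_ hk] ->; lia.
exists (absz (n + N%:Z)); first by rewrite mem_iota; lia.
by lia.
Qed.

Lemma uniq_freqs N : uniq (freqs N).
Proof. by rewrite map_inj_uniq ?iota_uniq// => a b; lia. Qed.

Lemma sum_freqs_sub (V : nmodType) N M (F : int -> V) : (N <= M)%N ->
  \sum_(n <- freqs M | (`|n| <= N)%N) F n = \sum_(n <- freqs N) F n.
Proof.
move=> NM; rewrite -big_filter; apply: perm_big; apply: uniq_perm; rewrite ?filter_uniq ?uniq_freqs//.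
by move=> n; rewrite mem_filter !mem_freqs; lia.
Qed.

Section dyadic_decomposition.
Context {R : realType}.
Local Notation mu := (@lebesgue_measure R).
Local Notation Re := (@complex.Re R).
Local Notation Im := (@complex.Im R).
Local Notation torus := (@torus R).
Local Notation pi := (@trigo.pi R).
Implicit Types (a : int -> R[i]) (x : R).

Definition trig (s : seq int) a x : R[i] := \sum_(n <- s) a n * cexp (n%:~R * x).

Lemma cmeas_trig D s a : measurable D -> cmeas D (trig s a).
Proof. by move=> mD; apply: cmeas_sum => n; apply: cmeasM; [exact: cmeas_cst|exact: cmeas_cexp]. Qed.

Lemma parseval s a : uniq s -> \int[mu]_(x in torus) normc (trig s a x) ^+ 2 = 2 * pi * \sum_(n <- s) normc (a n) ^+ 2.
Proof.
move=> us; have mT := @measurable_torus R.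
have e x : (normc (trig s a x) ^+ 2)%:C =
    \sum_(n <- s) \sum_(m <- s) a n * conjc (a m) * cexp ((n - m)%:~R * x).
  rewrite -mulc_conj /trig conjc_sum mulr_suml; apply: eq_bigr => n _.
  rewrite mulr_sumr; apply: eq_bigr => m _.
  by rewrite conjcM conj_cexp rmorphB /= mulrBl cexpD; ring.
have h : cintegral torus (fun x => (normc (trig s a x) ^+ 2)%:C) = (2 * pi * \sum_(n <- s) normc (a n) ^+ 2)%:C.
  rewrite (eq_cintegral (fun x _ => e x)) cintegral_sum//; last first.
    by move=> n; apply: cint_sum => // m; apply: cintZ => //; exact: cint_cexp.
  rewrite rmorphM rmorph_sum mulr_sumr /= big_seq [RHS]big_seq; apply: eq_bigr => n ns.
  rewrite cintegral_sum//; last by move=> m; apply: cintZ => //; exact: cint_cexp.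
  rewrite (perm_big _ (perm_to_rem ns)) big_cons; set dyadic_sum := \sum_(m <- rem n s) _.
  have -> : dyadic_sum = 0.
    rewrite /dyadic_sum big1_seq// => m /andP[_]; rewrite mem_rem_uniq// !inE => /andP[mn _].
    rewrite cintegralZ//; last exact: cint_cexp.
    by rewrite cintegral_cexp subr_eq0 eq_sym (negbTE mn) mulr0.
  apply: etrans (addr0 _) _.
  by rewrite cintegralZ//; [rewrite subrr cintegral_cexp eqxx mulc_conj mulrC|exact: cint_cexp].
by move/(congr1 Re): h => /= <-.
Qed.

Lemma rint_trig_sq s a : rint torus (fun x => normc (trig s a x) ^+ 2).
Proof.
have mT := @measurable_torus R.
apply: (@rint_bounded _ _ _ ((\sum_(n <- s) normc (a n)) ^+ 2)) => //; first exact: torus_lty.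
  by apply: measurable_funX; apply: cmeas_normc; exact: cmeas_trig.
move=> x _; rewrite ger0_norm ?sqr_ge0// ler_sqr ?nnegrE ?normc_ge0//; last by apply: sumr_ge0 => n _; exact: normc_ge0.
apply: le_trans (normc_sum _ _) _; apply: ler_sum => n _.
by rewrite normcM normc_cexp mulr1.
Qed.

Definition block (k : nat) : seq int :=
  if k is j.+1 then [seq n <- freqs (2 ^ k) | (2 ^ j < `|n|)%N] else freqs 1.

Arguments block : simpl never.

Lemma uniq_block k : uniq (block k).
Proof. by case: k => [|k]; rewrite /block ?filter_uniq ?uniq_freqs. Qed.

Lemma sum_block (V : nmodType) k (F : int -> V) :
  \sum_(n <- freqs (2 ^ k)) F n = \sum_(0 <= j < k.+1) \sum_(n <- block j) F n.
Proof.
elim: k => [|k IH]; first by rewrite big_nat1.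
rewrite big_nat_recr// -IH /= (bigID (fun n : int => (`|n| <= 2 ^ k)%N)) /=.
rewrite sum_freqs_sub ?leq_exp2l//; congr (_ + _).
by rewrite -/(block k.+1) /block big_filter; apply: eq_bigl => n; rewrite -ltnNge.
Qed.

Variables (b Bd : R) (a : int -> R[i]).
Hypothesis b3 : 3^-1 <= b.
Hypothesis Bd0 : 0 <= Bd.
Hypothesis aB : forall r, uniq r -> nX b r (fun n => normc (a n)) Bd.

(** Since [w^6 = 2], the factor [(w^k)^2 = 2^(k / 3)] is the squared [H^(1/6)] weight of a block at
    frequency [2^k]. *)
Let w : R := 2 `^ 6^-1.
Lemma w1 : 1 < w.
Proof. rewrite -[ltLHS](_ : 1 `^ 6^-1 = 1); last by rewrite powR1.
by rewrite gt0_ltr_powR ?invr_gt0 ?nnegrE// ltr1n. Qed.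

Lemma wX (k : nat) : w ^+ (6 * k) = 2 ^+ k.
Proof.
rewrite exprM /w -(@powR_mulrn _ (2 `^ 6^-1) 6) ?powR_ge0// -powRrM mulVf ?pnatr_eq0// powRr1//.
Qed.

Lemma powR_w k (p : R) m : (6 * k)%:R * p = m%:R -> (2 ^+ k) `^ p = w ^+ m.
Proof.
by move=> h; rewrite -wX -(@powR_mulrn _ w (6 * k)) ?powR_ge0// -powRrM h powR_mulrn ?powR_ge0.
Qed.

(** Cauchy-Schwarz against [jb^(- 1/3)], whose sum over [|n| <= 2^k] is of order [2^(2 k / 3)]; the
    square root of this is [w^(2 k)]. *)
Lemma dyadic_sup : exists2 M : R, 0 <= M & forall k, \sum_(n <- freqs (2 ^ k)) normc (a n) <= M * w ^+ (2 * k).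
Proof.
have h3 : 0 <= (3^-1 : R) < 1 by rewrite invr_ge0 ler0n invf_lt1 ?ltr1n.
have [C [C0 hC]] := @sum_jb_le R 3^-1 h3.
have w0 : 0 <= w by exact: ltW (lt_trans _ w1).
exists (Num.sqrt C * w ^+ 2 * Bd); first by rewrite !mulr_ge0 ?sqrtr_ge0 ?exprn_ge0.
move=> k; have h := aB (uniq_freqs (2 ^ k)).
rewrite (eq_bigr (fun n => (jb n `^ (- 3^-1 / 2)) * (jb n `^ (3^-1 / 2) * normc (a n)))); last first.
  move=> n _; rewrite mulrA -powRDp ?jb_gt0// mulNr addNr powRr0 mul1r//.
rewrite [leRHS](_ : _ = Num.sqrt C * w ^+ (2 * k.+1) * Bd); last by rewrite mulnS exprD; ring.
apply: cauchy_schwarz_le => //; first by rewrite mulr_ge0 ?sqrtr_ge0 ?exprn_ge0.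
  rewrite exprMn sqr_sqrtr ?(ltW C0)// -exprM.
  have := hC (freqs (2 ^ k)) (2 ^ k)%:Z (uniq_freqs _).
  have -> : \sum_(m <- freqs (2 ^ k)) (if (`|m| <= `|(2 ^ k)%:Z|)%N then jb m `^ (- 3^-1) else 0) =
     \sum_(n <- freqs (2 ^ k)) (jb n `^ (- 3^-1 / 2)) ^+ 2 :> R.
    rewrite !big_seq; apply: eq_bigr => n; rewrite mem_freqs absz_nat => ->.
    by rewrite powR_half ?jb_gt0.
  move=> {}hC; apply: le_trans hC _; rewrite ler_wpM2l ?(ltW C0)//.
  rewrite (_ : w ^+ (2 * k.+1 * 2) = (2 ^+ k.+1) `^ (1 - 3^-1)); last first.
    by apply/esym/powR_w; rewrite !natrM; field.
  rewrite ge0_ler_powR ?nnegrE ?exprn_ge0//.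
  - by rewrite subr_ge0 invf_le1// ler1n.
  - by rewrite ltW// jb_gt0.
  - rewrite /jb -pmulrn ger0_norm// natrX exprS mulr_natl mulr2n lerD2r.
    by rewrite exprn_ege1// lerDl.
apply: le_trans h; apply: ler_sum => n _; rewrite exprMn powR_half ?jb_gt0// ler_wpM2r ?sqr_ge0//.
by apply: ler_powR => //; exact: jb_ge1.
Qed.

Lemma block_weight k n : n \in block k -> (w ^+ k) ^+ 2 <= 2 * jb n `^ b.
Proof.
move=> h.
have h2 : 2 ^+ k <= 2 * jb n :> R.
  case: k h => [_|k].
    rewrite expr0; apply: (@le_trans _ _ (jb n)); first exact: jb_ge1.
    by rewrite ler_peMl ?ler1n// ltW// jb_gt0.
  rewrite mem_filter => /andP[h _]; rewrite exprS ler_pM2l// /jb -intr_norm.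
  rewrite -natrX; apply: (@le_trans _ _ (`|n|%N%:R)); first by rewrite ler_nat ltnW.
  by rewrite -abszE -pmulrn lerDr.
rewrite -exprM (_ : w ^+ (k * 2) = (2 ^+ k) `^ 3^-1); last by apply/esym/powR_w; rewrite !natrM; field.
apply: (@le_trans _ _ ((2 * jb n) `^ 3^-1)).
  by rewrite ge0_ler_powR ?nnegrE ?invr_ge0 ?exprn_ge0 ?mulr_ge0 ?(ltW (jb_gt0 _)).
rewrite powRM ?(ltW (jb_gt0 _))//; apply: ler_pM; rewrite ?powR_ge0//.
  by rewrite -[leRHS]powRr1//; apply: ler_powR; rewrite ?ler1n// invf_le1// ler1n.
by apply: ler_powR => //; exact: jb_ge1.
Qed.

Let wk k x := (w ^+ k * normc (trig (block k) a x)) ^+ 2.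

Lemma measurable_wk k : measurable_fun torus (wk k).
Proof.
apply: measurable_funX; apply: measurable_funM; first exact: measurable_cst.
by apply: cmeas_normc; apply: cmeas_trig; exact: measurable_torus.
Qed.

Lemma integral_wk k : (\int[mu]_(x in torus) (wk k x)%:E)%E = (2 * pi * (w ^+ k) ^+ 2 * \sum_(n <- block k) normc (a n) ^+ 2)%:E.
Proof.
have mT := @measurable_torus R.
have e : (fun x => (wk k x)) = (fun x => (w ^+ k) ^+ 2 * normc (trig (block k) a x) ^+ 2).
  by apply/funext => x; rewrite /wk exprMn.
have i1 : rint torus (wk k) by rewrite -[wk k]/(fun x => wk k x) e; exact: rintZ (rint_trig_sq _ _).
rewrite -[LHS]fineK; last exact: (integrable_fin_num _ i1).
rewrite -[fine _]/(Rintegral mu torus (fun x => wk k x)) e RintegralZl//; last exact: rint_trig_sq.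
by rewrite parseval ?uniq_block//; congr (_%:E); ring.
Qed.

Lemma integral_dyadic_sum K : (\sum_(0 <= k < K) \int[mu]_(x in torus) (wk k x)%:E <= (4 * pi * Bd ^+ 2)%:E)%E.
Proof.
under eq_bigr do rewrite integral_wk.
rewrite sumEFin lee_fin.
have p0 : 0 <= 4 * pi by rewrite mulr_ge0// ltW// pi_gt0.
case: K => [|K]; first by rewrite big_nil mulr_ge0 ?sqr_ge0.
have h := aB (uniq_freqs (2 ^ K)); rewrite /nX sum_block in h.
apply: le_trans (ler_wpM2l p0 h); rewrite mulr_sumr; apply: ler_sum => k _.
rewrite -mulrA (_ : 4 * pi = 2 * pi * 2); last by ring.
rewrite -[leRHS]mulrA ler_wpM2l//; first by rewrite ltW// pi2_gt0.
rewrite !mulr_sumr big_seq [leRHS]big_seq; apply: ler_sum => n nk.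
by rewrite [leRHS]mulrA ler_wpM2r ?sqr_ge0// block_weight.
Qed.

(** A weighted square function. By Parseval its integral is bounded by the squared Sobolev norm, and
    by [dyadic_cube] a multiple of it dominates the cubes of all dyadic partial sums at once. *)
Let E x : \bar R := (\sum_(k <oo) (wk k x)%:E)%E.

Lemma dyadic_integrable : mu.-integrable torus E.
Proof.
have mT := @measurable_torus R.
have wk0 k x : (0 <= (wk k x)%:E)%E by rewrite lee_fin sqr_ge0.
have mE : measurable_fun torus E.
  apply: ge0_emeasurable_sum => [k x _ _|k _]; first exact: wk0.
  by apply/measurable_EFinP; exact: measurable_wk.
have E0 x : (0 <= E x)%E by apply: nneseries_ge0 => k _ _; exact: wk0.
apply/integrableP; split=> //.
under eq_integral do rewrite gee0_abs//.
rewrite /E integral_nneseries//; last by move=> k; apply/measurable_EFinP; exact: measurable_wk.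
apply: le_lt_trans (ltry (4 * pi * Bd ^+ 2)); apply: lime_le.
  by apply: is_cvg_nneseries => k _ _; apply: integral_ge0.
by apply: nearW => K; exact: integral_dyadic_sum.
Qed.

Let h x := fine (E x).

Lemma rint_h : rint torus h.
Proof.
have mT := @measurable_torus R; have iE := dyadic_integrable.
have E0 x : (0 <= E x)%E by apply: nneseries_ge0 => k _ _; rewrite lee_fin sqr_ge0.
apply: le_integrable iE => //.
  apply/measurable_EFinP; apply: measurableT_comp => //; exact: measurable_int dyadic_integrable.
move=> x _; rewrite /= /h (gee0_abs (E0 x)); move: (E0 x); case: (E x) => [r| |]//= r0.
  by rewrite lee_fin ger0_norm.
by rewrite leey.
Qed.

Definition dyadic_sum k x := trig (freqs (2 ^ k)) a x.

Lemma dyadic_sum_block k x : dyadic_sum k x = \sum_(0 <= j < k.+1) trig (block j) a x.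
Proof. exact: sum_block. Qed.

Lemma dyadic_good : exists2 C : R, 0 <= C & {ae mu, forall x, torus x ->
  [/\ forall k, (\sum_(0 <= j < k.+1) normc (trig (block j) a x)) ^+ 3 <= C * h x & 0 <= h x]}.
Proof.
have [M M0 hM] := dyadic_sup.
have [c c0 hc] : exists2 c : R, 0 <= c & c = 3 * M * (1 + (w / (w - 1)) ^+ 2).
  by eexists; last reflexivity; rewrite !mulr_ge0// addr_ge0// sqr_ge0.
have hae : {ae mu, forall x : R, torus x -> E x \is a fin_num} := @integrable_ae _ _ R mu torus (@measurable_torus R) _ dyadic_integrable.
exists c => //; apply: (ae_imp _ hae) => x hx xT.
have {hx xT} hx := hx xT.
have E0 : (0 <= E x)%E by apply: nneseries_ge0 => k _ _; rewrite lee_fin sqr_ge0.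
split; last by rewrite fine_ge0.
move=> k; rewrite hc; apply: le_trans (dyadic_cube w1 M0 _ _ k) _.
- by move=> j; exact: normc_ge0.
- move=> j; apply: le_trans (hM j); rewrite sum_block; apply: ler_sum => i _.
  apply: le_trans (normc_sum _ _) _; apply: ler_sum => n _.
  by rewrite normcM normc_cexp mulr1.
rewrite -hc ler_wpM2l// -lee_fin /h fineK// -sumEFin.
by apply: nneseries_lim_ge => i _ _; rewrite lee_fin sqr_ge0.
Qed.

Lemma series_cvg (u : nat -> R) (c : R) : (forall k, \sum_(0 <= j < k.+1) `|u j| <= c) ->
  exists l : R, (\sum_(0 <= j < k.+1) u j : R) @[k --> \oo] --> l.
Proof.
move=> hu.
have hn : cvgn (series (fun j => `|u j|)).
  apply: nondecreasing_is_cvgn.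
    by apply/nondecreasing_seqP => k; rewrite /series /= big_nat_recr//= lerDl.
  exists c => _ [k _ <-]; apply: le_trans (hu k); rewrite /series /= [leRHS]big_nat_recr//= lerDl//.
have /cvg_ex[l hl] := normed_cvg hn.
exists l; have := hl; rewrite -cvg_shiftS; exact.
Qed.

Lemma good_cvg (c x : R) : (forall k, (\sum_(0 <= j < k.+1) normc (trig (block j) a x)) ^+ 3 <= c) ->
  exists l, ccvg (fun k => dyadic_sum k x) l.
Proof.
move=> hx.
have hc k : \sum_(0 <= j < k.+1) normc (trig (block j) a x) <= 1 + c.
  have := hx k; set s := \sum_(_ <= _ < _) _; have s0 : 0 <= s by apply: sumr_ge0 => j _; exact: normc_ge0.
  case: (leP s 1) => [s1 h'|s1]; first by rewrite (le_trans s1)// lerDl (le_trans _ h')// exprn_ge0.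
  move=> h'; apply: (@le_trans _ _ (s ^+ 3)); last by rewrite (le_trans h')// lerDr.
  by rewrite ler_eXnr// ltW.
have main (p : {additive R[i] -> R}) : (forall z, `|p z| <= normc z) -> exists l : R, p (dyadic_sum k x) @[k --> \oo] --> l.
  move=> pn; have [|l hl] := @series_cvg (fun j => p (trig (block j) a x)) (1 + c).
    by move=> k; apply: le_trans (hc k); apply: ler_sum => j _; exact: pn.
  exists l; apply: cvg_trans hl; apply: near_eq_cvg; apply: nearW => k.
  by rewrite dyadic_sum_block raddf_sum.
have [l1 h1] := main Re Re_le_normc; have [l2 h2] := main Im Im_le_normc.
by exists (l1 +i* l2).
Qed.

Lemma dyadic_sum_bound (C x : R) k : 0 <= C -> 0 <= h x ->
  (\sum_(0 <= j < k.+1) normc (trig (block j) a x)) ^+ 3 <= C * h x ->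
  normc (dyadic_sum k x) ^+ 3 <= C * h x /\ normc (dyadic_sum k x) <= 1 + C * h x.
Proof.
move=> C0 h0 hx.
have hS : normc (dyadic_sum k x) <= \sum_(0 <= j < k.+1) normc (trig (block j) a x).
  by rewrite dyadic_sum_block; exact: normc_sum.
have n0 := normc_ge0 (dyadic_sum k x).
have h3 : normc (dyadic_sum k x) ^+ 3 <= C * h x by apply: le_trans hx; rewrite lerXn2r ?nnegrE// (le_trans n0).
split=> //; case: (leP (normc (dyadic_sum k x)) 1) => s1; first by rewrite (le_trans s1)// lerDl mulr_ge0.
by apply: (@le_trans _ _ (normc (dyadic_sum k x) ^+ 3)); [rewrite ler_eXnr// ltW|rewrite (le_trans h3)// lerDr].
Qed.

Lemma rint_1Ch (C : R) : rint torus (fun x => 1 + C * h x).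
Proof.
have mT := @measurable_torus R; apply: rintD => //; last exact: rintZ rint_h.
by apply: (@rint_bounded _ torus (fun=> 1) 1) => // [|x _]; [exact: torus_lty|rewrite normr1].
Qed.

Lemma fourier_dyadic_sum k n : fourier_coef (dyadic_sum k) n = if n \in freqs (2 ^ k) then a n else 0.
Proof.
rewrite /fourier_coef (eq_cintegral (g := fun x => (\sum_(m <- freqs (2 ^ k)) a m * cexp (m%:~R * x)) * cexp (- (n%:~R * x))))//.
rewrite -/(fourier_coef _ n) (@fourier_coef_trig R _ _ a id).
case: ifP => hn.
  rewrite (perm_big _ (perm_to_rem hn)) big_cons eqxx big1_seq; first exact: addr0.
  move=> m /andP[_]; rewrite mem_rem_uniq ?uniq_freqs// !inE => /andP[/negbTE -> _] //.
by rewrite big1_seq// => m /andP[_ hm]; case: eqP => // e; rewrite -e hm in hn.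
Qed.

Lemma eventually_freqs n : \forall k \near \oo, n \in freqs (2 ^ k).
Proof.
exists `|n|%N => // k /= hk; rewrite mem_freqs; apply: leq_trans hk _.
by rewrite ltnW// ltn_expl.
Qed.

Lemma ccvg_mulr (z : nat -> R[i]) l v : ccvg z l -> ccvg (fun k => z k * v) (l * v).
Proof.
move=> [h1 h2]; case: v => c d; case: l h1 h2 => l1 l2 /= h1 h2; split.
  have e : (fun k => Re (z k * (c +i* d))) = (fun k => Re (z k) * c - Im (z k) * d) by apply/funext => k; case: (z k).
  by rewrite e /=; apply: cvgB; apply: cvgMl.
have e : (fun k => Im (z k * (c +i* d))) = (fun k => Re (z k) * d + Im (z k) * c) by apply/funext => k; case: (z k).
by rewrite e /=; apply: cvgD; apply: cvgMl.
Qed.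

(** The dyadic sums converge almost everywhere to some function. By dominated convergence its
    coefficients are [a], so it equals [f] by uniqueness. The limit is written as an upper limit to
    be measurable. *)
Lemma ae_cvg_fourier (f : R -> R[i]) : cint torus f -> (forall n, fourier_coef f n = a n) ->
  {ae mu, forall x, torus x -> ccvg (fun k => dyadic_sum k x) (f x)}.
Proof.
move=> fint fa; have mT := @measurable_torus R.
have [C C0 hgood] := dyadic_good.
pose lims (p : R[i] -> R) x := fine (limn_esup (fun k => (p (dyadic_sum k x))%:E)).
pose G x := lims Re x +i* lims Im x.
have mS k : cmeas torus (dyadic_sum k) by exact: cmeas_trig.
have mlims p : (forall k, measurable_fun torus (p \o dyadic_sum k)) -> measurable_fun torus (lims p).
  move=> mp; apply: measurableT_comp => //; apply: measurable_fun_limn_esup => k.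
  by apply/measurable_EFinP; exact: mp.
have mG : cmeas torus G.
  by split; [apply: (mlims Re) => k; exact: (mS k).1|apply: (mlims Im) => k; exact: (mS k).2].
have hlims p x l : p (dyadic_sum k x) @[k --> \oo] --> l -> lims p x = l.
  move=> hl; rewrite /lims.
  have hE : (p (dyadic_sum k x))%:E @[k --> \oo] --> l%:E by apply/fine_cvgP; split; [exact: nearW|exact: hl].
  by have [_ ->] := cvg_limn_einf_sup hE.
have cG : {ae mu, forall x, torus x -> ccvg (fun k => dyadic_sum k x) (G x)}.
  apply: (ae_imp _ hgood) => x hx /hx [h1 h2].
  have [l [l1 l2]] := good_cvg h1.
  by rewrite /G (hlims _ _ _ l1) (hlims _ _ _ l2).
have bG : {ae mu, forall x k, torus x -> normc (dyadic_sum k x) <= 1 + C * h x}.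
  apply: (ae_imp _ hgood) => x hx k /hx [h1 h2]; exact: (dyadic_sum_bound C0 h2 (h1 k)).2.
have [iG _] := cdominated mT mS mG (rint_1Ch C) cG bG.
have GE n : fourier_coef G n = a n.
  have [|||||_ hc] := @cdominated _ torus mT (fun k x => dyadic_sum k x * cexp (- (n%:~R * x))) (fun x => G x * cexp (- (n%:~R * x))) (fun x => 1 + C * h x).
  - by move=> k; apply: cmeasM => //; under eq_fun do rewrite -mulNr; exact: cmeas_cexp.
  - by apply: cmeasM => //; under eq_fun do rewrite -mulNr; exact: cmeas_cexp.
  - exact: rint_1Ch.
  - by apply: (ae_imp _ cG) => x hx /hx; exact: ccvg_mulr.
  - by apply: (ae_imp _ bG) => x hx k /(hx k); rewrite normcM normc_cexp mulr1.
  rewrite /fourier_coef mulrC; apply: (ccvg_unique (ccvg_mulr _ hc)).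
  have e : \forall k \near \oo, a n = cintegral torus (fun x => dyadic_sum k x * cexp (- (n%:~R * x))) * ((2 * pi)^-1)%:C.
    apply: filterS (eventually_freqs n) => k hk; have := fourier_dyadic_sum k n; rewrite hk => <-.
    by rewrite /fourier_coef mulrC.
  by split; apply: cvg_near_cst; apply: filterS e => k <-.
have fG : {ae mu, forall x, x \in `[0, 2 * pi] -> f x - G x = 0}.
  apply: fourier_uniqueness_torus.
    by apply: (@eq_cint _ torus mT (fun x => f x + (-1) * G x)) => [x _|]; [rewrite mulN1r|apply: cintD => //; exact: cintZ].
  by move=> n; rewrite fourier_coefB// fa GE subrr.
apply: (ae_imp _ (ae_and cG fG)) => x [h1 h2] xT.
have -> : f x = G x by apply/eqP; rewrite -subr_eq0; apply/eqP; apply: h2.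
exact: h1.
Qed.

Lemma sum_eq_freq (s : seq int) m (F : int -> R[i]) : uniq s ->
  \sum_(n <- s) (if n == m then F n else 0) = if m \in s then F m else 0.
Proof.
move=> us; case: ifP => hm.
  rewrite (perm_big _ (perm_to_rem hm)) big_cons eqxx big1_seq; first exact: addr0.
  by move=> n /andP[_]; rewrite mem_rem_uniq// !inE => /andP[/negbTE -> _].
by rewrite big1_seq// => n /andP[_ hn]; case: eqP => // e; rewrite -e hn in hm.
Qed.

Lemma fourier_cubic k n : fourier_coef (fun x => (normc (dyadic_sum k x) ^+ 2)%:C * dyadic_sum k x) n = cubic (freqs (2 ^ k)) a n.
Proof.
set r := freqs (2 ^ k).
pose T := [seq (q, n2) | q <- [seq (n1, n3) | n1 <- r, n3 <- r], n2 <- r].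
pose d (q : int * int * int) := a q.1.1 * conjc (a q.2) * a q.1.2.
pose l (q : int * int * int) := q.1.1 - q.2 + q.1.2.
have e : (fun x => (normc (dyadic_sum k x) ^+ 2)%:C * dyadic_sum k x) = (fun x => \sum_(q <- T) d q * cexp ((l q)%:~R * x)).
  apply/funext => x; rewrite -mulc_conj /T big_allpairs_dep big_allpairs_dep mulrAC.
  rewrite /dyadic_sum /trig -/r [X in X * _]mulr_suml mulr_suml; apply: eq_bigr => n1 _.
  rewrite mulr_sumr mulr_suml; apply: eq_bigr => n3 _.
  rewrite conjc_sum mulr_sumr; apply: eq_bigr => n2 _ /=.
  by rewrite conjcM conj_cexp /d /l /= rmorphD rmorphB /= mulrDl mulrBl !cexpD; ring.
rewrite e fourier_coef_trig /T big_allpairs_dep big_allpairs_dep /cubic.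
apply: eq_bigr => n1 _; apply: eq_bigr => n3 _.
rewrite -(sum_eq_freq _ (fun n2 => a n1 * conjc (a n2) * a n3))//; last exact: uniq_freqs.
apply: eq_bigr => n2 _; rewrite /l /d /=; congr (if _ then _ else _).
by apply/eqP/eqP => [<-|->]; ring.
Qed.

Lemma ccvg_cube (z : nat -> R[i]) l : ccvg z l ->
  ccvg (fun k => (normc (z k) ^+ 2)%:C * z k) ((normc l ^+ 2)%:C * l).
Proof.
move=> [h1 h2].
have eR (v : R[i]) : Re ((normc v ^+ 2)%:C * v) = (Re v * Re v + Im v * Im v) * Re v.
  by rewrite sqr_normc_ReIm; case: v => c d /=; ring.
have eI (v : R[i]) : Im ((normc v ^+ 2)%:C * v) = (Re v * Re v + Im v * Im v) * Im v.
  by rewrite sqr_normc_ReIm; case: v => c d /=; ring.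
split; rewrite ?eR ?eI; [under eq_fun do rewrite eR|under eq_fun do rewrite eI];
  by apply: cvgM => //; apply: cvgD; apply: cvgM.
Qed.

(** The cubes of the dyadic sums are dominated by [C * h] and converge almost everywhere to
    [|f|^2 f], while their coefficients are the finite sums computed in [fourier_cubic]. *)
Lemma cubic_limit (f : R -> R[i]) n : cint torus f -> (forall n, fourier_coef f n = a n) ->
  cint torus (fun x => (normc (f x) ^+ 2)%:C * f x * cexp (- (n%:~R * x))) /\
  ccvg (fun k => cubic (freqs (2 ^ k)) a n) (fourier_coef (fun x => (normc (f x) ^+ 2)%:C * f x) n).
Proof.
move=> fint fa; have mT := @measurable_torus R.
have [C C0 hgood] := dyadic_good.
have mcube (v : R -> R[i]) : cmeas torus v -> cmeas torus (fun x => (normc (v x) ^+ 2)%:C * v x * cexp (- (n%:~R * x))).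
  move=> mv; apply: cmeasM; last by under eq_fun do rewrite -mulNr; exact: cmeas_cexp.
  by apply: cmeasM => //; apply: cmeas_real; apply: measurable_funX; exact: cmeas_normc.
have [|||||hi hc] := @cdominated _ torus mT (fun k x => (normc (dyadic_sum k x) ^+ 2)%:C * dyadic_sum k x * cexp (- (n%:~R * x)))
   (fun x => (normc (f x) ^+ 2)%:C * f x * cexp (- (n%:~R * x))) (fun x => C * h x).
- by move=> k; apply: mcube; exact: cmeas_trig.
- by apply: mcube; exact: cint_meas.
- exact: rintZ rint_h.
- apply: (ae_imp _ (ae_cvg_fourier fint fa)) => x hx /hx hS.
  by apply: ccvg_mulr; exact: ccvg_cube.
- apply: (ae_imp _ hgood) => x hx k /hx [h1 h2].
  rewrite !normcM normc_cexp mulr1 normc_real ger0_norm ?sqr_ge0// -exprSr.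
  exact: (dyadic_sum_bound C0 h2 (h1 k)).1.
split=> //; rewrite /fourier_coef mulrC.
have e : (fun k => cubic (freqs (2 ^ k)) a n) = (fun k => cintegral torus (fun x => (normc (dyadic_sum k x) ^+ 2)%:C * dyadic_sum k x * cexp (- (n%:~R * x))) * ((2 * pi)^-1)%:C).
  by apply/funext => k; rewrite -fourier_cubic /fourier_coef mulrC.
by rewrite e; exact: ccvg_mulr.
Qed.

End dyadic_decomposition.

(** * The equation for the Fourier coefficients *)

Section smooth_functions.
Context {R : realType}.
Local Notation mu := (@lebesgue_measure R).
Implicit Types (f g : R -> R) (t : R).

Fixpoint smoothn (n : nat) f : Prop :=
  if n is m.+1 then exists2 f', (forall t, is_derive t 1 f (f' t)) & smoothn m f' else True.

Lemma smoothn_pred n f : smoothn n.+1 f -> smoothn n f.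
Proof. by elim: n f => // n IH f [f' h1 h2]; exists f' => //; exact: IH. Qed.

Lemma smoothnD n f g : smoothn n f -> smoothn n g -> smoothn n (fun t => f t + g t).
Proof.
elim: n f g => // n IH f g [f' h1 h2] [g' h3 h4]; exists (fun t => f' t + g' t); last exact: IH.
by move=> t; have a := h1 t; have c := h3 t; exact: is_deriveD.
Qed.

Lemma smoothn_cst n (c : R) : smoothn n (fun=> c).
Proof. by elim: n c => // n IH c; exists (fun=> 0) => // t; exact: is_derive_cst. Qed.

Lemma smoothnM n f g : smoothn n f -> smoothn n g -> smoothn n (fun t => f t * g t).
Proof.
elim: n f g => // n IH f g hf hg; have [f' h1 h2] := hf; have [g' h3 h4] := hg.
exists (fun t => f t * g' t + g t * f' t).
  by move=> t; have a := h1 t; have c := h3 t; exact: is_deriveM.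
by apply: smoothnD; apply: IH => //; exact: smoothn_pred.
Qed.

Lemma smoothn_affine n f (c d : R) : smoothn n f -> smoothn n (fun t => f (c * t + d)).
Proof.
elim: n f => // n IH f [f' h1 h2]; exists (fun t => c * f' (c * t + d)); last first.
  by apply: smoothnM; [exact: smoothn_cst|exact: IH].
move=> t; have a := h1 (c * t + d).
have h : is_derive t 1 (fun s : R => c * s + d) c by apply: is_derive_eq; rewrite /GRing.scale /=; ring.
have h3 := @is_derive1_comp _ f (fun s => c * s + d) t _ _ a h.
by apply: is_derive_eq h3 _; rewrite mulrC.
Qed.

Lemma smoothn_trig n (A B w : R) : smoothn n (fun x => A * cos (w * x) + B * sin (w * x)).
Proof.
elim: n A B => // n IH A B; exists (fun x => (B * w) * cos (w * x) + (- (A * w)) * sin (w * x)) => // t.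
have h : is_derive t 1 (fun s : R => w * s) w by apply: is_derive_eq; rewrite /GRing.scale /=; ring.
have hc := @is_derive1_comp _ cos (fun s => w * s) t _ _ (is_derive_cos _) h.
have hs := @is_derive1_comp _ sin (fun s => w * s) t _ _ (is_derive_sin _) h.
have h3 := is_deriveD (is_deriveZ A hc) (is_deriveZ B hs).
by apply: is_derive_eq h3 _; rewrite /GRing.scale /=; ring.
Qed.

Definition smooth1 f := forall n, smoothn n f.

Lemma smooth1_derive f : smooth1 f -> (forall t, derivable f t 1) /\ smooth1 (derive1 f).
Proof.
move=> h; split=> [t|n]; first by have [f' h1 _] := h 1; have a := h1 t; exact: ex_derive.
have [f' h1 h2] := h n.+1; suff -> : derive1 f = f' by [].
by apply/funext => t; rewrite derive1E; have a := h1 t; exact: derive_val.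
Qed.

Lemma smooth1_continuous f : smooth1 f -> continuous f.
Proof. by move=> /smooth1_derive[h _] t; apply: differentiable_continuous; exact/derivable1_diffP. Qed.

Lemma mixed_partial_prod (l : seq bool) f g : smooth1 f -> smooth1 g ->
  exists f' g', [/\ smooth1 f', smooth1 g' & mixed_partial l (fun t x => f t * g x) = fun t x => f' t * g' x].
Proof.
move=> sf sg; elim: l => [|[] l [f' [g' [h1 h2 h3]]]]; first by exists f, g.
  have [d s] := smooth1_derive h1; exists (derive1 f'), g'; split=> //.
  rewrite /mixed_partial /= -/(mixed_partial l _) h3; apply/funext => t; apply/funext => x.
  rewrite /partial_t derive1E; have a : is_derive t 1 f' (derive1 f' t) by rewrite derive1E; apply: DeriveDef => //; exact: d.
  have [_ e] := is_deriveM a (is_derive_cst (g' x) t 1); transitivity ('D_1 (f' * cst (g' x)) t) => //; rewrite e /=.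
  by rewrite /GRing.scale /=; ring.
have [d s] := smooth1_derive h2; exists f', (derive1 g'); split=> //.
rewrite /mixed_partial /= -/(mixed_partial l _) h3; apply/funext => t; apply/funext => x.
rewrite /partial_x derive1E; have a : is_derive x 1 g' (derive1 g' x) by rewrite derive1E; apply: DeriveDef => //; exact: d.
have [_ e] := is_deriveM (is_derive_cst (f' t) x 1) a; transitivity ('D_1 (cst (f' t) * g') x) => //; rewrite e /=.
by rewrite /GRing.scale /=; ring.
Qed.

Lemma smooth_prod f g : smooth1 f -> smooth1 g -> smooth (fun t x => f t * g x).
Proof.
move=> sf sg l; have [f' [g' [h1 h2 ->]]] := mixed_partial_prod l sf sg.
have [d1 _] := smooth1_derive h1; have [d2 _] := smooth1_derive h2.
split=> [t x|t x|].
- by apply: derivableM => //; exact: derivable_cst.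
- by apply: derivableM => //; exact: derivable_cst.
- move=> p; apply: cvgM.
    by apply: (continuous_comp (f := fst)); [exact: cvg_fst|exact: smooth1_continuous].
  by apply: (continuous_comp (f := snd)); [exact: cvg_snd|exact: smooth1_continuous].
Qed.

(* The derivatives of [t |-> exp (- 1 / t)], extended by 0, are combinations of these functions. *)
Definition flat (k : nat) t : R := if 0 < t then t ^- k * expR (- t^-1) else 0.

Lemma pow_expRN_le (k : nat) (s : R) : 0 <= s -> s ^+ k * expR (- s) <= k%:R ^+ k.
Proof.
move=> s0; case: k => [|k]; first by rewrite !expr0 mul1r -[leRHS]expR0 ler_expR oppr_le0.
have e : expR s = expR (s / k.+1%:R) ^+ k.+1 by rewrite -expRM_natl mulrC divfK.
have e0 : 0 <= k.+1%:R * expR (s / k.+1%:R) by apply: mulr_ge0 => //; exact: expR_ge0.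
rewrite expRN e ler_pdivrMr ?exprn_gt0 ?expR_gt0// -exprMn; apply: lerXn2r; rewrite ?nnegrE//.
have h := expR_ge1Dx (s / k.+1%:R).
rewrite -ler_pdivrMl// mulrC; apply: le_trans h; by rewrite lerDr.
Qed.

(** [t^(- k)] is [t^2] times [(1 / t)^(k + 2)], and the exponential controls the latter. A quadratic
    bound is what gives derivative 0 at the origin for every [k]. *)
Lemma flat_bound k t : `|flat k t| <= k.+2%:R ^+ k.+2 * t ^+ 2.
Proof.
rewrite /flat; case: ifP => t0; last by rewrite normr0; apply: mulr_ge0; [exact: exprn_ge0|exact: sqr_ge0].
rewrite ger0_norm; last by apply: mulr_ge0; rewrite ?expR_ge0// invr_ge0 exprn_ge0// ltW.
have := @pow_expRN_le k.+2 t^-1; rewrite invr_ge0 (ltW t0) => /(_ isT) h.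
apply: le_trans (ler_wpM2r (sqr_ge0 t) h); rewrite le_eqVlt; apply/orP; left; apply/eqP.
by rewrite -[k.+2]addn2 exprD exprVn mulrAC -[_ * t ^+ 2]mulrA -exprMn mulVf ?gt_eqF// expr1n mulr1.
Qed.

Lemma is_derive_of_sq_bound f (C : R) : f 0 = 0 -> (forall t, `|f t| <= C * t ^+ 2) -> is_derive (0 : R) 1 f 0.
Proof.
move=> f0 hf.
have h : (fun s : R => s^-1 *: (f (s *: 1 + 0) - f 0)) @ 0^' --> (0 : R).
  apply/cvgr0Pnorm_le => eta eta0.
  near=> s; have s0 : s != 0 by near: s; exact: nbhs_dnbhs_neq.
  rewrite f0 subr0 addr0 /GRing.scale /= mulr1 normrM normfV ler_pdivrMl ?normr_gt0//.
  apply: le_trans (hf s) _; rewrite -real_normK ?num_real// expr2 mulrA (mulrC `|s|) ler_wpM2r//.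
  apply: (@le_trans _ _ (`|C| * `|s|)); first by rewrite ler_wpM2r// ler_norm.
  have : `|s| < eta / (1 + `|C|).
    by near: s; apply: dnbhs0_lt; rewrite divr_gt0// ltr_pwDl.
  rewrite ltr_pdivlMr ?ltr_pwDl//; have := normr_ge0 s; have := normr_ge0 C; nra.
apply: DeriveDef; first by apply/cvg_ex; exists 0.
exact: cvg_lim h.
Unshelve. all: by end_near. Qed.

Lemma flat_derive k t : is_derive t 1 (flat k) (- k%:R * flat k.+1 t + flat k.+2 t).
Proof.
case: (ltgtP t 0) => t0.
- have -> : - k%:R * flat k.+1 t + flat k.+2 t = 0 by rewrite /flat ltNge (ltW t0)/= mulr0 addr0.
  have h : {near t, (fun=> 0 : R) =1 flat k}.
    near=> s; rewrite /flat ifF//; apply/negbTE; rewrite -leNgt ltW//.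
    by near: s; exact: lt_nbhsl.
  exact: near_eq_is_derive h (is_derive_cst _ _ _).
- rewrite /flat t0.
  have h : {near t, (fun s => s ^- k * expR (- s^-1)) =1 flat k}.
    near=> s; rewrite /flat ifT//; by near: s; exact: lt_nbhsr.
  apply: near_eq_is_derive h _; have tn : t != 0 by rewrite gt_eqF.
  have hV := @is_deriveV R id t 1 1 tn (is_derive_id t 1).
  have hX := @is_deriveX _ _ _ k _ _ _ hV.
  have hE := @is_derive1_comp _ expR (fun s => - s^-1) t _ _ (is_derive_expR _) (is_deriveN hV).
  have h3 := is_deriveM hX hE.
  have -> : (fun s : R => s ^- k * expR (- s^-1)) = (fun y => y^-1) ^+ k * (expR \o (fun s => - s^-1)).
    by apply/funext => s; rewrite fctE /= fctE exprVn.
  apply: is_derive_eq h3 _; rewrite /GRing.scale /= fctE.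
  case: k {hX} => [|k] /=.
    by rewrite !expr0 mulr0n; field.
  rewrite !exprVn; rewrite -[k.+3]addn3 -[k.+2]addn2 -[k.+1]addn1 !exprD.
  have := expf_neq0 k tn; rewrite natrD; move: (t ^+ k) (k%:R) => z y z0; field; exact/andP.
- rewrite t0; have -> : - k%:R * flat k.+1 0 + flat k.+2 0 = 0 by rewrite /flat ltxx mulr0 addr0.
  apply: is_derive_of_sq_bound (flat_bound k); by rewrite /flat ltxx.
Unshelve. all: by end_near. Qed.

Lemma smooth_flat k : smooth1 (flat k).
Proof.
move=> n; elim: n k => // n IH k; exists (fun t => - k%:R * flat k.+1 t + flat k.+2 t).
  by move=> t; exact: flat_derive.
by apply: smoothnD => //; apply: smoothnM => //; exact: smoothn_cst.
Qed.

Lemma smoothnV n f : (forall t, f t != 0) -> smoothn n f -> smoothn n (fun t => (f t)^-1).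
Proof.
move=> f0; elim: n => // n IH h; have [f' h1 h2] := h.
have h3 := IH (smoothn_pred h).
exists (fun t => (-1 * ((f t)^-1 * (f t)^-1)) * f' t).
  move=> t; apply: is_derive_eq (is_deriveV (f0 t) (h1 t)) _.
  by rewrite /GRing.scale /=; field.
by do 2?[apply: smoothnM => //]; [exact: smoothn_cst|exact: smoothnM].
Qed.

Lemma flat_ge0 k t : 0 <= flat k t.
Proof.
by rewrite /flat; case: ifP => // t0; apply: mulr_ge0; rewrite ?expR_ge0// invr_ge0 exprn_ge0// ltW.
Qed.

Lemma flat_gt0 k t : 0 < t -> 0 < flat k t.
Proof. by move=> t0; rewrite /flat t0; apply: mulr_gt0; rewrite ?expR_gt0// invr_gt0 exprn_gt0. Qed.

Definition step t : R := flat 0 t * (flat 0 t + flat 0 (1 - t))^-1.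

Lemma step_den_gt0 t : 0 < flat 0 t + flat 0 (1 - t).
Proof.
case: (ltP 0 t) => t0; first by rewrite ltr_pwDl ?flat_gt0 ?flat_ge0.
by rewrite ltr_wpDl ?flat_ge0 ?flat_gt0//; lra.
Qed.

Lemma smooth_step : smooth1 step.
Proof.
have e : (fun t : R => flat 0 (1 - t)) = (fun t => flat 0 (-1 * t + 1)).
  by apply/funext => t; congr flat; lra.
have h : smooth1 (fun t : R => flat 0 (1 - t)).
  by rewrite e => n; apply: smoothn_affine; exact: smooth_flat.
move=> n; apply: smoothnM; first exact: smooth_flat.
apply: smoothnV => [t|]; first by rewrite gt_eqF// step_den_gt0.
by apply: smoothnD; [exact: smooth_flat|exact: h].
Qed.

Lemma step0 t : t <= 0 -> step t = 0.
Proof. by move=> t0; rewrite /step {1}/flat ltNge t0 mul0r. Qed.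

Lemma step1 t : 1 <= t -> step t = 1.
Proof.
move=> t1; have := step_den_gt0 t; rewrite /step; have -> : flat 0 (1 - t) = 0 by rewrite /flat subr_gt0 ltNge t1.
rewrite addr0 => h.
by rewrite divff// gt_eqF.
Qed.

Lemma step_is_derive t : is_derive t 1 step (derive1 step t).
Proof. by have [d _] := smooth1_derive smooth_step; rewrite derive1E; exact: DeriveDef. Qed.

Lemma derive_step_ge0 t : 0 <= derive1 step t.
Proof.
have h1 := flat_derive 0 t; have h2 := flat_derive 0 (1 - t).
have h3 : is_derive t 1 (fun s : R => 1 - s) (-1).
  by apply: is_derive_eq; rewrite /GRing.scale /=; ring.
have h4 := @is_derive1_comp R (flat 0) (fun s => 1 - s) t _ _ h2 h3; have dt := step_den_gt0 t.
have h5 := @is_deriveV R (fun s => flat 0 s + flat 0 (1 - s)) t _ _ (lt0r_neq0 dt) (is_deriveD h1 h4).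
have h6 := is_deriveM h1 h5.
have -> : derive1 step t = (flat 2 t * flat 0 (1 - t) + flat 0 t * flat 2 (1 - t)) / (flat 0 t + flat 0 (1 - t)) ^+ 2.
  rewrite derive1E; have [_ ->] := h6; rewrite /GRing.scale /=; field; exact: lt0r_neq0.
by apply: mulr_ge0; rewrite ?invr_ge0 ?sqr_ge0//; apply: addr_ge0; apply: mulr_ge0; exact: flat_ge0.
Qed.

Lemma derive_step0 t : t < 0 \/ 1 < t -> derive1 step t = 0.
Proof.
move=> h; rewrite derive1E; case: h => ht.
  have h : {near t, (fun=> 0 : R) =1 step}.
    near=> s; rewrite step0// ltW//; near: s; exact: lt_nbhsl.
  by have [_ ->] := near_eq_is_derive h (is_derive_cst _ t 1).
have h : {near t, (fun=> 1 : R) =1 step}.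
  near=> s; rewrite step1// ltW//; near: s; exact: lt_nbhsr.
by have [_ ->] := near_eq_is_derive h (is_derive_cst _ t 1).
Unshelve. all: by end_near. Qed.

(* [plateau a b e] rises from 0 to 1 on [[a, a + e]] and falls back on [[b, b + e]]. *)
Definition plateau (a b e t : R) : R := step ((t - a) / e) - step ((t - b) / e).

Lemma smooth_plateau a b e : smooth1 (plateau a b e).
Proof.
have h (c : R) : smooth1 (fun t => step ((t - c) / e)).
  move=> n; have -> : (fun t : R => step ((t - c) / e)) = (fun t => step (e^-1 * t + (- c / e))).
    by apply/funext => t; congr step; ring.
  by apply: smoothn_affine; exact: smooth_step.
move=> n; have -> : plateau a b e = (fun t => step ((t - a) / e) + (-1) * step ((t - b) / e)).
  by apply/funext => t; rewrite /plateau mulN1r.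
by apply: smoothnD; [exact: h|apply: smoothnM; [exact: smoothn_cst|exact: h]].
Qed.

Lemma shifted_step_derive c e t : is_derive t 1 (fun t => step ((t - c) / e)) (derive1 step ((t - c) / e) / e).
Proof.
have h : is_derive t 1 (fun s : R => (s - c) / e) e^-1.
  by apply: is_derive_eq; rewrite /GRing.scale /=; ring.
exact: (is_derive1_comp (step_is_derive _) h).
Qed.

Lemma plateau_derive a b e t : derive1 (plateau a b e) t = derive1 step ((t - a) / e) / e - derive1 step ((t - b) / e) / e.
Proof.
by rewrite derive1E; have [_ e1] := is_deriveB (shifted_step_derive a e t) (shifted_step_derive b e t); exact: e1.
Qed.

End smooth_functions.

(** * From weak to classical derivatives in time *)

Section weak_derivative.
Context {R : realType}.
Local Notation mu := (@lebesgue_measure R).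
Implicit Types (f g h k : R -> R).

Lemma rint_continuous (a b : R) f : {in `[a, b], continuous f} -> rint `[a, b] f.
Proof.
move=> cf; apply: continuous_compact_integrable; first exact: segment_compact.
by apply: continuous_in_subspaceT => x /set_mem hx; exact: cf.
Qed.

Lemma continuous_derive_step (c e : R) : continuous (fun t : R => derive1 step ((t - c) / e) / e).
Proof.
have [_ s1] := smooth1_derive (@smooth_step R).
move=> t; apply: cvgM; last exact: cvg_cst.
apply: (@continuous_comp _ _ _ (fun t => (t - c) / e) (derive1 step)); last exact: smooth1_continuous.
by apply: cvgM; [apply: cvgB; [exact: cvg_id|exact: cvg_cst]|exact: cvg_cst].
Qed.

Lemma derive_step_mass (T c e : R) : 0 < c -> 0 < e -> c + e < T ->
  \int[mu]_(t in `[0, T]) (derive1 step ((t - c) / e) / e) = 1.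
Proof.
move=> c0 e0 cT.
have cD : {in `[0, T], continuous (fun t : R => derive1 step ((t - c) / e) / e)} by move=> x _; exact: continuous_derive_step.
have dD (x : R) : 0 <= x <= T -> is_derive x 1 (fun t => step ((t - c) / e)) (derive1 step ((x - c) / e) / e).
  by move=> _; exact: shifted_step_derive.
rewrite (FTC_closed _ cD dD); last first.
  by move: c0 e0 cT; lra.
rewrite step1 ?step0 ?subr0//.
  by rewrite sub0r pmulr_lle0 ?invr_gt0// oppr_le0 ltW.
by rewrite ler_pdivlMr// mul1r; lra.
Qed.

(** The derivative of the rescaled step is a nonnegative kernel of mass 1 concentrated on
    [[c, c + e]], hence an approximate identity at [c]. *)
Lemma derive_step_approx (T c e eta : R) k : 0 < c -> 0 < e -> c + e < T -> {in `[0, T], continuous k} ->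
  (forall t : R, c <= t <= c + e -> `|k t - k c| <= eta) ->
  `|\int[mu]_(t in `[0, T]) (derive1 step ((t - c) / e) / e * k t) - k c| <= eta.
Proof.
move=> c0 e0 cT ck hk; set B := fun t => derive1 step ((t - c) / e) / e.
have mD : measurable `[0, T]%classic by exact: measurable_itv.
have cB := @continuous_derive_step c e.
have B0 t : 0 <= B t by apply: mulr_ge0; [exact: derive_step_ge0|rewrite invr_ge0 ltW].
have iB : rint `[0, T] B by apply: rint_continuous => x _; exact: cB.
have iBk : rint `[0, T] (fun t => B t * k t).
  by apply: rint_continuous => x hx; apply: cvgM; [exact: cB|exact: ck].
have e1 : \int[mu]_(t in `[0, T]) (B t * k t) - k c = \int[mu]_(t in `[0, T]) (B t * (k t - k c)).
  rewrite -[X in _ - X]mulr1 -(derive_step_mass c0 e0 cT) -RintegralZl// -RintegralB//.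
    by apply: eq_Rintegral => t _; rewrite /B; ring.
  exact: rintZ.
rewrite e1 -[eta]mulr1 -(derive_step_mass c0 e0 cT) -RintegralZl//.
have iBd : rint `[0, T] (fun t => B t * (k t - k c)).
  by apply: rint_continuous => x hx; apply: cvgM; [exact: cB|apply: cvgB; [exact: ck|exact: cvg_cst]].
apply: le_trans (@le_normr_Rintegral _ _ R mu _ _ mD iBd) _.
apply: le_Rintegral => //; [exact: integrable_norm iBd|exact: rintZ|].
move=> t _; rewrite normrM ger0_norm// mulrC.
case: (leP c t) => ct; last by rewrite /B derive_step0 ?mul0r ?mulr0//; left; rewrite pmulr_llt0 ?invr_gt0// subr_lt0.
case: (leP t (c + e)) => te; last first.
  by rewrite /B derive_step0 ?mul0r ?mulr0//; right; rewrite ltr_pdivlMr// mul1r; lra.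
by apply: ler_wpM2r => //; apply: hk; rewrite ct.
Qed.

(** The derivative of a plateau is the difference of two approximate identities, at [a] and at [b];
    letting [e] tend to 0 compares [k a] with [k b]. *)
Lemma constant_of_weak (T : R) k : {in `[0, T], continuous k} ->
  (forall a b e : R, 0 < a -> a < b -> 0 < e -> b + e < T ->
    \int[mu]_(t in `[0, T]) (derive1 (plateau a b e) t * k t) = 0) ->
  forall a b : R, 0 < a -> a < b -> b < T -> k a = k b.
Proof.
move=> ck hw a b a0 ab bT; apply/eqP; rewrite -subr_eq0 -normr_le0; apply/ler_addgt0Pr => eta eta0.
have eta2 : 0 < eta / 2 by rewrite divr_gt0.
have near_c (c : R) : 0 < c -> c < T -> \forall e \near (0 : R)^'+, forall t : R, c <= t <= c + e -> `|k t - k c| <= eta / 2.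
  move=> c0 cT; have hc : c \in `[0, T] by rewrite in_itv /= !ltW.
  have /cvgrPdist_le/(_ _ eta2) := ck c hc; rewrite -nbhs_nearE => /nbhs_ballP[d /= d0 hd].
  near=> e => t /andP[h1 h2]; rewrite distrC; apply: hd; rewrite /ball /= ltr_norml.
  have : e < d by near: e; exact: nbhs_right_lt.
  by lra.
have tri (x y : R) : `|x - k a| <= eta / 2 -> `|y - k b| <= eta / 2 -> x - y = 0 -> `|k a - k b| <= 0 + eta.
  by move=> /ler_normlP[A1 A2] /ler_normlP[B1 B2] C; apply/ler_normlP; rewrite add0r; split; lra.
suff : \forall e \near (0 : R)^'+, `|k a - k b| <= 0 + eta by move=> /filter_ex [e].
near=> e.
have e0 : 0 < e by near: e; exact: nbhs_right_gt.
have ebT : e < T - b by near: e; apply: nbhs_right_lt; rewrite subr_gt0.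
have ha : forall t, a <= t <= a + e -> `|k t - k a| <= eta / 2 by near: e; apply: near_c => //; lra.
have hb : forall t, b <= t <= b + e -> `|k t - k b| <= eta / 2 by near: e; apply: near_c => //; lra.
have aT' : a + e < T by lra.
have bT' : b + e < T by lra.
have b0 : 0 < b by lra.
have A := derive_step_approx a0 e0 aT' ck ha.
have B := derive_step_approx b0 e0 bT' ck hb.
have := hw a b e a0 ab e0 bT'.
rewrite (_ : \int[mu]_(t in `[0, T]) (derive1 (plateau a b e) t * k t) =
  \int[mu]_(t in `[0, T]) (derive1 step ((t - a) / e) / e * k t) - \int[mu]_(t in `[0, T]) (derive1 step ((t - b) / e) / e * k t)); last first.
  have iB c : rint `[0, T] (fun t => derive1 step ((t - c) / e) / e * k t).
    by apply: rint_continuous => x hx; apply: cvgM; [exact: continuous_derive_step|exact: ck].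
  have mD : measurable `[0, T]%classic by exact: measurable_itv.
  rewrite -(@RintegralB _ _ R mu _ _ _ mD (iB a) (iB b)).
  by apply: eq_Rintegral => t _; rewrite plateau_derive mulrBl.
exact: tri A B.
Unshelve. all: by end_near. Qed.

(** Du Bois-Reymond: after subtraction of a primitive [G] of [g], the function [h - G] has zero weak
    derivative and is constant on [(0, T)]. *)
Lemma derivative_of_weak (T : R) h g : continuous h -> continuous g ->
  (forall a b e : R, 0 < a -> a < b -> 0 < e -> b + e < T ->
    \int[mu]_(t in `[0, T]) (derive1 (plateau a b e) t * h t) =
    - \int[mu]_(t in `[0, T]) (plateau a b e t * g t)) ->
  forall t : R, 0 < t -> t < T -> is_derive t 1 h (g t).
Proof.
move=> ch cg hw t0 t00 t0T.
(* The primitive starts at -1 so that it is differentiable at every point of [[0, T]], including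
   0. *)
pose G (x : R) := \int[mu]_(t in `[-1, x]) g t.
have dG (x : R) : -1 < x -> is_derive x 1 G (g x).
  move=> x1; have [||d e] := @continuous_FTC1_closed _ g (-1) x (x + 1) _ _ x1 (cg x).
  - by rewrite ltrDl.
  - by apply: rint_continuous => y _; exact: cg.
  by rewrite derive1E in e; exact: DeriveDef d e.
have cG (x : R) : -1 < x -> {for x, continuous G}.
  by move=> x1; apply: differentiable_continuous; apply/derivable1_diffP; have h1 := dG x x1; exact: ex_derive.
have ck : {in `[0, T], continuous (fun t => h t - G t)}.
  move=> x; rewrite in_itv /= => /andP[x0 _]; apply: cvgB; first exact: ch.
  by apply: cG; lra.
have T0 : 0 < T by lra.
have hk : forall a b e : R, 0 < a -> a < b -> 0 < e -> b + e < T ->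
    \int[mu]_(t in `[0, T]) (derive1 (plateau a b e) t * (h t - G t)) = 0.
  move=> a b e a0 ab e0 bT.
  have [dp sp] := smooth1_derive (@smooth_plateau R a b e).
  have cp := smooth1_continuous (@smooth_plateau R a b e).
  have cdp := smooth1_continuous sp.
  have i1 : rint `[0, T] (fun t => derive1 (plateau a b e) t * h t).
    by apply: rint_continuous => x hx; apply: cvgM; [exact: cdp|exact: ch].
  have cinG x : x \in `[0, T] -> {for x, continuous G}.
    by rewrite in_itv /= => /andP[x0 _]; apply: cG; lra.
  have i2 : rint `[0, T] (fun t => derive1 (plateau a b e) t * G t).
    by apply: rint_continuous => x hx; apply: cvgM; [exact: cdp|exact: cinG].
  have i3 : rint `[0, T] (fun t => plateau a b e t * g t).
    by apply: rint_continuous => x hx; apply: cvgM; [exact: cp|exact: cg].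
  have e1 : \int[mu]_(t in `[0, T]) (plateau a b e t * g t + derive1 (plateau a b e) t * G t) = 0.
    have pT : plateau a b e T = 0.
      by rewrite /plateau !step1 ?subrr// ler_pdivlMr// mul1r; lra.
    have p0 : plateau a b e 0 = 0.
      rewrite /plateau !step0 ?subrr//; rewrite sub0r pmulr_lle0 ?invr_gt0//; lra.
    have cD : {in `[0, T], continuous (fun t => plateau a b e t * g t + derive1 (plateau a b e) t * G t)}.
      move=> x hx; apply: cvgD; apply: cvgM; [exact: cp|exact: cg|exact: cdp|exact: cinG].
    have dD (x : R) : 0 <= x <= T -> is_derive x 1 (fun t => plateau a b e t * G t) (plateau a b e x * g x + derive1 (plateau a b e) x * G x).
      move=> /andP[x0 _]; have x1 : -1 < x by lra.
      have h1 : is_derive x 1 (plateau a b e) (derive1 (plateau a b e) x) by rewrite derive1E; apply: DeriveDef => //; exact: dp.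
      have h2 := is_deriveM h1 (dG x x1).
      by apply: is_derive_eq h2 _; rewrite /GRing.scale /=; ring.
    by rewrite (FTC_closed T0 cD dD) pT p0 !mul0r subrr.
  have e2 := hw a b e a0 ab e0 bT.
  have mD : measurable `[0, T]%classic by exact: measurable_itv.
  rewrite (@RintegralD _ _ R mu _ _ _ mD i3 i2) in e1.
  under eq_Rintegral do rewrite mulrBr.
  rewrite (@RintegralB _ _ R mu _ _ _ mD i1 i2).
  by rewrite e2 -opprD e1 oppr0.
have kc := constant_of_weak ck hk.
have key : {near t0, (fun t => (h t0 - G t0) + G t) =1 h}.
  near=> t.
  have tt0 : 0 < t by near: t; exact: lt_nbhsr.
  have ttT : t < T by near: t; exact: lt_nbhsl.
  have -> : h t0 - G t0 = h t - G t.
    by case: (ltgtP t t0) => [lt|lt|->//]; [rewrite -(kc t t0)|rewrite (kc t0 t)].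
  by rewrite subrK.
apply: near_eq_is_derive key _.
have h1 : -1 < t0 by lra.
have h2 := is_deriveD (is_derive_cst (h t0 - G t0) t0 1) (dG t0 h1).
by apply: is_derive_eq h2 _; rewrite add0r.
Unshelve. all: by end_near. Qed.

End weak_derivative.

Section weak_equation.
Context {R : realType}.
Local Notation mu := (@lebesgue_measure R).
Local Notation Re := (@complex.Re R).
Local Notation Im := (@complex.Im R).
Local Notation torus := (@torus R).
Local Notation pi := (@trigo.pi R).

Lemma fourier_coef_monomial (z : R[i]) (m n : int) :
  fourier_coef (fun x => z * cexp (m%:~R * x)) n = if m == n then z else 0.
Proof.
have := @fourier_coef_trig R int [:: m] (fun=> z) id n; rewrite big_seq1 => <-.
by congr fourier_coef; apply/funext => x; rewrite big_seq1.
Qed.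

Lemma frac_laplacian_monomial (alpha : R) (z : R[i]) (m : int) x :
  frac_laplacian alpha (fun x => z * cexp (m%:~R * x)) x = (`|m%:~R| `^ (2 * alpha))%:C * (z * cexp (m%:~R * x)).
Proof.
rewrite /frac_laplacian /fourier_multiplier; set w := RHS.
set S := fun N : nat => _.
have hS : \forall N \near \oo, S N = w.
  near=> N; rewrite /S /=.
  transitivity (\sum_(n <- freqs N) (if n == m then w else 0)).
    have -> : freqs N = [seq k%:Z - N%:Z | k <- index_iota 0 (2 * N).+1] by rewrite /index_iota subn0.
    rewrite big_map big_mkord; apply: eq_bigr => k _.
    rewrite fourier_coef_monomial eq_sym; case: eqP => [->|_]; last by rewrite mulr0 mul0r.
    by rewrite /w mulrA.
  rewrite sum_eq_freq ?uniq_freqs// mem_freqs ifT//.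
  by near: N; exact: nbhs_infty_ge.
have h1 : \forall N \near \oo, Re (S N) = Re w by apply: filterS hS => N ->.
have h2 : \forall N \near \oo, Im (S N) = Im w by apply: filterS hS => N ->.
by rewrite /climn (lim_near_cst _ h1)// (lim_near_cst _ h2)//; case: (w).
Unshelve. all: by end_near. Qed.

(** The conjugate character makes integration against it pick out the [n]-th coefficient. *)
Definition wave (p : R -> R) (n : int) (t x : R) : R[i] := (p t)%:C * cexp (- (n%:~R * x)).

Lemma wave_ReIm p n : (fun t x => Re (wave p n t x)) = (fun t x => p t * cos (- (n%:~R * x))) /\
  (fun t x => Im (wave p n t x)) = (fun t x => p t * sin (- (n%:~R * x))).
Proof. by split; apply/funext => t; apply/funext => x; rewrite /wave /cexp /=; ring. Qed.

Lemma csmooth_wave p n : smooth1 p -> csmooth (wave p n).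
Proof.
move=> sp; have [e1 e2] := wave_ReIm p n; split; rewrite ?e1 ?e2; apply: smooth_prod => // k.
  have := @smoothn_trig R k 1 0 (- n%:~R); congr smoothn; apply/funext => x.
  by rewrite mul1r mul0r addr0 mulNr.
have := @smoothn_trig R k 0 1 (- n%:~R); congr smoothn; apply/funext => x.
by rewrite mul1r mul0r add0r mulNr.
Qed.

Lemma cpartial_t_wave (p : R -> R) n (t x : R) : derivable p t 1 -> cpartial_t (wave p n) t x = wave (derive1 p) n t x.
Proof.
move=> dp; have [e1 e2] := wave_ReIm p n; rewrite /cpartial_t e1 e2 /partial_t.
have h (y : R) : derive1 (fun t => p t * y) t = derive1 p t * y.
  have a : is_derive t 1 p (derive1 p t) by rewrite derive1E; exact: DeriveDef.
  have [_ e] := is_deriveM a (is_derive_cst y t 1); rewrite derive1E.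
  transitivity ('D_1 (p * cst y) t) => //; rewrite e /GRing.scale /=; ring.
by rewrite !h /wave /cexp /=; congr (_ +i* _); ring.
Qed.

Lemma test_function_wave (T a b e : R) n : 0 < a -> a < b -> 0 < e -> b + e < T -> test_function T (wave (plateau a b e) n).
Proof.
move=> a0 ab e0 bT; split.
- by apply: csmooth_wave; exact: smooth_plateau.
- move=> t x; rewrite /wave mulrDr opprD cexpD; congr (_ * _).
  have -> : - (n%:~R * (2 * pi)) = (- n)%:~R * (2 * pi) :> R by rewrite rmorphN mulNr.
  by rewrite cexp_2pi mulr1.
- exists a, (b + e); split=> // t x; rewrite in_itv /= negb_and -!ltNge => h.
  rewrite /wave /plateau; case/orP: h => h.
    by rewrite !step0 ?subrr ?mul0r// pmulr_lle0 ?invr_gt0//; lra.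
  by rewrite !step1 ?subrr ?mul0r// ler_pdivlMr// mul1r; lra.
Qed.

Lemma cintegral_wave (f : R -> R[i]) (p : R -> R) n t : cint torus (fun x => f x * cexp (- (n%:~R * x))) ->
  cintegral torus (fun x => f x * wave p n t x) = (2 * pi)%:C * ((p t)%:C * fourier_coef f n).
Proof.
move=> hf; rewrite /fourier_coef.
rewrite [in RHS]mulrCA [X in _ = _ * X]mulrA -rmorphM /= mulfV ?lt0r_neq0 ?pi2_gt0// mul1r.
rewrite -(cintegralZ (@measurable_torus R))//.
by apply: eq_cintegral => x _; rewrite /wave mulrCA.
Qed.

Lemma cint_continuous (D : R * R) (z : R -> R[i]) : continuous (Re \o z) -> continuous (Im \o z) -> cint `[D.1, D.2] z.
Proof. by move=> c1 c2; split; apply: rint_continuous => x _; [exact: c1|exact: c2]. Qed.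

Lemma continuous_cmul (p : R -> R) (z : R -> R[i]) : continuous p -> continuous (Re \o z) -> continuous (Im \o z) ->
  continuous (Re \o (fun t => (p t)%:C * z t)) /\ continuous (Im \o (fun t => (p t)%:C * z t)).
Proof.
move=> cp c1 c2.
have -> : Re \o (fun t => (p t)%:C * z t) = (fun t => p t * Re (z t)).
  by apply/funext => t /=; case: (z t) => x y /=; ring.
have -> : Im \o (fun t => (p t)%:C * z t) = (fun t => p t * Im (z t)).
  by apply/funext => t /=; case: (z t) => x y /=; ring.
by split=> x; apply: cvgM; [exact: cp|exact: c1|exact: cp|exact: c2].
Qed.

(** Testing with waves whose profile is a plateau gives the equation for [c] in the weak sense, and
    continuity of [c] and [F] upgrades it. These are continuous on the whole line and represent the
    coefficients on [[0, T]] only. *)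
Lemma fourier_ode (alpha T : R) (sgn : bool) (u : R -> R -> R[i]) (c F : R -> R[i]) (n : int) :
  fNLS_distr alpha T sgn u ->
  (forall t : R, t \in `[0, T] -> cint torus (u t)) ->
  (forall t : R, t \in `[0, T] -> cint torus (fun x => (normc (u t x) ^+ 2)%:C * u t x * cexp (- (n%:~R * x)))) ->
  (forall t : R, t \in `[0, T] -> fourier_coef (u t) n = c t) ->
  (forall t : R, t \in `[0, T] -> fourier_coef (fun x => (normc (u t x) ^+ 2)%:C * u t x) n = F t) ->
  continuous (Re \o c) -> continuous (Im \o c) -> continuous (Re \o F) -> continuous (Im \o F) ->
  forall t : R, 0 < t -> t < T ->
    cder c t ('i * (`|n%:~R| `^ (2 * alpha))%:C * c t + - ('i * (-1) ^+ sgn) * F t).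
Proof.
move=> hd hu hF uc uF c1 c2 F1 F2; set m := `|_| `^ _.
set G := fun t : R => 'i * m%:C * c t + - ('i * (-1) ^+ sgn) * F t.
pose D : set R := `[0, T]%classic; have mD : measurable D by exact: measurable_itv.
pose J (p : R -> R) (z : R -> R[i]) : R[i] := cintegral D (fun t => (p t)%:C * z t).
have cJ (p : R -> R) (z : R -> R[i]) : continuous p -> continuous (Re \o z) -> continuous (Im \o z) -> cint D (fun t => (p t)%:C * z t).
  by move=> h1 h2 h3; have [h4 h5] := continuous_cmul h1 h2 h3; exact: (@cint_continuous (0, T)).
have weak (a b e : R) : 0 < a -> a < b -> 0 < e -> b + e < T -> J (derive1 (plateau a b e)) c = - J (plateau a b e) G.
  move=> a0 ab e0 bT; set p := plateau a b e.
  have sp : smooth1 p by exact: smooth_plateau.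
  have cp := smooth1_continuous sp.
  have [dp /smooth1_continuous cdp] := smooth1_derive sp.
  have pi0 : (2 * pi)%:C != 0 :> R[i] by rewrite fmorph_eq0 lt0r_neq0// pi2_gt0.
  have pair (w : R -> R -> R[i]) (k : R -> R[i]) q phi : (forall t x, phi t x = wave q n t x) ->
      (forall t : R, t \in `[0, T] -> cint torus (fun x => w t x * cexp (- (n%:~R * x)))) ->
      (forall t : R, t \in `[0, T] -> fourier_coef (w t) n = k t) ->
      cint D (fun t => (q t)%:C * k t) -> pairing T w phi = (2 * pi)%:C * J q k.
    move=> ephi wi wk iq; rewrite /pairing /J -(cintegralZ mD)//; apply: eq_cintegral => t Dt.
    rewrite -(wk _ Dt) -cintegral_wave; last exact: wi.
    by apply: eq_cintegral => x _; rewrite ephi.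
  have hui (t : R) : t \in `[0, T] -> cint torus (fun x => u t x * cexp (- (n%:~R * x))).
    by move=> /hu h; have := cint_fourier (- n%:~R) h; under eq_fun do rewrite mulNr.
  have := hd _ (test_function_wave n a0 ab e0 bT).
  rewrite (pair u c (derive1 p) (cpartial_t (wave (plateau a b e) n)))//; last 2 first.
  - by move=> t x; exact: cpartial_t_wave.
  - exact: cJ.
  rewrite (pair (fun t x => (normc (u t x) ^+ 2)%:C * u t x) F p)//; last exact: cJ.
  have -> : pairing T u (fun t => frac_laplacian alpha (wave (plateau a b e) n t)) = (2 * pi)%:C * (m%:C * J p c).
    rewrite (pair u c (fun t => m * p t)) //; last 2 first.
    - move=> t x; have -> : wave (plateau a b e) n t = (fun x => (p t)%:C * cexp ((- n)%:~R * x)).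
        by apply/funext => y; rewrite /wave rmorphN /= mulNr.
      rewrite frac_laplacian_monomial rmorphN /= normrN mulrA mulNr /wave; congr (_ * _).
      by rewrite -rmorphM.
    - apply: (eq_cint mD (f := fun t => m%:C * ((p t)%:C * c t))).
        by move=> t _; rewrite mulrA -rmorphM.
      by apply: cintZ => //; exact: cJ.
    congr (_ * _); rewrite /J -(cintegralZ mD); last exact: cJ.
    by apply: eq_cintegral => t _; rewrite mulrA -rmorphM.
  have -> : (0 +i* 1 : R[i]) = 'i by [].
  (* The tested equation is multiplied by ['i] to solve it for the term with the derivative. *)
  move=> eq; have ii : 'i * 'i = -1 :> R[i] by rewrite -expr2 sqr_i.
  have JG : J p G = 'i * m%:C * J p c + - ('i * (-1) ^+ sgn) * J p F.
    have ic := cJ p c cp c1 c2; have iF := cJ p F cp F1 F2.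
    transitivity (cintegral D (fun t => 'i * m%:C * ((p t)%:C * c t) + - ('i * (-1) ^+ sgn) * ((p t)%:C * F t))).
      by apply: eq_cintegral => t _; rewrite /G; ring.
    by rewrite (cintegralD mD (cintZ mD _ ic) (cintZ mD _ iF)) (cintegralZ mD _ ic) (cintegralZ mD _ iF).
  rewrite JG; apply: (mulfI pi0).
  have -> : (2 * pi)%:C * J (derive1 p) c = - ('i * 'i) * ((2 * pi)%:C * J (derive1 p) c) by rewrite ii opprK mul1r.
  have -> : - ('i * 'i) * ((2 * pi)%:C * J (derive1 p) c) = 'i * ('i * - ((2 * pi)%:C * J (derive1 p) c)) by ring.
  have -> : 'i * - ((2 * pi)%:C * J (derive1 p) c) = (-1) ^+ sgn * ((2 * pi)%:C * J p F) - (2 * pi)%:C * (m%:C * J p c).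
    by rewrite -eq addrK.
  by ring.
have cG : continuous (Re \o G) /\ continuous (Im \o G).
  have lin (z1 z2 : R[i]) (p q : R -> R[i]) : continuous (Re \o p) -> continuous (Im \o p) ->
      continuous (Re \o q) -> continuous (Im \o q) ->
      continuous (Re \o (fun t => z1 * p t + z2 * q t)) /\ continuous (Im \o (fun t => z1 * p t + z2 * q t)).
    move=> p1 p2 q1 q2; case: z1 => x1 y1; case: z2 => x2 y2; split.
      have -> : Re \o (fun t => (x1 +i* y1) * p t + (x2 +i* y2) * q t) =
         (fun t => x1 * Re (p t) - y1 * Im (p t) + (x2 * Re (q t) - y2 * Im (q t))).
        by apply/funext => t /=; case: (p t); case: (q t).
      move=> t; apply: cvgD; apply: cvgB; apply: cvgM; (try exact: cvg_cst); [exact: p1|exact: p2|exact: q1|exact: q2].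
    have -> : Im \o (fun t => (x1 +i* y1) * p t + (x2 +i* y2) * q t) =
       (fun t => x1 * Im (p t) + y1 * Re (p t) + (x2 * Im (q t) + y2 * Re (q t))).
      by apply/funext => t /=; case: (p t); case: (q t).
    move=> t; apply: cvgD; apply: cvgD; apply: cvgM; (try exact: cvg_cst); [exact: p2|exact: p1|exact: q2|exact: q1].
  exact: lin.
have weakRe (a b e : R) : 0 < a -> a < b -> 0 < e -> b + e < T -> 
   \int[mu]_(t in `[0, T]) (derive1 (plateau a b e) t * Re (c t)) =
    - \int[mu]_(t in `[0, T]) (plateau a b e t * Re (G t)).
  move=> a0 ab e0 bT; have := congr1 Re (weak a b e a0 ab e0 bT).
  rewrite raddfN /= => h; have ReM (y : R) (z : R[i]) : Re (y%:C * z) = y * Re z by case: z => x1 y1 /=; ring.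
  by move: h; congr (_ = - _); apply: eq_Rintegral => t _; rewrite ReM.
have weakIm (a b e : R) : 0 < a -> a < b -> 0 < e -> b + e < T -> 
   \int[mu]_(t in `[0, T]) (derive1 (plateau a b e) t * Im (c t)) =
    - \int[mu]_(t in `[0, T]) (plateau a b e t * Im (G t)).
  move=> a0 ab e0 bT; have := congr1 Im (weak a b e a0 ab e0 bT).
  rewrite raddfN /= => h; have ImM (y : R) (z : R[i]) : Im (y%:C * z) = y * Im z by case: z => x1 y1 /=; ring.
  by move: h; congr (_ = - _); apply: eq_Rintegral => t _; rewrite ImM.
move=> t t0 tT; split.
  exact: (derivative_of_weak c1 cG.1 weakRe).
exact: (derivative_of_weak c2 cG.2 weakIm).
Qed.

End weak_equation.

(** * Compactness in time *)

Section cubic_estimates.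
Context {R : realType}.
Variable b : R.
Hypotheses (hb : 3^-1 <= b < 1) (hrr : 3 * b - 1 <= b).
Local Notation rr := (3 * b - 1).
Local Notation Re := (@complex.Re R).
Local Notation Im := (@complex.Im R).
Implicit Types (r : seq int) (a : int -> R[i]).

Definition trilinear_lipschitz (C : R) := forall r a a' B delta n, uniq r -> 0 <= B -> 0 <= delta ->
  nX b r (fun n => normc (a n)) B -> nX b r (fun n => normc (a' n)) B ->
  nX b r (fun n => normc (a n - a' n)) delta ->
  jb n `^ (rr / 2) * normc (cubic r a n - cubic r a' n) <= C * B ^+ 2 * delta.

Lemma normc_triple_sub (p1 p2 p3 q1 q2 q3 : R[i]) :
  normc (p1 * conjc p2 * p3 - q1 * conjc q2 * q3) <= normc (p1 - q1) * normc p2 * normc p3 +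
    (normc q1 * normc (p2 - q2) * normc p3 + normc q1 * normc q2 * normc (p3 - q3)).
Proof.
have -> : p1 * conjc p2 * p3 - q1 * conjc q2 * q3 =
  (p1 - q1) * conjc p2 * p3 + (q1 * conjc (p2 - q2) * p3 + q1 * conjc q2 * (p3 - q3)).
  by rewrite rmorphB; ring.
apply: le_trans (normc_le_add _ _) _; rewrite !normcM normc_conj lerD2l.
by apply: le_trans (normc_le_add _ _) _; rewrite !normcM !normc_conj.
Qed.

Lemma cubic_lipschitz : exists2 C : R, 0 < C & trilinear_lipschitz C.
Proof.
have [C [C0 h]] := weak_product hb hrr.
exists (3 * C); first by rewrite mulr_gt0.
move=> r a a' B dl n ur B0 d0 ha ha' hd.
pose x m := normc (a m); pose y m := normc (a' m); pose d m := normc (a m - a' m).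
have x0 m : 0 <= x m by exact: normc_ge0.
have y0 m : 0 <= y m by exact: normc_ge0.
have dd0 m : 0 <= d m by exact: normc_ge0.
have h1 := h r d x x dl B B n ur dd0 x0 x0 d0 B0 B0 hd ha ha.
have h2 := h r y d x B dl B n ur y0 dd0 x0 B0 d0 B0 ha' hd ha.
have h3 := h r y y d B B dl n ur y0 y0 dd0 B0 B0 d0 ha' ha' hd.
have e : C * dl * B * B + (C * B * dl * B + C * B * B * dl) = 3 * C * B ^+ 2 * dl by ring.
rewrite -e; apply: le_trans (lerD h1 (lerD h2 h3)); rewrite -!mulrDr; apply: ler_wpM2l; first exact: powR_ge0.
rewrite /cubic /tri -sumrB -!big_split /=; apply: le_trans (normc_sum _ _) _; apply: ler_sum => n1 _.
rewrite -sumrB -!big_split /=; apply: le_trans (normc_sum _ _) _; apply: ler_sum => n3 _.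
case: ifP => _; last by rewrite subrr normc0 !addr0.
by rewrite !mul1r; exact: normc_triple_sub.
Qed.

Lemma ccvg_normc_le (z : nat -> R[i]) l c : ccvg z l -> (\forall k \near \oo, normc (z k) <= c) -> normc l <= c.
Proof.
move=> [h1 h2] hz; have c0 : 0 <= c by have [k hk] := filter_ex hz; exact: le_trans (normc_ge0 _) hk.
rewrite -ler_sqr ?nnegrE ?normc_ge0// sqr_normc_ReIm.
have h3 : Re (z k) ^+ 2 + Im (z k) ^+ 2 @[k --> \oo] --> Re l ^+ 2 + Im l ^+ 2.
  by apply: cvgD; rewrite !expr2; under eq_fun do rewrite expr2; exact: cvgM.
apply: ler_cvg_to h3 (cvg_cst (c ^+ 2)) _; near=> k.
by rewrite -sqr_normc_ReIm ler_sqr ?nnegrE ?normc_ge0//; near: k.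
Unshelve. all: by end_near. Qed.

Lemma ccvgB (z w : nat -> R[i]) l m : ccvg z l -> ccvg w m -> ccvg (fun k => z k - w k) (l - m).
Proof.
move=> [h1 h2] [h3 h4]; split.
  by rewrite raddfB /=; under eq_fun do rewrite raddfB /=; exact: cvgB.
by rewrite raddfB /=; under eq_fun do rewrite raddfB /=; exact: cvgB.
Qed.

Lemma ccvg_near_cst (z : nat -> R[i]) l : (\forall k \near \oo, z k = l) -> ccvg z l.
Proof.
by move=> h; split; apply: cvg_near_cst; apply: filterS h => k ->.
Qed.

Lemma limit_lipschitz C a a' F F' B delta n : trilinear_lipschitz C -> 0 <= B -> 0 <= delta ->
  (forall r, uniq r -> nX b r (fun n => normc (a n)) B) -> (forall r, uniq r -> nX b r (fun n => normc (a' n)) B) ->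
  (forall r, uniq r -> nX b r (fun n => normc (a n - a' n)) delta) ->
  ccvg (fun k => cubic (freqs (2 ^ k)) a n) F -> ccvg (fun k => cubic (freqs (2 ^ k)) a' n) F' ->
  jb n `^ (rr / 2) * normc (F - F') <= C * B ^+ 2 * delta.
Proof.
move=> hC B0 d0 ha ha' hd cF cF'; have j0 : 0 < jb n `^ (rr / 2) by rewrite powR_gt0 ?jb_gt0.
rewrite -ler_pdivlMl//; apply: ccvg_normc_le (ccvgB cF cF') _; near=> k.
by rewrite ler_pdivlMl//; apply: hC => //; first exact: uniq_freqs; [apply: ha|apply: ha'|apply: hd]; exact: uniq_freqs.
Unshelve. all: by end_near. Qed.

Lemma sum_restrict (V : nmodType) r r' (G : int -> V) : uniq r -> uniq r' -> {subset r <= r'} ->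
  \sum_(n <- r') (if n \in r then G n else 0) = \sum_(n <- r) G n.
Proof.
move=> ur ur' rr'; rewrite -big_mkcond -big_filter; apply: perm_big; apply: uniq_perm => //; first exact: filter_uniq.
by move=> n; rewrite mem_filter andb_idr//; exact: rr'.
Qed.

Definition truncation r a (n : int) : R[i] := if n \in r then a n else 0.

Lemma cubic_truncation r r' a n : uniq r -> uniq r' -> {subset r <= r'} -> cubic r' (truncation r a) n = cubic r a n.
Proof.
move=> ur ur' rr'; rewrite /cubic -(sum_restrict _ ur ur' rr'); apply: eq_bigr => n1 _.
rewrite /truncation; case: ifP => h1; last by rewrite big1// => n3 _; case: ifP => // _; rewrite !mul0r.
rewrite -(sum_restrict _ ur ur' rr'); apply: eq_bigr => n3 _.
case: (boolP (n1 + n3 - n \in r)) => [h2|_]; last by rewrite conjc0 mulr0 mul0r; case: ifP => _; case: ifP.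
by rewrite rr'//; case: ifP => // _; rewrite mulr0.
Qed.

(** The cubic sum over a window is the nonlinearity of the truncated sequence, whose approximations
    are eventually constant. The error is thus a difference of two values of the nonlinearity, to
    which the Lipschitz bound applies. *)
Lemma truncation_error C a F B delta N n : trilinear_lipschitz C -> 0 <= B -> 0 <= delta ->
  (forall r, uniq r -> nX b r (fun n => normc (a n)) B) ->
  (forall r, uniq r -> nX b r (fun n => normc (a n - truncation (freqs N) a n)) delta) ->
  ccvg (fun k => cubic (freqs (2 ^ k)) a n) F ->
  jb n `^ (rr / 2) * normc (F - cubic (freqs N) a n) <= C * B ^+ 2 * delta.
Proof.
move=> hC B0 d0 ha hd cF; apply: (limit_lipschitz hC B0 d0 ha _ hd cF).
  move=> r ur; apply: le_trans (ha r ur); apply: ler_sum => m _; apply: ler_wpM2l; first exact: powR_ge0.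
  by rewrite ler_sqr ?nnegrE ?normc_ge0// /truncation; case: ifP => // _; rewrite normc0 normc_ge0.
apply: ccvg_near_cst; near=> k; apply: cubic_truncation; rewrite ?uniq_freqs// => m.
rewrite !mem_freqs => /leq_trans; apply; apply: (@leq_trans k); last by rewrite ltnW// ltn_expl.
by near: k; exact: nbhs_infty_ge.
Unshelve. all: by end_near. Qed.

(** Some finite set almost attains the supremum of the weighted sums, so every finite set disjoint
    from it has a small sum. *)
Lemma tail_small a B eps : 0 < eps -> (forall r, uniq r -> nX b r (fun n => normc (a n)) B) ->
  exists N, forall r, uniq r -> nX b r (fun n => normc (a n - truncation (freqs N) a n)) eps.
Proof.
move=> eps0 ha; pose w m := jb m `^ b * normc (a m) ^+ 2.
have w0 m : 0 <= w m by apply: mulr_ge0; [exact: powR_ge0|exact: sqr_ge0].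
pose E : set R := [set x | exists2 r, uniq r & x = \sum_(m <- r) w m].
have ubE : ubound E (B ^+ 2) by move=> x [r ur ->]; exact: ha.
have hE : has_sup E by split; [exists (\sum_(m <- [::]) w m), [::]|exists (B ^+ 2)].
have [x [r0 ur0 ->] hx] := sup_adherent (exprn_gt0 2 eps0) hE.
exists (\max_(m <- r0) `|m|)%N => r ur; rewrite /nX; set K := freqs _.
have hK m : m \in r0 -> m \in K by move=> hm; rewrite mem_freqs; exact: leq_bigmax_seq.
pose r1 := [seq m <- r | m \notin r0].
have -> : \sum_(m <- r) jb m `^ b * normc (a m - truncation K a m) ^+ 2 = \sum_(m <- r) (if m \notin K then w m else 0).
  by apply: eq_bigr => m _; rewrite /truncation; case: ifP => /= _; rewrite ?subr0// subrr normc0 expr0n mulr0.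
apply: (@le_trans _ _ (\sum_(m <- r1) w m)).
  rewrite big_filter [leRHS]big_mkcond; apply: ler_sum => m _; case: ifPn => hm; last by case: ifP.
  by rewrite ifT//; apply: contra hm => /hK.
have h : \sum_(m <- r1 ++ r0) w m <= sup E.
  apply: sup_upper_bound => //; exists (r1 ++ r0) => //; rewrite cat_uniq ur0 filter_uniq//= andbT.
  by apply/hasPn => m hm; rewrite mem_filter hm.
by move: h; rewrite big_cat /= => h; move: h hx; lra.
Qed.

End cubic_estimates.

Section sobolev_norm.
Context {R : realType}.

Lemma compact_uniform (T : R) (P : R -> nat -> Prop) : (forall t N M, (N <= M)%N -> P t N -> P t M) ->
  (forall t, 0 <= t <= T -> exists N, exists2 del : R, 0 < del & forall t', 0 <= t' <= T -> `|t' - t| < del -> P t' N) ->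
  exists N, forall t, 0 <= t <= T -> P t N.
Proof.
move=> mono loc.
have /compact_near_coveringP/(_ nat \oo (fun N t => 0 <= t <= T -> P t N) _) := @segment_compact R 0 T.
case=> [t /=|N _ hN].
  rewrite in_itv /= => /loc[N [del del0 h]]; exists (ball t del, [set M | (N <= M)%N]).
    by split; [exact: nbhsx_ballx|exact: nbhs_infty_ge].
  by move=> [t' M] /= [tt' NM] ht'; apply: mono NM (h _ ht' _); rewrite distrC.
exists N => t ht; apply: (hN N (leqnn N)) => //; by rewrite /= in_itv.
Qed.

(** From [(1 + |n|)^2 <= 2 (1 + n^2)], raised to the power [b / 2 <= s]; the constant is
    [2^(b / 2) <= 2]. *)
Lemma jb_powR_le (b s : R) n : 0 <= b <= 1 -> b <= 2 * s -> jb n `^ b <= 2 * (1 + n%:~R ^+ 2) `^ s.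
Proof.
move=> /andP[b0 b1] bs; set y : R := 1 + n%:~R ^+ 2.
have y1 : 1 <= y by rewrite lerDl sqr_ge0.
have j2 : jb n ^+ 2 <= 2 * y.
  by rewrite /jb /y -[n%:~R ^+ 2]real_normK ?num_real//; set z := `|_|; have := sqr_ge0 (z - 1); nra.
have e : jb n `^ b = (jb n ^+ 2) `^ (b / 2) by rewrite -powR_mulrn ?(ltW (jb_gt0 n))// -powRrM mulrC divfK.
have b2 : 0 <= b / 2 by rewrite divr_ge0.
have y0 : 0 <= y by exact: le_trans y1.
rewrite e; apply: (@le_trans _ _ ((2 * y) `^ (b / 2))).
  by apply: ge0_ler_powR => //; rewrite ?nnegrE ?sqr_ge0// mulr_ge0.
rewrite powRM//; apply: ler_pM; rewrite ?powR_ge0//.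
  by rewrite -[leRHS]powRr1//; apply: ler_powR; lra.
by apply: ler_powR => //; lra.
Qed.

Lemma Hs_norm_sum (s H : R) (f : R -> R[i]) r : 0 <= H -> (Hs_norm s f <= H%:E)%E -> uniq r ->
  \sum_(n <- r) (1 + n%:~R ^+ 2) `^ s * normc (fourier_coef f n) ^+ 2 <= H ^+ 2.
Proof.
move=> H0; rewrite /Hs_norm; set E := esum _ _ => hE ur; pose w (n : int) : R := (1 + n%:~R ^+ 2) `^ s * normc (fourier_coef f n) ^+ 2.
have w0 n : 0 <= w n by apply: mulr_ge0; [exact: powR_ge0|exact: sqr_ge0].
have E0 : (0 <= E)%E by apply: esum_ge0 => n _; rewrite lee_fin; exact: w0.
have EH : (E <= (H ^+ 2)%:E)%E.
  have -> : E = poweR (poweR E 2^-1) 2 by rewrite -poweRrM mulVf// poweRe1.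
  rewrite -powR_mulrn// -poweR_EFin; apply: gt0_ler_poweR => //.
  - by rewrite in_itv /= poweR_ge0 leey.
  - by rewrite in_itv /= lee_fin H0 leey.
rewrite -lee_fin; apply: le_trans EH; rewrite -sumEFin.
apply: esum_ge; exists [set` r]; first by split; [exact: finite_seq|].
by rewrite fsbig_seq.
Qed.

Lemma Hs_nX (b s H : R) (f : R -> R[i]) r : 0 <= b <= 1 -> b <= 2 * s -> 0 <= H -> (Hs_norm s f <= H%:E)%E -> uniq r ->
  nX b r (fun n => normc (fourier_coef f n)) (2 * H).
Proof.
move=> hb bs H0 hH ur; have h := Hs_norm_sum H0 hH ur; rewrite /nX.
apply: (@le_trans _ _ (2 * H ^+ 2)); last by rewrite exprMn; have := sqr_ge0 H; lra.
apply: le_trans (ler_wpM2l _ h) => //; rewrite mulr_sumr; apply: ler_sum => n _.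
by rewrite [leRHS]mulrA; apply: ler_wpM2r; [exact: sqr_ge0|exact: jb_powR_le].
Qed.

End sobolev_norm.

Section curves.
Context {R : realType}.
Local Notation mu := (@lebesgue_measure R).
Local Notation Re := (@complex.Re R).
Local Notation Im := (@complex.Im R).
Local Notation torus := (@torus R).
Variables (b s T : R) (u : R -> R -> R[i]).
Hypotheses (b01 : 0 <= b <= 1) (bs : b <= 2 * s) (hu : C_Hs s T u).
Implicit Types (t : R) (r : seq int).

Let A t n : R[i] := fourier_coef (u t) n.

Lemma curve_L2T t : 0 <= t <= T -> L2T (u t).
Proof. by move=> ht; have [h _] := hu; have [] := h t; rewrite ?in_itv. Qed.

Lemma curve_continuous t0 eps : 0 <= t0 <= T -> 0 < eps -> exists2 del, 0 < del &
  forall t, 0 <= t <= T -> `|t - t0| < del -> forall r, uniq r -> nX b r (fun n => normc (A t n - A t0 n)) eps.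
Proof.
move=> ht0 eps0; have [_ hc] := hu.
have eps2 : 0 < eps / 2 by rewrite divr_gt0.
have h0 : nbhs (0 : \bar R)%E [set y : \bar R | (y < (eps / 2)%:E)%E].
  by apply: open_nbhs_nbhs; split; [exact: open_ereal_lt_ereal|rewrite /= lte_fin].
have := hc t0; rewrite in_itv /= => /(_ ht0) /(_ _ h0); rewrite /= /within /= => /nbhs_ballP[del /= del0 hd].
exists del => // t ht tt0 r ur; have := hd t; rewrite /ball /= distrC => /(_ tt0); rewrite in_itv /= => /(_ ht) hn.
have := Hs_nX b01 bs (ltW eps2) (ltW hn) ur; rewrite mulrCA divff// mulr1.
by congr (is_true (nX _ _ _ _)); apply/funext => n; rewrite fourier_coefB//; apply: L2T_cint; exact: curve_L2T.
Qed.

Lemma curve_pointwise_bound t : 0 <= t <= T -> exists2 B, 0 <= B & forall r, uniq r -> nX b r (fun n => normc (A t n)) B.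
Proof.
move=> ht; have [h _] := hu; have [|_ hfin] := h t; first by rewrite in_itv.
have n0 : (0 <= Hs_norm s (u t))%E by exact: poweR_ge0.
exists (2 * fine (Hs_norm s (u t))) => [|r ur]; first by rewrite mulr_ge0// fine_ge0.
by apply: Hs_nX b01 bs _ _ ur; rewrite ?fine_ge0// fineK// ge0_fin_numE.
Qed.

Lemma curve_bounded : exists2 B, 0 <= B & forall t, 0 <= t <= T -> forall r, uniq r -> nX b r (fun n => normc (A t n)) B.
Proof.
have [||N hN] := @compact_uniform R T (fun t N => forall r, uniq r -> nX b r (fun n => normc (A t n)) N%:R).
- move=> t N M NM h r ur; apply: nX_le (h r ur) => [|n _]; first by rewrite ler_nat NM andbT.
  by rewrite normc_ge0 lexx.
- move=> t ht; have [B B0 hB] := curve_pointwise_bound ht.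
  have [del del0 hd] := curve_continuous ht ltr01.
  exists (Num.truncn (B + 1)).+1, del => // t' ht' tt' r ur.
  have h2 := nX_add B0 ler01 (hB r ur) (hd t' ht' tt' r ur).
  apply: nX_le h2 => [|n _]; first by rewrite addr_ge0//= ltW// truncnS_gt.
  apply/andP; split; first exact: normc_ge0.
  by have := normc_le_add (A t n) (A t' n - A t n); rewrite addrC subrK.
by exists N%:R.
Qed.

Lemma curve_tails eps : 0 < eps -> exists N, forall t, 0 <= t <= T -> forall M r, (N <= M)%N -> uniq r ->
  nX b r (fun n => normc (A t n - truncation (freqs M) (A t) n)) eps.
Proof.
move=> eps0; have eps2 : 0 < eps / 2 by rewrite divr_gt0.
have mono t N M r e : (N <= M)%N -> 0 <= e -> nX b r (fun n => normc (A t n - truncation (freqs N) (A t) n)) e ->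
    nX b r (fun n => normc (A t n - truncation (freqs M) (A t) n)) e.
  move=> NM e0; apply: nX_le => [|n _]; first by rewrite e0 lexx.
  rewrite normc_ge0 /truncation !mem_freqs /=; case: ifP => h; first by rewrite subrr normc0 normc_ge0.
  by rewrite ifF//; apply/negP => /leq_trans/(_ NM); rewrite h.
have [||N hN] := @compact_uniform R T
   (fun t N => forall r, uniq r -> nX b r (fun n => normc (A t n - truncation (freqs N) (A t) n)) eps).
- by move=> t N M NM h r ur; apply: mono NM (ltW eps0) (h r ur).
- move=> t ht; have [B B0 hB] := curve_pointwise_bound ht.
  have [N hN] := tail_small eps2 hB.
  have [del del0 hd] := curve_continuous ht eps2.
  exists N, del => // t' ht' tt' r ur.
  have h2 := nX_add (ltW eps2) (ltW eps2) (hN r ur) (hd t' ht' tt' r ur); rewrite -splitr in h2.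
  apply: nX_le h2 => [|n _]; first by rewrite ltW// lexx.
  rewrite normc_ge0 /truncation; case: ifP => h; first by rewrite !subrr normc0 addr_ge0 ?normc_ge0.
  by rewrite !subr0; have := normc_le_add (A t n) (A t' n - A t n); rewrite addrC subrK.
by exists N => t ht M r NM ur; apply: mono NM (ltW eps0) (hN t ht r ur).
Qed.

Hypotheses (b3 : 3^-1 <= b < 1) (hrr : 3 * b - 1 <= b).
Let F t n : R[i] := fourier_coef (fun x => (normc (u t x) ^+ 2)%:C * u t x) n.

Lemma curve_cubic t n : 0 <= t <= T ->
  cint torus (fun x => (normc (u t x) ^+ 2)%:C * u t x * cexp (- (n%:~R * x))) /\
  ccvg (fun k => cubic (freqs (2 ^ k)) (A t) n) (F t n).
Proof.
move=> ht; have [B B0 hB] := curve_pointwise_bound ht.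
by have [b1 _] := andP b3; apply: (cubic_limit b1 B0 hB) => //; apply: L2T_cint; exact: curve_L2T.
Qed.

(** Tails are small uniformly in time by compactness of [[0, T]], and the Lipschitz bound transfers
    this to the nonlinearity. This is the approximation hypothesis of [coefficient_uniqueness]. *)
Lemma curve_cubic_uniform eps : 0 < eps -> exists N, forall M, (N <= M)%N -> forall t, 0 <= t <= T ->
  nY (3 * b - 1) (freqs M) (fun n => normc (F t n - cubic (freqs M) (A t) n)) eps.
Proof.
move=> eps0; have [C C0 hC] := cubic_lipschitz b3 hrr; have [B B0 hB] := curve_bounded.
pose d := eps / (C * B ^+ 2 + 1).
have q0 : 0 <= C * B ^+ 2 by rewrite mulr_ge0 ?sqr_ge0// ltW.
have d0 : 0 < d by rewrite divr_gt0// ltr_wpDl.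
have [N hN] := curve_tails d0; exists N => M NM t ht n _.
have [_ hc] := curve_cubic n ht.
apply: le_trans (truncation_error hC B0 (ltW d0) (hB t ht) (fun r ur => hN t ht M r NM ur) hc) _.
by rewrite /d mulrA ler_pdivrMr ?ltr_wpDl// mulrC ler_pM2l//; lra.
Qed.

Lemma curve_coef_continuous n t0 eps : 0 <= t0 <= T -> 0 < eps -> exists2 del, 0 < del &
  forall t, 0 <= t <= T -> `|t - t0| < del -> normc (A t n - A t0 n) <= eps.
Proof.
move=> ht0 eps0; have [del del0 hd] := curve_continuous ht0 eps0; exists del => // t ht tt0.
have [b0 _] := andP b01.
exact: (@nX_point R b (fun n => normc (A t n - A t0 n)) eps n b0 (ltW eps0) (normc_ge0 _) (hd t ht tt0 [:: n] isT)).
Qed.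

Lemma curve_cubic_continuous n t0 eps : 0 <= t0 <= T -> 0 < eps -> exists2 del, 0 < del &
  forall t, 0 <= t <= T -> `|t - t0| < del -> normc (F t n - F t0 n) <= eps.
Proof.
move=> ht0 eps0; have [C C0 hC] := cubic_lipschitz b3 hrr; have [B B0 hB] := curve_bounded.
pose d := eps / (C * B ^+ 2 + 1).
have q0 : 0 <= C * B ^+ 2 by rewrite mulr_ge0 ?sqr_ge0// ltW.
have d0 : 0 < d by rewrite divr_gt0// ltr_wpDl.
have [del del0 hd] := curve_continuous ht0 d0; exists del => // t ht tt0.
have [_ c1] := curve_cubic n ht; have [_ c2] := curve_cubic n ht0.
have h := limit_lipschitz hC B0 (ltW d0) (hB t ht) (hB t0 ht0) (hd t ht tt0) c1 c2.
apply: (@le_trans _ _ (C * B ^+ 2 * d)).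
  by apply: le_trans h; rewrite ler_peMl ?normc_ge0// one_le_jb_powR//; have [] := andP b3; lra.
by rewrite /d mulrA ler_pdivrMr ?ltr_wpDl// mulrC ler_pM2l//; lra.
Qed.

End curves.

Section clamped_coefficients.
Context {R : realType}.
Local Notation Re := (@complex.Re R).
Local Notation Im := (@complex.Im R).

(** Freezing the curve outside [[0, T]] makes its coefficients continuous on the whole line, as
    [fourier_ode] requires. *)
Definition clamp (T t : R) : R := Num.max 0 (Num.min t T).

Lemma clamp_itv (T t : R) : 0 < T -> 0 <= clamp T t <= T.
Proof. by move=> T0; rewrite /clamp; case: (leP t T) => h1; case: (leP 0 t) => h2; case: (leP 0 T) => h3; lra. Qed.

Lemma clamp_id (T t : R) : 0 <= t <= T -> clamp T t = t.
Proof. by move=> /andP[h1 h2]; rewrite /clamp (min_idPl h2) (max_idPr h1). Qed.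

Lemma clamp_lipschitz (T t t0 : R) : `|clamp T t - clamp T t0| <= `|t - t0|.
Proof.
wlog tt : t t0 / t0 <= t.
  by move=> h; case: (leP t0 t) => [/h//|/ltW/h]; rewrite distrC (distrC t0).
rewrite (ger0_norm (x := t - _)) ?subr_ge0// ler_norml.
by rewrite /clamp; case: (leP t T) => ?; case: (leP t0 T) => ?; case: (leP 0 t) => ?; case: (leP 0 t0) => ?; case: (leP 0 T) => ?; lra.
Qed.

Lemma clamp_continuous (T : R) (z : R -> R[i]) : 0 < T ->
  (forall t0 eps : R, 0 <= t0 <= T -> 0 < eps -> exists2 del, 0 < del &
    forall t, 0 <= t <= T -> `|t - t0| < del -> normc (z t - z t0) <= eps) ->
  continuous (Re \o (z \o clamp T)) /\ continuous (Im \o (z \o clamp T)).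
Proof.
move=> T0 hz.
have main (p : R[i] -> R) : (forall x y, p (x - y) = p x - p y) -> (forall x, `|p x| <= normc x) -> continuous (p \o (z \o clamp T)).
  move=> pB pn t0; apply/cvgrPdist_le => eps eps0.
  have [del del0 hd] := hz (clamp T t0) eps (clamp_itv t0 T0) eps0.
  near=> t; rewrite distrC /= -pB; apply: le_trans (pn _) _; apply: hd; first exact: clamp_itv.
  apply: le_lt_trans (clamp_lipschitz _ _ _) _; rewrite distrC; near: t.
  exact: (nbhsx_ballx t0 del del0).
split; apply: main => *; rewrite ?raddfB//; [exact: Re_le_normc|exact: Im_le_normc].
Unshelve. all: by end_near. Qed.

End clamped_coefficients.

(** * Choice of the exponents and conclusion *)

Section uniqueness.
Context {R : realType}.
Local Notation mu := (@lebesgue_measure R).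
Local Notation Re := (@complex.Re R).
Local Notation Im := (@complex.Im R).
Local Notation torus := (@torus R).

Lemma cintegral_ae (D : set R) (f g : R -> R[i]) : measurable D -> cmeas D f -> cmeas D g ->
  {ae mu, forall x, f x = g x} -> cintegral D f = cintegral D g.
Proof.
move=> mD [f1 f2] [g1 g2] fg; rewrite /cintegral /Rintegral; congr (fine _ +i* fine _).
  apply: ae_eq_integral => //; [exact/measurable_EFinP|exact/measurable_EFinP|].
  by apply: ae_imp fg => x e _ /=; rewrite e.
apply: ae_eq_integral => //; [exact/measurable_EFinP|exact/measurable_EFinP|].
by apply: ae_imp fg => x e _ /=; rewrite e.
Qed.

Lemma eqT_fourier_coef (f g : R -> R[i]) n : L2T f -> L2T g -> eqT f g -> fourier_coef f n = fourier_coef g n.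
Proof.
move=> hf hg fg; have mT := @measurable_torus R; rewrite /fourier_coef; congr (_ * _); apply: cintegral_ae => //.
- apply: cmeasM; first exact: L2T_cmeas.
  by under eq_fun do rewrite -mulNr; exact: cmeas_cexp.
- apply: cmeasM; first exact: L2T_cmeas.
  by under eq_fun do rewrite -mulNr; exact: cmeas_cexp.
- by apply: ae_imp fg => x ->.
Qed.

(** With [g = 2 - 2 alpha] and [r = 3 b - 1], the bounds [1/3 <= b < 1/2] give [0 <= r <= b], and
    [b > 1 - alpha] says that the gap [D = 2 b - g] is positive. Such a [b] exists because
    [alpha > 1/2]. For [th = 2 - 2 eta] the last condition in [kernel_params] becomes
    [d + eta (2 alpha - 1) <= D], so [d] and [eta] may each use half of [D]. *)
Lemma exponents (alpha s : R) : 2^-1 < alpha -> alpha < 1 -> 6^-1 <= s -> (1 - alpha) / 2 < s ->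
  exists b d th : R, [/\ kernel_params (2 - 2 * alpha) b d (3 * b - 1) th, th < 2, 3^-1 <= b < 2^-1 & b <= 2 * s].
Proof.
move=> a1 a2 s1 s2.
have [b [b1 b2 b3 b4]] : exists b : R, [/\ 3^-1 <= b, b < 2^-1, 1 - alpha < b & b <= 2 * s].
  case: (ltP (2 * s) 2^-1) => h; first by exists (2 * s); split; lra.
  case: (leP 3^-1 ((1 - alpha + 2^-1) / 2)) => h2; first by exists ((1 - alpha + 2^-1) / 2); split; lra.
  by exists 3^-1; split; lra.
pose D := 2 * b - (2 - 2 * alpha); have D0 : 0 < D by rewrite /D; lra.
pose d := Num.min (D / 2) (2 * alpha - 1); pose eta := Num.min (D / 2) 2^-1.
have [d0 d1 d2] : [/\ 0 < d, d <= D / 2 & d <= 2 * alpha - 1].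
  by rewrite lt_min !ge_min !lexx orbT; split=> //; apply/andP; split; lra.
have [e0 e1 e2] : [/\ 0 < eta, eta <= D / 2 & eta <= 2^-1].
  by rewrite lt_min !ge_min !lexx orbT; split=> //; apply/andP; split; lra.
have e3 : eta * (2 * alpha - 1) <= eta by rewrite ler_piMr; lra.
move: d0 d1 d2 e0 e1 e2 e3; rewrite /D; clearbody d eta => d0 d1 d2 e0 e1 e2 e3.
exists b, d, (2 - 2 * eta); split; [split; [|exact: d0|split; [| |split]]| | |exact: b4]; lra.
Qed.

Lemma normc_sign (sgn : bool) : normc (- ('i * (-1) ^+ sgn) : R[i]) = 1.
Proof.
by rewrite normcN normcM normc_i mul1r; case: sgn; rewrite ?expr1 ?normcN ?expr0 normc_real normr1.
Qed.

End uniqueness.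

Theorem theorem4p1 (R : realType) (alpha s : R) (sgn : bool) :
  2^-1 < alpha -> alpha < 1 ->
  6^-1 <= s -> (1 - alpha) / 2 < s ->
  forall (T : R) (u0 : R -> R[i]), 0 < T -> Hs s u0 ->
  forall u v : R -> R -> R[i],
    fNLS_solution alpha s T sgn u0 u ->
    fNLS_solution alpha s T sgn u0 v ->
    forall t : R, t \in `[0, T] -> eqT (u t) (v t).
Proof.
move=> a1 a2 s1 s2 T u0 T0 [hu0 _] u v [hu du eu] [hv dv ev] t ht.
have [b [d [th [hp th2 /andP[b1 b2] bs]]]] := exponents a1 a2 s1 s2.
have b01 : 0 <= b <= 1 by apply/andP; split; move: b1 b2; lra.
have b3 : 3^-1 <= b < 1 by rewrite b1; move: b2; lra.
have hrr : 3 * b - 1 <= b by move: b2; lra.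
pose A (w : R -> R -> R[i]) n t := fourier_coef (w (clamp T t)) n.
pose F (w : R -> R -> R[i]) t n := fourier_coef (fun x => (normc (w (clamp T t) x) ^+ 2)%:C * w (clamp T t) x) n.
have cl t' := @clamp_itv R T t' T0.
have [Bu Bu0 hBu] := curve_bounded b01 bs hu; have [Bv Bv0 hBv] := curve_bounded b01 bs hv.
have e0 : 0 <= (0 : R) <= T by rewrite lexx ltW.
have ode (w : R -> R -> R[i]) : C_Hs s T w -> fNLS_distr alpha T sgn w -> forall t, 0 < t < T -> forall n,
    cder (A w n) t ('i * (`|n%:~R| `^ (2 - (2 - 2 * alpha)))%:C * A w n t + - ('i * (-1) ^+ sgn) * F w t n).
  move=> hw dw t' /andP[t0 tT] n; rewrite [2 - _](_ : _ = 2 * alpha); last by ring.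
  have [c1 c2] := @clamp_continuous R T _ T0 (@curve_coef_continuous R b s T w b01 bs hw n).
  have [F1 F2] := @clamp_continuous R T _ T0 (@curve_cubic_continuous R b s T w b01 bs hw b3 hrr n).
  apply: (fourier_ode dw _ _ _ _ c1 c2 F1 F2) => // q; rewrite in_itv /= => hq.
  - by apply: L2T_cint; exact: curve_L2T hw q hq.
  - by have [] := curve_cubic b01 bs hw b3 n hq.
  - by rewrite /= clamp_id.
  - by rewrite /= clamp_id.
have key := coefficient_uniqueness hp th2 (normc_sign sgn) (addr_ge0 Bu0 Bv0) (u := A u) (v := A v) (Fu := F u) (Fv := F v) T0.
have coefs n : fourier_coef (u t) n = fourier_coef (v t) n.
  have ht' : 0 <= t <= T by rewrite in_itv in ht.
  have : A u n t = A v n t; last by rewrite /A clamp_id.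
  apply: key ht' n.
  - move=> q _ r ur; split; [apply: nX_le (hBu _ (cl q) r ur)|apply: nX_le (hBv _ (cl q) r ur)] => [|n _||n _].
    + by rewrite Bu0 lerDl.
    + by rewrite normc_ge0 lexx.
    + by rewrite Bv0 lerDr.
    + by rewrite normc_ge0 lexx.
  - by move=> q hq n; split; apply: ode.
  - move=> eps r eps0.
    have [Nu hNu] := curve_cubic_uniform b01 bs hu b3 hrr eps0.
    have [Nv hNv] := curve_cubic_uniform b01 bs hv b3 hrr eps0.
    pose N := maxn (maxn Nu Nv) (\max_(m <- r) `|m|)%N.
    exists (freqs N); split; first exact: uniq_freqs.
      by move=> m hm; rewrite mem_freqs; apply: leq_trans (leq_maxr _ _); exact: leq_bigmax_seq.
    move=> q hq; split; [apply: hNu (cl q)|apply: hNv (cl q)].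
      by rewrite /N (leq_trans (leq_maxl Nu Nv))// leq_maxl.
    by rewrite /N (leq_trans (leq_maxr Nu Nv))// leq_maxl.
  - move=> t0 eps ht0 eps0.
    have [du1 du0 hdu] := curve_continuous b01 bs hu ht0 eps0.
    have [dv1 dv0 hdv] := curve_continuous b01 bs hv ht0 eps0.
    exists (Num.min du1 dv1); first by rewrite lt_min du0.
    move=> q hq; rewrite lt_min => /andP[q1 q2] r ur; rewrite /A !clamp_id//.
    by split; [exact: hdu|exact: hdv].
  - move=> n; rewrite /A clamp_id//.
    by rewrite (eqT_fourier_coef n (curve_L2T hu e0) hu0 eu) (eqT_fourier_coef n (curve_L2T hv e0) hu0 ev).
have ht' : 0 <= t <= T by rewrite in_itv in ht.
have Lu := curve_L2T hu ht'; have Lv := curve_L2T hv ht'; have Lw := L2T_sub Lu Lv.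
have pw : periodic (fun x => u t x - v t x) (2 * trigo.pi) by case: Lw.
have h := fourier_uniqueness pw (L2T_cint Lw).
rewrite /eqT; apply: ae_imp (h _) => [x /subr0_eq//|n].
by rewrite fourier_coefB ?coefs ?subrr//; exact: L2T_cint.
Qed.
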